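(* Let $d=1$, $\sigma^2=\operatorname{Var}(X)$, and suppose $\rho/\sqrt N\to\alpha\in(0,\infty)$, with $L=N/\rho$. Then for every $\epsilon>0$, uniformly in integers $0\le j\le(1-\epsilon)N$, $$H_{N-j}(L)\sim\frac{C_0e^{G_L(1-L^{-2})}}{N}\Big(1-\frac jN\Big)^{-3/2}\sum_{n=0}^\infty(-1)^n\binom{-2\theta}{n}(\theta+n)\exp\Big(\frac{-(\theta+n)^2}{2\alpha^2\sigma^2(1-\frac jN)}\Big)\qquad(N\to\infty),$$ where $C_0:=\frac{e^{\sqrt2\sigma^{-1}\theta}(1-e^{-\sqrt2\sigma^{-1}})^{2\theta}}{\sqrt{2\pi}\,\alpha\sigma}$ and $\binom{t}{n}:=\frac{1}{n!}t(t-1)\cdots(t-n+1)$.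
   Context: $\theta>0$ is fixed. $X$ is a real random variable with density $\varphi$, a Schwartz function, with $\mathbb E X=0$ and variance $\operatorname{Var}(X)$; $\varphi^{*j}$ is the $j$-fold convolution. $W_{L,j}:=\theta L\sum_{k\in\mathbb Z}\varphi^{*j}(Lk)$, $G_L(z):=\sum_{j\ge1}W_{L,j}z^j/j$ for $|z|<1$, and $H_n(L)$ is defined by $\sum_{n\ge0}H_n(L)z^n=e^{G_L(z)}$. *)

(* Defs.v *)
From Stdlib Require Import Reals Lra ZArith Classical ClassicalEpsilon.
Open Scope R_scope.

Definition choiceR (P : R -> Prop) : R :=
  match excluded_middle_informative (exists x, P x) with
  | left H => proj1_sig (constructive_indefinite_description P H)
  | right _ => 0
  end.

(* Riemann integral over [a,b] (value; 0 if not integrable). *)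
Definition RInt (f : R -> R) (a b : R) : R :=
  choiceR (fun l => exists pr : Riemann_integrable f a b, RiemannInt pr = l).

Definition is_improper_integral (f : R -> R) (l : R) : Prop :=
  (forall a b, a <= b -> inhabited (Riemann_integrable f a b)) /\
  forall eps, 0 < eps -> exists M, forall a b, a <= - M -> M <= b ->
    Rabs (RInt f a b - l) < eps.

Definition ImpInt (f : R -> R) : R := choiceR (is_improper_integral f).

(* Sum over Z: sum_{k=-m}^{n} f k converges as m,n -> oo independently. *)
Definition is_sumZ (f : Z -> R) (l : R) : Prop :=
  forall eps, 0 < eps -> exists M : nat, forall m n : nat, (M <= m)%nat -> (M <= n)%nat ->
    Rabs (sum_f_R0 (fun i => f (Z.of_nat i - Z.of_nat m)%Z) (m + n) - l) < eps.

Definition sumZ (f : Z -> R) : R := choiceR (is_sumZ f).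

Definition ser (a : nat -> R) : R := choiceR (infinite_sum a).

Definition Schwartz (phi : R -> R) : Prop :=
  exists D : nat -> R -> R,
    (forall x, D 0%nat x = phi x) /\
    (forall k x, derivable_pt_lim (D k) x (D (S k) x)) /\
    (forall k m : nat, exists C, forall x, Rabs (x ^ m * D k x) <= C).

(* j-fold convolution phi^{*j} for j >= 1 (value at j = 0 is a dummy 0, unused). *)
Fixpoint convpow (phi : R -> R) (j : nat) (x : R) : R :=
  match j with
  | O => 0
  | S m => match m with
           | O => phi x
           | S _ => ImpInt (fun y => convpow phi m (x - y) * phi y)
           end
  end.

Definition W (phi : R -> R) (theta L : R) (j : nat) : R :=
  theta * L * sumZ (fun k => convpow phi j (L * IZR k)).

Definition G (phi : R -> R) (theta L z : R) : R :=
  ser (fun j => match j with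
                | O => 0
                | S _ => W phi theta L j / INR j * z ^ j
                end).

Definition H (phi : R -> R) (theta L : R) (n : nat) : R :=
  choiceR (fun h => exists c : nat -> R, c n = h /\
     forall z, Rabs z < 1 -> infinite_sum (fun k => c k * z ^ k) (exp (G phi theta L z))).

Fixpoint fallfact (t : R) (n : nat) : R :=
  match n with
  | O => 1
  | S m => fallfact t m * (t - INR m)
  end.

Definition gbinom (t : R) (n : nat) : R := fallfact t n / INR (fact n).

(* Main.v *)
(* Poisson summation gives W_j = theta sum_m chi(2 pi m / L)^j, where chi is the characteristic function of X, so that
   G(z) = - theta sum_m ln(1 - chi(2 pi m / L) z). With r = 1 - L^-2, the tilted coefficients
   p_n = H_n r^n / exp(G(r)) form a probability distribution, and sum_n p_n r^(n(s-1)) = exp(G(r^s) - G(r)). Since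
   1 - chi(t) ~ sigma^2 t^2 / 2, the right-hand side tends to
   prod_m (1 + 2 pi^2 sigma^2 m^2)^theta (s + 2 pi^2 sigma^2 m^2)^-theta = (sinh(b sqrt s) / sinh b)^(-2 theta), with b = 1/(sqrt 2 sigma).
   Expanding by the binomial series in exp(-2 b sqrt s) and inverting exp(-c sqrt s) term by term produces a limit density,
   which is the series of the theorem. Thus the p_n converge weakly, with test functions of r^n on [0,1] approximated by
   Bernstein polynomials.

   The identity n H_n = sum_(j<=n) W_j H_(n-j) upgrades this to a local limit theorem: with |W_j| <= C (1 + L / sqrt j) and
   a bound on W_(j+1) - W_j, it gives p_n = O(L^-2) and the equicontinuity of L^2 p_n for n of order L^2, so that
   narrow tent functions as test functions recover L^2 p_n pointwise. Taking n = N - j and N / L^2 = rho^2 / N -> alpha^2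
   finishes the proof, as r^n ~ exp(-n / L^2) and L^2 H_n / exp(G(r)) = L^2 p_n r^-n. *)
From Coquelicot Require Import Coquelicot.
Require Import Defs.
From Stdlib Require Import Reals ZArith Lra Lia Psatz Classical ClassicalEpsilon.
Open Scope R_scope.

(** * Improper integrals *)

(* [field] and [ring] do not recognise an equation stated in the carrier of Coquelicot's
   [R_NormedModule] or [R_AbelianMonoid] as one in [R]. *)
Ltac eqR := match goal with |- @eq _ ?a ?b => change (@eq R a b) end.

(** Weak convergence sees the p_n only through averages over windows of about L^2 indices, so the
    heart of the proof is a regularity estimate for the individual coefficients. Positivity takes
    the place of a contour argument: W_j, H_n and the weights of the limit series are all
    nonnegative, so the total mass one bounds every partial sum and the identity for n H_n can be
    bootstrapped. The positive lower bound of the limit density on compact ranges finally turns an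
    absolute error into the relative one that is claimed. The transform is computed only at integers
    s, that is, for the moments of r^n, which is why polynomials are the natural test functions.
    Since the index at which p_n is wanted moves with N, convergence must be uniform over all test
    functions with a given Lipschitz constant. Complex numbers are avoided by the polar form of the
    characteristic function. Poisson summation is proved at every shift u with an error of order 1 +
    u^2, which can be averaged against phi and thus passes to convolution powers. *)

Lemma choiceR_unique (P : R -> Prop) (l : R) :
  P l -> (forall l', P l' -> l' = l) -> choiceR P = l.
Proof.
  intros Hl Hu. unfold choiceR.
  destruct (excluded_middle_informative (exists x, P x)) as [He|Hn].
  - apply Hu. apply (proj2_sig (constructive_indefinite_description P He)).
  - exfalso; apply Hn; now exists l.
Qed.

Lemma Defs_RInt (f : R -> R) (a b l : R) : is_RInt f a b l -> RInt f a b = l.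
Proof.
  intros Hf. apply choiceR_unique.
  - exists (ex_RInt_Reals_0 f a b (ex_intro _ l Hf)).
    rewrite <- (RInt_Reals f a b). apply is_RInt_unique, Hf.
  - intros l' [pr Hl']. rewrite <- Hl', <- (RInt_Reals f a b). apply is_RInt_unique, Hf.
Qed.

Definition is_imp := is_improper_integral.

(** The sign condition on [M] forces [a <= b] for the intervals concerned, the only orientation for
    which integrability is assumed. *)
Lemma is_imp_intro (f : R -> R) (l : R) :
  (forall a b, a <= b -> ex_RInt f a b) ->
  (forall eps, 0 < eps -> exists M, 0 <= M /\ forall a b, a <= - M -> M <= b ->
     Rabs (RInt.RInt f a b - l) < eps) -> is_imp f l.
Proof.
  intros He Hl. split.
  - intros a b Hab. apply inhabits, ex_RInt_Reals_0, He, Hab.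
  - intros eps Heps. destruct (Hl eps Heps) as [M [HM H]]. exists M. intros a b Ha Hb.
    rewrite (Defs_RInt f a b (RInt.RInt f a b)); [now apply H|].
    apply (RInt_correct f). apply He. lra.
Qed.

Lemma is_imp_ex (f : R -> R) (l a b : R) : is_imp f l -> ex_RInt f a b.
Proof.
  intros [H _]. destruct (Rle_dec a b) as [Hab|Hab].
  - destruct (H a b Hab) as [pr]. exact (ex_RInt_Reals_1 _ _ _ pr).
  - destruct (H b a ltac:(lra)) as [pr]. apply ex_RInt_swap. exact (ex_RInt_Reals_1 _ _ _ pr).
Qed.

Lemma is_imp_lim (f : R -> R) (l : R) : is_imp f l ->
  forall eps, 0 < eps -> exists M, 0 <= M /\ forall a b, a <= - M -> M <= b ->
     Rabs (RInt.RInt f a b - l) < eps.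
Proof.
  intros Hf eps Heps. destruct (proj2 Hf eps Heps) as [M H]. exists (Rmax M 0).
  pose proof (Rmax_l M 0). pose proof (Rmax_r M 0). split; [lra|]. intros a b Ha Hb.
  rewrite <- (Defs_RInt f a b (RInt.RInt f a b)).
  - apply H; lra.
  - apply (RInt_correct f), (is_imp_ex f l), Hf.
Qed.

Lemma is_imp_sym_seq (f : R -> R) (l : R) : is_imp f l ->
  is_lim_seq (fun n => RInt.RInt f (- INR n) (INR n)) l.
Proof.
  intros Hf. apply is_lim_seq_Reals. intros eps Heps.
  destruct (is_imp_lim f l Hf eps Heps) as [M [HM H]].
  destruct (INR_unbounded M) as [N HN]. exists N. intros n Hn.
  apply le_INR in Hn. apply H; lra.
Qed.

Lemma is_imp_uniq (f : R -> R) (l l' : R) : is_imp f l -> is_imp f l' -> l = l'.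
Proof.
  intros H H'. apply is_imp_sym_seq, is_lim_seq_unique in H.
  apply is_imp_sym_seq, is_lim_seq_unique in H'. congruence.
Qed.

Lemma ImpInt_eq (f : R -> R) (l : R) : is_imp f l -> ImpInt f = l.
Proof. intros H. apply choiceR_unique; [exact H|]. intros l' H'. eapply is_imp_uniq; eauto. Qed.

Lemma is_imp_ext (f g : R -> R) (l : R) : (forall x, f x = g x) -> is_imp f l -> is_imp g l.
Proof.
  intros Hfg Hf. apply is_imp_intro.
  - intros a b _. apply ex_RInt_ext with f; [auto|]. now apply is_imp_ex with l.
  - intros eps Heps. destruct (is_imp_lim f l Hf eps Heps) as [M [HM H]].
    exists M; split; [auto|]. intros a b Ha Hb.
    rewrite <- (RInt_ext f g); auto.
Qed.

Lemma is_imp_lin (f g : R -> R) (a b lf lg : R) : is_imp f lf -> is_imp g lg ->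
  is_imp (fun x => a * f x + b * g x) (a * lf + b * lg).
Proof.
  intros Hf Hg.
  assert (HI : forall u v, is_RInt (fun x => a * f x + b * g x) u v
     (a * RInt.RInt f u v + b * RInt.RInt g u v)).
  { intros u v. apply (is_RInt_plus (V := R_NormedModule) (fun x => a * f x) (fun x => b * g x)).
    - apply (is_RInt_scal (V := R_NormedModule) f u v a), (RInt_correct (V:=R_CompleteNormedModule)), (is_imp_ex f lf), Hf.
    - apply (is_RInt_scal (V := R_NormedModule) g u v b), (RInt_correct (V:=R_CompleteNormedModule)), (is_imp_ex g lg), Hg. }
  apply is_imp_intro.
  - intros u v _. eexists. apply HI.
  - intros eps Heps.
    assert (He1 : 0 < eps / 2 / (Rabs a + 1)).
    { apply Rdiv_lt_0_compat; [lra|]. pose proof (Rabs_pos a). lra. }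
    assert (He2 : 0 < eps / 2 / (Rabs b + 1)).
    { apply Rdiv_lt_0_compat; [lra|]. pose proof (Rabs_pos b). lra. }
    destruct (is_imp_lim f lf Hf _ He1) as [M1 [HM1 H1]].
    destruct (is_imp_lim g lg Hg _ He2) as [M2 [HM2 H2]].
    exists (M1 + M2). split; [lra|]. intros u v Hu Hv.
    specialize (H1 u v ltac:(lra) ltac:(lra)). specialize (H2 u v ltac:(lra) ltac:(lra)).
    rewrite (is_RInt_unique _ _ _ _ (HI u v)).
    replace (a * RInt.RInt f u v + b * RInt.RInt g u v - (a * lf + b * lg))
      with (a * (RInt.RInt f u v - lf) + b * (RInt.RInt g u v - lg)) by ring.
    eapply Rle_lt_trans; [apply Rabs_triang|]. rewrite !Rabs_mult.
    assert (forall A x e, 0 <= A -> 0 <= x -> 0 < e -> x < e / 2 / (A + 1) -> A * x <= e / 2 * (A / (A+1))) as Haux.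
    { intros A x e HA Hx He Hlt. replace (e / 2 * (A / (A+1))) with (A * (e / 2 / (A + 1))) by (field; lra).
      apply Rmult_le_compat_l; lra. }
    assert (forall A, 0 <= A -> A / (A + 1) < 1) as Hfr.
    { intros A HA. apply (Rmult_lt_reg_r (A+1)); [lra|]. unfold Rdiv. rewrite Rmult_assoc, Rinv_l; lra. }
    pose proof (Haux (Rabs a) _ eps (Rabs_pos a) (Rabs_pos _) Heps H1).
    pose proof (Haux (Rabs b) _ eps (Rabs_pos b) (Rabs_pos _) Heps H2).
    pose proof (Hfr _ (Rabs_pos a)). pose proof (Hfr _ (Rabs_pos b)). nra.
Qed.

Lemma is_imp_scal (f : R -> R) (a l : R) : is_imp f l -> is_imp (fun x => a * f x) (a * l).
Proof.
  intros H. replace (a * l) with (a * l + 0 * l) by ring.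
  eapply is_imp_ext; [|apply (is_imp_lin f f a 0 l l H H)]. intros; simpl; ring.
Qed.

Lemma is_imp_le (f g : R -> R) (lf lg : R) : (forall x, f x <= g x) ->
  is_imp f lf -> is_imp g lg -> lf <= lg.
Proof.
  intros Hle Hf Hg.
  pose proof (is_imp_sym_seq f lf Hf) as H1. pose proof (is_imp_sym_seq g lg Hg) as H2.
  apply (is_lim_seq_le _ _ _ _ (fun n => RInt_le f g (- INR n) (INR n)
    ltac:(pose proof (pos_INR n); lra) (is_imp_ex _ _ _ _ Hf) (is_imp_ex _ _ _ _ Hg)
    (fun x _ => Hle x)) H1 H2).
Qed.

(** Beyond a large [-M, M] two integrals of [f] differ by tail integrals, which the tails of [h]
    dominate; the Cauchy criterion along [-n, n] then produces the limit. *)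
Lemma is_imp_dom (f h : R -> R) (lh : R) :
  (forall x, continuous f x) -> (forall x, Rabs (f x) <= h x) -> is_imp h lh ->
  exists l, is_imp f l /\ Rabs l <= lh.
Proof.
  intros Hc Hd Hh.
  assert (Hex : forall a b, ex_RInt f a b) by (intros; apply (ex_RInt_continuous (V:=R_CompleteNormedModule)); auto).
  assert (Hpos : forall x, 0 <= h x) by (intros x; eapply Rle_trans; [apply Rabs_pos|apply Hd]).
  set (I := RInt.RInt f). set (J := RInt.RInt h).
  assert (HJ : forall a b c, J a b + J b c = J a c).
  { intros. unfold J. apply (RInt_Chasles (V:=R_CompleteNormedModule)); eapply is_imp_ex; eauto. }
  assert (HI : forall a b c, I a b + I b c = I a c).
  { intros. unfold I. apply (RInt_Chasles (V:=R_CompleteNormedModule)); auto. }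
  assert (HIJ : forall a b, a <= b -> Rabs (I a b) <= J a b).
  { intros a b Hab. apply (norm_RInt_le f h a b); auto.
    - apply (RInt_correct (V:=R_CompleteNormedModule)); auto.
    - apply (RInt_correct (V:=R_CompleteNormedModule)). eapply is_imp_ex; eauto. }
  assert (HC : forall eps, 0 < eps -> exists M, 0 <= M /\ forall a b a' b', a <= - M -> M <= b ->
     a' <= -M -> M <= b' -> Rabs (I a b - I a' b') < eps).
  (* [J a b] and [J (-M) M] both lie within eps/8 of [lh], so the two tails of [h] together weigh
     less than eps/4. *)
  { intros eps Heps. destruct (is_imp_lim h lh Hh (eps/8) ltac:(lra)) as [M [HM H]].
    exists M; split; auto.
    assert (Ht : forall a b, a <= -M -> M <= b -> Rabs (I a b - I (-M) M) < eps/2).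
    { intros a b Ha Hb. replace (I a b - I (-M) M) with (I a (-M) + I M b).
      2:{ rewrite <- (HI a (-M) b), <- (HI (-M) M b). ring. }
      eapply Rle_lt_trans; [apply Rabs_triang|].
      pose proof (HIJ a (-M) Ha). pose proof (HIJ M b Hb).
      pose proof (HJ a (-M) b). pose proof (HJ (-M) M b).
      pose proof (H a b Ha Hb) as H5. pose proof (H (-M) M ltac:(lra) ltac:(lra)) as H6.
      fold J in H5, H6. apply Rabs_def2 in H5. apply Rabs_def2 in H6. lra. }
    intros a b a' b' Ha Hb Ha' Hb'. pose proof (Ht a b Ha Hb) as H1. pose proof (Ht a' b' Ha' Hb') as H2.
    apply Rabs_def2 in H1. apply Rabs_def2 in H2. apply Rabs_def1; lra. }
  assert (Hcv : Cauchy_crit (fun n => I (- INR n) (INR n))).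
  { intros eps Heps. destruct (HC eps Heps) as [M [HM H]]. destruct (INR_unbounded M) as [N HN].
    exists N. intros n m Hn Hm. apply le_INR in Hn. apply le_INR in Hm. apply H; lra. }
  destruct (R_complete _ Hcv) as [l Hl]. exists l.
  assert (Hf : is_imp f l).
  { apply is_imp_intro; [auto|]. intros eps Heps.
    destruct (HC (eps/2) ltac:(lra)) as [M [HM H]]. exists M. split; auto. intros a b Ha Hb.
    destruct (Hl (eps/2) ltac:(lra)) as [N1 HN1]. destruct (INR_unbounded M) as [N2 HN2].
    pose proof (HN1 (max N1 N2) ltac:(lia)) as H1.
    assert (INR N2 <= INR (max N1 N2)) by (apply le_INR; lia).
    pose proof (H a b (- INR (max N1 N2)) (INR (max N1 N2)) Ha Hb ltac:(lra) ltac:(lra)) as H2.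
    fold (I a b). unfold Rdist in H1. apply Rabs_def2 in H1. apply Rabs_def2 in H2. apply Rabs_def1; lra. }
  split; [exact Hf|]. apply Rabs_le. split.
  - pose proof (is_imp_scal h (-1) lh Hh) as Hm. replace (- lh) with (-1 * lh) by ring.
    apply (is_imp_le _ f _ _) with (2 := Hm) (3 := Hf). intros x. pose proof (Rle_abs (- f x)) as Ha.
    rewrite Rabs_Ropp in Ha. pose proof (Hd x). lra.
  - apply (is_imp_le f h); auto. intros x. pose proof (Rle_abs (f x)). pose proof (Hd x). lra.
Qed.

Lemma atan_tends_PI2 : forall eps, 0 < eps -> exists M, 0 <= M /\ forall x, M <= x -> PI/2 - eps < atan x < PI / 2.
Proof.
  intros eps Heps.
  set (e := Rmin eps 1). assert (0 < e <= 1) by (unfold e; split; [apply Rmin_pos; lra|apply Rmin_r]).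
  assert (He : e <= eps) by apply Rmin_l.
  pose proof PI2_1. pose proof PI_RGT_0.
  exists (tan (PI/2 - e/2)). split.
  - left. apply tan_gt_0; lra.
  - intros x Hx. split; [|apply atan_bound].
    assert (PI/2 - e/2 <= atan x); [|lra].
    rewrite <- (atan_tan (PI/2 - e/2)) by lra.
    destruct Hx as [Hx|Hx]; [left; now apply atan_increasing|rewrite Hx; lra].
Qed.

(** The majorant, up to a constant, in every use of [is_imp_dom]. *)
Lemma is_imp_inv1p2 : is_imp (fun x => / (1 + x ^ 2)) PI.
Proof.
  assert (HI : forall a b, is_RInt (fun x => / (1 + x ^ 2)) a b (atan b - atan a)).
  { intros a b. apply (is_RInt_derive (V:=R_CompleteNormedModule) atan).
    - intros x _. apply is_derive_Reals, derivable_pt_lim_atan.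
    - intros x _. apply (ex_derive_continuous (V := R_NormedModule)). auto_derive. nra. }
  apply is_imp_intro.
  - intros a b _. eexists; apply HI.
  - intros eps Heps. destruct (atan_tends_PI2 (eps/2) ltac:(lra)) as [M [HM H]].
    exists M. split; auto. intros a b Ha Hb. rewrite (is_RInt_unique _ _ _ _ (HI a b)).
    pose proof (H b Hb). pose proof (H (-a) ltac:(lra)) as H2. rewrite atan_opp in H2.
    apply Rabs_def1; lra.
Qed.

(** * Expectations and the characteristic function *)

(** What is kept of the Schwartz property, with a single constant [K]. The sixth-order decay of
    [phi] makes fourth moments available, the decay of [D1] gives Lipschitz bounds for the
    periodization, and that of [D2] a characteristic function of order t^-2. *)
Record smooth_density (phi D1 D2 : R -> R) (K : R) : Prop := {
  sd_nonneg : forall x, 0 <= phi x;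
  sd_D1 : forall x, is_derive phi x (D1 x);
  sd_D2 : forall x, is_derive D1 x (D2 x);
  sd_D2_cont : forall x, continuous D2 x;
  sd_decay : forall x, phi x * (1 + x ^ 2) ^ 3 <= K;
  sd_D1_decay : forall x, Rabs (D1 x) * (1 + x ^ 2) <= K;
  sd_D2_decay : forall x, Rabs (D2 x) * (1 + x ^ 2) <= K;
  sd_mass : is_imp phi 1;
  sd_mean : is_imp (fun x => x * phi x) 0 }.

Lemma continuous_mult_R (f g : R -> R) x : continuous f x -> continuous g x -> continuous (fun x => f x * g x) x.
Proof. intros. apply (continuous_mult (K:=R_AbsRing)); auto. Qed.

Lemma continuous_plus_R (f g : R -> R) x : continuous f x -> continuous g x -> continuous (fun x => f x + g x) x.
Proof. intros. apply (continuous_plus (V:=R_NormedModule)); auto. Qed.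

(** Degree 4 is what the decay of [phi] allows: the product with [phi] is still of order 1/(1 +
    x^2). *)
Definition poly_growth (f : R -> R) (k : R) :=
  (forall x, continuous f x) /\ (forall x, Rabs (f x) <= k * (1 + x ^ 2) ^ 2).

Definition expect (phi f : R -> R) : R := ImpInt (fun x => f x * phi x).

Section Expect.
Variables (phi D1 D2 : R -> R) (K : R).
Hypothesis Hphi : smooth_density phi D1 D2 K.

Local Notation E := (expect phi).

Lemma sd_K_pos : 0 <= K.
Proof. pose proof (sd_decay _ _ _ _ Hphi 0). pose proof (sd_nonneg _ _ _ _ Hphi 0). nra. Qed.

Lemma sd_cont x : continuous phi x.
Proof. apply (ex_derive_continuous (V:=R_NormedModule)). eexists; apply (sd_D1 _ _ _ _ Hphi). Qed.

Lemma expect_spec f k : poly_growth f k -> is_imp (fun x => f x * phi x) (E f).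
Proof.
  intros [Hc Hk].
  destruct (is_imp_dom (fun x => f x * phi x) (fun x => (k * K) * / (1 + x^2)) ((k*K) * PI)) as [l [Hl _]].
  - intros x. apply continuous_mult_R; [auto|apply sd_cont].
  - intros x. rewrite Rabs_mult, (Rabs_pos_eq (phi x)) by apply (sd_nonneg _ _ _ _ Hphi).
    pose proof (Hk x). pose proof (sd_decay _ _ _ _ Hphi x). pose proof (sd_nonneg _ _ _ _ Hphi x).
    assert (0 < 1 + x^2) by nra. apply (Rmult_le_reg_r (1+x^2)); auto.
    rewrite (Rmult_assoc _ (/ _)), Rinv_l by lra.
    assert (0 <= k). { pose proof (Rabs_pos (f x)). assert (0 < (1 + x^2)^2) by (apply pow_lt; lra). nra. }
    apply Rle_trans with (k * (1+x^2)^2 * phi x * (1+x^2)); [|replace (k * (1+x^2)^2 * phi x * (1+x^2)) with (k * (phi x * (1+x^2)^3)) by ring; nra].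
    apply Rmult_le_compat_r; [lra|]. apply Rmult_le_compat_r; auto.
  - apply is_imp_scal, is_imp_inv1p2.
  - unfold expect. now rewrite (ImpInt_eq _ _ Hl).
Qed.

Lemma expect_eq f l : is_imp (fun x => f x * phi x) l -> E f = l.
Proof. apply ImpInt_eq. Qed.

Lemma expect_lin f g a b k1 k2 : poly_growth f k1 -> poly_growth g k2 ->
  E (fun x => a * f x + b * g x) = a * E f + b * E g.
Proof.
  intros Hf Hg. apply expect_eq. eapply is_imp_ext; [|apply (is_imp_lin _ _ a b _ _ (expect_spec _ _ Hf) (expect_spec _ _ Hg))].
  intros; simpl; ring.
Qed.

Lemma expect_scal f a k : poly_growth f k -> E (fun x => a * f x) = a * E f.
Proof. intros Hf. apply expect_eq. eapply is_imp_ext; [|apply (is_imp_scal _ a _ (expect_spec _ _ Hf))]. intros; simpl; ring. Qed.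

Lemma expect_ext f g : (forall x, f x = g x) -> E f = E g.
Proof.
  intros H. unfold expect. f_equal. apply FunctionalExtensionality.functional_extensionality.
  intros x. now rewrite H.
Qed.

Lemma expect_le f g k1 k2 : poly_growth f k1 -> poly_growth g k2 -> (forall x, f x <= g x) -> E f <= E g.
Proof.
  intros Hf Hg H. apply (is_imp_le _ _ _ _ (fun x => Rmult_le_compat_r _ _ _ (sd_nonneg _ _ _ _ Hphi x) (H x))
    (expect_spec _ _ Hf) (expect_spec _ _ Hg)).
Qed.

Lemma expect_abs_le f g k1 k2 : poly_growth f k1 -> poly_growth g k2 -> (forall x, Rabs (f x) <= g x) -> Rabs (E f) <= E g.
Proof.
  intros Hf Hg H. apply Rabs_le. split.
  - replace (- E g) with ((-1) * E g) by ring. rewrite <- (expect_scal g (-1) k2 Hg).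
    apply (expect_le _ _ k2 k1); auto.
    + destruct Hg as [Hc Hk]. split.
      * intros x. apply continuous_mult_R; [apply continuous_const|auto].
      * intros x. rewrite Rabs_mult, (Rabs_left (-1)) by lra. pose proof (Hk x). lra.
    + intros x. pose proof (H x) as H1. apply Rabs_le_between in H1. lra.
  - apply (expect_le _ _ k1 k2); auto. intros x. pose proof (H x) as H1. apply Rabs_le_between in H1. lra.
Qed.

Lemma pg_const c : poly_growth (fun _ => c) (Rabs c).
Proof.
  split; [intros; apply continuous_const|]. intros x. pose proof (Rabs_pos c).
  assert (1 <= (1 + x^2)^2) by nra. nra.
Qed.

Lemma expect_const c : E (fun _ => c) = c.
Proof.
  apply expect_eq. pose proof (is_imp_scal phi c 1 (sd_mass _ _ _ _ Hphi)) as H. now rewrite Rmult_1_r in H.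
Qed.

Lemma expect_id : E (fun x => x) = 0.
Proof. apply expect_eq, (sd_mean _ _ _ _ Hphi). Qed.

Lemma pg_lin f g a b k1 k2 : poly_growth f k1 -> poly_growth g k2 ->
  poly_growth (fun x => a * f x + b * g x) (Rabs a * k1 + Rabs b * k2).
Proof.
  intros [C1 B1] [C2 B2]. split.
  - intros x. apply (continuous_plus (V:=R_NormedModule)); apply continuous_mult_R; auto; apply continuous_const.
  - intros x. eapply Rle_trans; [apply Rabs_triang|]. rewrite !Rabs_mult.
    pose proof (Rabs_pos a). pose proof (Rabs_pos b). pose proof (B1 x). pose proof (B2 x). nra.
Qed.

Lemma pg_pow2 : poly_growth (fun x => x ^ 2) 1.
Proof.
  split. { intros x. apply (ex_derive_continuous (V:=R_NormedModule)). auto_derive; auto. }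
  intros x. rewrite Rabs_pos_eq; nra.
Qed.

Lemma pg_pow4 : poly_growth (fun x => x ^ 4) 1.
Proof.
  split. { intros x. apply (ex_derive_continuous (V:=R_NormedModule)). auto_derive; auto. }
  intros x. rewrite Rabs_pos_eq; nra.
Qed.

Lemma pg_id : poly_growth (fun x => x) 1.
Proof.
  split. { intros x. apply continuous_id. }
  intros x. apply Rabs_le; split; nra.
Qed.

Lemma continuous_cos_aff a b x : continuous (fun y => cos (a + b * y)) x.
Proof. apply (ex_derive_continuous (V:=R_NormedModule)). auto_derive; auto. Qed.

Lemma continuous_sin_aff a b x : continuous (fun y => sin (a + b * y)) x.
Proof. apply (ex_derive_continuous (V:=R_NormedModule)). auto_derive; auto. Qed.

Lemma pg_cos a b : poly_growth (fun y => cos (a + b * y)) 1.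
Proof.
  split; [intros; apply continuous_cos_aff|]. intros x.
  apply Rle_trans with 1; [apply Rabs_le, COS_bound|]. nra.
Qed.

Lemma pg_sin a b : poly_growth (fun y => sin (a + b * y)) 1.
Proof.
  split; [intros; apply continuous_sin_aff|]. intros x.
  apply Rle_trans with 1; [apply Rabs_le, SIN_bound|]. nra.
Qed.

Lemma pg_ext f g k : (forall x, f x = g x) -> poly_growth f k -> poly_growth g k.
Proof.
  intros H [Hc Hb]. split.
  - intros x. apply continuous_ext with f; auto.
  - intros x. rewrite <- H. auto.
Qed.

(* The characteristic function of X is chi_c + i chi_s = rho exp(i omega). *)
Definition chi_c (t : R) := E (fun y => cos (t * y)).
Definition chi_s (t : R) := E (fun y => sin (t * y)).

Lemma pg_cos0 t : poly_growth (fun y => cos (t * y)) 1.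
Proof. apply pg_ext with (2 := pg_cos 0 t). intros; f_equal; ring. Qed.
Lemma pg_sin0 t : poly_growth (fun y => sin (t * y)) 1.
Proof. apply pg_ext with (2 := pg_sin 0 t). intros; f_equal; ring. Qed.

Definition rho (t : R) := sqrt (chi_c t ^ 2 + chi_s t ^ 2).

(** The polar form stands in for complex arithmetic: powers of the characteristic function become
    rho^j cos(j omega) and rho^j sin(j omega). At the origin any angle will do. *)
Lemma polar_exists x y : exists w, x = sqrt (x^2+y^2) * cos w /\ y = sqrt (x^2+y^2) * sin w.
Proof.
  destruct (Req_dec (x^2+y^2) 0) as [H0|H0].
  - exists 0. rewrite H0, sqrt_0. assert (x = 0) by nra. assert (y = 0) by nra. subst. split; ring.
  - assert (Hp : 0 < x^2+y^2) by nra. set (r := sqrt (x^2+y^2)).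
    assert (Hr : 0 < r) by (apply sqrt_lt_R0; auto).
    assert (Hr2 : r * r = x^2+y^2) by (apply sqrt_sqrt; lra).
    assert (Hb : -1 <= x / r <= 1).
    { apply Rabs_le_between. unfold Rdiv. rewrite Rabs_mult, Rabs_inv, (Rabs_pos_eq r) by lra.
      apply (Rmult_le_reg_r r); auto. rewrite Rmult_assoc, Rinv_l by lra.
      apply Rsqr_incr_0_var; [|lra]. unfold Rsqr. pose proof (Rsqr_abs x) as Hx. unfold Rsqr in Hx. nra. }
    assert (Hs : sqrt (1 - (x/r)^2) = Rabs y / r).
    { replace (1 - (x/r)^2) with ((Rabs y / r)^2).
      - apply sqrt_pow2. apply Rmult_le_pos; [apply Rabs_pos|left; apply Rinv_0_lt_compat; auto].
      - unfold Rdiv. rewrite !Rpow_mult_distr, pow2_abs. replace (y^2) with (r*r - x^2) by lra. field. lra. }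
    assert (Hs' : sin (acos (x/r)) = Rabs y / r).
    { rewrite sin_acos by auto. rewrite <- Hs. f_equal. unfold Rsqr. ring. }
    destruct (Rle_dec 0 y) as [Hy|Hy].
    + exists (acos (x/r)). rewrite cos_acos, Hs' by auto. rewrite Rabs_pos_eq by auto. split; field; lra.
    + exists (- acos (x/r)). rewrite cos_neg, sin_neg, cos_acos, Hs' by auto. rewrite Rabs_left by lra. split; field; lra.
Qed.

Definition omega (t : R) : R := proj1_sig (constructive_indefinite_description _ (polar_exists (chi_c t) (chi_s t))).

Lemma chi_c_polar t : chi_c t = rho t * cos (omega t).
Proof. unfold omega. destruct (constructive_indefinite_description _ _) as [w [H1 H2]]. exact H1. Qed.
Lemma chi_s_polar t : chi_s t = rho t * sin (omega t).
Proof. unfold omega. destruct (constructive_indefinite_description _ _) as [w [H1 H2]]. exact H2. Qed.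

Lemma rho_nonneg t : 0 <= rho t.
Proof. apply sqrt_pos. Qed.

(** Real part of E exp(i(a + tX)) = exp(ia) chi(t). Averaging a wave against [phi] damps it by [rho]
    and shifts its phase by [omega]; with a = - omega, [rho] itself appears as an expectation. *)
Lemma expect_cos_aff a t : E (fun y => cos (a + t * y)) = rho t * cos (a + omega t).
Proof.
  rewrite (expect_ext _ (fun y => cos a * cos (t * y) + (- sin a) * sin (t * y))).
  - rewrite (expect_lin _ _ _ _ 1 1 (pg_cos0 t) (pg_sin0 t)). fold (chi_c t). fold (chi_s t).
    rewrite chi_c_polar, chi_s_polar, cos_plus. ring.
  - intros x. rewrite cos_plus. ring.
Qed.

End Expect.

(** * Finite sums and elementary inequalities *)

(** The range is half-open, unlike that of [sum_f_R0], so that empty sums and splittings at an index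
    need no special case. *)
Fixpoint psum (a : nat -> R) (n : nat) : R :=
  match n with O => 0 | S m => psum a m + a m end.

Lemma psum_S a n : psum a (S n) = psum a n + a n.
Proof. reflexivity. Qed.

Lemma psum_ext a b n : (forall i, (i < n)%nat -> a i = b i) -> psum a n = psum b n.
Proof. induction n; intros H; simpl; auto. rewrite IHn, H; auto. Qed.

Lemma psum_scal a x n : psum (fun i => x * a i) n = x * psum a n.
Proof. induction n; simpl; [ring|rewrite IHn; ring]. Qed.

Lemma psum_minus a b n : psum (fun i => a i - b i) n = psum a n - psum b n.
Proof. induction n; simpl; [ring|rewrite IHn; ring]. Qed.

Lemma psum_plus a b n : psum (fun i => a i + b i) n = psum a n + psum b n.
Proof. induction n; simpl; [ring|rewrite IHn; ring]. Qed.

Lemma psum_le a b n : (forall i, (i < n)%nat -> a i <= b i) -> psum a n <= psum b n.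
Proof. induction n; intros H; simpl; [lra|]. apply Rplus_le_compat; auto. Qed.

Lemma psum_nonneg a n : (forall i, (i < n)%nat -> 0 <= a i) -> 0 <= psum a n.
Proof. induction n; intros H; simpl; [lra|]. pose proof (H n ltac:(lia)). assert (0 <= psum a n) by auto. lra. Qed.

Lemma psum_abs a n : Rabs (psum a n) <= psum (fun i => Rabs (a i)) n.
Proof. induction n; simpl; [rewrite Rabs_R0; lra|]. eapply Rle_trans; [apply Rabs_triang|]. lra. Qed.

Lemma psum_abs_le a b n : (forall i, (i < n)%nat -> Rabs (a i) <= b i) -> Rabs (psum a n) <= psum b n.
Proof. intros H. eapply Rle_trans; [apply psum_abs|now apply psum_le]. Qed.

Lemma psum_const c n : psum (fun _ => c) n = INR n * c.
Proof. induction n; [simpl; ring|]. rewrite S_INR. simpl psum. rewrite IHn. ring. Qed.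

Lemma psum_S_l a n : psum a (S n) = a 0%nat + psum (fun i => a (S i)) n.
Proof. induction n; [simpl; ring|]. simpl psum in *. rewrite IHn. ring. Qed.

Lemma psum_add a m n : psum a (m + n) = psum a m + psum (fun i => a (m + i)%nat) n.
Proof. induction n; [rewrite Nat.add_0_r; simpl; ring|]. rewrite Nat.add_succ_r. simpl. rewrite IHn. ring. Qed.

Lemma psum_incr a m n : (forall i, 0 <= a i) -> (m <= n)%nat -> psum a m <= psum a n.
Proof.
  intros H Hmn. replace n with (m + (n - m))%nat by lia. rewrite psum_add.
  assert (0 <= psum (fun i => a (m + i)%nat) (n - m)) by (apply psum_nonneg; auto). lra.
Qed.

Lemma psum_swap (f : nat -> nat -> R) m n :
  psum (fun i => psum (fun j => f i j) n) m = psum (fun j => psum (fun i => f i j) m) n.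
Proof.
  induction m; simpl.
  - induction n; simpl; auto. rewrite <- IHn. ring.
  - rewrite IHm, <- psum_plus. reflexivity.
Qed.

Lemma psum_sum_f_R0 a n : sum_f_R0 a n = psum a (S n).
Proof. induction n; simpl; [ring|]. rewrite IHn. reflexivity. Qed.

Lemma psum_sum_n a n : sum_n a n = psum a (S n).
Proof. rewrite sum_n_Reals. apply psum_sum_f_R0. Qed.

Lemma is_series_psum a l : is_series a l <-> is_lim_seq (psum a) l.
Proof.
  assert (H : is_series a l <-> is_lim_seq (sum_n a) l) by reflexivity.
  rewrite H, (is_lim_seq_incr_1 (psum a)). split; apply is_lim_seq_ext; intros; now rewrite psum_sum_n.
Qed.

Lemma psum_le_series a l n : (forall i, 0 <= a i) -> is_series a l -> psum a n <= l.
Proof.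
  intros Ha Hl. apply is_series_psum in Hl.
  apply (is_lim_seq_le_loc (fun _ => psum a n) (psum a) (psum a n) l).
  - exists n. intros m Hm. now apply psum_incr.
  - apply is_lim_seq_const.
  - exact Hl.
Qed.

Lemma ex_series_bounded a B : (forall i, 0 <= a i) -> (forall n, psum a n <= B) -> ex_series a.
Proof.
  intros Ha HB.
  destruct (ex_finite_lim_seq_incr (psum a) B) as [l Hl].
  - intros n. simpl. pose proof (Ha n). lra.
  - auto.
  - exists l. apply is_series_psum, Hl.
Qed.

Lemma is_derive_nonneg_le (f df : R -> R) a b : a <= b ->
  (forall x, a <= x <= b -> is_derive f x (df x)) -> (forall x, a <= x <= b -> 0 <= df x) -> f a <= f b.
Proof.
  intros Hab Hd Hp. destruct (MVT_gen f a b df) as [c [Hc He]].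
  - rewrite Rmin_left, Rmax_right by lra. intros; apply Hd; lra.
  - rewrite Rmin_left, Rmax_right by lra. intros x Hx. apply continuity_pt_filterlim.
    apply (ex_derive_continuous (V:=R_NormedModule)). eexists; apply Hd, Hx.
  - rewrite Rmin_left, Rmax_right in Hc by lra. pose proof (Hp c Hc). nra.
Qed.

Lemma is_derive_bounded (f df : R -> R) a b B :
  (forall x, Rmin a b <= x <= Rmax a b -> is_derive f x (df x)) ->
  (forall x, Rmin a b <= x <= Rmax a b -> Rabs (df x) <= B) -> Rabs (f b - f a) <= B * Rabs (b - a).
Proof.
  intros Hd Hp. destruct (MVT_gen f a b df) as [c [Hc He]].
  - intros; apply Hd; lra.
  - intros x Hx. apply continuity_pt_filterlim.
    apply (ex_derive_continuous (V:=R_NormedModule)). eexists; apply Hd, Hx.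
  - rewrite He, Rabs_mult. apply Rmult_le_compat_r; [apply Rabs_pos|auto].
Qed.

(** Start of a chain of alternating Taylor bounds for sin and cos, each obtained from the preceding
    one by comparing derivatives from 0. *)
Lemma sin_le_id x : 0 <= x -> sin x <= x.
Proof.
  intros Hx. pose proof (is_derive_nonneg_le (fun x => x - sin x) (fun x => 1 - cos x) 0 x Hx) as H.
  simpl in H. rewrite sin_0 in H. apply Rminus_le. enough (0 - 0 <= x - sin x) by lra. apply H.
  - intros. auto_derive; auto. ring.
  - intros y _. pose proof (COS_bound y). lra.
Qed.

Lemma cos_ge_2 x : 1 - x^2/2 <= cos x.
Proof.
  assert (forall x, 0 <= x -> 1 - x^2/2 <= cos x) as Hp.
  { clear x. intros x Hx. pose proof (is_derive_nonneg_le (fun x => cos x - 1 + x^2/2) (fun x => x - sin x) 0 x Hx) as H.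
    simpl in H. rewrite cos_0 in H. enough (1 - 1 + 0 * (0 * 1) / 2 <= cos x - 1 + x * (x * 1) / 2) by lra. apply H.
    - intros. auto_derive; auto. field.
    - intros y Hy. pose proof (sin_le_id y). lra. }
  destruct (Rle_dec 0 x); [now apply Hp|]. rewrite <- cos_neg. replace (x^2) with ((-x)^2) by ring. apply Hp. lra.
Qed.

Lemma sin_ge_3 x : 0 <= x -> x - x^3/6 <= sin x.
Proof.
  intros Hx. pose proof (is_derive_nonneg_le (fun x => sin x - x + x^3/6) (fun x => cos x - 1 + x^2/2) 0 x Hx) as H.
  simpl in H. rewrite sin_0 in H. enough (0 - 0 + 0 * (0 * (0*1)) / 6 <= sin x - x + x * (x * (x*1)) / 6) by lra. apply H.
  - intros. auto_derive; auto. field.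
  - intros y Hy. pose proof (cos_ge_2 y). lra.
Qed.

Lemma cos_le_4 x : cos x <= 1 - x^2/2 + x^4/24.
Proof.
  assert (forall x, 0 <= x -> cos x <= 1 - x^2/2 + x^4/24) as Hp.
  { clear x. intros x Hx. pose proof (is_derive_nonneg_le (fun x => 1 - x^2/2 + x^4/24 - cos x) (fun x => sin x - x + x^3/6) 0 x Hx) as H.
    simpl in H. rewrite cos_0 in H. enough (1 - 0 * (0 * 1) / 2 + 0 * (0*(0*(0*1)))/24 - 1 <= 1 - x * (x * 1) / 2 + x * (x*(x*(x*1)))/24 - cos x) by lra. apply H.
    - intros. auto_derive; auto. field.
    - intros y Hy. pose proof (sin_ge_3 y). lra. }
  destruct (Rle_dec 0 x); [now apply Hp|]. rewrite <- cos_neg. replace (x^2) with ((-x)^2) by ring. replace (x^4) with ((-x)^4) by ring. apply Hp. lra.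
Qed.

Lemma sin_le_5 x : 0 <= x -> sin x <= x - x^3/6 + x^5/120.
Proof.
  intros Hx. pose proof (is_derive_nonneg_le (fun x => x - x^3/6 + x^5/120 - sin x) (fun x => 1 - x^2/2 + x^4/24 - cos x) 0 x Hx) as H.
  simpl in H. rewrite sin_0 in H.
  enough (0 - 0 * (0 * (0*1)) / 6 + 0*(0 * (0*(0*(0*1))))/120 - 0 <= x - x * (x * (x*1)) / 6 + x*(x * (x*(x*(x*1))))/120 - sin x) by lra. apply H.
  - intros. auto_derive; auto. field.
  - intros y Hy. pose proof (cos_le_4 y). lra.
Qed.

Lemma atan_diff_ge a b : 0 <= a <= b -> (b - a) / (1 + b^2) <= atan b - atan a.
Proof.
  intros Hab. destruct (MVT_gen atan a b (fun x => / (1 + x^2))) as [c [Hc He]].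
  - intros. apply is_derive_Reals, derivable_pt_lim_atan.
  - intros x _. apply derivable_continuous_pt. eexists; apply derivable_pt_lim_atan.
  - rewrite Rmin_left, Rmax_right in Hc by lra. rewrite He. unfold Rdiv. rewrite Rmult_comm.
    apply Rmult_le_compat_r; [lra|]. apply Rinv_le_contravar; nra.
Qed.

(** Integral comparison with the arctangent as primitive. Majorants c/(1 + a^2 (i+1)^2) serve for
    all sums over lattice points (a = L) as well as over frequencies (a = 2 pi/L), and the bound
    makes their tails explicit. *)
Lemma psum_inv1p2_tail a m n : 0 < a ->
  psum (fun i => / (1 + a^2 * (INR (m + i) + 1)^2)) n <= (PI/2 - atan (a * INR m)) / a.
Proof.
  intros Ha.
  assert (H : psum (fun i => / (1 + a^2 * (INR (m + i) + 1)^2)) n <= (atan (a * INR (m + n)) - atan (a * INR m)) / a).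
  { induction n.
    - simpl. rewrite Nat.add_0_r. unfold Rdiv. lra.
    - simpl psum. pose proof (atan_diff_ge (a * INR (m+n)) (a * INR (m + S n))) as Hd.
      rewrite Nat.add_succ_r, S_INR in *.
      specialize (Hd ltac:(pose proof (pos_INR (m+n)); nra)).
      replace (a * (INR (m + n) + 1) - a * INR (m + n)) with a in Hd by ring.
      replace ((a * (INR (m + n) + 1))^2) with (a^2 * (INR (m + n) + 1)^2) in Hd by ring.
      assert (/ (1 + a ^ 2 * (INR (m + n) + 1) ^ 2) <= (atan (a * (INR (m + n) + 1)) - atan (a * INR (m + n))) / a).
      { apply (Rmult_le_reg_l a); auto. unfold Rdiv in *. rewrite (Rmult_comm (_ - _) (/ a)), <- (Rmult_assoc a (/a)), Rinv_r; lra. }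
      eapply Rle_trans; [apply Rplus_le_compat; [exact IHn|exact H]|]. right. field. lra. }
  eapply Rle_trans; [exact H|]. unfold Rdiv. apply Rmult_le_compat_r; [left; now apply Rinv_0_lt_compat|].
  pose proof (atan_bound (a * INR (m+n))). lra.
Qed.

Lemma psum_inv1p2 a n : 0 < a -> psum (fun i => / (1 + a^2 * (INR i + 1)^2)) n <= PI / (2 * a).
Proof.
  intros Ha. pose proof (psum_inv1p2_tail a 0 n Ha) as H. simpl Nat.add in H. change (INR 0) with 0 in H. rewrite Rmult_0_r, atan_0 in H.
  replace (PI / (2 * a)) with ((PI / 2 - 0)/a) by (field; lra). exact H.
Qed.

(** * Poisson kernel and Abel summation of Fourier series *)

(** The squared modulus of 1 - q exp(2 pi i x). *)
Definition poisson_den (q x : R) : R := 1 - 2 * q * cos (2 * PI * x) + q ^ 2.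
Definition poisson_kernel (q x : R) : R := (1 - q ^ 2) / poisson_den q x.
(** Truncated Fourier series of [poisson_kernel]; as a finite sum it can be integrated term by
    term. *)
Definition poisson_partial (q : R) (M : nat) (x : R) : R :=
  1 + 2 * psum (fun i => q ^ S i * cos (2 * PI * INR (S i) * x)) M.

Lemma poisson_den_ge q x : 0 <= q -> (1 - q) ^ 2 <= poisson_den q x.
Proof. intros Hq. unfold poisson_den. pose proof (COS_bound (2 * PI * x)). nra. Qed.

(** By 2 cos A cos B = cos(A + B) + cos(A - B) the product telescopes, leaving only the two ends of
    the sum. *)
Lemma poisson_partial_id q M x :
  poisson_den q x * poisson_partial q M x =
  1 - q ^ 2 - 2 * q ^ S M * cos (2 * PI * INR (S M) * x) + 2 * q ^ S (S M) * cos (2 * PI * INR M * x).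
Proof.
  unfold poisson_partial, poisson_den. induction M.
  - simpl. replace (2 * PI * 0 * x) with 0 by ring. rewrite cos_0. replace (2 * PI * 1 * x) with (2 * PI * x) by ring. ring.
  - rewrite psum_S.
    replace (2 * PI * INR (S (S M)) * x) with (2 * PI * INR (S M) * x + 2 * PI * x) by (rewrite (S_INR (S M)); ring).
    replace (2 * PI * INR M * x) with (2 * PI * INR (S M) * x - 2 * PI * x) in IHM by (rewrite (S_INR M); ring).
    rewrite cos_plus. rewrite cos_minus in IHM.
    set (P := psum _ M) in *. set (A := 2 * PI * INR (S M) * x) in *. set (B := 2 * PI * x) in *.
    replace ((1 - 2 * q * cos B + q ^ 2) * (1 + 2 * (P + q ^ S M * cos A))) with
      ((1 - 2 * q * cos B + q ^ 2) * (1 + 2 * P) + (1 - 2 * q * cos B + q ^ 2) * (2 * q ^ S M * cos A)) by ring.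
    rewrite IHM. simpl. ring.
Qed.

Lemma poisson_partial_close q M x : 0 <= q < 1 ->
  Rabs (poisson_partial q M x - poisson_kernel q x) <= 4 * q ^ S M / (1 - q) ^ 2.
Proof.
  intros Hq. pose proof (poisson_den_ge q x ltac:(lra)) as Hd.
  assert (Hd1 : 0 < (1 - q)^2) by (apply pow_lt; lra).
  assert (He : poisson_partial q M x - poisson_kernel q x =
    (- 2 * q ^ S M * cos (2 * PI * INR (S M) * x) + 2 * q ^ S (S M) * cos (2 * PI * INR M * x)) / poisson_den q x).
  { unfold poisson_kernel. apply (Rmult_eq_reg_l (poisson_den q x)); [|lra].
    rewrite Rmult_minus_distr_l, poisson_partial_id. field. lra. }
  rewrite He. unfold Rdiv. rewrite Rabs_mult, Rabs_inv, (Rabs_pos_eq (poisson_den q x)) by lra.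
  apply Rmult_le_compat.
  - apply Rabs_pos.
  - left; apply Rinv_0_lt_compat; lra.
  - pose proof (pow_le q (S M) ltac:(lra)).
    assert (q ^ S (S M) <= q ^ S M) by (simpl; simpl in H; nra). pose proof (pow_le q (S (S M)) ltac:(lra)).
    pose proof (COS_bound (2 * PI * INR (S M) * x)). pose proof (COS_bound (2 * PI * INR M * x)).
    apply Rabs_le. set (a := q ^ S M) in *. set (b := q ^ S (S M)) in *. set (c := cos _) in *. set (d := cos _) in *. split; nra.
  - apply Rinv_le_contravar; lra.
Qed.

Lemma poisson_kernel_nonneg q x : 0 <= q < 1 -> 0 <= poisson_kernel q x.
Proof.
  intros Hq. pose proof (poisson_den_ge q x ltac:(lra)). assert (0 < (1-q)^2) by (apply pow_lt; lra).
  apply Rmult_le_pos; [nra|]. left; apply Rinv_0_lt_compat; lra.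
Qed.

(** Where |x| > eta, the bounds cos(2 pi x) <= 1 - 2 x^2 and q >= 1/2 make the denominator at least
    2 x^2, hence the kernel at most (1 - q)/x^2. *)
Lemma poisson_kernel_first_moment q x eta : 1/2 <= q < 1 -> 0 < eta -> Rabs x <= 1/2 ->
  Rabs x * poisson_kernel q x <= eta * poisson_kernel q x + (1 - q) / eta.
Proof.
  intros Hq He Hx. pose proof (poisson_kernel_nonneg q x ltac:(lra)) as Hp.
  assert (Hq1 : 0 < (1 - q) / eta) by (apply Rdiv_lt_0_compat; lra).
  destruct (Rle_dec (Rabs x) eta) as [Hxe|Hxe]; [nra|]. apply Rnot_le_lt in Hxe.
  assert (H : Rabs x * poisson_kernel q x <= (1 - q) / eta); [|nra].
  set (y := Rabs x) in *.
  assert (Hc : cos (2 * PI * x) <= 1 - 2 * y^2).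
  { replace (cos (2 * PI * x)) with (cos (2 * (PI * y))).
    2:{ unfold y, Rabs. destruct (Rcase_abs x).
        - rewrite <- cos_neg. f_equal. ring.
        - f_equal. ring. }
    rewrite cos_2a_sin. pose proof PI2_3_2. pose proof PI_4. pose proof PI_RGT_0.
    pose proof (sin_ge_3 (PI * y) ltac:(nra)) as Hs.
    assert (PI * y <= 2) by nra.
    (* For z = pi y <= 2 the cubic bound gives sin z >= z/3, and z >= 3 y. *)
    assert (y <= sin (PI * y)).
    { assert (Hz : 0 <= PI * y) by nra. remember (PI * y) as z eqn:Ez.
      assert (0 <= z * ((2 - z) * (2 + z))) by (repeat apply Rmult_le_pos; lra).
      assert (3 * y <= z) by (rewrite Ez; apply Rmult_le_compat_r; lra). nra. }
    nra. }
  assert (Hd : 2 * y ^ 2 <= poisson_den q x).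
  { unfold poisson_den. nra. }
  assert (0 < y) by lra. assert (0 < y^2) by nra.
  unfold poisson_kernel.
  apply Rle_trans with (y * (2 * (1 - q) / (2 * y^2))).
  - apply Rmult_le_compat_l; [lra|]. unfold Rdiv. apply Rmult_le_compat; [nra| left; apply Rinv_0_lt_compat; lra| nra |].
    apply Rinv_le_contravar; nra.
  - replace (y * (2 * (1 - q) / (2 * y^2))) with ((1 - q) / y) by (field; lra).
    unfold Rdiv. apply Rmult_le_compat_l; [lra|]. apply Rinv_le_contravar; lra.
Qed.

Lemma is_RInt_cos_period m : is_RInt (fun x => cos (2 * PI * INR (S m) * x)) (-(1/2)) (1/2) 0.
Proof.
  pose proof PI_RGT_0 as Hpi. pose proof (lt_0_INR (S m) ltac:(lia)) as Hm.
  set (w := 2 * PI * INR (S m)). assert (Hw : 0 < w) by (unfold w; nra).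
  replace 0 with (minus (sin (w * (1/2)) / w) (sin (w * (-(1/2))) / w)).
  - apply (is_RInt_derive (V:=R_CompleteNormedModule) (fun x => sin (w * x) / w)).
    + intros. auto_derive; [lra|]. field. lra.
    + intros x _. apply (ex_derive_continuous (V:=R_NormedModule)). auto_derive; auto.
  - assert (sin (w * (1/2)) = 0) as Hs.
    { apply sin_eq_0_1. exists (Z.of_nat (S m)). rewrite <- INR_IZR_INZ. unfold w. field. }
    replace (w * - (1/2)) with (- (w * (1/2))) by ring. rewrite sin_neg, Hs.
    unfold minus, plus, opp; simpl. field. lra.
Qed.

Lemma is_RInt_psum (f : nat -> R -> R) (l : nat -> R) a b n :
  (forall i, is_RInt (f i) a b (l i)) -> is_RInt (fun x => psum (fun i => f i x) n) a b (psum l n).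
Proof.
  intros H. induction n.
  - simpl. apply is_RInt_ext with (fun _ => 0); auto.
    pose proof (is_RInt_const (V:=R_NormedModule) a b 0) as Hc. unfold scal in Hc; simpl in Hc. unfold mult in Hc; simpl in Hc.
    now rewrite Rmult_0_r in Hc.
  - simpl. apply (is_RInt_plus (V:=R_NormedModule)); auto.
Qed.

Lemma is_RInt_scalR (f : R -> R) a b k l : is_RInt f a b l -> is_RInt (fun x => k * f x) a b (k * l).
Proof. apply (is_RInt_scal (V:=R_NormedModule)). Qed.

Lemma is_RInt_plusR (f g : R -> R) a b k l : is_RInt f a b k -> is_RInt g a b l -> is_RInt (fun x => f x + g x) a b (k + l).
Proof. apply (is_RInt_plus (V:=R_NormedModule)). Qed.

Lemma is_RInt_constR (c : R) a b : is_RInt (fun _ => c) a b ((b - a) * c).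
Proof. apply (is_RInt_const (V:=R_NormedModule)). Qed.

Lemma is_RInt_poisson_partial q M : is_RInt (poisson_partial q M) (-(1/2)) (1/2) 1.
Proof.
  replace 1 with ((1/2 - -(1/2)) * 1 + 2 * psum (fun i => q ^ S i * 0) M) at 3.
  - apply is_RInt_plusR; [apply is_RInt_constR|]. apply is_RInt_scalR.
    apply (is_RInt_psum (fun i x => q ^ S i * cos (2 * PI * INR (S i) * x)) (fun i => q ^ S i * 0)).
    intros i. apply is_RInt_scalR, is_RInt_cos_period.
  - rewrite (psum_ext _ (fun _ => 0)) by (intros; ring). rewrite psum_const. field.
Qed.

Lemma continuous_poisson_kernel q x : 0 <= q < 1 -> continuous (poisson_kernel q) x.
Proof.
  intros Hq. apply (ex_derive_continuous (V:=R_NormedModule)). unfold poisson_kernel, poisson_den. auto_derive.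
  pose proof (poisson_den_ge q x ltac:(lra)) as Hd. unfold poisson_den in Hd. assert (0 < (1-q)^2) by (apply pow_lt; lra). lra.
Qed.

(** The quantity on the left is the integral of p - p(0) against the truncated kernel, whose mass is
    1. Passing to the true Poisson kernel costs [e] pointwise; that kernel then has mass at most 1 +
    e, and the Lipschitz bound reduces the rest to its first moment. *)
Lemma poisson_approx (p : R -> R) (Kl B q eta : R) (M : nat) (A : nat -> R) :
  1/2 <= q < 1 -> 0 < eta ->
  (forall x, continuous p x) ->
  (forall x, Rabs x <= 1/2 -> Rabs (p x - p 0) <= Kl * Rabs x) ->
  (forall x, Rabs x <= 1/2 -> Rabs (p x - p 0) <= B) ->
  (forall m, is_RInt (fun x => p x * cos (2 * PI * INR m * x)) (-(1/2)) (1/2) (A m)) ->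
  let e := 4 * q ^ S M / (1 - q) ^ 2 in
  Rabs (A 0%nat + 2 * psum (fun i => q ^ S i * A (S i)) M - p 0) <=
    Kl * (eta * (1 + e) + (1 - q) / eta) + B * e.
Proof.
  intros Hq Heta Hc HL HB HA e.
  assert (He : 0 <= e).
  { unfold e. apply Rmult_le_pos; [|left; apply Rinv_0_lt_compat, pow_lt; lra].
    pose proof (pow_le q (S M) ltac:(lra)). lra. }
  assert (HK : 0 <= Kl). { pose proof (HL (1/2)) as H. rewrite Rabs_pos_eq in H by lra. specialize (H ltac:(lra)).
    pose proof (Rabs_pos (p (1/2) - p 0)). lra. }
  assert (HB0 : 0 <= B). { pose proof (HB 0) as H. rewrite Rabs_R0 in H. specialize (H ltac:(lra)).
    pose proof (Rabs_pos (p 0 - p 0)). lra. }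
  assert (Hint1 : is_RInt (fun x => (p x - p 0) * poisson_partial q M x) (-(1/2)) (1/2)
     (A 0%nat + 2 * psum (fun i => q ^ S i * A (S i)) M - p 0)).
  { replace (A 0%nat + 2 * psum (fun i => q ^ S i * A (S i)) M - p 0) with
     (A 0%nat + 2 * psum (fun i => q ^ S i * A (S i)) M + (- p 0) * 1) by ring.
    apply is_RInt_ext with (fun x => (p x * cos (2 * PI * INR 0 * x) + 2 * psum (fun i => q ^ S i * (p x * cos (2 * PI * INR (S i) * x))) M)
       + (- p 0) * poisson_partial q M x).
    - intros x _. rewrite (psum_ext _ (fun i => p x * (q ^ S i * cos (2 * PI * INR (S i) * x)))) by (intros; ring).
      rewrite psum_scal. unfold poisson_partial. change (INR 0) with 0. replace (2 * PI * 0 * x) with 0 by ring.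
      rewrite cos_0. eqR. ring.
    - apply is_RInt_plusR.
      + apply is_RInt_plusR; [apply HA|]. apply is_RInt_scalR.
        apply (is_RInt_psum (fun i x => q ^ S i * (p x * cos (2 * PI * INR (S i) * x)))). intros i. apply is_RInt_scalR, HA.
      + apply is_RInt_scalR, is_RInt_poisson_partial. }
  assert (Hk : exists k, is_RInt (poisson_kernel q) (-(1/2)) (1/2) k /\ k <= 1 + e).
  { destruct (ex_RInt_continuous (V:=R_CompleteNormedModule) (poisson_kernel q) (-(1/2)) (1/2)) as [k Hk].
    { intros; apply continuous_poisson_kernel; lra. }
    exists k. split; auto.
    apply (is_RInt_le (poisson_kernel q) (fun x => poisson_partial q M x + e) (-(1/2)) (1/2)); auto; [lra| |].
    - replace (1 + e) with (1 + (1/2 - -(1/2)) * e) by field. apply is_RInt_plusR; [apply is_RInt_poisson_partial|apply is_RInt_constR].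
    - intros x _. pose proof (poisson_partial_close q M x ltac:(lra)) as H. fold e in H.
      apply Rabs_le_between in H. lra. }
  destruct Hk as [k [Hk Hk1]].
  apply Rle_trans with (Kl * (eta * k + (1 - q) / eta) + B * e).
  - apply (norm_RInt_le (V:=R_NormedModule) (fun x => (p x - p 0) * poisson_partial q M x)
     (fun x => Kl * (eta * poisson_kernel q x + (1 - q) / eta) + B * e) (-(1/2)) (1/2)); [lra| |exact Hint1|].
    + intros x Hx. change (norm ((p x - p 0) * poisson_partial q M x)) with (Rabs ((p x - p 0) * poisson_partial q M x)).
      rewrite Rabs_mult.
      assert (Hx1 : Rabs x <= 1/2) by (apply Rabs_le; lra).
      pose proof (HL x Hx1). pose proof (HB x Hx1). pose proof (Rabs_pos (p x - p 0)).
      pose proof (poisson_kernel_nonneg q x ltac:(lra)).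
      pose proof (poisson_kernel_first_moment q x eta Hq Heta Hx1).
      assert (Rabs (poisson_partial q M x) <= poisson_kernel q x + e).
      { pose proof (poisson_partial_close q M x ltac:(lra)) as Hcl. fold e in Hcl.
        pose proof (Rabs_triang_inv (poisson_partial q M x) (poisson_kernel q x)) as Ht.
        rewrite (Rabs_pos_eq (poisson_kernel q x)) in Ht by auto. lra. }
      pose proof (Rabs_pos x).
      apply Rle_trans with (Rabs (p x - p 0) * (poisson_kernel q x + e)); [apply Rmult_le_compat_l; auto|].
      rewrite Rmult_plus_distr_l. apply Rplus_le_compat; [|nra].
      apply Rle_trans with (Kl * (Rabs x * poisson_kernel q x)); [rewrite <- Rmult_assoc; apply Rmult_le_compat_r; auto|].
      apply Rmult_le_compat_l; auto.
    + replace (Kl * (eta * k + (1 - q) / eta) + B * e) with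
        (Kl * (eta * k + (1/2 - -(1/2)) * ((1 - q) / eta)) + (1/2 - -(1/2)) * (B * e)) by (field; lra).
      apply is_RInt_plusR; [|apply is_RInt_constR]. apply is_RInt_scalR.
      apply is_RInt_plusR; [|apply is_RInt_constR]. apply is_RInt_scalR, Hk.
  - apply Rplus_le_compat_r, Rmult_le_compat_l; auto. apply Rplus_le_compat_r, Rmult_le_compat_l; lra.
Qed.

Lemma one_minus_pow_le q n : 0 <= q <= 1 -> 1 - q ^ n <= INR n * (1 - q).
Proof.
  intros Hq. induction n; [simpl; lra|]. rewrite S_INR. simpl.
  assert (0 <= q ^ n <= 1). { split; [apply pow_le; lra|]. rewrite <- (pow1 n). apply pow_incr; lra. }
  nra.
Qed.

Lemma atan_tail_small a c eps : 0 < a -> 0 < eps -> 0 <= c -> exists M : nat, forall m, (M <= m)%nat ->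
  c * ((PI/2 - atan (a * INR m)) / a) <= eps.
Proof.
  intros Ha He Hc. destruct (atan_tends_PI2 (eps * a / (c + 1))) as [X [HX H]].
  { apply Rdiv_lt_0_compat; nra. }
  destruct (INR_unbounded (X / a)) as [M HM]. exists M. intros m Hm. apply le_INR in Hm.
  specialize (H (a * INR m)). assert (X <= a * INR m).
  { apply (Rmult_le_reg_r (/ a)); [now apply Rinv_0_lt_compat|]. unfold Rdiv in HM. replace (a * INR m * / a) with (INR m) by (field; lra). lra. }
  specialize (H H0). set (d := PI/2 - atan (a * INR m)) in *.
  assert (Hd : 0 <= d <= eps * a / (c + 1)) by (unfold d; lra).
  apply (Rmult_le_reg_r (a * (c + 1))); [apply Rmult_lt_0_compat; lra|].
  replace (c * (d / a) * (a * (c+1))) with (c * (d * (c + 1))) by (field; lra).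
  assert (d * (c + 1) <= eps * a).
  { destruct Hd as [_ Hd]. apply (Rmult_le_compat_r (c+1)) in Hd; [|lra]. replace (eps * a / (c + 1) * (c + 1)) with (eps * a) in Hd by (field; lra). exact Hd. }
  assert (0 < eps * a) by nra. nra.
Qed.

Lemma tail_bound (b : nat -> R) a c m n : 0 < a -> (m <= n)%nat ->
  (forall i, Rabs (b i) <= c * / (1 + a ^ 2 * (INR i + 1) ^ 2)) ->
  Rabs (psum b n - psum b m) <= c * ((PI/2 - atan (a * INR m)) / a).
Proof.
  intros Ha Hmn Hb. replace n with (m + (n - m))%nat by lia. rewrite psum_add.
  replace (psum b m + psum (fun i => b (m+i)%nat) (n-m) - psum b m) with (psum (fun i => b (m+i)%nat) (n-m)) by ring.
  eapply Rle_trans; [apply (psum_abs_le _ (fun i => c * / (1 + a^2 * (INR (m+i) + 1)^2))); intros; apply Hb|].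
  rewrite psum_scal. apply Rmult_le_compat_l; [|now apply psum_inv1p2_tail].
  pose proof (Hb 0%nat) as H. pose proof (Rabs_pos (b 0%nat)).
  assert (0 < / (1 + a ^ 2 * (INR 0 + 1) ^ 2)) by (apply Rinv_0_lt_compat; simpl; nra). nra.
Qed.

Lemma tail_bound_lim (b : nat -> R) (a c : R) (m : nat) (l : R) : 0 < a -> is_lim_seq (psum b) l ->
  (forall i, Rabs (b i) <= c * / (1 + a ^ 2 * (INR i + 1) ^ 2)) ->
  Rabs (l - psum b m) <= c * ((PI/2 - atan (a * INR m)) / a).
Proof.
  intros Ha Hl Hb.
  assert (Hm : is_lim_seq (fun n => Rabs (psum b n - psum b m)) (Rabs (l - psum b m))).
  { apply (is_lim_seq_abs _ (l - psum b m)). apply (is_lim_seq_minus' _ _ _ _ Hl), is_lim_seq_const. }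
  apply (is_lim_seq_le_loc _ (fun _ => c * ((PI/2 - atan (a * INR m)) / a)) _ _) with (2 := Hm) (3 := is_lim_seq_const _).
  exists m. intros n Hn. now apply tail_bound.
Qed.

Lemma dominated_conv (b : nat -> R) a c : 0 < a ->
  (forall i, Rabs (b i) <= c * / (1 + a ^ 2 * (INR i + 1) ^ 2)) -> exists l : R, is_lim_seq (psum b) l.
Proof.
  intros Ha Hb.
  destruct (ex_series_Rabs b) as [l Hl].
  - apply (ex_series_bounded _ (c * (PI / (2 * a)))); [intros; apply Rabs_pos|].
    intros n. eapply Rle_trans; [apply psum_le; intros; apply Hb|]. rewrite psum_scal.
    apply Rmult_le_compat_l; [|now apply psum_inv1p2].
    pose proof (Hb 0%nat) as H. pose proof (Rabs_pos (b 0%nat)).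
    assert (0 < / (1 + a ^ 2 * (INR 0 + 1) ^ 2)) by (apply Rinv_0_lt_compat; simpl; nra). nra.
  - exists l. now apply is_series_psum.
Qed.

(** The coefficients are absolutely summable, so their sum exists and is the limit of the Abel
    means. The assumed estimate, with [eta] small, then [q] close to 1 and finally [M] large,
    identifies it with [p0]. *)
Lemma abel_poisson (A : nat -> R) (p0 Kl B c a : R) : 0 < a -> 0 <= Kl -> 0 <= B ->
  (forall q eta M, 1/2 <= q < 1 -> 0 < eta ->
    let e := 4 * q ^ S M / (1 - q) ^ 2 in
    Rabs (A 0%nat + 2 * psum (fun i => q ^ S i * A (S i)) M - p0) <=
    Kl * (eta * (1 + e) + (1 - q) / eta) + B * e) ->
  (forall i, Rabs (A (S i)) <= c * / (1 + a ^ 2 * (INR i + 1) ^ 2)) ->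
  is_lim_seq (fun M => A 0%nat + 2 * psum (fun i => A (S i)) M) p0.
Proof.
  intros Ha HKl HB H Hdec.
  destruct (dominated_conv (fun i => A (S i)) a c Ha Hdec) as [l Hl].
  assert (Hlim : is_lim_seq (fun M => A 0%nat + 2 * psum (fun i => A (S i)) M) (A 0%nat + 2 * l)).
  { apply is_lim_seq_plus'; [apply is_lim_seq_const|]. apply (is_lim_seq_mult' (fun _ => 2)); [apply is_lim_seq_const|exact Hl]. }
  enough (A 0%nat + 2 * l = p0) by (subst; auto).
  apply cond_eq. intros eps0 Heps0.
  set (eps := eps0 / 20). assert (Heps : 0 < eps) by (unfold eps; lra).
  assert (Hc : 0 <= c).
  { pose proof (Hdec 0%nat) as H1. pose proof (Rabs_pos (A 1%nat)).
    assert (0 < / (1 + a ^ 2 * (INR 0 + 1) ^ 2)) by (apply Rinv_0_lt_compat; simpl; nra). nra. }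
  destruct (atan_tail_small a c eps Ha Heps Hc) as [I HI]. specialize (HI I (le_n I)).
  set (S0 := psum (fun i => INR (S i) * Rabs (A (S i))) I).
  assert (HS0 : 0 <= S0). { apply psum_nonneg. intros; apply Rmult_le_pos; [apply pos_INR|apply Rabs_pos]. }
  set (eta := eps / (Kl + 1)). assert (Heta : 0 < eta) by (apply Rdiv_lt_0_compat; lra).
  assert (HKeta : Kl * eta <= eps).
  { unfold eta. replace (Kl * (eps / (Kl + 1))) with (eps * (Kl / (Kl + 1))) by (field; lra).
    assert (Kl / (Kl + 1) <= 1). { apply (Rmult_le_reg_r (Kl+1)); [lra|]. unfold Rdiv. rewrite Rmult_assoc, Rinv_l; lra. } nra. }
  (* [d <= eta ^ 2] makes (1 - q)/eta at most eta, and [d * S0 <= eps] controls the first [I] terms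
     through 1 - q^i <= i (1 - q). *)
  set (d := Rmin (1/2) (Rmin (eta ^ 2) (eps / (S0 + 1)))).
  assert (Hd : 0 < d). { repeat apply Rmin_pos; [lra|apply pow_lt; auto|apply Rdiv_lt_0_compat; lra]. }
  assert (Hd1 : d <= 1/2) by apply Rmin_l.
  assert (Hd2 : d <= eta ^ 2). { eapply Rle_trans; [apply Rmin_r|apply Rmin_l]. }
  assert (Hd3 : d * S0 <= eps).
  { assert (d <= eps / (S0 + 1)) by (eapply Rle_trans; [apply Rmin_r|apply Rmin_r]).
    apply (Rmult_le_compat_r (S0+1)) in H0; [|lra]. replace (eps / (S0 + 1) * (S0 + 1)) with eps in H0 by (field; lra). nra. }
  set (q := 1 - d). assert (Hq : 1/2 <= q < 1) by (unfold q; lra).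
  assert (He0 : is_lim_seq (fun M => 4 * q ^ S M / (1 - q)^2) 0).
  { replace (Finite 0) with (Rbar_mult (4 * / (1-q)^2) 0) by (simpl; f_equal; ring).
    apply is_lim_seq_ext with (fun M => (4 * / (1-q)^2) * q ^ (S M)).
    - intros; field. lra.
    - apply is_lim_seq_scal_l. apply -> (is_lim_seq_incr_1 (fun n => q ^ n)). apply is_lim_seq_geom. rewrite Rabs_pos_eq; lra. }
  apply is_lim_seq_Reals in He0. apply is_lim_seq_Reals in Hl.
  assert (HeB : 0 < Rmin 1 (eps / (B + 1))) by (apply Rmin_pos; [lra|apply Rdiv_lt_0_compat; lra]).
  destruct (He0 _ HeB) as [M1 HM1].
  destruct (Hl eps Heps) as [M2 HM2].
  set (M := (M1 + M2 + I)%nat). specialize (HM1 M ltac:(unfold M; lia)). specialize (HM2 M ltac:(unfold M; lia)).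
  unfold Rdist in HM1, HM2. rewrite Rminus_0_r in HM1.
  specialize (H q eta M Hq Heta). cbv zeta in H. set (e := 4 * q ^ S M / (1 - q) ^ 2) in *.
  assert (He : 0 <= e). { unfold e. apply Rmult_le_pos; [|left; apply Rinv_0_lt_compat, pow_lt; lra].
    pose proof (pow_le q (S M) ltac:(lra)). lra. }
  rewrite Rabs_pos_eq in HM1 by auto.
  assert (He1 : e <= 1) by (pose proof (Rmin_l 1 (eps / (B+1))); lra).
  assert (HBe : B * e <= eps).
  { assert (e <= eps / (B + 1)) by (pose proof (Rmin_r 1 (eps / (B+1))); lra).
    apply (Rmult_le_compat_r (B+1)) in H0; [|lra]. replace (eps / (B + 1) * (B + 1)) with eps in H0 by (field; lra). nra. }
  assert (Hdiff : Rabs (psum (fun i => A (S i)) M - psum (fun i => q ^ S i * A (S i)) M) <= 2 * eps).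
  { rewrite <- psum_minus. unfold M. rewrite Nat.add_comm, psum_add.
    eapply Rle_trans; [apply Rabs_triang|]. replace (2 * eps) with (eps + eps) by ring. apply Rplus_le_compat.
    - eapply Rle_trans; [|exact Hd3]. unfold S0. rewrite <- psum_scal. apply psum_abs_le. intros i _.
      replace (A (S i) - q ^ S i * A (S i)) with ((1 - q ^ S i) * A (S i)) by ring.
      rewrite Rabs_mult, <- Rmult_assoc. apply Rmult_le_compat_r; [apply Rabs_pos|].
      pose proof (one_minus_pow_le q (S i) ltac:(lra)). assert (q ^ S i <= 1). { rewrite <- (pow1 (S i)). apply pow_incr; lra. }
      rewrite Rabs_pos_eq by lra. unfold q at 2 in H0. lra.
    - eapply Rle_trans; [|exact HI].
      eapply Rle_trans.
      + apply (psum_abs_le _ (fun i => c * / (1 + a ^ 2 * (INR (I + i) + 1) ^ 2))). intros i _.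
        replace (A (S (I+i)) - q ^ S (I+i) * A (S (I+i))) with ((1 - q ^ S (I+i)) * A (S (I+i))) by ring.
        rewrite Rabs_mult. eapply Rle_trans; [|apply Hdec].
        assert (q ^ S (I+i) <= 1). { rewrite <- (pow1 (S (I+i))). apply pow_incr; lra. }
        pose proof (pow_le q (S (I+i)) ltac:(lra)). rewrite Rabs_pos_eq by lra. pose proof (Rabs_pos (A (S (I+i)))). nra.
      + rewrite psum_scal. apply Rmult_le_compat_l; auto. now apply psum_inv1p2_tail. }
  assert (Hq2 : (1 - q) / eta <= eta).
  { unfold q. replace (1 - (1 - d)) with d by ring. apply (Rmult_le_reg_r eta); auto. unfold Rdiv. rewrite Rmult_assoc, Rinv_l; [|lra]. nra. }
  assert (HKl2 : Kl * (eta * (1 + e) + (1 - q) / eta) <= 3 * eps).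
  { apply Rle_trans with (Kl * (3 * eta)); [|lra]. apply Rmult_le_compat_l; auto. nra. }
  apply Rabs_le_between in Hdiff. apply Rabs_le_between in H. apply Rabs_def2 in HM2.
  apply Rabs_def1; unfold eps in *; lra.
Qed.

(** * Decay of the characteristic function *)

Section Decay.
Variables (phi D1 D2 : R -> R) (K : R).
Hypothesis Hphi : smooth_density phi D1 D2 K.

Lemma rho_le_1 t : rho phi t <= 1.
Proof.
  pose proof (expect_cos_aff phi D1 D2 K Hphi (- omega phi t) t) as H.
  replace (- omega phi t + omega phi t) with 0 in H by ring. rewrite cos_0, Rmult_1_r in H. rewrite <- H.
  rewrite <- (expect_const phi D1 D2 K Hphi 1).
  apply (expect_le phi D1 D2 K Hphi _ _ 1 (Rabs 1)); [apply pg_cos|apply pg_const|]. intros x. apply COS_bound.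
Qed.

Lemma sd_decay1 x : phi x <= K * / (1 + x ^ 2).
Proof.
  pose proof (sd_decay _ _ _ _ Hphi x). pose proof (sd_nonneg _ _ _ _ Hphi x).
  assert (1 <= 1 + x^2) by nra. apply (Rmult_le_reg_r (1 + x^2)); [lra|]. rewrite Rmult_assoc, Rinv_l by lra.
  assert (1 <= (1 + x^2)^2) by nra. replace (phi x * (1+x^2)^3) with (phi x * (1 + x^2) * (1+x^2)^2) in H by ring.
  assert (0 <= phi x * (1 + x^2)) by nra. nra.
Qed.

(** Two integrations by parts, with the phase frozen at w = omega(t) so that the cosine integral is
    [rho] itself: t^2 rho is minus the integral of cos(ty - w) against the second derivative. *)
Lemma rho_decay t : t ^ 2 * rho phi t <= K * PI.
Proof.
  set (w := omega phi t). set (f := fun y => cos (- w + t * y)).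
  pose proof (expect_cos_aff phi D1 D2 K Hphi (- w) t) as HE. fold f in HE. fold w in HE.
  replace (- w + w) with 0 in HE by ring. rewrite cos_0, Rmult_1_r in HE.
  pose proof (expect_spec phi D1 D2 K Hphi f 1 (pg_cos _ _)) as Hf. rewrite HE in Hf.
  destruct (is_imp_dom (fun y => f y * D2 y) (fun y => K * / (1 + y^2)) (K * PI)) as [l [Hl Hlb]].
  - intros x. apply continuous_mult_R; [apply (continuous_cos_aff)|apply (sd_D2_cont _ _ _ _ Hphi)].
  - intros x. rewrite Rabs_mult. pose proof (sd_D2_decay _ _ _ _ Hphi x).
    assert (0 < 1 + x^2) by nra. assert (Rabs (f x) <= 1) by (apply Rabs_le, COS_bound).
    pose proof (Rabs_pos (D2 x)). apply Rle_trans with (Rabs (D2 x)); [pose proof (Rabs_pos (f x)); nra|].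
    apply (Rmult_le_reg_r (1 + x^2)); auto. rewrite Rmult_assoc, Rinv_l by lra. lra.
  - apply is_imp_scal, is_imp_inv1p2.
  - pose proof (is_imp_lin _ _ (t^2) 1 _ _ Hf Hl) as Hs.
    assert (Hz : is_imp (fun x => t ^ 2 * (f x * phi x) + 1 * (f x * D2 x)) 0).
    { enough (t ^ 2 * rho phi t + 1 * l = 0) as <- by exact Hs.
      pose proof (is_imp_sym_seq _ _ Hs) as Hlim. apply is_lim_seq_unique in Hlim.
      (* [F] collects the boundary terms of both integrations by parts; it vanishes at infinity. *)
      set (F := fun y => D1 y * cos (-w + t * y) + t * phi y * sin (-w + t * y)).
      assert (HF : forall a b, is_RInt (fun x => t ^ 2 * (f x * phi x) + 1 * (f x * D2 x)) a b (F b - F a)).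
      { intros a b. apply (is_RInt_derive (V:=R_CompleteNormedModule) F).
        - intros x _. unfold F. evar_last.
          + apply (is_derive_plus (V:=R_NormedModule)).
            * apply (is_derive_mult D1 (fun y => cos (- w + t * y)) x (D2 x) (- (t * sin (-w + t * x)))).
              -- apply (sd_D2 _ _ _ _ Hphi).
              -- auto_derive; auto. ring.
              -- intros; apply Rmult_comm.
            * apply (is_derive_mult (fun y => t * phi y) (fun y => sin (- w + t * y)) x (t * D1 x) (t * cos (-w + t * x))).
              -- apply (is_derive_scal phi x t (D1 x)), (sd_D1 _ _ _ _ Hphi).
              -- auto_derive; auto. ring.
              -- intros; apply Rmult_comm.
          + unfold f, plus, mult; simpl. ring.
        - intros x _. apply (continuous_plus (V:=R_NormedModule)); repeat apply continuous_mult_R; try apply continuous_const;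
            try apply continuous_cos_aff; [eapply sd_cont; eauto|apply (sd_D2_cont _ _ _ _ Hphi)]. }
      assert (HB : forall x, Rabs (F x) <= (K + Rabs t * K) * / (1 + x^2)).
      { intros x. unfold F. eapply Rle_trans; [apply Rabs_triang|]. rewrite Rmult_plus_distr_r. assert (0 < 1 + x^2) by nra. apply Rplus_le_compat.
        - rewrite Rabs_mult. assert (Rabs (cos (- w + t * x)) <= 1) by (apply Rabs_le, COS_bound).
          pose proof (sd_D1_decay _ _ _ _ Hphi x). pose proof (Rabs_pos (D1 x)).
          apply Rle_trans with (Rabs (D1 x)); [pose proof (Rabs_pos (cos (-w+t*x))); nra|].
          apply (Rmult_le_reg_r (1 + x^2)); auto. rewrite Rmult_assoc, Rinv_l by lra. lra.
        - rewrite !Rabs_mult. assert (Rabs (sin (- w + t * x)) <= 1) by (apply Rabs_le, SIN_bound).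
          pose proof (sd_nonneg _ _ _ _ Hphi x). rewrite (Rabs_pos_eq (phi x)) by auto. pose proof (sd_decay1 x).
          pose proof (Rabs_pos t). apply Rle_trans with (Rabs t * phi x); [|rewrite Rmult_assoc; nra].
          assert (0 <= Rabs t * phi x) by nra. nra. }
      assert (Hl0 : is_lim_seq (fun n => RInt.RInt (fun x => t ^ 2 * (f x * phi x) + 1 * (f x * D2 x)) (- INR n) (INR n)) 0).
      { apply is_lim_seq_abs_0.
        assert (Hup : is_lim_seq (fun n => (2 * (K + Rabs t * K)) * / INR n) 0).
        { replace (Finite 0) with (Rbar_mult (2 * (K + Rabs t * K)) 0) by (simpl; f_equal; ring).
          apply is_lim_seq_scal_l. replace (Finite 0) with (Rbar_inv p_infty) by reflexivity. apply is_lim_seq_inv; [apply is_lim_seq_INR|discriminate]. }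
        apply (is_lim_seq_le_le_loc (fun _ => 0) _ (fun n => (2 * (K + Rabs t * K)) * / INR n) 0) with (3 := Hup) (2 := is_lim_seq_const 0).
        exists 1%nat. intros n Hn. split; [apply Rabs_pos|]. rewrite (is_RInt_unique _ _ _ _ (HF _ _)).
        pose proof (HB (INR n)) as H1. pose proof (HB (- INR n)) as H2. replace ((- INR n)^2) with (INR n ^ 2) in H2 by ring.
        assert (Hn1 : 1 <= INR n) by (apply (le_INR 1); auto).
        assert (H3 : / (1 + INR n ^ 2) <= / INR n) by (apply Rinv_le_contravar; nra).
        assert (0 <= K + Rabs t * K) by (pose proof (sd_K_pos _ _ _ _ Hphi); pose proof (Rabs_pos t); nra).
        unfold Rminus. eapply Rle_trans; [apply Rabs_triang|]. rewrite Rabs_Ropp.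
        assert ((K + Rabs t * K) * / (1 + INR n ^ 2) <= (K + Rabs t * K) * / INR n) by nra. lra. }
      apply is_lim_seq_unique in Hl0. rewrite Hl0 in Hlim. injection Hlim; auto. }
    pose proof (is_imp_uniq _ _ _ Hs Hz). apply Rabs_le_between in Hlb. lra.
Qed.

Lemma rho_decay2 t : rho phi t <= (1 + K * PI) * / (1 + t^2).
Proof.
  pose proof (rho_decay t). pose proof (rho_le_1 t). assert (0 < 1 + t^2) by nra.
  apply (Rmult_le_reg_r (1 + t^2)); auto. rewrite Rmult_assoc, Rinv_l by lra. lra.
Qed.
End Decay.

(** * Poisson summation *)

(** The window of [is_sumZ], with its two ends independent. *)
Definition zsum (f : Z -> R) (m n : nat) : R :=
  sum_f_R0 (fun i => f (Z.of_nat i - Z.of_nat m)%Z) (m + n).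

Lemma zsum_split f m n :
  zsum f m n = f 0%Z + psum (fun i => f (Z.of_nat (S i))) n + psum (fun i => f (- Z.of_nat (S i))%Z) m.
Proof.
  unfold zsum. rewrite psum_sum_f_R0. replace (S (m + n)) with (m + (1 + n))%nat by lia.
  rewrite !psum_add.
  replace (psum (fun i => f (Z.of_nat i - Z.of_nat m)%Z) m) with (psum (fun i => f (- Z.of_nat (S i))%Z) m).
  - simpl (psum _ 1). rewrite (psum_ext _ (fun i => f (Z.of_nat (S i))) n).
    + replace (Z.of_nat (m + 0) - Z.of_nat m)%Z with 0%Z by lia. ring.
    + intros i _. f_equal. lia.
  - induction m; [reflexivity|]. rewrite psum_S, psum_S_l, Rplus_comm. f_equal.
    rewrite IHm. apply psum_ext. intros i _. f_equal. lia.
Qed.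

Lemma is_RInt_lim_seq (f : R -> R) (l : R) a b : is_imp f l ->
  is_lim_seq a m_infty -> is_lim_seq b p_infty -> is_lim_seq (fun n => RInt.RInt f (a n) (b n)) l.
Proof.
  intros Hf Ha Hb. apply is_lim_seq_Reals. intros eps Heps.
  destruct (is_imp_lim f l Hf eps Heps) as [M [HM H]].
  apply is_lim_seq_spec in Ha. apply is_lim_seq_spec in Hb.
  destruct (Ha (- M)) as [N1 HN1]. destruct (Hb M) as [N2 HN2].
  exists (N1 + N2)%nat. intros n Hn. apply H; left; [apply HN1|apply HN2]; lia.
Qed.

Lemma is_lim_seq_psum (f : nat -> nat -> R) (l : nat -> R) M :
  (forall i, is_lim_seq (fun n => f n i) (l i)) -> is_lim_seq (fun n => psum (f n) M) (psum l M).
Proof.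
  intros H. induction M; simpl; [apply is_lim_seq_const|]. now apply is_lim_seq_plus'.
Qed.

Lemma cos_period_IZR x k : cos (x + 2 * IZR k * PI) = cos x.
Proof.
  assert (Hn : forall n x, cos (x + 2 * IZR (Z.of_nat n) * PI) = cos x).
  { intros n y. rewrite <- INR_IZR_INZ. apply cos_period. }
  destruct (Z_le_gt_dec 0 k) as [Hk|Hk].
  - rewrite <- (Z2Nat.id k Hk). apply Hn.
  - rewrite <- (Hn (Z.to_nat (- k)) (x + 2 * IZR k * PI)), Z2Nat.id, opp_IZR by lia. f_equal. ring.
Qed.

Section Poisson.
Variables (phi D1 D2 : R -> R) (K : R).
Hypothesis Hphi : smooth_density phi D1 D2 K.
Variable L : R.
Hypothesis HL : 0 < L.

Definition freq (L : R) (i : nat) : R := 2 * PI / L * INR i.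

Let t := freq L.

(** Real part of the sum of chi(t_i)^j exp(- i t_i u) over the first [M] positive frequencies.
    Opposite frequencies are conjugate, so that 1 + 2 [char_sum] is the symmetric Fourier sum. *)
Definition char_sum (j M : nat) (u : R) : R :=
  psum (fun i => rho phi (t (S i)) ^ j * cos (INR j * omega phi (t (S i)) - t (S i) * u)) M.

Lemma freq_coef_pos : 0 < 2 * PI / L.
Proof. pose proof PI_RGT_0. apply Rdiv_lt_0_compat; lra. Qed.

Lemma rho_freq_decay i : rho phi (t (S i)) <= (1 + K * PI) * / (1 + (2 * PI / L) ^ 2 * (INR i + 1) ^ 2).
Proof.
  pose proof (rho_decay2 phi D1 D2 K Hphi (t (S i))) as H. unfold t, freq in *.
  rewrite S_INR in *. replace ((2 * PI / L * (INR i + 1))^2) with ((2 * PI / L) ^ 2 * (INR i + 1) ^ 2) in H by ring. exact H.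
Qed.

(** Peetre's inequality: the shift leaves the decaying factor at the price of 1 + u^2. *)
Lemma weight_shift u v : / (1 + (u + v) ^ 2) <= 2 * (1 + u ^ 2) * / (1 + v ^ 2).
Proof.
  pose proof (pow2_ge_0 v). pose proof (pow2_ge_0 (u + v)). assert (0 < 1 + v^2) by lra. assert (0 < 1 + (u+v)^2) by lra.
  apply (Rmult_le_reg_r ((1 + (u+v)^2) * (1 + v^2))); [now apply Rmult_lt_0_compat|].
  replace (/ (1 + (u + v) ^ 2) * ((1 + (u + v) ^ 2) * (1 + v ^ 2))) with (1 + v^2) by (field; lra).
  replace (2 * (1 + u ^ 2) * / (1 + v ^ 2) * ((1 + (u + v) ^ 2) * (1 + v ^ 2))) with (2 * (1 + u ^ 2) * (1 + (u+v)^2)) by (field; lra).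
  assert (v^2 <= 2 * (u+v)^2 + 2 * u^2) by (pose proof (pow2_ge_0 (2*u+v)); nra).
  assert (0 <= u^2 * (u+v)^2) by (apply Rmult_le_pos; apply pow2_ge_0). lra.
Qed.

Lemma phi_shift_le u k : phi (u + L * IZR k) <= 2 * K * (1 + u ^ 2) * / (1 + L ^ 2 * IZR k ^ 2).
Proof.
  eapply Rle_trans; [apply (sd_decay1 phi D1 D2 K Hphi)|].
  pose proof (weight_shift u (L * IZR k)) as H. pose proof (sd_K_pos _ _ _ _ Hphi).
  rewrite Rpow_mult_distr in H.
  replace (2 * K * (1 + u ^ 2) * / (1 + L ^ 2 * IZR k ^ 2)) with (K * (2 * (1 + u ^ 2) * / (1 + L ^ 2 * IZR k ^ 2))) by ring.
  apply Rmult_le_compat_l; auto.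
Qed.

Lemma INR_IZR_S i : IZR (Z.of_nat (S i)) = INR i + 1.
Proof. rewrite <- INR_IZR_INZ, S_INR. reflexivity. Qed.

Lemma phi_shift_pos u i : Rabs (phi (u + L * IZR (Z.of_nat (S i)))) <= 2 * K * (1 + u ^ 2) * / (1 + L ^ 2 * (INR i + 1) ^ 2).
Proof. rewrite Rabs_pos_eq by (apply (sd_nonneg _ _ _ _ Hphi)). pose proof (phi_shift_le u (Z.of_nat (S i))) as H. now rewrite INR_IZR_S in H at 2. Qed.

Lemma phi_shift_neg u i : Rabs (phi (u + L * IZR (- Z.of_nat (S i)))) <= 2 * K * (1 + u ^ 2) * / (1 + L ^ 2 * (INR i + 1) ^ 2).
Proof.
  rewrite Rabs_pos_eq by (apply (sd_nonneg _ _ _ _ Hphi)). pose proof (phi_shift_le u (- Z.of_nat (S i))) as H.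
  rewrite (opp_IZR (Z.of_nat (S i))) in H at 2. rewrite INR_IZR_S in H. replace ((- (INR i + 1))^2) with ((INR i + 1)^2) in H by ring. exact H.
Qed.

(** Truncated periodization of [phi] around [u], rescaled to period 1. It is not periodic itself,
    but its Fourier integrals over one period are exact integrals of [phi], see [p_coef]. *)
Let p (u : R) (n : nat) (x : R) := zsum (fun k => phi (u + L * (x + IZR k))) n n.

Lemma p_cont u n x : continuous (p u n) x.
Proof.
  assert (Hk : forall k, continuous (fun x => phi (u + L * (x + IZR k))) x).
  { intros k. apply (continuous_comp (fun x => u + L * (x + IZR k)) phi).
    - apply (ex_derive_continuous (V:=R_NormedModule)). auto_derive; auto.
    - eapply sd_cont; eauto. }
  assert (Hp : forall (f : nat -> Z) m, continuous (fun x => psum (fun i => phi (u + L * (x + IZR (f i)))) m) x).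
  { intros f m. induction m; simpl; [apply continuous_const|]. now apply (continuous_plus (V:=R_NormedModule)). }
  apply continuous_ext with (fun x => phi (u + L * (x + IZR 0)) + psum (fun i => phi (u + L * (x + IZR (Z.of_nat (S i))))) n
     + psum (fun i => phi (u + L * (x + IZR (- Z.of_nat (S i))))) n).
  - intros y. unfold p. now rewrite zsum_split.
  - apply continuous_plus_R; [apply continuous_plus_R|]; auto.
Qed.

(** Lipschitz constant: [L] comes from the chain rule, [K] from the decay of [D1], and the rest from
    [weight_shift] with (u + L y)^2 <= 2 u^2 + L^2/2 for |y| <= 1/2. *)
Let Q (u : R) := L * K * (2 * (1 + 2 * u ^ 2 + L ^ 2 / 2)).

Lemma phi_lip u k x : Rabs x <= 1/2 ->
  Rabs (phi (u + L * (x + IZR k)) - phi (u + L * (0 + IZR k))) <= Q u * / (1 + L ^ 2 * IZR k ^ 2) * Rabs x.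
Proof.
  intros Hx. pose proof (sd_K_pos _ _ _ _ Hphi) as HK.
  pose proof (is_derive_bounded (fun x => phi (u + L * (x + IZR k))) (fun x => L * D1 (u + L * (x + IZR k))) 0 x
    (Q u * / (1 + L ^ 2 * IZR k ^ 2))) as H. rewrite Rminus_0_r in H. apply H.
  - intros y _. apply (is_derive_comp phi (fun x => u + L * (x + IZR k)) y (D1 (u + L * (y + IZR k))) L); [apply (sd_D1 _ _ _ _ Hphi)|].
    auto_derive; auto. ring.
  - intros y Hy.
    assert (Hy2 : Rabs y <= 1/2).
    { apply Rabs_le_between in Hx. apply Rabs_le. revert Hy. unfold Rmin, Rmax. destruct (Rle_dec 0 x); lra. }
    rewrite Rabs_mult, (Rabs_pos_eq L) by lra.
    pose proof (sd_D1_decay _ _ _ _ Hphi (u + L * (y + IZR k))) as Hd.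
    pose proof (weight_shift (u + L * y) (L * IZR k)) as Hw. replace (u + L * y + L * IZR k) with (u + L * (y + IZR k)) in Hw by ring.
    rewrite Rpow_mult_distr in Hw. set (xi := u + L * (y + IZR k)) in *.
    assert (0 < 1 + xi^2) by (pose proof (pow2_ge_0 xi); lra).
    assert (Hd2 : Rabs (D1 xi) <= K * / (1 + xi^2)). { apply (Rmult_le_reg_r (1+xi^2)); auto. rewrite Rmult_assoc, Rinv_l by lra. lra. }
    assert (Hu : (u + L * y)^2 <= 2 * u^2 + L^2/2).
    { assert ((u + L * y)^2 <= 2 * u^2 + 2 * (L * y)^2) by (pose proof (pow2_ge_0 (u - L*y)); nra).
      assert (y^2 <= 1/4). { rewrite <- pow2_abs. pose proof (Rabs_pos y). nra. }
      assert (0 <= L^2) by nra. rewrite Rpow_mult_distr in H1. nra. }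
    unfold Q. assert (Hi : 0 < / (1 + L ^ 2 * IZR k ^ 2)).
    { apply Rinv_0_lt_compat. pose proof (pow2_ge_0 L). pose proof (pow2_ge_0 (IZR k)). nra. }
    rewrite !Rmult_assoc. apply Rmult_le_compat_l; [lra|]. eapply Rle_trans; [exact Hd2|]. apply Rmult_le_compat_l; auto.
    eapply Rle_trans; [exact Hw|]. rewrite Rmult_assoc. apply Rmult_le_compat_l; [lra|]. apply Rmult_le_compat_r; lra.
Qed.

Lemma p_lip u n x : Rabs x <= 1/2 -> Rabs (p u n x - p u n 0) <= Q u * (1 + PI / L) * Rabs x.
Proof.
  intros Hx. unfold p. rewrite !zsum_split.
  set (A := phi (u + L * (x + IZR 0))). set (A' := phi (u + L * (0 + IZR 0))).
  assert (HA : Rabs (A - A') <= Q u * Rabs x).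
  { pose proof (phi_lip u 0 x Hx) as H. replace (1 + L ^ 2 * 0 ^ 2) with 1 in H by ring. rewrite Rinv_1, Rmult_1_r in H. exact H. }
  assert (Hs : forall f : nat -> Z, (forall i, IZR (f i) ^ 2 = (INR i + 1)^2) ->
     Rabs (psum (fun i => phi (u + L * (x + IZR (f i)))) n - psum (fun i => phi (u + L * (0 + IZR (f i)))) n) <= (Q u * Rabs x) * (PI / (2 * L))).
  { intros f Hf. rewrite <- psum_minus. eapply Rle_trans.
    - apply (psum_abs_le _ (fun i => (Q u * Rabs x) * / (1 + L ^ 2 * (INR i + 1) ^ 2))). intros i _.
      eapply Rle_trans; [apply phi_lip; auto|]. rewrite Hf. right; ring.
    - rewrite psum_scal. apply Rmult_le_compat_l; [|now apply psum_inv1p2].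
      eapply Rle_trans; [|exact HA]. apply Rabs_pos. }
  pose proof (Hs (fun i => Z.of_nat (S i))) as H1. pose proof (Hs (fun i => (- Z.of_nat (S i))%Z)) as H2. cbv beta in H1, H2.
  specialize (H1 ltac:(intros; now rewrite INR_IZR_S)).
  specialize (H2 ltac:(intros; rewrite opp_IZR, INR_IZR_S; ring)).
  replace (Q u * (1 + PI / L) * Rabs x) with (Q u * Rabs x + Q u * Rabs x * (PI / (2 * L)) + Q u * Rabs x * (PI / (2 * L))) by (field; lra).
  apply Rabs_le_between in HA. apply Rabs_le_between in H1. apply Rabs_le_between in H2. apply Rabs_le. lra.
Qed.

Let g (u : R) (m : nat) (y : R) := cos (- (t m * u) + t m * y) * phi y.

Lemma g_ex u m a b : ex_RInt (g u m) a b.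
Proof.
  apply (ex_RInt_continuous (V:=R_CompleteNormedModule)). intros x _. apply continuous_mult_R; [apply continuous_cos_aff|]. eapply sd_cont; eauto.
Qed.

Lemma p_coef_k u m k a b : a = u + L * (IZR k - 1/2) -> b = u + L * (IZR k + 1/2) ->
  is_RInt (fun x => phi (u + L * (x + IZR k)) * cos (2 * PI * INR m * x)) (-(1/2)) (1/2) (RInt.RInt (g u m) a b / L).
Proof.
  intros Ea Eb. subst a b.
  pose proof (RInt_correct (V:=R_CompleteNormedModule) _ _ _ (g_ex u m (u + L * (IZR k - 1/2)) (u + L * (IZR k + 1/2)))) as H.
  pose proof (is_RInt_comp_lin (V:=R_NormedModule) (g u m) L (u + L * IZR k) (-(1/2)) (1/2) (RInt.RInt (g u m) (u + L * (IZR k - 1/2)) (u + L * (IZR k + 1/2)))) as Hc.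
  replace (L * - (1/2) + (u + L * IZR k)) with (u + L * (IZR k - 1/2)) in Hc by ring.
  replace (L * (1/2) + (u + L * IZR k)) with (u + L * (IZR k + 1/2)) in Hc by ring.
  specialize (Hc H). apply (is_RInt_scalR _ _ _ (/L)) in Hc.
  unfold Rdiv. rewrite (Rmult_comm _ (/ L)). apply is_RInt_ext with (2 := Hc).
  intros x _. unfold scal; simpl. unfold mult; simpl. eqR. unfold g.
  replace (L * x + (u + L * IZR k)) with (u + L * (x + IZR k)) by ring.
  replace (- (t m * u) + t m * (u + L * (x + IZR k))) with (2 * PI * INR m * x + 2 * IZR (Z.of_nat m * k) * PI).
  - rewrite (cos_period_IZR (2 * PI * INR m * x) (Z.of_nat m * k)). field. lra.
  - unfold t, freq. rewrite mult_IZR, <- INR_IZR_INZ. field. lra.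
Qed.

(** The translates of one period tile a long interval, and integer shifts leave the cosine
    unchanged; each further [n] adds one tile at either end. *)
Lemma p_coef u m n : is_RInt (fun x => p u n x * cos (2 * PI * INR m * x)) (-(1/2)) (1/2)
   (RInt.RInt (g u m) (u - L * (INR n + 1/2)) (u + L * (INR n + 1/2)) / L).
Proof.
  induction n.
  - simpl INR. apply is_RInt_ext with (fun x => phi (u + L * (x + IZR 0)) * cos (2 * PI * INR m * x)).
    + intros x _. unfold p. rewrite zsum_split. simpl psum. eqR. ring.
    + apply p_coef_k; simpl; field.
  - rewrite S_INR.
    replace (RInt.RInt (g u m) (u - L * (INR n + 1 + 1/2)) (u + L * (INR n + 1 + 1/2))) with
     (RInt.RInt (g u m) (u - L * (INR n + 1/2)) (u + L * (INR n + 1/2)) +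
      RInt.RInt (g u m) (u - L * (INR n + 1 + 1/2)) (u - L * (INR n + 1/2)) + RInt.RInt (g u m) (u + L * (INR n + 1/2)) (u + L * (INR n + 1 + 1/2))).
    2:{ rewrite <- (RInt_Chasles (V:=R_CompleteNormedModule) (g u m) (u - L * (INR n + 1 + 1/2)) (u - L * (INR n + 1/2)) (u + L * (INR n + 1 + 1/2))) by apply g_ex.
        rewrite <- (RInt_Chasles (V:=R_CompleteNormedModule) (g u m) (u - L * (INR n + 1/2)) (u + L * (INR n + 1/2)) (u + L * (INR n + 1 + 1/2))) by apply g_ex.
        unfold plus; simpl. ring. }
    unfold Rdiv. rewrite !Rmult_plus_distr_r.
    apply is_RInt_ext with (fun x => p u n x * cos (2 * PI * INR m * x) + phi (u + L * (x + IZR (- Z.of_nat (S n)))) * cos (2 * PI * INR m * x)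
        + phi (u + L * (x + IZR (Z.of_nat (S n)))) * cos (2 * PI * INR m * x)).
    + intros x _. unfold p. rewrite !zsum_split, !psum_S. eqR. ring.
    + apply is_RInt_plusR; [apply is_RInt_plusR|].
      * exact IHn.
      * apply p_coef_k; rewrite opp_IZR, INR_IZR_S; field.
      * apply p_coef_k; rewrite INR_IZR_S; field.
Qed.

Lemma phi_zsum_lim u : exists l : R, is_lim_seq (fun n => zsum (fun k => phi (u + L * IZR k)) n n) l.
Proof.
  destruct (dominated_conv _ L _ HL (phi_shift_pos u)) as [l1 H1].
  destruct (dominated_conv _ L _ HL (phi_shift_neg u)) as [l2 H2].
  exists (phi (u + L * IZR 0) + l1 + l2). eapply is_lim_seq_ext; [intros n; symmetry; apply zsum_split|].
  apply is_lim_seq_plus'; auto. apply is_lim_seq_plus'; auto. apply is_lim_seq_const.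
Qed.

Let A (u : R) (m : nat) := rho phi (t m) * cos (- (t m * u) + omega phi (t m)) / L.

Lemma A_lim u m : is_lim_seq (fun n => RInt.RInt (g u m) (u - L * (INR n + 1/2)) (u + L * (INR n + 1/2)) / L) (A u m).
Proof.
  unfold A. rewrite <- (expect_cos_aff phi D1 D2 K Hphi (- (t m * u)) (t m)).
  pose proof (expect_spec phi D1 D2 K Hphi _ _ (pg_cos (- (t m * u)) (t m))) as H.
  set (E0 := expect phi _) in *. unfold Rdiv.
  apply (is_lim_seq_mult' _ (fun _ => / L) E0); [|apply is_lim_seq_const].
  apply is_RInt_lim_seq; [exact H| |].
  - apply is_lim_seq_opp. simpl. apply (is_lim_seq_le_p_loc (fun n => L * INR n - u)).
    + exists 0%nat. intros n _. nra.
    + apply is_lim_seq_minus with p_infty u; [|apply is_lim_seq_const|reflexivity].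
      apply is_lim_seq_mult with L p_infty; [apply is_lim_seq_const|apply is_lim_seq_INR|].
      unfold is_Rbar_mult; simpl. destruct (Rle_dec 0 L) as [Hle|]; [|exfalso; lra]. destruct (Rle_lt_or_eq_dec 0 L Hle); [auto|exfalso; lra].
  - apply (is_lim_seq_le_p_loc (fun n => L * INR n + u)).
    + exists 0%nat. intros n _. nra.
    + apply is_lim_seq_plus with p_infty u; [|apply is_lim_seq_const|reflexivity].
      apply is_lim_seq_mult with L p_infty; [apply is_lim_seq_const|apply is_lim_seq_INR|].
      unfold is_Rbar_mult; simpl. destruct (Rle_dec 0 L) as [Hle|]; [|exfalso; lra]. destruct (Rle_lt_or_eq_dec 0 L Hle); [auto|exfalso; lra].
Qed.

Lemma A_0 u : A u 0 = / L.
Proof.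
  unfold A. rewrite <- (expect_cos_aff phi D1 D2 K Hphi (- (t 0 * u)) (t 0)).
  rewrite (expect_ext _ _ (fun _ => 1)).
  - rewrite (expect_const phi D1 D2 K Hphi). field. lra.
  - intros x. unfold t, freq. simpl. rewrite <- cos_0. f_equal. ring.
Qed.

(** The constants of [p_lip] do not depend on [n], so [n] may tend to infinity inside the estimate
    of [poisson_approx]; the limiting estimate is what [abel_poisson] consumes. *)
Lemma poisson_pointwise u (l : R) : is_lim_seq (fun n => zsum (fun k => phi (u + L * IZR k)) n n) l ->
  is_lim_seq (fun M => 1 + 2 * char_sum 1 M u) (L * l).
Proof.
  intros Hl.
  assert (HQ : 0 <= Q u). { unfold Q. pose proof (sd_K_pos _ _ _ _ Hphi). repeat apply Rmult_le_pos; nra. }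
  assert (Hf : 0 < 1 + PI / L). { pose proof PI_RGT_0. assert (0 < PI / L) by (apply Rdiv_lt_0_compat; lra). lra. }
  set (Kl := Q u * (1 + PI / L)). assert (HKl : 0 <= Kl) by (unfold Kl; nra).
  assert (HA : is_lim_seq (fun M => A u 0 + 2 * psum (fun i => A u (S i)) M) l).
  { apply (abel_poisson (A u) l Kl Kl ((1 + K * PI) / L) (2 * PI / L)); auto.
    - apply freq_coef_pos.
    - intros q eta M Hq Heta. cbv zeta. set (e := 4 * q ^ S M / (1 - q) ^ 2).
      apply (is_lim_seq_le (fun n => Rabs (RInt.RInt (g u 0) (u - L * (INR n + 1/2)) (u + L * (INR n + 1/2)) / L +
         2 * psum (fun i => q ^ S i * (RInt.RInt (g u (S i)) (u - L * (INR n + 1/2)) (u + L * (INR n + 1/2)) / L)) M - p u n 0))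
         (fun _ => Kl * (eta * (1 + e) + (1 - q) / eta) + Kl * e)
         (Rabs (A u 0 + 2 * psum (fun i => q ^ S i * A u (S i)) M - l)) (Kl * (eta * (1 + e) + (1 - q) / eta) + Kl * e)).
      + intros n. apply (poisson_approx (p u n) Kl Kl q eta M
          (fun m => RInt.RInt (g u m) (u - L * (INR n + 1/2)) (u + L * (INR n + 1/2)) / L)); auto.
        * intros x. apply p_cont.
        * intros x Hx. now apply p_lip.
        * intros x Hx. eapply Rle_trans; [now apply p_lip|]. fold Kl. pose proof (Rabs_pos x). nra.
        * intros m. apply p_coef.
      + apply (is_lim_seq_abs _ (Finite _)). apply is_lim_seq_minus'.
        * apply is_lim_seq_plus'; [apply A_lim|]. apply (is_lim_seq_mult' (fun _ => 2)); [apply is_lim_seq_const|].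
          apply is_lim_seq_psum. intros i. apply (is_lim_seq_mult' (fun _ => q ^ S i)); [apply is_lim_seq_const|apply A_lim].
        * apply is_lim_seq_ext with (2 := Hl). intros n. unfold p. rewrite !zsum_split. simpl IZR. rewrite Rplus_0_l. f_equal; [f_equal|]; apply psum_ext; intros; f_equal; ring.
      + apply is_lim_seq_const.
    - intros i. unfold A. unfold Rdiv at 1. rewrite !Rabs_mult, (Rabs_pos_eq (rho phi _)) by apply rho_nonneg.
      assert (HiL : 0 < / L) by (now apply Rinv_0_lt_compat). rewrite (Rabs_pos_eq (/L)) by lra.
      pose proof (rho_freq_decay i) as Hr. assert (Hc : Rabs (cos (- (t (S i) * u) + omega phi (t (S i)))) <= 1) by (apply Rabs_le, COS_bound).
      pose proof (rho_nonneg phi (t (S i))) as Hr0.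
      replace ((1 + K * PI) / L * / (1 + (2 * PI / L) ^ 2 * (INR i + 1) ^ 2)) with
        ((1 + K * PI) * / (1 + (2 * PI / L) ^ 2 * (INR i + 1) ^ 2) * / L) by (unfold Rdiv at 2; ring).
      apply Rmult_le_compat_r; [lra|]. apply Rle_trans with (rho phi (t (S i))); [|exact Hr].
      rewrite <- (Rmult_1_r (rho phi (t (S i)))) at 2. apply Rmult_le_compat_l; auto. }
  apply is_lim_seq_ext with (fun M => L * (A u 0 + 2 * psum (fun i => A u (S i)) M)).
  - intros M. rewrite A_0. unfold char_sum.
    rewrite (psum_ext (fun i => A u (S i)) (fun i => / L * (rho phi (t (S i)) ^ 1 * cos (INR 1 * omega phi (t (S i)) - t (S i) * u)))).
    + rewrite psum_scal. field. lra.
    + intros i _. unfold A. replace (INR 1 * omega phi (t (S i)) - t (S i) * u) with (- (t (S i) * u) + omega phi (t (S i))) by (simpl; ring).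
      field. lra.
  - apply (is_lim_seq_mult' (fun _ => L)); [apply is_lim_seq_const|exact HA].
Qed.
End Poisson.

(** * Poisson summation for convolution powers *)

Section Periodized.
Variables (phi D1 D2 : R -> R) (K : R).
Hypothesis Hphi : smooth_density phi D1 D2 K.
Variable L : R.
Hypothesis HL : 0 < L.

Local Notation t := (freq L).

Lemma convpow_S j x : convpow phi (S (S j)) x = expect phi (fun y => convpow phi (S j) (x - y)).
Proof. reflexivity. Qed.

Lemma pg_bounded_lip f B : (forall x, Rabs (f x) <= B) -> (forall x y, Rabs (f x - f y) <= B * Rabs (x - y)) ->
  forall x, poly_growth (fun y => f (x - y)) B.
Proof.
  intros Hb Hl x. pose proof (Hb 0) as HB. pose proof (Rabs_pos (f 0)). split.
  - intros y. apply continuity_pt_filterlim. intros eps Heps. exists (eps / (B + 1)).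
    split; [apply Rdiv_lt_0_compat; lra|]. intros z [_ Hz]. simpl in *. unfold Rdist in *.
    eapply Rle_lt_trans; [apply Hl|]. replace (x - z - (x - y)) with (- (z - y)) by ring. rewrite Rabs_Ropp.
    apply Rle_lt_trans with (B * (eps / (B+1))); [apply Rmult_le_compat_l; lra|].
    apply (Rmult_lt_reg_r (B + 1)); [lra|]. replace (B * (eps / (B + 1)) * (B + 1)) with (B * eps) by (field; lra). nra.
  - intros y. eapply Rle_trans; [apply Hb|]. pose proof (pow2_ge_0 y). assert (1 <= (1 + y^2)^2) by nra. nra.
Qed.

(** Averaging against a probability density preserves both the bound and the Lipschitz constant, so
    the same [K] serves for every power. This is enough for all convolution integrals to exist. *)
Lemma convpow_reg j : (forall x, 0 <= convpow phi (S j) x <= K) /\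
  (forall x y, Rabs (convpow phi (S j) x - convpow phi (S j) y) <= K * Rabs (x - y)).
Proof.
  pose proof (sd_K_pos _ _ _ _ Hphi) as HK.
  induction j as [|j [IH1 IH2]].
  - simpl. split.
    + intros x. split; [apply (sd_nonneg _ _ _ _ Hphi)|]. eapply Rle_trans; [apply (sd_decay1 phi D1 D2 K Hphi)|].
      rewrite <- (Rmult_1_r K) at 2. apply Rmult_le_compat_l; auto. rewrite <- Rinv_1. apply Rinv_le_contravar; [lra|]. pose proof (pow2_ge_0 x). lra.
    + intros x y. apply (is_derive_bounded phi D1).
      * intros; apply (sd_D1 _ _ _ _ Hphi).
      * intros z _. pose proof (sd_D1_decay _ _ _ _ Hphi z). pose proof (pow2_ge_0 z). pose proof (Rabs_pos (D1 z)). nra.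
  - assert (Hb : forall x, Rabs (convpow phi (S j) x) <= K) by (intros; rewrite Rabs_pos_eq; apply IH1).
    pose proof (pg_bounded_lip _ K Hb IH2) as Hpg.
    split.
    + intros x. rewrite convpow_S. split.
      * rewrite <- (expect_const phi D1 D2 K Hphi 0). apply (expect_le phi D1 D2 K Hphi _ _ (Rabs 0) K); [apply pg_const|apply Hpg|].
        intros; apply IH1.
      * rewrite <- (expect_const phi D1 D2 K Hphi K). apply (expect_le phi D1 D2 K Hphi _ _ K (Rabs K)); [apply Hpg|apply pg_const|].
        intros; apply IH1.
    + intros x y. rewrite !convpow_S.
      replace (expect phi (fun z => convpow phi (S j) (x - z)) - expect phi (fun z => convpow phi (S j) (y - z))) with
        (expect phi (fun z => 1 * convpow phi (S j) (x - z) + (-1) * convpow phi (S j) (y - z))).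
      2:{ rewrite (expect_lin phi D1 D2 K Hphi _ _ _ _ K K); auto. ring. }
      rewrite <- (expect_const phi D1 D2 K Hphi (K * Rabs (x - y))).
      eapply (expect_abs_le phi D1 D2 K Hphi); [apply pg_lin; apply Hpg|apply pg_const|].
      intros z. replace (1 * convpow phi (S j) (x - z) + -1 * convpow phi (S j) (y - z)) with (convpow phi (S j) (x - z) - convpow phi (S j) (y - z)) by ring.
      eapply Rle_trans; [apply IH2|]. right. f_equal. f_equal. ring.
Qed.

Lemma convpow_pg j x : poly_growth (fun y => convpow phi (S j) (x - y)) K.
Proof.
  destruct (convpow_reg j) as [H1 H2]. apply (pg_bounded_lip (convpow phi (S j)) K); auto.
  intros; rewrite Rabs_pos_eq; apply H1.
Qed.

Lemma expect_psum (f : nat -> R -> R) n : (forall i, exists k, poly_growth (f i) k) ->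
  (exists k, poly_growth (fun y => psum (fun i => f i y) n) k) /\
  expect phi (fun y => psum (fun i => f i y) n) = psum (fun i => expect phi (f i)) n.
Proof.
  intros Hf. induction n as [|n [[k Hk] IH]].
  - split; [exists (Rabs 0); apply (pg_const 0)|]. apply (expect_const phi D1 D2 K Hphi 0).
  - destruct (Hf n) as [kn Hn]. split.
    + eexists. eapply pg_ext; [|apply (pg_lin _ _ 1 1 _ _ Hk Hn)]. intros; simpl; ring.
    + simpl. rewrite <- IH. rewrite (expect_ext _ _ (fun y => 1 * psum (fun i => f i y) n + 1 * f n y)) by (intros; simpl; ring).
      rewrite (expect_lin phi D1 D2 K Hphi _ _ _ _ k kn Hk Hn). ring.
Qed.

(** The threshold is uniform in the shift [u], at the price of the weight 1 + u^2. That weight is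
    integrable against [phi], and this makes the statement stable under convolution. *)
Definition poisson_unif (j : nat) := forall eps, 0 < eps -> exists M0 : nat, forall m n M u,
  (M0 <= m)%nat -> (M0 <= n)%nat -> (M0 <= M)%nat ->
  Rabs (L * zsum (fun k => convpow phi j (u + L * IZR k)) m n - (1 + 2 * char_sum phi L j M u)) <= eps * (1 + u ^ 2).

Lemma char_term_le j i u :
  Rabs (rho phi (t (S i)) ^ S j * cos (INR (S j) * omega phi (t (S i)) - t (S i) * u)) <=
   (1 + K * PI) * / (1 + (2 * PI / L) ^ 2 * (INR i + 1) ^ 2).
Proof.
  rewrite Rabs_mult. assert (Hc : Rabs (cos (INR (S j) * omega phi (t (S i)) - t (S i) * u)) <= 1) by (apply Rabs_le, COS_bound).
  pose proof (rho_nonneg phi (t (S i))) as H0. pose proof (rho_le_1 phi D1 D2 K Hphi (t (S i))) as H1.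
  eapply Rle_trans; [|apply (rho_freq_decay phi D1 D2 K Hphi L)].
  rewrite Rabs_pos_eq by (apply pow_le; auto). simpl (_ ^ S j).
  assert (rho phi (t (S i)) ^ j <= 1). { rewrite <- (pow1 j). apply pow_incr; auto. }
  pose proof (pow_le _ j H0). pose proof (Rabs_pos (cos (INR (S j) * omega phi (t (S i)) - t (S i) * u))).
  set (r := rho phi (t (S i))) in *. set (c := Rabs _) in *.
  assert (0 <= r * r ^ j) by nra. assert (r * r^j <= r) by nra. nra.
Qed.

Lemma poisson_unif_1 : poisson_unif 1.
Proof.
  intros eps Heps. pose proof (sd_K_pos _ _ _ _ Hphi) as HK. pose proof PI_RGT_0 as Hpi.
  assert (HKP : 0 <= 1 + K * PI) by nra.
  destruct (atan_tail_small L (L * (2 * K)) (eps / 8) HL ltac:(lra) ltac:(nra)) as [M1 HM1].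
  destruct (atan_tail_small (2 * PI / L) (1 + K * PI) (eps / 8) (freq_coef_pos L HL) ltac:(lra) HKP) as [M2 HM2].
  exists (M1 + M2)%nat. intros m n M u Hm Hn HM.
  destruct (phi_zsum_lim phi D1 D2 K Hphi L HL u) as [l Hl].
  pose proof (poisson_pointwise phi D1 D2 K Hphi L HL u l Hl) as Hp.
  destruct (dominated_conv _ L _ HL (phi_shift_pos phi D1 D2 K Hphi L u)) as [l1 H1].
  destruct (dominated_conv _ L _ HL (phi_shift_neg phi D1 D2 K Hphi L u)) as [l2 H2].
  assert (El : l = phi (u + L * IZR 0) + l1 + l2).
  { apply is_lim_seq_unique in Hl. 
    assert (Hl' : is_lim_seq (fun n => zsum (fun k => phi (u + L * IZR k)) n n) (phi (u + L * IZR 0) + l1 + l2)).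
    { eapply is_lim_seq_ext; [intros q; symmetry; apply zsum_split|].
      apply is_lim_seq_plus'; auto. apply is_lim_seq_plus'; auto. apply is_lim_seq_const. }
    apply is_lim_seq_unique in Hl'. rewrite Hl' in Hl. injection Hl; auto. }
  assert (Hu : 1 <= 1 + u^2) by (pose proof (pow2_ge_0 u); lra).
  assert (T1 : L * Rabs (l1 - psum (fun i => phi (u + L * IZR (Z.of_nat (S i)))) n) <= eps / 8 * (1 + u^2)).
  { pose proof (tail_bound_lim _ L _ n l1 HL H1 (phi_shift_pos phi D1 D2 K Hphi L u)) as Ht.
    specialize (HM1 n ltac:(lia)). apply (Rmult_le_compat_l L) in Ht; [|lra]. eapply Rle_trans; [exact Ht|].
    replace (L * (2 * K * (1 + u ^ 2) * ((PI / 2 - atan (L * INR n)) / L))) with (L * (2 * K) * ((PI / 2 - atan (L * INR n)) / L) * (1 + u^2)) by ring.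
    apply Rmult_le_compat_r; lra. }
  assert (T2 : L * Rabs (l2 - psum (fun i => phi (u + L * IZR (- Z.of_nat (S i)))) m) <= eps / 8 * (1 + u^2)).
  { pose proof (tail_bound_lim _ L _ m l2 HL H2 (phi_shift_neg phi D1 D2 K Hphi L u)) as Ht.
    specialize (HM1 m ltac:(lia)). apply (Rmult_le_compat_l L) in Ht; [|lra]. eapply Rle_trans; [exact Ht|].
    replace (L * (2 * K * (1 + u ^ 2) * ((PI / 2 - atan (L * INR m)) / L))) with (L * (2 * K) * ((PI / 2 - atan (L * INR m)) / L) * (1 + u^2)) by ring.
    apply Rmult_le_compat_r; lra. }
  assert (T3 : Rabs (L * l - (1 + 2 * char_sum phi L 1 M u)) <= eps / 4 * (1 + u^2)).
  { destruct (dominated_conv _ (2 * PI / L) _ (freq_coef_pos L HL) (fun i => char_term_le 0 i u)) as [l3 H3].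
    assert (E3 : L * l = 1 + 2 * l3).
    { assert (Hp' : is_lim_seq (fun M => 1 + 2 * char_sum phi L 1 M u) (1 + 2 * l3)).
      { apply is_lim_seq_plus'; [apply is_lim_seq_const|]. apply (is_lim_seq_mult' (fun _ => 2)); [apply is_lim_seq_const|exact H3]. }
      apply is_lim_seq_unique in Hp'. apply is_lim_seq_unique in Hp. rewrite Hp' in Hp. injection Hp; auto. }
    rewrite E3. replace (1 + 2 * l3 - (1 + 2 * char_sum phi L 1 M u)) with (2 * (l3 - char_sum phi L 1 M u)) by ring.
    rewrite Rabs_mult, (Rabs_pos_eq 2) by lra.
    pose proof (tail_bound_lim _ (2 * PI / L) _ M l3 (freq_coef_pos L HL) H3 (fun i => char_term_le 0 i u)) as Ht.
    specialize (HM2 M ltac:(lia)). fold (char_sum phi L 1 M u) in Ht.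
    apply Rle_trans with (2 * (eps / 8)); [lra|]. nra. }
  rewrite zsum_split. simpl (convpow phi 1).
  set (s1 := psum (fun i => phi (u + L * IZR (Z.of_nat (S i)))) n) in *.
  set (s2 := psum (fun i => phi (u + L * IZR (- Z.of_nat (S i)))) m) in *.
  assert (Eq : L * (phi (u + L * 0) + s1 + s2) - (1 + 2 * char_sum phi L 1 M u) =
    (L * l - (1 + 2 * char_sum phi L 1 M u)) - L * (l1 - s1) - L * (l2 - s2)) by (rewrite El; ring).
  rewrite <- (Rabs_pos_eq L) in T1 at 1 by lra. rewrite <- Rabs_mult in T1. rewrite <- (Rabs_pos_eq L) in T2 at 1 by lra. rewrite <- Rabs_mult in T2.
  apply Rabs_le_between in T1. apply Rabs_le_between in T2. apply Rabs_le_between in T3. apply Rabs_le.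
  assert (0 < eps * (1 + u^2)) by (apply Rmult_lt_0_compat; lra).
  cbv beta. rewrite Eq. lra.
Qed.

(** The statement for j+1 is the expectation in y of the statement for j at u - y: on the lattice
    side this convolves, on the Fourier side [expect_cos_aff] supplies one more factor chi(t_i). *)
Lemma poisson_unif_S j : poisson_unif (S j) -> poisson_unif (S (S j)).
Proof.
  intros IH eps Heps.
  pose proof (sd_K_pos _ _ _ _ Hphi) as HK.
  set (C := expect phi (fun y => 1 * 1 + 1 * y^2)).
  assert (HpgC : poly_growth (fun y => 1 * 1 + 1 * y ^ 2) (Rabs 1 * Rabs 1 + Rabs 1 * 1)).
  { apply (pg_lin (fun _ => 1) (fun y => y^2)); [apply pg_const|apply pg_pow2]. }
  assert (HC : 0 <= C).
  { unfold C. rewrite <- (expect_const phi D1 D2 K Hphi 0). eapply (expect_le phi D1 D2 K Hphi); [apply pg_const|exact HpgC|].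
    intros x; simpl. pose proof (pow2_ge_0 x). simpl in *; lra. }
  destruct (IH (eps / (2 * (C + 1)))) as [M0 HM0]; [apply Rdiv_lt_0_compat; lra|].
  exists M0. intros m n M u Hm Hn HM.
  assert (E1 : zsum (fun k => convpow phi (S (S j)) (u + L * IZR k)) m n =
     expect phi (fun y => zsum (fun k => convpow phi (S j) (u - y + L * IZR k)) m n) /\
     exists k, poly_growth (fun y => zsum (fun k => convpow phi (S j) (u - y + L * IZR k)) m n) k).
  { destruct (expect_psum (fun i y => convpow phi (S j) ((u + L * IZR (Z.of_nat i - Z.of_nat m)) - y)) (S (m + n))) as [[k Hk] Hs].
    { intros i. exists K. apply convpow_pg. }
    assert (Hx : forall y, zsum (fun k => convpow phi (S j) (u - y + L * IZR k)) m n = psum (fun i => convpow phi (S j) ((u + L * IZR (Z.of_nat i - Z.of_nat m)) - y)) (S (m + n))).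
    { intros y. unfold zsum. rewrite psum_sum_f_R0. apply psum_ext. intros; f_equal; ring. }
    split.
    - rewrite (expect_ext _ _ _ Hx), Hs. unfold zsum. rewrite psum_sum_f_R0. apply psum_ext. intros; apply convpow_S.
    - exists k. eapply pg_ext; [|exact Hk]. intros; symmetry; apply Hx. }
  destruct E1 as [E1 [k1 Hk1]].
  assert (E2 : char_sum phi L (S (S j)) M u = expect phi (fun y => char_sum phi L (S j) M (u - y)) /\
     exists k, poly_growth (fun y => char_sum phi L (S j) M (u - y)) k).
  { destruct (expect_psum (fun i y => rho phi (t (S i)) ^ S j * cos ((INR (S j) * omega phi (t (S i)) - t (S i) * u) + t (S i) * y)) M) as [[k Hk] Hs].
    { intros i. eexists. eapply pg_ext; [|apply (pg_lin (fun y => cos ((INR (S j) * omega phi (t (S i)) - t (S i) * u) + t (S i) * y)) (fun _ => 0) (rho phi (t (S i)) ^ S j) 0 _ _ (pg_cos _ _) (pg_const 0))].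
      intros; simpl; ring. }
    assert (Hx : forall y, char_sum phi L (S j) M (u - y) = psum (fun i => rho phi (t (S i)) ^ S j * cos ((INR (S j) * omega phi (t (S i)) - t (S i) * u) + t (S i) * y)) M).
    { intros y. unfold char_sum. apply psum_ext. intros; f_equal; f_equal; ring. }
    split.
    - rewrite (expect_ext _ _ _ Hx), Hs. unfold char_sum. apply psum_ext. intros i _.
      rewrite (expect_scal phi D1 D2 K Hphi _ _ 1 (pg_cos _ _)), (expect_cos_aff phi D1 D2 K Hphi).
      rewrite (S_INR (S j)). simpl (_ ^ S (S j)). simpl (_ ^ S j).
      replace (INR (S j) * omega phi (t (S i)) - t (S i) * u + omega phi (t (S i))) with ((INR (S j) + 1) * omega phi (t (S i)) - t (S i) * u) by ring. ring.
    - exists k. eapply pg_ext; [|exact Hk]. intros; symmetry; apply Hx. }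
  destruct E2 as [E2 [k2 Hk2]].
  rewrite E1, E2.
  replace (L * expect phi (fun y => zsum (fun k => convpow phi (S j) (u - y + L * IZR k)) m n) - (1 + 2 * expect phi (fun y => char_sum phi L (S j) M (u - y)))) with
    (expect phi (fun y => 1 * (L * zsum (fun k => convpow phi (S j) (u - y + L * IZR k)) m n + (-2) * char_sum phi L (S j) M (u - y)) + (-1) * 1)).
  2:{ rewrite (expect_lin phi D1 D2 K Hphi _ (fun _ => 1) _ _ _ _ (pg_lin _ _ _ _ _ _ Hk1 Hk2) (pg_const 1)).
      rewrite (expect_lin phi D1 D2 K Hphi _ _ _ _ _ _ Hk1 Hk2), (expect_const phi D1 D2 K Hphi). ring. }
  (* From 1 + (u - y)^2 <= 2 (1 + u^2)(1 + y^2); the expectation of 1 + y^2 is [C]. *)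
  set (c := eps / (2 * (C + 1)) * (2 * (1 + u^2))).
  apply Rle_trans with (expect phi (fun y => c * (1 * 1 + 1 * y ^ 2))).
  - eapply (expect_abs_le phi D1 D2 K Hphi).
    + apply pg_lin; [apply pg_lin; eauto|apply pg_const].
    + eapply pg_ext; [|apply (pg_lin _ (fun _ => 0) c 0 _ _ HpgC (pg_const 0))]. intros; simpl; ring.
    + intros y. pose proof (HM0 m n M (u - y) Hm Hn HM) as Hb.
      replace (1 * (L * zsum (fun k => convpow phi (S j) (u - y + L * IZR k)) m n + -2 * char_sum phi L (S j) M (u - y)) + -1 * 1) with
       (L * zsum (fun k => convpow phi (S j) (u - y + L * IZR k)) m n - (1 + 2 * char_sum phi L (S j) M (u - y))) by ring.
      eapply Rle_trans; [exact Hb|]. unfold c. rewrite Rmult_assoc. apply Rmult_le_compat_l.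
      * left; apply Rdiv_lt_0_compat; lra.
      * pose proof (pow2_ge_0 (u + y)). assert (0 <= u^2 * y^2) by (apply Rmult_le_pos; apply pow2_ge_0). nra.
  - rewrite (expect_scal phi D1 D2 K Hphi _ c _ HpgC). fold C. unfold c.
    replace (eps / (2 * (C + 1)) * (2 * (1 + u ^ 2)) * C) with (eps * (1 + u^2) * (C / (C + 1))) by (field; lra).
    assert (C / (C + 1) <= 1). { apply (Rmult_le_reg_r (C+1)); [lra|]. unfold Rdiv. rewrite Rmult_assoc, Rinv_l; lra. }
    assert (0 <= eps * (1 + u^2)) by (pose proof (pow2_ge_0 u); nra). nra.
Qed.

Lemma poisson_unif_all j : poisson_unif (S j).
Proof. induction j; [apply poisson_unif_1|now apply poisson_unif_S]. Qed.

Definition char_coef (j i : nat) : R := rho phi (t (S i)) ^ j * cos (INR j * omega phi (t (S i))).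

Lemma char_coef_le j i : Rabs (char_coef (S j) i) <= (1 + K * PI) * / (1 + (2 * PI / L) ^ 2 * (INR i + 1) ^ 2).
Proof.
  pose proof (char_term_le j i 0) as H. unfold char_coef.
  replace (INR (S j) * omega phi (t (S i)) - t (S i) * 0) with (INR (S j) * omega phi (t (S i))) in H by ring. exact H.
Qed.

(** Poisson summation at u = 0 with the number of frequencies sent to infinity. The sign is read off
    the lattice side, where all summands are nonnegative; the cosine series does not show it. *)
Lemma W_series theta j : exists l : R, is_lim_seq (psum (char_coef (S j))) l /\
  W phi theta L (S j) = theta * (1 + 2 * l) /\ 0 <= 1 + 2 * l.
Proof.
  destruct (dominated_conv _ _ _ (freq_coef_pos L HL) (char_coef_le j)) as [l Hl].
  exists l. split; [exact Hl|].
  assert (Hz : forall eps, 0 < eps -> exists M : nat, forall m n, (M <= m)%nat -> (M <= n)%nat ->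
    Rabs (L * zsum (fun k => convpow phi (S j) (L * IZR k)) m n - (1 + 2 * l)) < eps).
  { intros eps Heps. destruct (poisson_unif_all j (eps / 2) ltac:(lra)) as [M0 HM0].
    exists M0. intros m n Hm Hn.
    assert (Hlim : is_lim_seq (fun M => Rabs (L * zsum (fun k => convpow phi (S j) (L * IZR k)) m n - (1 + 2 * psum (char_coef (S j)) M)))
        (Rabs (L * zsum (fun k => convpow phi (S j) (L * IZR k)) m n - (1 + 2 * l)))).
    { apply (is_lim_seq_abs _ (Finite _)). apply is_lim_seq_minus'; [apply is_lim_seq_const|].
      apply is_lim_seq_plus'; [apply is_lim_seq_const|]. apply (is_lim_seq_mult' (fun _ => 2)); [apply is_lim_seq_const|exact Hl]. }
    apply Rle_lt_trans with (eps / 2); [|lra].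
    apply (is_lim_seq_le_loc _ (fun _ => eps / 2) _ _) with (2 := Hlim) (3 := is_lim_seq_const _).
    exists M0. intros M HM. pose proof (HM0 m n M 0 Hm Hn HM) as H.
    replace (eps / 2 * (1 + 0 ^ 2)) with (eps / 2) in H by ring. eapply Rle_trans; [|exact H]. right. f_equal. f_equal.
    - f_equal. unfold zsum. rewrite !psum_sum_f_R0. apply psum_ext. intros; f_equal; ring.
    - f_equal. f_equal. unfold char_sum, char_coef. apply psum_ext. intros; f_equal. f_equal. ring. }
  assert (HS : is_sumZ (fun k => convpow phi (S j) (L * IZR k)) ((1 + 2 * l) / L)).
  { intros eps Heps. destruct (Hz (L * eps)) as [M HM]; [nra|]. exists M. intros m n Hm Hn.
    specialize (HM m n Hm Hn). fold (zsum (fun k => convpow phi (S j) (L * IZR k)) m n). set (z := zsum _ m n) in *.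
    replace (z - (1 + 2 * l) / L) with ((L * z - (1 + 2 * l)) / L) by (field; lra).
    unfold Rdiv. rewrite Rabs_mult, Rabs_inv, (Rabs_pos_eq L) by lra.
    apply (Rmult_lt_reg_r L); auto. rewrite Rmult_assoc, Rinv_l by lra. lra. }
  split.
  - unfold W. replace (sumZ _) with ((1 + 2 * l) / L); [field; lra|]. symmetry. apply choiceR_unique; auto.
    intros l' Hl'. apply cond_eq. intros eps Heps.
    destruct (HS (eps/2) ltac:(lra)) as [M1 HM1]. destruct (Hl' (eps/2) ltac:(lra)) as [M2 HM2].
    specialize (HM1 (M1 + M2)%nat (M1 + M2)%nat ltac:(lia) ltac:(lia)). specialize (HM2 (M1 + M2)%nat (M1 + M2)%nat ltac:(lia) ltac:(lia)).
    apply Rabs_def2 in HM1. apply Rabs_def2 in HM2. apply Rabs_def1; lra.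
  - destruct (Rle_dec 0 (1 + 2 * l)) as [|Hn]; auto. exfalso. apply Rnot_le_lt in Hn.
    destruct (Hz (- (1 + 2 * l)) ltac:(lra)) as [M HM]. specialize (HM M M (le_n _) (le_n _)).
    apply Rabs_def2 in HM.
    assert (0 <= zsum (fun k => convpow phi (S j) (L * IZR k)) M M).
    { unfold zsum. rewrite psum_sum_f_R0. apply psum_nonneg. intros; apply convpow_reg. }
    nra.
Qed.
End Periodized.

(** * Bounds on the characteristic function *)

(** Up to 2 the quintic Taylor bound suffices; beyond, |sin v| <= 1 is far below 9 v/10. One formula
    thus covers both the quadratic loss near 0 and the fixed loss far away. *)
Lemma sinc_gap v : 0 < v -> Rabs (sin v) <= v * (1 - 1/10 * (v^2 / (1 + v^2))).
Proof.
  intros Hv. assert (Hv2 : 0 < v^2) by nra.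
  assert (Hf : v^2 / (1+v^2) <= 1). { apply (Rmult_le_reg_r (1+v^2)); [lra|]. unfold Rdiv. rewrite Rmult_assoc, Rinv_l; lra. }
  assert (Hf2 : v^2 / (1+v^2) <= v^2). { apply (Rmult_le_reg_r (1+v^2)); [lra|]. unfold Rdiv. rewrite Rmult_assoc, Rinv_l; [|lra]. nra. }
  destruct (Rle_dec v 2) as [H2|H2].
  - rewrite Rabs_pos_eq.
    2:{ pose proof (sin_ge_3 v ltac:(lra)). assert (v^3/6 <= v). { assert (0 <= v * (4 - v^2)) by (apply Rmult_le_pos; nra). nra. } lra. }
    pose proof (sin_le_5 v ltac:(lra)) as H5. eapply Rle_trans; [exact H5|].
    replace (v - v^3/6 + v^5/120) with (v * (1 - v^2 * (20 - v^2) / 120)) by field.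
    apply Rmult_le_compat_l; [lra|]. assert (v^2 <= 4) by nra. assert (v^2 * 16 <= v^2 * (20 - v^2)) by (apply Rmult_le_compat_l; lra). lra.
  - apply Rnot_le_lt in H2. apply Rle_trans with 1; [apply Rabs_le, SIN_bound|]. nra.
Qed.

Lemma sin_minus_id_le x : Rabs (sin x - x) <= x^2.
Proof.
  assert (forall x, 0 <= x -> Rabs (sin x - x) <= x^2) as Hp.
  { clear x. intros x Hx. pose proof (sin_le_id x Hx). rewrite Rabs_left1 by lra.
    destruct (Rle_dec x 6).
    - pose proof (sin_ge_3 x Hx). assert (x^3/6 <= x^2) by nra. lra.
    - pose proof (SIN_bound x). nra. }
  destruct (Rle_dec 0 x); [now apply Hp|]. replace (sin x - x) with (- (sin (-x) - - x)) by (rewrite sin_neg; ring).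
  rewrite Rabs_Ropp. replace (x^2) with ((-x)^2) by ring. apply Hp. lra.
Qed.

Lemma sin_minus_id_le3 x : Rabs (sin x - x) <= Rabs x * x^2 / 6.
Proof.
  assert (forall x, 0 <= x -> Rabs (sin x - x) <= Rabs x * x^2 / 6) as Hp.
  { clear x. intros x Hx. pose proof (sin_le_id x Hx). rewrite Rabs_left1 by lra. rewrite Rabs_pos_eq by lra.
    pose proof (sin_ge_3 x Hx). nra. }
  destruct (Rle_dec 0 x); [now apply Hp|]. replace (sin x - x) with (- (sin (-x) - - x)) by (rewrite sin_neg; ring).
  rewrite Rabs_Ropp. replace (x^2) with ((-x)^2) by ring. rewrite <- (Rabs_Ropp x). apply Hp. lra.
Qed.

(** Bernoulli's inequality for (1 + x)^j, together with (1 - x)(1 + x) <= 1. *)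
Lemma pow_one_minus_le x j : 0 <= x <= 1 -> (1 - x) ^ j <= / (1 + INR j * x).
Proof.
  intros Hx. pose proof (pos_INR j).
  assert (Hb : forall n, 1 + INR n * x <= (1 + x)^n).
  { induction n; [simpl; lra|]. rewrite S_INR. simpl. pose proof (pos_INR n). nra. }
  assert (Hp : (1 - x) ^ j * (1 + x) ^ j <= 1).
  { pose proof (pow_incr ((1-x)*(1+x)) 1 j) as Hq. rewrite pow1, Rpow_mult_distr in Hq. apply Hq. split; nra. }
  assert (0 <= (1 - x)^j) by (apply pow_le; lra). specialize (Hb j).
  assert (0 < 1 + INR j * x) by nra. apply (Rmult_le_reg_r (1 + INR j * x)); auto. rewrite Rinv_l by lra. nra.
Qed.

Section ChiBounds.
Variables (phi D1 D2 : R -> R) (K : R).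
Hypothesis Hphi : smooth_density phi D1 D2 K.

Definition second_moment (phi : R -> R) := expect phi (fun x => x ^ 2).
Definition fourth_moment (phi : R -> R) := expect phi (fun x => x ^ 4).

Let V := second_moment phi.
Let m4 := fourth_moment phi.

Lemma pg_scal f k a : poly_growth f k -> poly_growth (fun x => a * f x) (Rabs a * k).
Proof.
  intros [H1 H2]. split.
  - intros x. apply continuous_mult_R; [apply continuous_const|auto].
  - intros x. rewrite Rabs_mult, Rmult_assoc. apply Rmult_le_compat_l; auto. apply Rabs_pos.
Qed.

Lemma chi_c_lower t : 1 - V * t ^ 2 / 2 <= chi_c phi t.
Proof.
  replace (1 - V * t ^ 2 / 2) with (expect phi (fun y => 1 * 1 + (- (t ^ 2 / 2)) * y ^ 2)).
  - eapply (expect_le phi D1 D2 K Hphi); [apply (pg_lin (fun _ => 1) (fun y => y^2)); [apply pg_const|apply pg_pow2]|apply pg_cos0|].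
    intros x. pose proof (cos_ge_2 (t * x)). simpl in *. nra.
  - rewrite (expect_lin phi D1 D2 K Hphi (fun _ => 1) (fun y => y^2) _ _ _ _ (pg_const 1) pg_pow2), (expect_const phi D1 D2 K Hphi).
    fold (second_moment phi). fold V. field.
Qed.

Lemma chi_c_upper t : chi_c phi t <= 1 - V * t ^ 2 / 2 + m4 * t ^ 4 / 24.
Proof.
  replace (1 - V * t ^ 2 / 2 + m4 * t ^ 4 / 24) with (expect phi (fun y => 1 * (1 * 1 + (- (t ^ 2 / 2)) * y ^ 2) + t^4/24 * y^4)).
  - eapply (expect_le phi D1 D2 K Hphi); [apply pg_cos0| |].
    + apply pg_lin; [|apply pg_pow4]. apply (pg_lin (fun _ => 1) (fun y => y^2)); [apply pg_const|apply pg_pow2].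
    + intros x. pose proof (cos_le_4 (t * x)) as H. rewrite !Rpow_mult_distr in H. lra.
  - rewrite (expect_lin phi D1 D2 K Hphi _ (fun y => y^4) _ _ _ _ (pg_lin (fun _ => 1) (fun y => y^2) _ _ _ _ (pg_const 1) pg_pow2) pg_pow4).
    rewrite (expect_lin phi D1 D2 K Hphi (fun _ => 1) (fun y => y^2) _ _ _ _ (pg_const 1) pg_pow2), (expect_const phi D1 D2 K Hphi).
    fold (second_moment phi). fold V. fold (fourth_moment phi). fold m4. field.
Qed.

(* Subtracting [t y] costs nothing because the mean vanishes, and improves the bound to third order. *)
Lemma chi_s_centered t : chi_s phi t = expect phi (fun y => 1 * sin (t * y) + (- t) * y).
Proof.
  rewrite (expect_lin phi D1 D2 K Hphi _ (fun y => y) _ _ _ _ (pg_sin0 t) pg_id), (expect_id phi D1 D2 K Hphi).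
  fold (chi_s phi t). ring.
Qed.

Lemma chi_s_le2 t : Rabs (chi_s phi t) <= V * t ^ 2.
Proof.
  rewrite chi_s_centered. replace (V * t^2) with (expect phi (fun y => t^2 * y^2)).
  - eapply (expect_abs_le phi D1 D2 K Hphi).
    + apply pg_lin; [apply pg_sin0|apply pg_id].
    + apply pg_scal, pg_pow2.
    + intros x. pose proof (sin_minus_id_le (t * x)) as H. rewrite Rpow_mult_distr in H.
      replace (1 * sin (t * x) + - t * x) with (sin (t * x) - t * x) by ring. exact H.
  - rewrite (expect_scal phi D1 D2 K Hphi _ _ _ pg_pow2). fold (second_moment phi). fold V. ring.
Qed.

Lemma chi_s_le3 t : Rabs (chi_s phi t) <= (V + m4) * Rabs t ^ 3.
Proof.
  rewrite chi_s_centered. replace ((V + m4) * Rabs t ^ 3) with (expect phi (fun y => Rabs t ^ 3 * y^2 + Rabs t ^ 3 * y ^ 4)).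
  - eapply (expect_abs_le phi D1 D2 K Hphi).
    + apply pg_lin; [apply pg_sin0|apply pg_id].
    + apply pg_lin; [apply pg_pow2|apply pg_pow4].
    + intros x. pose proof (sin_minus_id_le3 (t * x)) as H. rewrite Rpow_mult_distr, Rabs_mult in H.
      replace (1 * sin (t * x) + - t * x) with (sin (t * x) - t * x) by ring. eapply Rle_trans; [exact H|].
      rewrite <- (pow2_abs t), <- (pow2_abs x). replace (x^4) with (Rabs x ^ 4) by (replace (x^4) with ((x^2)^2) by ring; rewrite <- (pow2_abs x); ring).
      replace (Rabs t * Rabs x * (Rabs t ^ 2 * Rabs x ^ 2) / 6) with (Rabs t ^ 3 * (Rabs x ^ 3 / 6)) by field.
      replace (Rabs t ^ 3 * Rabs x ^ 2 + Rabs t ^ 3 * Rabs x ^ 4) with (Rabs t ^ 3 * (Rabs x ^ 2 + Rabs x ^ 4)) by ring.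
      apply Rmult_le_compat_l; [apply pow_le, Rabs_pos|]. pose proof (Rabs_pos x). set (a := Rabs x) in *.
      assert (0 <= a^2 * (1 - a)^2) by (apply Rmult_le_pos; apply pow2_ge_0).
      assert (0 <= a^2) by (apply pow2_ge_0). assert (0 <= a^3) by (apply pow_le; auto). nra.
  - rewrite (expect_lin phi D1 D2 K Hphi _ _ _ _ _ _ pg_pow2 pg_pow4). fold (second_moment phi). fold V. fold (fourth_moment phi). fold m4. ring.
Qed.

Lemma sd_pos_interval : exists x0 h k, 0 < h /\ 0 < k /\ forall x, x0 - h <= x <= x0 + h -> k <= phi x.
Proof.
  destruct (classic (exists x0, 0 < phi x0)) as [[x0 Hx0]|Hn].
  - assert (Hc : continuity_pt phi x0) by (apply continuity_pt_filterlim; eapply sd_cont; eauto).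
    destruct (Hc (phi x0 / 2) ltac:(lra)) as [d [Hd H]].
    exists x0, (d/2), (phi x0 / 2). repeat split; try lra. intros x Hx.
    destruct (Req_dec x x0) as [->|Hne]; [lra|].
    specialize (H x). simpl in H. unfold Rdist, D_x, no_cond in H.
    specialize (H ltac:(repeat split; auto; apply Rabs_def1; lra)). apply Rabs_def2 in H. lra.
  - exfalso. assert (Hz : forall x, phi x = 0).
    { intros x. pose proof (sd_nonneg _ _ _ _ Hphi x). destruct (Req_dec (phi x) 0); auto. exfalso; apply Hn; exists x; lra. }
    pose proof (sd_mass _ _ _ _ Hphi) as H1.
    assert (H0 : is_imp phi 0).
    { eapply is_imp_ext; [|rewrite <- (Rmult_0_l 1); apply (is_imp_scal _ 0 _ H1)]. intros; simpl. rewrite Hz. ring. }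
    pose proof (is_imp_uniq _ _ _ H0 H1). lra.
Qed.

Lemma expect_ge_RInt f k a b c : poly_growth f k -> (forall x, 0 <= f x) -> a <= b ->
  (forall x, a <= x <= b -> c <= phi x) -> 0 <= c -> c * RInt.RInt f a b <= expect phi f.
Proof.
  intros Hf Hp Hab Hc Hc0. pose proof (expect_spec phi D1 D2 K Hphi f k Hf) as Hi.
  assert (Hex : forall a b, ex_RInt f a b) by (intros; apply (ex_RInt_continuous (V:=R_CompleteNormedModule)); intros; apply Hf).
  set (g := fun x => f x * phi x) in *.
  assert (Hgx : forall a b, ex_RInt g a b) by (intros; eapply is_imp_ex; eauto).
  assert (Hg0 : forall x, 0 <= g x). { intros x; unfold g. apply Rmult_le_pos; auto. apply (sd_nonneg _ _ _ _ Hphi). }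
  assert (Hge : forall u v, u <= v -> 0 <= RInt.RInt g u v) by (intros; apply RInt_ge_0; auto).
  assert (H1 : c * RInt.RInt f a b <= RInt.RInt g a b).
  { rewrite <- (is_RInt_unique _ _ _ _ (is_RInt_scalR f a b c _ (RInt_correct (V:=R_CompleteNormedModule) _ _ _ (Hex a b)))).
    apply RInt_le; auto.
    - eexists. apply is_RInt_scalR, (RInt_correct (V:=R_CompleteNormedModule)), Hex.
    - intros x Hx. unfold g. rewrite Rmult_comm. apply Rmult_le_compat_l; auto. apply Hc; lra. }
  eapply Rle_trans; [exact H1|]. pose proof (is_imp_sym_seq _ _ Hi) as Hl.
  apply (is_lim_seq_le_loc (fun _ => RInt.RInt g a b) _ _ _) with (2 := is_lim_seq_const _) (3 := Hl).
  destruct (INR_unbounded (Rabs a + Rabs b)) as [N HN]. exists N. intros n Hn. apply le_INR in Hn.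
  pose proof (Rabs_pos a). pose proof (Rabs_pos b). pose proof (Rle_abs b). pose proof (Rle_abs (-a)) as Ha. rewrite Rabs_Ropp in Ha.
  rewrite <- (RInt_Chasles (V:=R_CompleteNormedModule) g (- INR n) a (INR n)) by apply Hgx.
  rewrite <- (RInt_Chasles (V:=R_CompleteNormedModule) g a b (INR n)) by apply Hgx.
  pose proof (Hge (- INR n) a ltac:(lra)). pose proof (Hge b (INR n) ltac:(lra)). unfold plus; simpl. lra.
Qed.

(** 1 - rho is the expectation of 1 - cos(tX - omega). Only an interval where [phi] is bounded below
    is kept; there the integral is explicit, and [sinc_gap] bounds it from below whatever the phase
    is. *)
Lemma rho_gap : exists k, 0 < k <= 1 /\ forall t, 0 < t -> rho phi t <= 1 - k * (t ^ 2 / (1 + t ^ 2)).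
Proof.
  destruct sd_pos_interval as [x0 [h [c [Hh [Hc Hlow]]]]].
  (* A half-length of at most 1 gives h'^2 t^2/(1 + t^2) <= (t h')^2/(1 + (t h')^2). *)
  set (h' := Rmin h 1). assert (Hh' : 0 < h' <= 1) by (unfold h'; split; [apply Rmin_pos; lra|apply Rmin_r]).
  assert (Hhh : h' <= h) by apply Rmin_l.
  assert (Hmain : forall t, 0 < t -> rho phi t <= 1 - (c * h' ^ 3 / 5) * (t ^ 2 / (1 + t ^ 2))).
  { intros t Ht. set (w := omega phi t).
    pose proof (expect_cos_aff phi D1 D2 K Hphi (- w) t) as HE.
    replace (- w + omega phi t) with 0 in HE by (unfold w; ring). rewrite cos_0, Rmult_1_r in HE.
    set (f := fun y => 1 * 1 + (-1) * cos (- w + t * y)).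
    assert (Hpg : poly_growth f (Rabs 1 * Rabs 1 + Rabs (-1) * 1)).
    { apply (pg_lin (fun _ => 1) (fun y => cos (- w + t * y))); [apply pg_const|apply pg_cos]. }
    assert (Ef : expect phi f = 1 - rho phi t).
    { unfold f. rewrite (expect_lin phi D1 D2 K Hphi (fun _ => 1) (fun y => cos (- w + t * y)) _ _ _ _ (pg_const 1) (pg_cos _ _)).
      rewrite (expect_const phi D1 D2 K Hphi), HE. ring. }
    pose proof (expect_ge_RInt f _ (x0 - h') (x0 + h') c Hpg) as Hge.
    assert (HI : is_RInt f (x0 - h') (x0 + h') (2 * h' - 2 * sin (t * h') * cos (- w + t * x0) / t)).
    { replace (2 * h' - 2 * sin (t * h') * cos (- w + t * x0) / t) with
        (minus ((fun y => y - sin (- w + t * y) / t) (x0 + h')) ((fun y => y - sin (- w + t * y) / t) (x0 - h'))).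
      - apply (is_RInt_derive (V:=R_CompleteNormedModule) (fun y => y - sin (- w + t * y) / t)).
        + intros x _. unfold f. auto_derive; [lra|]. field. lra.
        + intros x _. apply Hpg.
      - unfold minus, plus, opp; simpl.
        replace (- w + t * (x0 + h')) with ((- w + t * x0) + t * h') by ring.
        replace (- w + t * (x0 - h')) with ((- w + t * x0) - t * h') by ring.
        rewrite sin_plus, sin_minus. field. lra. }
    rewrite (is_RInt_unique _ _ _ _ HI), Ef in Hge.
    specialize (Hge ltac:(intros x; unfold f; pose proof (COS_bound (- w + t * x)); lra) ltac:(lra) ltac:(intros; apply Hlow; lra) ltac:(lra)).
    pose proof (sinc_gap (t * h') ltac:(nra)) as Hs.
    assert (Hcs : sin (t * h') * cos (- w + t * x0) <= Rabs (sin (t * h'))).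
    { eapply Rle_trans; [apply Rle_abs|]. rewrite Rabs_mult. assert (Rabs (cos (- w + t * x0)) <= 1) by (apply Rabs_le, COS_bound).
      pose proof (Rabs_pos (sin (t * h'))). nra. }
    assert (Hfr : h'^2 * (t^2 / (1 + t^2)) <= (t * h')^2 / (1 + (t * h')^2)).
    { assert (0 <= t^2) by nra. assert (0 < h'^2) by nra. assert (h'^2 <= 1) by nra. assert (0 <= (t*h')^2) by (apply pow2_ge_0).
      replace (h'^2 * (t^2 / (1 + t^2))) with ((t * h')^2 * / (1 + t^2)) by (field; lra).
      unfold Rdiv. apply Rmult_le_compat_l; auto. apply Rinv_le_contravar; [lra|]. rewrite Rpow_mult_distr. nra. }
    assert (Hdiv : 2 * sin (t * h') * cos (- w + t * x0) / t <= 2 * h' * (1 - 1/10 * (h'^2 * (t^2 / (1 + t^2))))).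
    { apply (Rmult_le_reg_r t); auto. unfold Rdiv at 1. rewrite Rmult_assoc, Rinv_l, Rmult_1_r by lra.
      apply Rle_trans with (2 * (t * h' * (1 - 1/10 * ((t * h')^2 / (1 + (t * h')^2))))); [lra|].
      replace (2 * h' * (1 - 1 / 10 * (h' ^ 2 * (t ^ 2 / (1 + t ^ 2)))) * t) with (2 * (t * h' * (1 - 1/10 * (h' ^ 2 * (t ^ 2 / (1 + t ^ 2)))))) by ring.
      assert (0 < t * h') by nra. nra. }
    assert (c * (2 * h' * (1/10 * (h'^2 * (t^2 / (1 + t^2))))) <= 1 - rho phi t).
    { eapply Rle_trans; [|exact Hge]. apply Rmult_le_compat_l; lra. }
    replace (c * h' ^ 3 / 5 * (t ^ 2 / (1 + t ^ 2))) with (c * (2 * h' * (1/10 * (h'^2 * (t^2 / (1 + t^2)))))) by (field; nra). lra. }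
  exists (Rmin 1 (c * h' ^ 3 / 5)). assert (0 < c * h'^3/5). { assert (0 < h'^3) by (apply pow_lt; lra). nra. }
  split. { split; [apply Rmin_pos; lra|apply Rmin_l]. }
  intros t Ht. specialize (Hmain t Ht). pose proof (Rmin_r 1 (c * h' ^ 3 / 5)).
  assert (0 <= t^2/(1+t^2)). { assert (0 < t^2) by nra. apply Rmult_le_pos; [lra|]. left; apply Rinv_0_lt_compat; lra. }
  nra.
Qed.

(** For t <= 1 the quadratic gap and [pow_one_minus_le] suffice. For t > 1 one factor [rho] supplies
    the decay in t, and the other j - 1, bounded away from 1, the decay in j. The result has the
    shape of the summable majorants with a of order sqrt(j)/L. *)
Lemma rho_pow_le : exists C, 0 < C /\ forall j t, (1 <= j)%nat -> 0 < t -> rho phi t ^ j <= C * / (1 + INR j * t ^ 2).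
Proof.
  destruct rho_gap as [k [Hk Hgap]]. pose proof PI_RGT_0. pose proof (sd_K_pos _ _ _ _ Hphi) as HK.
  set (K' := 1 + K * PI). assert (HK' : 1 <= K') by (unfold K'; nra).
  exists (K' * (2 / k)).
  assert (Hk2 : 2 <= 2 / k). { apply (Rmult_le_reg_r k); [lra|]. unfold Rdiv. rewrite Rmult_assoc, Rinv_l; lra. }
  assert (Hkk : k * (2 / k) = 2) by (field; lra).
  split; [nra|].
  intros j t Hj Ht. pose proof (Hgap t Ht) as Hg. pose proof (rho_nonneg phi t) as H0.
  assert (Hj1 : 1 <= INR j) by (apply (le_INR 1); auto).
  assert (Ht2 : 0 < t^2) by nra. assert (Hd : 0 < 1 + INR j * t^2) by nra.
  apply (Rmult_le_reg_r (1 + INR j * t^2)); auto. rewrite Rmult_assoc, Rinv_l, Rmult_1_r by lra.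
  destruct (Rle_dec t 1) as [Ht1|Ht1].
  - assert (t^2 <= 1) by nra.
    assert (Hx : t^2/2 <= t^2/(1+t^2)). { unfold Rdiv. apply Rmult_le_compat_l; [lra|]. apply Rinv_le_contravar; lra. }
    set (x := k * (t^2/2)). assert (0 <= x <= 1) by (unfold x; nra).
    assert (rho phi t ^ j <= / (1 + INR j * x)).
    { eapply Rle_trans; [|apply pow_one_minus_le; auto]. apply pow_incr. split; auto. unfold x. nra. }
    assert (0 < 1 + INR j * x) by nra.
    apply Rle_trans with (/ (1 + INR j * x) * (1 + INR j * t^2)); [apply Rmult_le_compat_r; lra|].
    apply (Rmult_le_reg_l (1 + INR j * x)); auto. rewrite <- Rmult_assoc, Rinv_r, Rmult_1_l by lra.
    assert (Ex : (2 / k) * x = t^2) by (unfold x; field; lra).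
    assert (1 + INR j * t^2 <= (1 + INR j * x) * (2/k)). { rewrite <- Ex. assert (0 <= INR j * x) by nra. nra. }
    assert (0 <= (1 + INR j * x) * (2/k)) by nra. nra.
  - apply Rnot_le_lt in Ht1. assert (1 < t^2) by nra.
    assert (Hx : 1/2 <= t^2/(1+t^2)). { apply (Rmult_le_reg_r (1+t^2)); [lra|]. unfold Rdiv. rewrite Rmult_assoc, Rmult_assoc, Rinv_l; lra. }
    destruct j as [|j]; [lia|]. rewrite S_INR in *. simpl (_ ^ S j).
    assert (Hpw : rho phi t ^ j <= / (1 + INR j * (k/2))).
    { eapply Rle_trans; [|apply pow_one_minus_le; lra]. apply pow_incr. split; auto. nra. }
    pose proof (pos_INR j). pose proof (rho_decay2 phi D1 D2 K Hphi t) as Hr. fold K' in Hr.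
    assert (0 < 1 + INR j * (k/2)) by nra.
    assert (Hr1 : rho phi t * (1 + t^2) <= K').
    { apply (Rmult_le_compat_r (1+t^2)) in Hr; [|lra]. rewrite Rmult_assoc, Rinv_l in Hr; lra. }
    assert (Hp1 : rho phi t ^ j * (INR j + 1) <= 2 / k).
    { apply Rle_trans with (/ (1 + INR j * (k / 2)) * (INR j + 1)); [apply Rmult_le_compat_r; lra|].
      apply (Rmult_le_reg_l (1 + INR j * (k/2))); auto. rewrite <- Rmult_assoc, Rinv_r, Rmult_1_l by lra.
      replace ((1 + INR j * (k / 2)) * (2 / k)) with (2 / k + INR j) by (field; lra). lra. }
    pose proof (pow_le _ j H0).
    apply Rle_trans with ((rho phi t * (1 + t^2)) * (rho phi t ^ j * (INR j + 1))).
    + replace (rho phi t * rho phi t ^ j * (1 + (INR j + 1) * t^2)) with (rho phi t * (rho phi t ^ j * (1 + (INR j + 1) * t^2))) by ring.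
      rewrite (Rmult_assoc (rho phi t)). apply Rmult_le_compat_l; auto.
      replace ((1 + t^2) * (rho phi t ^ j * (INR j + 1))) with (rho phi t ^ j * ((1 + t^2) * (INR j + 1))) by ring.
      apply Rmult_le_compat_l; auto. nra.
    + apply Rmult_le_compat; auto; nra.
Qed.

(** Real part of chi^j (chi - 1), where 1 - Re chi <= V t^2/2 and |Im chi| <= V t^2. *)
Lemma char_step_le j t : let r := rho phi t in let w := omega phi t in
  Rabs (r ^ S j * cos (INR (S j) * w) - r ^ j * cos (INR j * w)) <= 2 * V * t ^ 2 * r ^ j.
Proof.
  intros r w. rewrite S_INR. replace ((INR j + 1) * w) with (INR j * w + w) by ring. rewrite cos_plus. simpl (_ ^ S j).
  replace (r * r ^ j * (cos (INR j * w) * cos w - sin (INR j * w) * sin w) - r ^ j * cos (INR j * w)) with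
   (r ^ j * (- (cos (INR j * w) * (1 - r * cos w)) - sin (INR j * w) * (r * sin w))) by ring.
  unfold r, w. rewrite <- chi_c_polar, <- chi_s_polar. fold r. fold w.
  rewrite Rabs_mult, (Rabs_pos_eq (r ^ j)), Rmult_comm by (apply pow_le, rho_nonneg).
  apply Rmult_le_compat_r; [apply pow_le, rho_nonneg|].
  pose proof (chi_c_lower t). pose proof (chi_s_le2 t) as Hs.
  assert (Hc1 : chi_c phi t <= 1).
  { unfold chi_c. rewrite <- (expect_const phi D1 D2 K Hphi 1). eapply (expect_le phi D1 D2 K Hphi); [apply pg_cos0|apply pg_const|]. intros; apply COS_bound. }
  assert (HV : 0 <= V * t^2) by (pose proof (Rabs_pos (chi_s phi t)); lra).
  eapply Rle_trans; [apply Rabs_triang|]. rewrite !Rabs_Ropp, !Rabs_mult.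
  assert (Rabs (cos (INR j * w)) <= 1) by (apply Rabs_le, COS_bound).
  assert (Rabs (sin (INR j * w)) <= 1) by (apply Rabs_le, SIN_bound).
  rewrite (Rabs_pos_eq (1 - chi_c phi t)) by lra.
  pose proof (Rabs_pos (chi_s phi t)).
  assert (Rabs (cos (INR j * w)) * (1 - chi_c phi t) <= 1 * (1 - chi_c phi t)) by (apply Rmult_le_compat_r; lra).
  assert (Rabs (sin (INR j * w)) * Rabs (chi_s phi t) <= 1 * Rabs (chi_s phi t)) by (apply Rmult_le_compat_r; lra).
  lra.
Qed.

(** A vanishing second moment would force Re chi(1) >= 1, against the gap of [rho] at 1. *)
Lemma second_moment_pos : 0 < V.
Proof.
  destruct (Rle_lt_dec V 0) as [HV|HV]; auto. exfalso.
  destruct rho_gap as [k [Hk Hgap]]. specialize (Hgap 1 Rlt_0_1).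
  pose proof (chi_c_lower 1). pose proof (chi_c_polar phi 1). pose proof (COS_bound (omega phi 1)). pose proof (rho_nonneg phi 1).
  assert (1^2/(1+1^2) = 1/2) as E by field. rewrite E in Hgap. nra.
Qed.
End ChiBounds.

(** * The weights W and the function G *)

Lemma lim_abs_le (u : nat -> R) (l B : R) : is_lim_seq u l -> (forall n, Rabs (u n) <= B) -> Rabs l <= B.
Proof.
  intros Hl HB. apply (is_lim_seq_le (fun n => Rabs (u n)) (fun _ => B) (Rabs l) B); auto.
  - apply (is_lim_seq_abs _ (Finite l)), Hl.
  - apply is_lim_seq_const.
Qed.

Lemma ser_eq (a : nat -> R) (l : R) : is_series a l -> ser a = l.
Proof.
  intros Hl. apply choiceR_unique; [now apply is_series_Reals|].
  intros l' Hl'. apply is_series_Reals in Hl'. apply is_series_unique in Hl. apply is_series_unique in Hl'. congruence.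
Qed.

Lemma ln_le_sub x : 0 < x -> ln x <= x - 1.
Proof. intros Hx. pose proof (exp_ineq1_le (ln x)) as H. rewrite exp_ln in H by auto. lra. Qed.

Lemma ln_ratio_bound x y m : 0 < m -> m <= x -> m <= y -> Rabs (ln x - ln y) <= Rabs (x - y) / m.
Proof.
  assert (H : forall x y, 0 < m -> m <= x -> m <= y -> ln x - ln y <= Rabs (x - y) / m).
  { clear. intros x y Hm Hx Hy. rewrite <- ln_div by lra.
    eapply Rle_trans; [apply ln_le_sub, Rdiv_lt_0_compat; lra|].
    replace (x / y - 1) with ((x - y) / y) by (field; lra).
    apply Rle_trans with (Rabs (x - y) / y).
    - unfold Rdiv. apply Rmult_le_compat_r; [left; apply Rinv_0_lt_compat; lra|apply Rle_abs].
    - unfold Rdiv. apply Rmult_le_compat_l; [apply Rabs_pos|]. apply Rinv_le_contravar; lra. }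
  intros Hm Hx Hy. apply Rabs_le. pose proof (H x y Hm Hx Hy). pose proof (H y x Hm Hy Hx) as H2.
  rewrite Rabs_minus_sym in H2. lra.
Qed.

(* [log_den c r z] is |1 - (c + i s) z|^2 when c^2 + s^2 = r^2. *)
Definition log_den (c r z : R) : R := 1 - 2 * z * c + z ^ 2 * r ^ 2.

(** The derivative in x of the difference is the remainder of a geometric sum of cosines, which
    telescopes; the bound follows by the mean value inequality from 0. It is uniform in [w]. *)
Lemma log_series_partial w x M : 0 <= x < 1 ->
  Rabs (psum (fun j => cos (INR (S j) * w) * x ^ S j / INR (S j)) M - (- (1/2) * ln (log_den (cos w) 1 x)))
   <= 2 * x ^ S M / (1 - x) ^ 2.
Proof.
  intros Hx.
  assert (Hden : forall y, 0 <= y <= x -> (1 - x)^2 <= 1 - 2 * y * cos w + y^2).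
  { intros y Hy. pose proof (COS_bound w). nra. }
  assert (Hx1 : 0 < (1 - x)^2) by (apply pow_lt; lra).
  set (f := fun y => psum (fun j => cos (INR (S j) * w) * y ^ S j / INR (S j)) M - (- (1/2) * ln (1 - 2 * y * cos w + y^2))).
  assert (Hsum : forall y n, (1 - 2 * y * cos w + y^2) * psum (fun j => cos (INR (S j) * w) * y ^ j) n =
    cos w - y - y ^ n * cos (INR (S n) * w) + y ^ S n * cos (INR n * w)).
  { intros y n. induction n.
    - simpl. replace (0 * w) with 0 by ring. replace (1 * w) with w by ring. rewrite cos_0. ring.
    - rewrite psum_S, Rmult_plus_distr_l, IHn.
      replace (INR (S (S n)) * w) with (INR (S n) * w + w) by (rewrite (S_INR (S n)); ring).
      replace (INR n * w) with (INR (S n) * w - w) by (rewrite (S_INR n); ring).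
      rewrite cos_plus, cos_minus. simpl (y ^ _). ring. }
  assert (Hd : forall y, 0 <= y <= x -> is_derive f y ((- y ^ M * cos (INR (S M) * w) + y ^ S M * cos (INR M * w)) / (1 - 2 * y * cos w + y^2))).
  { intros y Hy. pose proof (Hden y Hy) as Hdy.
    evar_last.
    - apply (is_derive_minus (V:=R_NormedModule) (fun y => psum (fun j => cos (INR (S j) * w) * y ^ S j / INR (S j)) M) (fun y => - (1/2) * ln (1 - 2 * y * cos w + y^2)) y
        (psum (fun j => cos (INR (S j) * w) * y ^ j) M) ((cos w - y) / (1 - 2 * y * cos w + y^2))).
      + clear -w. induction M as [|n IH]; [apply (is_derive_const (V:=R_NormedModule) 0)|].
        apply (is_derive_ext (fun y => psum (fun j => cos (INR (S j) * w) * y ^ S j / INR (S j)) n + cos (INR (S n) * w) * y ^ S n / INR (S n))); [intros; now rewrite psum_S|].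
        rewrite psum_S.
        apply (is_derive_plus (V:=R_NormedModule)); [exact IH|].
        assert (Hn : INR (S n) <> 0) by (apply not_0_INR; lia).
        evar_last.
        * apply is_derive_ext with (fun y => cos (INR (S n) * w) / INR (S n) * y ^ S n); [intros; eqR; field; exact Hn|].
          apply is_derive_scal, (is_derive_pow (fun y => y) (S n) y 1), (is_derive_id (K:=R_AbsRing)).
        * change (pred (S n)) with n. eqR. field. exact Hn.
      + auto_derive; [nra|]. field. nra.
    - unfold minus, plus, opp; simpl.
      apply (Rmult_eq_reg_l (1 - 2 * y * cos w + y^2)); [|lra].
      rewrite Rmult_plus_distr_l, Hsum. simpl. field. simpl in *; lra. }
  pose proof (is_derive_bounded f (fun y => (- y ^ M * cos (INR (S M) * w) + y ^ S M * cos (INR M * w)) / (1 - 2 * y * cos w + y^2)) 0 x (2 * x ^ M / (1-x)^2)) as HB.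
  rewrite Rmin_left, Rmax_right, Rminus_0_r, (Rabs_pos_eq x) in HB by lra.
  assert (Hf0 : f 0 = 0).
  { unfold f. rewrite (psum_ext _ (fun _ => 0)) by (intros; simpl; unfold Rdiv; ring). rewrite psum_const.
    replace (1 - 2 * 0 * cos w + 0^2) with 1 by ring. rewrite ln_1. ring. }
  rewrite Hf0, Rminus_0_r in HB.
  replace (log_den (cos w) 1 x) with (1 - 2 * x * cos w + x^2) by (unfold log_den; ring). fold (f x).
  replace (2 * x ^ S M / (1 - x) ^ 2) with (2 * x ^ M / (1 - x) ^ 2 * x) by (simpl; field; lra).
  apply HB; [exact Hd|]. intros y Hy. pose proof (Hden y Hy) as Hdy.
  unfold Rdiv. rewrite Rabs_mult, Rabs_inv, (Rabs_pos_eq (1 - 2 * y * cos w + y^2)) by lra.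
  apply Rmult_le_compat; [apply Rabs_pos|left; apply Rinv_0_lt_compat; lra| |apply Rinv_le_contravar; lra].
  assert (0 <= y ^ M <= x ^ M) by (split; [apply pow_le; lra|apply pow_incr; lra]).
  assert (0 <= y ^ S M <= x ^ M) by (split; [apply pow_le; lra|simpl; nra]).
  pose proof (COS_bound (INR (S M) * w)). pose proof (COS_bound (INR M * w)).
  set (a := y ^ M) in *. set (b := y ^ S M) in *. set (c := cos (INR (S M) * w)) in *. set (d := cos (INR M * w)) in *. apply Rabs_le; split; nra.
Qed.

Lemma geom_psum_le z M : 0 <= z < 1 -> psum (fun j => z ^ S j) M <= / (1 - z).
Proof.
  intros Hz. assert (H : psum (fun j => z ^ S j) M = z * (1 - z ^ M) / (1 - z)).
  { induction M; [simpl; unfold Rdiv; ring|]. rewrite psum_S, IHM. simpl. field. lra. }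
  rewrite H. unfold Rdiv. rewrite <- (Rmult_1_l (/ (1 - z))) at 2. apply Rmult_le_compat_r; [left; apply Rinv_0_lt_compat; lra|].
  pose proof (pow_le z M ltac:(lra)). nra.
Qed.

Section WBounds.
Variables (phi D1 D2 : R -> R) (K : R).
Hypothesis Hphi : smooth_density phi D1 D2 K.
Variable theta : R.
Hypothesis Htheta : 0 < theta.

Lemma W_nonneg L j : 0 < L -> 0 <= W phi theta L (S j).
Proof.
  intros HL. destruct (W_series phi D1 D2 K Hphi L HL theta j) as [l [_ [E H]]]. rewrite E. nra.
Qed.

(** The zero frequency contributes the 1. The others are summed against 1/(1 + j t_i^2), which gives
    the order L/sqrt(j). *)
Lemma W_bound : exists C, 0 < C /\ forall L j, 0 < L -> (1 <= j)%nat -> W phi theta L j <= C * (1 + L / sqrt (INR j)).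
Proof.
  destruct (rho_pow_le phi D1 D2 K Hphi) as [C [HC Hr]].
  exists (theta * (1 + C)). split; [nra|]. intros L j HL Hj. destruct j as [|j]; [lia|].
  destruct (W_series phi D1 D2 K Hphi L HL theta j) as [l [Hl [E _]]]. rewrite E.
  assert (Hj0 : 0 < INR (S j)) by (apply lt_0_INR; lia). assert (Hsj : 0 < sqrt (INR (S j))) by (apply sqrt_lt_R0; auto).
  pose proof (freq_coef_pos L HL) as Hf. pose proof PI_RGT_0 as Hpi.
  assert (Hb : Rabs l <= C * (L / sqrt (INR (S j)) / 4)).
  { apply (lim_abs_le _ _ _ Hl). intros n. eapply Rle_trans.
    - apply (psum_abs_le _ (fun i => C * / (1 + (sqrt (INR (S j)) * (2 * PI / L)) ^ 2 * (INR i + 1) ^ 2))). intros i _.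
      unfold char_coef. rewrite Rabs_mult, Rabs_pos_eq by (apply pow_le, rho_nonneg).
      assert (Ht : 0 < freq L (S i)). { unfold freq. apply Rmult_lt_0_compat; auto. apply lt_0_INR; lia. }
      pose proof (Hr (S j) _ Hj Ht) as H. assert (Rabs (cos (INR (S j) * omega phi (freq L (S i)))) <= 1) by (apply Rabs_le, COS_bound).
      pose proof (pow_le _ (S j) (rho_nonneg phi (freq L (S i)))).
      eapply Rle_trans; [|eapply Rle_trans; [exact H|]].
      + rewrite <- (Rmult_1_r (rho phi (freq L (S i)) ^ S j)) at 2. apply Rmult_le_compat_l; auto.
      + right. f_equal. f_equal. f_equal. unfold freq. rewrite Rpow_mult_distr, (S_INR i).
        rewrite (Rpow_mult_distr (sqrt _)), pow2_sqrt by lra. ring.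
    - rewrite psum_scal. apply Rmult_le_compat_l; [lra|]. eapply Rle_trans; [apply psum_inv1p2; nra|].
      right. field. repeat split; lra. }
  apply Rabs_le_between in Hb. assert (0 < L / sqrt (INR (S j))) by (apply Rdiv_lt_0_compat; auto).
  rewrite Rmult_assoc. apply Rmult_le_compat_l; [lra|]. set (y := L / sqrt (INR (S j))) in *. nra.
Qed.

(** rho^j <= (rho^m)^2: one factor absorbs the t^2 of [char_step_le] and yields 1/m, the other makes
    the sum over frequencies converge and yields L/sqrt(m). *)
Lemma W_step : exists C, 0 < C /\ forall L j m, 0 < L -> (1 <= m)%nat -> (2 * m <= j)%nat ->
  Rabs (W phi theta L (S j) - W phi theta L j) <= C * L / (INR m * sqrt (INR m)).
Proof.
  destruct (rho_pow_le phi D1 D2 K Hphi) as [C [HC Hr]]. set (V := second_moment phi).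
  assert (HV : 0 < V) by (eapply second_moment_pos; eauto).
  exists (theta * (V * C ^ 2)). split. { assert (0 < C^2) by nra. assert (0 < V * C^2) by nra. nra. }
  intros L j m HL Hm Hj. destruct j as [|j]; [lia|].
  destruct (W_series phi D1 D2 K Hphi L HL theta j) as [l [Hl [E _]]].
  destruct (W_series phi D1 D2 K Hphi L HL theta (S j)) as [l' [Hl' [E' _]]]. rewrite E, E'.
  assert (Hm0 : 0 < INR m) by (apply lt_0_INR; lia). assert (Hsm : 0 < sqrt (INR m)) by (apply sqrt_lt_R0; auto).
  pose proof (freq_coef_pos L HL) as Hf. pose proof PI_RGT_0 as Hpi.
  assert (Hb : Rabs (l' - l) <= 2 * V * C ^ 2 / INR m * (L / sqrt (INR m) / 4)).
  { apply (lim_abs_le (fun n => psum (char_coef phi L (S (S j))) n - psum (char_coef phi L (S j)) n)).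
    { apply is_lim_seq_minus'; auto. }
    intros n. rewrite <- psum_minus. eapply Rle_trans.
    - apply (psum_abs_le _ (fun i => 2 * V * C ^ 2 / INR m * / (1 + (sqrt (INR m) * (2 * PI / L)) ^ 2 * (INR i + 1) ^ 2))). intros i _.
      unfold char_coef. set (t := freq L (S i)).
      assert (Ht : 0 < t). { unfold t, freq. apply Rmult_lt_0_compat; auto. apply lt_0_INR; lia. }
      pose proof (char_step_le phi D1 D2 K Hphi (S j) t) as Hs. cbv zeta in Hs. fold V in Hs.
      eapply Rle_trans; [exact Hs|].
      pose proof (Hr m t Hm Ht) as Hrm. pose proof (rho_nonneg phi t) as H0. pose proof (rho_le_1 phi D1 D2 K Hphi t) as H1.
      assert (Hp : rho phi t ^ S j <= (C * / (1 + INR m * t^2)) * (C * / (1 + INR m * t^2))).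
      { apply Rle_trans with (rho phi t ^ m * rho phi t ^ m).
        - replace (S j) with (m + m + (S j - (m + m)))%nat by lia. rewrite !pow_add.
          pose proof (pow_le _ m H0). assert (rho phi t ^ (S j - (m + m)) <= 1). { rewrite <- (pow1 (S j - (m+m))). apply pow_incr; auto. }
          pose proof (pow_le _ (S j - (m+m)) H0). assert (0 <= rho phi t ^ m * rho phi t ^ m) by nra. nra.
        - pose proof (pow_le _ m H0). apply Rmult_le_compat; auto. }
      assert (Ht2 : 0 < t^2) by nra. assert (Hd : 0 < 1 + INR m * t^2) by nra.
      replace (1 + (sqrt (INR m) * (2 * PI / L)) ^ 2 * (INR i + 1) ^ 2) with (1 + INR m * t^2).
      2:{ unfold t, freq. rewrite (Rpow_mult_distr (2 * PI / L)), (S_INR i), (Rpow_mult_distr (sqrt _)), pow2_sqrt by lra. ring. }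
      set (d := 1 + INR m * t^2) in *.
      apply Rle_trans with (2 * V * t^2 * (C * / d * (C * / d))); [apply Rmult_le_compat_l; nra|].
      replace (2 * V * t ^ 2 * (C * / d * (C * / d))) with (2 * V * C^2 * / d * (t^2 / d)) by (field; lra).
      replace (2 * V * C ^ 2 / INR m * / d) with (2 * V * C^2 * / d * / INR m) by (field; lra).
      apply Rmult_le_compat_l.
      + apply Rmult_le_pos; [assert (0 < C^2) by nra; nra|left; now apply Rinv_0_lt_compat].
      + apply (Rmult_le_reg_r (d * INR m)); [nra|]. replace (t^2 / d * (d * INR m)) with (INR m * t^2) by (field; lra).
        replace (/ INR m * (d * INR m)) with d by (field; lra). unfold d; lra.
    - rewrite psum_scal. apply Rmult_le_compat_l; [apply Rmult_le_pos; [assert (0 < C^2) by nra; nra|left; now apply Rinv_0_lt_compat]|].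
      eapply Rle_trans; [apply psum_inv1p2; nra|]. right. field. repeat split; lra. }
  replace (theta * (1 + 2 * l') - theta * (1 + 2 * l)) with (2 * theta * (l' - l)) by ring.
  rewrite Rabs_mult, (Rabs_pos_eq (2 * theta)) by lra.
  apply Rle_trans with (2 * theta * (2 * V * C ^ 2 / INR m * (L / sqrt (INR m) / 4))); [apply Rmult_le_compat_l; lra|].
  right. field. lra.
Qed.

Definition gcoef (L : R) (j : nat) : R := match j with O => 0 | S _ => W phi theta L j / INR j end.

Lemma gcoef_bound L : 0 < L -> exists C, 0 < C /\ forall j, 0 <= gcoef L j <= C.
Proof.
  intros HL. destruct W_bound as [C [HC HW]]. exists (C * (1 + L)). split; [nra|].
  intros [|j]; [simpl; split; [lra|nra]|]. change (gcoef L (S j)) with (W phi theta L (S j) / INR (S j)).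
  assert (Hj1 : 1 <= INR (S j)) by (apply (le_INR 1); lia).
  pose proof (W_nonneg L j HL) as H0. pose proof (HW L (S j) HL ltac:(lia)) as H1.
  assert (H2 : 1 <= sqrt (INR (S j))). { rewrite <- sqrt_1. now apply sqrt_le_1_alt. }
  assert (L / sqrt (INR (S j)) <= L). { apply (Rmult_le_reg_r (sqrt (INR (S j)))); [lra|]. unfold Rdiv. rewrite Rmult_assoc, Rinv_l by lra. nra. }
  split.
  - apply Rmult_le_pos; auto. left; apply Rinv_0_lt_compat; lra.
  - apply (Rmult_le_reg_r (INR (S j))); [lra|]. unfold Rdiv. rewrite Rmult_assoc, Rinv_l by lra.
    assert (C * (1 + L / sqrt (INR (S j))) <= C * (1 + L)) by (apply Rmult_le_compat_l; lra).
    assert (0 <= C * (1 + L)) by (apply Rmult_le_pos; lra). nra.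
Qed.

Lemma gcoef_radius L z : 0 < L -> Rabs z < 1 -> Rbar_lt (Rabs z) (CV_radius (gcoef L)).
Proof.
  intros HL Hz. destruct (gcoef_bound L HL) as [C [HC Hb]].
  set (r := (Rabs z + 1) / 2). pose proof (Rabs_pos z).
  apply Rbar_lt_le_trans with r; [simpl; unfold r; lra|].
  apply (proj1 (CV_radius_bounded (gcoef L))). exists C. intros n.
  rewrite Rabs_mult, (Rabs_pos_eq (gcoef L n)), Rabs_pos_eq by (try apply pow_le; unfold r; try apply Hb; lra).
  assert (r ^ n <= 1). { rewrite <- (pow1 n). apply pow_incr. unfold r; lra. }
  assert (0 <= r ^ n) by (apply pow_le; unfold r; lra). pose proof (Hb n). nra.
Qed.

Lemma G_series L z : 0 < L -> Rabs z < 1 -> is_series (fun j => gcoef L j * z ^ j) (G phi theta L z) /\ G phi theta L z = PSeries (gcoef L) z.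
Proof.
  intros HL Hz. pose proof (CV_radius_inside _ _ (gcoef_radius L z HL Hz)) as Hex.
  apply PSeries_correct, is_pseries_R in Hex.
  assert (E : G phi theta L z = PSeries (gcoef L) z).
  { apply ser_eq. apply is_series_ext with (2 := Hex). intros [|n]; simpl; ring. }
  rewrite E. split; auto.
Qed.

Lemma log_den_term L i z M : 0 < L -> 0 <= z < 1 ->
  Rabs (psum (fun j => char_coef phi L (S j) i * z ^ S j / INR (S j)) M -
     (- (1/2) * ln (log_den (chi_c phi (freq L (S i))) (rho phi (freq L (S i))) z))) <= 2 * z ^ S M / (1 - z) ^ 2.
Proof.
  intros HL Hz. set (t := freq L (S i)). pose proof (rho_nonneg phi t) as H0. pose proof (rho_le_1 phi D1 D2 K Hphi t) as H1.
  assert (Hx : 0 <= rho phi t * z <= z) by nra.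
  pose proof (log_series_partial (omega phi t) (rho phi t * z) M ltac:(lra)) as H.
  assert (E : log_den (cos (omega phi t)) 1 (rho phi t * z) = log_den (chi_c phi t) (rho phi t) z).
  { unfold log_den. rewrite chi_c_polar. ring. }
  rewrite E in H. rewrite (psum_ext (fun j => char_coef phi L (S j) i * z ^ S j / INR (S j)) (fun j => cos (INR (S j) * omega phi t) * (rho phi t * z) ^ S j / INR (S j))).
  - eapply Rle_trans; [exact H|]. unfold Rdiv. apply Rmult_le_compat.
    + assert (0 <= (rho phi t * z) ^ S M) by (apply pow_le; lra). lra.
    + left. apply Rinv_0_lt_compat, pow_lt. lra.
    + apply Rmult_le_compat_l; [lra|]. apply pow_incr; lra.
    + apply Rinv_le_contravar; [apply pow_lt; lra|]. apply pow_incr; lra.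
  - intros j _. unfold char_coef. fold t. rewrite Rpow_mult_distr. unfold Rdiv. ring.
Qed.

(* The identity G(z) = - theta (ln(1-z) + sum_i ln |1 - chi(t_i) z|^2). *)
Lemma G_log_lim L z : 0 < L -> 0 <= z < 1 ->
  is_lim_seq (fun I => psum (fun i => - (1/2) * ln (log_den (chi_c phi (freq L (S i))) (rho phi (freq L (S i))) z)) I)
     ((G phi theta L z / theta + ln (1 - z)) / 2).
Proof.
  intros HL Hz. pose proof (sd_K_pos _ _ _ _ Hphi) as HK. pose proof PI_RGT_0 as Hpi.
  destruct (G_series L z HL) as [HG _]; [rewrite Rabs_pos_eq; lra|].
  apply is_series_psum in HG. apply is_lim_seq_incr_1 in HG.
  assert (HG' : is_lim_seq (psum (fun j => W phi theta L (S j) * z ^ S j / INR (S j))) (G phi theta L z)).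
  { apply is_lim_seq_ext with (2 := HG). intros n. rewrite psum_S_l. simpl (gcoef L 0). rewrite Rmult_0_l, Rplus_0_l.
    apply psum_ext. intros i _. change (gcoef L (S i)) with (W phi theta L (S i) / INR (S i)). unfold Rdiv. ring. }
  set (gi := fun i => - (1/2) * ln (log_den (chi_c phi (freq L (S i))) (rho phi (freq L (S i))) z)).
  assert (Hrem : is_lim_seq (fun M => 2 * z ^ S M / (1 - z) ^ 2) 0).
  { replace (Finite 0) with (Rbar_mult (2 * / (1-z)^2) 0) by (simpl; f_equal; ring).
    apply is_lim_seq_ext with (fun M => (2 * / (1-z)^2) * z ^ (S M)).
    - intros; field. lra.
    - apply is_lim_seq_scal_l. apply -> (is_lim_seq_incr_1 (fun n => z ^ n)). apply is_lim_seq_geom. rewrite Rabs_pos_eq; lra. }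
  assert (Hterm : forall i, is_lim_seq (fun M => psum (fun j => char_coef phi L (S j) i * z ^ S j / INR (S j)) M) (gi i)).
  { intros i. apply is_lim_seq_ext with (fun M => (psum (fun j => char_coef phi L (S j) i * z ^ S j / INR (S j)) M - gi i) + gi i); [intros; ring|].
    replace (Finite (gi i)) with (Finite (0 + gi i)) by (f_equal; ring). apply is_lim_seq_plus'; [|apply is_lim_seq_const].
    apply is_lim_seq_abs_0. apply (is_lim_seq_le_le (fun _ => 0) _ (fun M => 2 * z ^ S M / (1 - z) ^ 2)); auto using is_lim_seq_const.
    intros n. split; [apply Rabs_pos|]. now apply log_den_term. }
  assert (Hterm0 : is_lim_seq (fun M => psum (fun j => z ^ S j / INR (S j)) M) (- ln (1 - z))).
  { apply is_lim_seq_ext with (fun M => (psum (fun j => z ^ S j / INR (S j)) M - - ln (1 - z)) + - ln (1 - z)); [intros; ring|].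
    replace (Finite (- ln (1 - z))) with (Finite (0 + - ln (1 - z))) by (f_equal; ring). apply is_lim_seq_plus'; [|apply is_lim_seq_const].
    apply is_lim_seq_abs_0. apply (is_lim_seq_le_le (fun _ => 0) _ (fun M => 2 * z ^ S M / (1 - z) ^ 2)); auto using is_lim_seq_const.
    intros n. split; [apply Rabs_pos|]. pose proof (log_series_partial 0 z n Hz) as H. rewrite cos_0 in H.
    replace (- (1 / 2) * ln (log_den 1 1 z)) with (- ln (1 - z)) in H.
    - rewrite (psum_ext (fun j => z ^ S j / INR (S j)) (fun j => cos (INR (S j) * 0) * z ^ S j / INR (S j))); [exact H|].
      intros. rewrite Rmult_0_r, cos_0. unfold Rdiv; ring.
    - replace (log_den 1 1 z) with ((1 - z) * (1 - z)) by (unfold log_den; ring). rewrite ln_mult by lra. field. }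
  apply is_lim_seq_Reals. intros eps Heps. unfold Rdist. set (Gz := G phi theta L z) in *.
  (* The tail of the frequency sum is bounded uniformly in j, and the sum over j of z^j costs 1/(1 -
     z); this is the origin of the factor 1 - z. *)
  destruct (atan_tail_small (2 * PI / L) (1 + K * PI) (eps / 2 * (1 - z)) (freq_coef_pos L HL) ltac:(nra) ltac:(nra)) as [I0 HI0].
  exists I0. intros I HI. specialize (HI0 I HI). set (e := eps / 2 * (1 - z)) in *. fold gi.
  assert (Hmain : Rabs (Gz - theta * (- ln (1 - z) + 2 * psum gi I)) <= 2 * theta * e * / (1 - z)).
  { apply (lim_abs_le (fun M => psum (fun j => W phi theta L (S j) * z ^ S j / INR (S j)) M -
       theta * (psum (fun j => z ^ S j / INR (S j)) M + 2 * psum (fun i => psum (fun j => char_coef phi L (S j) i * z ^ S j / INR (S j)) M) I))).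
    - apply is_lim_seq_minus'; [exact HG'|]. apply (is_lim_seq_mult' (fun _ => theta)); [apply is_lim_seq_const|].
      apply is_lim_seq_plus'; [exact Hterm0|]. apply (is_lim_seq_mult' (fun _ => 2)); [apply is_lim_seq_const|].
      apply (is_lim_seq_psum (fun M i => psum (fun j => char_coef phi L (S j) i * z ^ S j / INR (S j)) M)). exact Hterm.
    (* Finite sums over j and over frequencies may be exchanged; for each j the difference is the
       tail of [W_series] beyond the [I] frequencies kept. *)
    - intros M. rewrite psum_swap, <- psum_scal, <- psum_plus, <- psum_scal, <- psum_minus.
      eapply Rle_trans.
      + apply (psum_abs_le _ (fun j => 2 * theta * e * z ^ S j)). intros j _.
        destruct (W_series phi D1 D2 K Hphi L HL theta j) as [l [Hl [E _]]]. rewrite E.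
        pose proof (tail_bound_lim _ _ _ I l (freq_coef_pos L HL) Hl (char_coef_le phi D1 D2 K Hphi L j)) as Ht.
        rewrite (psum_ext _ (fun i => (z ^ S j / INR (S j)) * char_coef phi L (S j) i)) by (intros; unfold Rdiv; ring).
        rewrite psum_scal.
        replace (theta * (1 + 2 * l) * z ^ S j / INR (S j) - theta * (z ^ S j / INR (S j) + 2 * (z ^ S j / INR (S j) * psum (char_coef phi L (S j)) I)))
          with (2 * theta * (l - psum (char_coef phi L (S j)) I) * (z ^ S j / INR (S j))) by (unfold Rdiv; ring).
        assert (Hj1 : 1 <= INR (S j)) by (apply (le_INR 1); lia).
        assert (Hz0 : 0 <= z ^ S j) by (apply pow_le; lra).
        assert (Hzj : 0 <= z ^ S j / INR (S j) <= z ^ S j).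
        { split; [apply Rmult_le_pos; auto; left; apply Rinv_0_lt_compat; lra|].
          apply (Rmult_le_reg_r (INR (S j))); [lra|]. unfold Rdiv. rewrite Rmult_assoc, Rinv_l by lra. nra. }
        rewrite !Rabs_mult, (Rabs_pos_eq 2), (Rabs_pos_eq theta), (Rabs_pos_eq (z ^ S j / INR (S j))) by lra.
        apply Rmult_le_compat; [|lra| |lra].
        * apply Rmult_le_pos; [lra|apply Rabs_pos].
        * apply Rmult_le_compat_l; [lra|]. lra.
      + rewrite psum_scal. apply Rmult_le_compat_l; [|now apply geom_psum_le]. unfold e. assert (0 < eps / 2 * (1 - z)) by nra. nra. }
  unfold e in Hmain. replace (2 * theta * (eps / 2 * (1 - z)) * / (1 - z)) with (theta * eps) in Hmain by (field; lra).
  replace (psum gi I - (Gz / theta + ln (1 - z)) / 2) with (- (Gz - theta * (- ln (1 - z) + 2 * psum gi I)) / (2 * theta)) by (field; lra).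
  unfold Rdiv. rewrite Rabs_mult, Rabs_Ropp, Rabs_inv, (Rabs_pos_eq (2 * theta)) by lra.
  apply Rle_lt_trans with (theta * eps * / (2 * theta)).
  - apply Rmult_le_compat_r; [left; apply Rinv_0_lt_compat; lra|exact Hmain].
  - replace (theta * eps * / (2 * theta)) with (eps / 2) by (field; lra). lra.
Qed.
End WBounds.

(** * Exponential of a power series *)

Lemma psum_cauchy (a b : nat -> R) m :
  psum (fun n => psum (fun j => a j * b (n - j)%nat) (S n)) m = psum (fun j => a j * psum b (m - j)) m.
Proof.
  induction m; [reflexivity|]. rewrite psum_S, IHm.
  rewrite (psum_S (fun j => a j * psum b (S m - j))).
  rewrite (psum_ext (fun j => a j * psum b (S m - j)) (fun j => a j * psum b (m - j) + a j * b (m - j)%nat)).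
  - rewrite psum_plus, (psum_S (fun j => a j * b (m - j)%nat)).
    replace (S m - m)%nat with 1%nat by lia. rewrite Nat.sub_diag. simpl psum. ring.
  - intros j Hj. replace (S m - j)%nat with (S (m - j)) by lia. simpl psum. ring.
Qed.

Lemma radius_ge_1 (a : nat -> R) : (forall r, 0 <= r < 1 -> exists B, forall n, Rabs (a n * r ^ n) <= B) ->
  forall z, Rabs z < 1 -> Rbar_lt (Rabs z) (CV_radius a).
Proof.
  intros H z Hz. set (r := (Rabs z + 1) / 2). pose proof (Rabs_pos z).
  apply Rbar_lt_le_trans with r; [simpl; unfold r; lra|].
  apply (proj1 (CV_radius_bounded a)). apply H. unfold r; lra.
Qed.

Section ExpSeries.
Variable g : nat -> R.

(** The relation h' = g' h reads n h_n = sum of j g_j h_(n-j) and refers to all earlier values. Such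
    a course-of-values recursion is encoded by tables: [exp_pre n] is correct up to index [n]. *)
Fixpoint exp_pre (n : nat) : nat -> R :=
  match n with
  | O => fun _ => 1
  | S m => fun k => if (k <=? m)%nat then exp_pre m k
                    else psum (fun j => INR (S j) * g (S j) * exp_pre m (m - j)%nat) (S m) / INR (S m)
  end.

Definition exp_coef (n : nat) : R := exp_pre n n.

Lemma exp_pre_stable n k : (k <= n)%nat -> exp_pre n k = exp_coef k.
Proof.
  intros Hk. induction n.
  - replace k with 0%nat by lia. reflexivity.
  - destruct (Nat.eq_dec k (S n)) as [->|Hne]; [reflexivity|].
    simpl. destruct (Nat.leb_spec k n); [apply IHn; auto|lia].
Qed.

Lemma exp_coef_S n : INR (S n) * exp_coef (S n) = psum (fun j => INR (S j) * g (S j) * exp_coef (n - j)) (S n).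
Proof.
  unfold exp_coef at 1. cbn [exp_pre]. destruct (Nat.leb_spec (S n) n); [lia|].
  rewrite (psum_ext _ (fun j => INR (S j) * g (S j) * exp_coef (n - j))).
  - field. apply not_0_INR; lia.
  - intros j Hj. rewrite exp_pre_stable by lia. reflexivity.
Qed.

Hypothesis g_nonneg : forall j, 0 <= g j.
Hypothesis g_radius : forall z, Rabs z < 1 -> Rbar_lt (Rabs z) (CV_radius g).
Hypothesis g_0 : g 0%nat = 0.

Lemma exp_coef_nonneg n : 0 <= exp_coef n.
Proof.
  induction n as [n IH] using lt_wf_ind. destruct n; [unfold exp_coef; simpl; lra|].
  pose proof (exp_coef_S n) as H. pose proof (lt_0_INR (S n) ltac:(lia)).
  assert (0 <= psum (fun j => INR (S j) * g (S j) * exp_coef (n - j)) (S n)).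
  { apply psum_nonneg. intros j Hj. apply Rmult_le_pos; [apply Rmult_le_pos; [apply pos_INR|auto]|apply IH; lia]. }
  destruct (Rle_dec 0 (exp_coef (S n))); auto. exfalso. nra.
Qed.

Lemma PSeries_ge_psum a z m : (forall j, 0 <= a j) -> 0 <= z -> Rbar_lt (Rabs z) (CV_radius a) ->
  psum (fun j => a j * z ^ j) m <= PSeries a z.
Proof.
  intros Ha Hz Hr. apply psum_le_series.
  - intros; apply Rmult_le_pos; auto. now apply pow_le.
  - apply is_pseries_R, PSeries_correct, CV_radius_inside, Hr.
Qed.

Lemma is_derive_poly (a : nat -> R) M z : is_derive (fun z => psum (fun n => a n * z ^ n) (S M)) z
  (psum (fun n => INR (S n) * a (S n) * z ^ n) M).
Proof.
  induction M as [|M IH].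
  - apply is_derive_ext with (fun _ => a 0%nat); [intros; eqR; simpl; ring|]. apply (is_derive_const (V:=R_NormedModule) (a 0%nat)).
  - apply (is_derive_ext (fun z => psum (fun n => a n * z ^ n) (S M) + a (S M) * z ^ S M)); [reflexivity|].
    rewrite psum_S. apply (is_derive_plus (V:=R_NormedModule)); [exact IH|].
    evar_last.
    + apply is_derive_scal, (is_derive_pow (fun y => y) (S M) z 1), (is_derive_id (K:=R_AbsRing)).
    + change (pred (S M)) with M. eqR. ring.
Qed.

(** Nonnegative coefficients make the partial sum F satisfy F' <= g' F on [0, z], so that F exp(-g)
    does not increase from its value 1 at 0. Convergence of the full series follows without
    composing power series. *)
Lemma exp_partial_le M z : 0 <= z < 1 -> psum (fun n => exp_coef n * z ^ n) (S M) <= exp (PSeries g z).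
Proof.
  intros Hz. set (F := fun z => psum (fun n => exp_coef n * z ^ n) (S M)).
  set (g1 := PSeries (PS_derive g)).
  assert (Hr : forall y, 0 <= y <= z -> Rbar_lt (Rabs y) (CV_radius g)) by (intros; apply g_radius; rewrite Rabs_pos_eq; lra).
  assert (Hg1 : forall j, 0 <= PS_derive g j) by (intros; unfold PS_derive; apply Rmult_le_pos; [apply pos_INR|auto]).
  assert (HF : forall y, 0 <= y <= z -> psum (fun n => INR (S n) * exp_coef (S n) * y ^ n) M <= g1 y * F y).
  { intros y Hy.
    rewrite (psum_ext _ (fun n => psum (fun j => (INR (S j) * g (S j) * y ^ j) * (exp_coef (n - j) * y ^ (n - j))) (S n))).
    2:{ intros n _. rewrite exp_coef_S, Rmult_comm, <- psum_scal. apply psum_ext. intros j Hj.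
        replace (y ^ n) with (y ^ j * y ^ (n - j)) by (rewrite <- pow_add; f_equal; lia). ring. }
    rewrite (psum_cauchy (fun j => INR (S j) * g (S j) * y ^ j) (fun k => exp_coef k * y ^ k)).
    assert (HFm : forall m, (m <= S M)%nat -> psum (fun k => exp_coef k * y ^ k) m <= F y).
    { intros m Hm. apply (psum_incr (fun k => exp_coef k * y ^ k)); auto. intros i. apply Rmult_le_pos; [apply exp_coef_nonneg|apply pow_le; lra]. }
    eapply Rle_trans.
    - apply (psum_le _ (fun j => F y * (PS_derive g j * y ^ j))). intros j Hj. unfold PS_derive.
      rewrite (Rmult_comm (F y)). apply Rmult_le_compat_l.
      + apply Rmult_le_pos; [apply (Hg1 j)|apply pow_le; lra].
      + apply HFm. lia.
    - rewrite psum_scal, Rmult_comm. apply Rmult_le_compat_r.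
      + apply (psum_nonneg (fun k => exp_coef k * y ^ k)). intros; apply Rmult_le_pos; [apply exp_coef_nonneg|apply pow_le; lra].
      + unfold g1. apply PSeries_ge_psum; auto; [lra|]. rewrite CV_radius_derive. auto. }
  pose proof (is_derive_nonneg_le (fun y => - (F y * exp (- PSeries g y)))
    (fun y => - (psum (fun n => INR (S n) * exp_coef (S n) * y ^ n) M * exp (- PSeries g y) + F y * (- g1 y * exp (- PSeries g y)))) 0 z ltac:(lra)) as Hmono.
  assert (H0 : F 0 * exp (- PSeries g 0) = 1).
  { unfold F. rewrite psum_S_l. rewrite (psum_ext _ (fun _ => 0)) by (intros; simpl; ring).
    rewrite psum_const, PSeries_0, g_0, Ropp_0, exp_0. unfold exp_coef; simpl. ring. }
  cbv beta in Hmono. rewrite H0 in Hmono.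
  assert (Hfin : -1 <= - (F z * exp (- PSeries g z))).
  { apply Hmono.
    - intros y Hy. pose proof (is_derive_PSeries g y (Hr y Hy)) as Hd.
      assert (He : is_derive (fun y => exp (- PSeries g y)) y (- g1 y * exp (- PSeries g y))).
      { apply (is_derive_comp exp (fun y => - PSeries g y)); [apply is_derive_exp|]. apply (is_derive_opp (V:=R_NormedModule)), Hd. }
      apply (is_derive_opp (V:=R_NormedModule) (fun y => F y * exp (- PSeries g y))).
      apply (is_derive_mult F (fun y => exp (- PSeries g y))); [apply is_derive_poly|exact He|intros; apply Rmult_comm].
    - intros y Hy. pose proof (HF y Hy). pose proof (exp_pos (- PSeries g y)). nra. }
  fold (F z). rewrite exp_Ropp in Hfin. pose proof (exp_pos (PSeries g z)).
  apply (Rmult_le_reg_r (/ exp (PSeries g z))); [now apply Rinv_0_lt_compat|]. rewrite Rinv_r by lra. lra.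
Qed.

Lemma exp_radius z : Rabs z < 1 -> Rbar_lt (Rabs z) (CV_radius exp_coef).
Proof.
  apply radius_ge_1. intros r Hr. exists (exp (PSeries g r)). intros n.
  rewrite Rabs_pos_eq by (apply Rmult_le_pos; [apply exp_coef_nonneg|apply pow_le; lra]).
  eapply Rle_trans; [|apply (exp_partial_le n r Hr)]. rewrite psum_S.
  assert (0 <= psum (fun n => exp_coef n * r ^ n) n).
  { apply psum_nonneg. intros; apply Rmult_le_pos; [apply exp_coef_nonneg|apply pow_le; lra]. }
  lra.
Qed.

(** The quotient of both sides has derivative zero, by the recursion read as a Cauchy product, and
    equals 1 at 0. *)
Lemma exp_series z : Rabs z < 1 -> PSeries exp_coef z = exp (PSeries g z).
Proof.
  intros Hz. set (f := fun y => PSeries exp_coef y * exp (- PSeries g y)).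
  assert (Hy1 : forall y, Rmin 0 z <= y <= Rmax 0 z -> Rabs y < 1).
  { intros y Hy. apply Rabs_def2 in Hz. apply Rabs_def1; unfold Rmin, Rmax in Hy; destruct (Rle_dec 0 z); lra. }
  assert (Hd : forall y, Rmin 0 z <= y <= Rmax 0 z -> is_derive f y 0).
  { intros y Hy. specialize (Hy1 y Hy).
    pose proof (is_derive_PSeries _ y (g_radius y Hy1)) as Hdg. pose proof (is_derive_PSeries _ y (exp_radius y Hy1)) as Hdh.
    assert (He : is_derive (fun y => exp (- PSeries g y)) y (- PSeries (PS_derive g) y * exp (- PSeries g y))).
    { apply (is_derive_comp exp (fun y => - PSeries g y)); [apply is_derive_exp|]. apply (is_derive_opp (V:=R_NormedModule)), Hdg. }
    evar_last; [apply (is_derive_mult _ _ y _ _ Hdh He); intros; apply Rmult_comm|].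
    rewrite (PSeries_ext (PS_derive exp_coef) (PS_mult (PS_derive g) exp_coef)).
    - rewrite PSeries_mult.
      + unfold plus, mult; simpl. ring.
      + rewrite CV_radius_derive. auto.
      + now apply exp_radius.
    - intros n. unfold PS_derive at 1. rewrite exp_coef_S. unfold PS_mult. rewrite psum_sum_f_R0. reflexivity. }
  assert (E : f z = f 0).
  { pose proof (is_derive_bounded f (fun _ => 0) 0 z 0 Hd) as Hb. specialize (Hb ltac:(intros; cbv beta; rewrite Rabs_R0; lra)).
    rewrite Rmult_0_l in Hb. pose proof (Rabs_pos (f z - f 0)). apply Rminus_diag_uniq. destruct (Req_dec (f z - f 0) 0); auto.
    pose proof (Rabs_pos_lt _ H0). lra. }
  unfold f in E. rewrite !PSeries_0, g_0, Ropp_0, exp_0, exp_Ropp in E. unfold exp_coef at 2 in E. simpl in E.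
  pose proof (exp_pos (PSeries g z)). apply (Rmult_eq_reg_r (/ exp (PSeries g z))).
  - rewrite Rinv_r by lra. lra.
  - apply Rinv_neq_0_compat; lra.
Qed.
End ExpSeries.

Section HSeries.
Variables (phi D1 D2 : R -> R) (K : R).
Hypothesis Hphi : smooth_density phi D1 D2 K.
Variable theta : R.
Hypothesis Htheta : 0 < theta.
Variable L : R.
Hypothesis HL : 0 < L.

Let g := gcoef phi theta L.

Lemma gcoef_nonneg j : 0 <= g j.
Proof. destruct (gcoef_bound phi D1 D2 K Hphi theta Htheta L HL) as [C [_ H]]. apply H. Qed.

Lemma H_exp_coef n : H phi theta L n = exp_coef g n.
Proof.
  pose proof (gcoef_radius phi D1 D2 K Hphi theta Htheta L) as Hrad.
  assert (Hr : forall z, Rabs z < 1 -> Rbar_lt (Rabs z) (CV_radius g)) by (intros; now apply Hrad).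
  pose proof (exp_radius g gcoef_nonneg Hr eq_refl) as Hre.
  apply choiceR_unique.
  - exists (exp_coef g). split; auto. intros z Hz. apply is_series_Reals.
    destruct (G_series phi D1 D2 K Hphi theta Htheta L z HL Hz) as [_ ->]. fold g.
    rewrite <- (exp_series g gcoef_nonneg Hr eq_refl z Hz).
    apply is_pseries_R, PSeries_correct, CV_radius_inside. auto.
  - intros h' [c [Hc Hs]]. rewrite <- Hc.
    assert (Hps : forall z, Rabs z < 1 -> is_pseries c z (exp (G phi theta L z))).
    { intros z Hz. apply is_pseries_R, is_series_Reals, Hs, Hz. }
    apply PSeries_ext_recip.
    (* Uniqueness of coefficients requires a positive radius for the arbitrary sequence [c]:
       convergence at r < 1 already makes the terms c_n r^n bounded. *)
    + replace (Finite 0) with (Finite (Rabs 0)) by (now rewrite Rabs_R0).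
      apply radius_ge_1; [|rewrite Rabs_R0; lra]. intros r Hr'.
      assert (Hex : ex_series (fun n => c n * r ^ n)). { eexists. apply is_series_Reals, Hs. rewrite Rabs_pos_eq; lra. }
      apply ex_series_lim_0 in Hex.
      apply is_lim_seq_Reals in Hex. destruct (maj_by_pos _ (exist _ 0 Hex)) as [B [_ HB]]. exists B. exact HB.
    + replace (Finite 0) with (Finite (Rabs 0)) by (now rewrite Rabs_R0). apply Hre. rewrite Rabs_R0; lra.
    + exists (mkposreal 1 Rlt_0_1). intros z Hz.
      assert (Hz1 : Rabs z < 1). { revert Hz. generalize z. clear. intros z Hz. change (Rabs (z + - 0) < 1) in Hz. rewrite Ropp_0, Rplus_0_r in Hz. exact Hz. }
      rewrite (is_pseries_unique _ _ _ (Hps z Hz1)). destruct (G_series phi D1 D2 K Hphi theta Htheta L z HL Hz1) as [_ ->]. fold g.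
      symmetry. apply (exp_series g gcoef_nonneg Hr eq_refl z Hz1).
Qed.

Lemma H_nonneg n : 0 <= H phi theta L n.
Proof. rewrite H_exp_coef. apply exp_coef_nonneg. apply gcoef_nonneg. Qed.

Lemma H_rec n : INR (S n) * H phi theta L (S n) = psum (fun j => W phi theta L (S j) * H phi theta L (n - j)) (S n).
Proof.
  rewrite H_exp_coef, exp_coef_S. apply psum_ext. intros j _. rewrite H_exp_coef.
  change (g (S j)) with (W phi theta L (S j) / INR (S j)). field. apply not_0_INR; lia.
Qed.

Lemma H_gen z : 0 <= z < 1 -> is_series (fun n => H phi theta L n * z ^ n) (exp (G phi theta L z)).
Proof.
  intros Hz. assert (Hz1 : Rabs z < 1) by (rewrite Rabs_pos_eq; lra).
  pose proof (gcoef_radius phi D1 D2 K Hphi theta Htheta L) as Hrad.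
  assert (Hr : forall z, Rabs z < 1 -> Rbar_lt (Rabs z) (CV_radius g)) by (intros; now apply Hrad).
  destruct (G_series phi D1 D2 K Hphi theta Htheta L z HL Hz1) as [_ ->]. fold g.
  rewrite <- (exp_series g gcoef_nonneg Hr eq_refl z Hz1).
  apply is_series_ext with (fun n => exp_coef g n * z ^ n); [intros; now rewrite H_exp_coef|].
  apply is_pseries_R, PSeries_correct, CV_radius_inside. apply exp_radius; auto. apply gcoef_nonneg.
Qed.
End HSeries.

(** * Limit of the Laplace transforms *)

(** Dominated convergence for series: beyond a fixed index all tails are small by the common
    majorant, and the finite sums converge term by term. *)
Lemma tannery (f : nat -> nat -> R) (l F : nat -> R) (a c : R) : 0 < a ->
  (forall N i, Rabs (f N i) <= c * / (1 + a ^ 2 * (INR i + 1) ^ 2)) ->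
  (forall i, is_lim_seq (fun N => f N i) (l i)) ->
  (forall N, is_lim_seq (psum (f N)) (F N)) ->
  exists S : R, is_lim_seq (psum l) S /\ is_lim_seq F S.
Proof.
  intros Ha Hd Hl HF.
  assert (Hdl : forall i, Rabs (l i) <= c * / (1 + a ^ 2 * (INR i + 1) ^ 2)) by (intros i; eapply lim_abs_le; [apply Hl|intros; apply Hd]).
  destruct (dominated_conv l a c Ha Hdl) as [S HS]. exists S. split; auto.
  assert (Hc : 0 <= c).
  { pose proof (Hdl 0%nat) as H1. pose proof (Rabs_pos (l 0%nat)).
    assert (0 < / (1 + a ^ 2 * (INR 0 + 1) ^ 2)) by (apply Rinv_0_lt_compat; simpl; nra). nra. }
  apply is_lim_seq_Reals. intros eps Heps.
  destruct (atan_tail_small a c (eps/4) Ha ltac:(lra) Hc) as [I HI]. specialize (HI I (le_n _)).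
  pose proof (is_lim_seq_psum f l I Hl) as Hp. apply is_lim_seq_Reals in Hp.
  destruct (Hp (eps/4) ltac:(lra)) as [N0 HN0]. exists N0. intros N HN. specialize (HN0 N HN). unfold Rdist in *.
  pose proof (tail_bound_lim _ a c I _ Ha HS Hdl) as T1. pose proof (tail_bound_lim _ a c I _ Ha (HF N) (Hd N)) as T2.
  apply Rabs_le_between in T1. apply Rabs_le_between in T2. apply Rabs_def2 in HN0. apply Rabs_def1; lra.
Qed.

Section Laplace.
Variables (phi D1 D2 : R -> R) (K : R).
Hypothesis Hphi : smooth_density phi D1 D2 K.
Variable theta : R.
Hypothesis Htheta : 0 < theta.
Variable Ls : nat -> R.
Hypothesis HLs2 : forall N, 2 <= Ls N.
Hypothesis HLs : is_lim_seq Ls p_infty.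

Definition radius (L : R) := 1 - / L ^ 2.

Let V := second_moment phi.

Lemma radius_bounds L : 2 <= L -> 3/4 <= radius L < 1.
Proof.
  intros HL. unfold radius. assert (4 <= L^2) by nra. assert (0 < / L^2) by (apply Rinv_0_lt_compat; lra).
  assert (/ L^2 <= / 4) by (apply Rinv_le_contravar; lra). lra.
Qed.

Lemma log_den_lower c r z : 0 <= r <= 1 -> Rabs c <= r -> 0 <= z <= 1 -> (1 - r)^2 <= log_den c r z.
Proof.
  intros Hr Hc Hz. apply Rabs_le_between in Hc. unfold log_den. assert (z * r <= r) by nra.
  assert ((1 - r)^2 <= (1 - z * r)^2) by nra. assert (z * c <= z * r) by nra. nra.
Qed.

Lemma chi_c_abs_le t : Rabs (chi_c phi t) <= rho phi t.
Proof.
  rewrite chi_c_polar, Rabs_mult, (Rabs_pos_eq (rho phi t)) by apply rho_nonneg.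
  assert (Rabs (cos (omega phi t)) <= 1) by (apply Rabs_le, COS_bound). pose proof (rho_nonneg phi t). nra.
Qed.

Lemma rho_sq t : rho phi t ^ 2 = chi_c phi t ^ 2 + chi_s phi t ^ 2.
Proof. unfold rho. rewrite pow2_sqrt; [reflexivity|]. pose proof (pow2_ge_0 (chi_c phi t)). pose proof (pow2_ge_0 (chi_s phi t)). lra. Qed.

(** The majorant for [tannery]. Both arguments of the logarithm are at least (1 - rho)^2, of order
    t^4/(1 + t^2)^2. Their difference factors into z - z', of order L^-2, and a term of order t^2/(1
    + t^2)^2, by cancellation for t <= 1 and by the decay of [rho] for t > 1. *)
Lemma log_den_ratio (s : nat) : (1 <= s)%nat -> exists C, 0 < C /\ forall L t, 2 <= L -> 2 * PI / L <= t ->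
  Rabs (ln (log_den (chi_c phi t) (rho phi t) (radius L ^ s)) - ln (log_den (chi_c phi t) (rho phi t) (radius L))) <= C / (L ^ 2 * t ^ 2).
Proof.
  intros Hs. destruct (rho_gap phi D1 D2 K Hphi) as [k [Hk Hgap]].
  assert (HV : 0 < V) by (eapply second_moment_pos; eauto).
  pose proof (sd_K_pos _ _ _ _ Hphi) as HK. pose proof PI_RGT_0 as Hpi.
  assert (Hs1 : 1 <= INR s) by (apply (le_INR 1); auto).
  (* The first summand serves t <= 1, where (1 + t^2)^2 <= 4; the second serves t > 1, where 1 + t^2
     <= 2 t^2. *)
  set (B := 4 * (3 * V + 1 + INR s) + 8 * (1 + K * PI)). assert (HKP : 0 <= K * PI) by nra. assert (HB : 0 < B) by (unfold B; lra).
  exists (INR s * B / k^2). assert (Hk2 : 0 < k^2) by nra.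
  split; [apply Rdiv_lt_0_compat; nra|]. intros L t HL Ht.
  assert (H2p : 0 < 2 * PI / L) by (apply Rdiv_lt_0_compat; lra). assert (Ht0 : 0 < t) by lra.
  pose proof (radius_bounds L HL) as Hr. set (z := radius L) in *. set (z' := z ^ s).
  assert (Hzz : 0 <= z' <= z).
  { unfold z'. split; [apply pow_le; lra|]. destruct s as [|s']; [lia|]. simpl. assert (z ^ s' <= 1). { rewrite <- (pow1 s'). apply pow_incr; lra. } nra. }
  assert (Hdz : 1 - z' <= INR s * / L^2).
  { pose proof (one_minus_pow_le z s ltac:(lra)) as H. unfold z' . replace (/ L^2) with (1 - z) by (unfold z, radius; ring). exact H. }
  set (c := chi_c phi t). set (r := rho phi t).
  pose proof (rho_nonneg phi t) as H0. pose proof (rho_le_1 phi D1 D2 K Hphi t) as H1. fold r in H0, H1.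
  pose proof (chi_c_abs_le t) as Hc. fold c r in Hc.
  assert (Ht2 : 0 < t^2) by nra. set (w := (1 + t^2)^2). assert (Hw : 0 < w) by (apply pow_lt; lra).
  assert (HL2 : 0 < L^2) by nra.
  assert (Hm : k^2 * t^4 / w <= (1 - r)^2).
  { pose proof (Hgap t Ht0) as Hg. fold r in Hg. assert (0 <= t^2/(1+t^2)) by (apply Rmult_le_pos; [lra|left; apply Rinv_0_lt_compat; lra]).
    replace (k^2 * t^4 / w) with ((k * (t^2/(1+t^2)))^2) by (unfold w; field; lra). apply pow_incr. split; [nra|lra]. }
  assert (Hm0 : 0 < k^2 * t^4 / w). { assert (0 < t^4) by (apply pow_lt; auto). apply Rdiv_lt_0_compat; auto. nra. }
  eapply Rle_trans.
  { apply (ln_ratio_bound _ _ (k^2 * t^4 / w)); auto; (eapply Rle_trans; [exact Hm|]); apply log_den_lower; auto; lra. }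
  assert (Hdiff : Rabs (log_den c r z' - log_den c r z) <= INR s * / L^2 * (B * t^2 / w)).
  { replace (log_den c r z' - log_den c r z) with ((z - z') * (2 * c - r^2 * (z + z'))) by (unfold log_den; ring).
    rewrite Rabs_mult. apply Rmult_le_compat; try apply Rabs_pos.
    - rewrite Rabs_pos_eq; lra.
    - assert (Hiw : 0 < / w) by (now apply Rinv_0_lt_compat).
      destruct (Rle_dec t 1) as [Ht1|Ht1].
      + assert (t^2 <= 1) by nra. assert (w <= 4) by (unfold w; nra).
        assert (Hmain : Rabs (2 * c - r^2 * (z + z')) <= (3 * V + 1 + INR s) * t^2).
        { pose proof (chi_c_lower phi D1 D2 K Hphi t) as Hcl. pose proof (chi_s_le2 phi D1 D2 K Hphi t) as Hsl. fold c in Hcl. fold V in Hcl, Hsl.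
          pose proof (rho_sq t) as Hrs. fold r c in Hrs. set (q := chi_s phi t) in *.
          assert (Hq1 : Rabs q <= 1). { rewrite <- (Rabs_pos_eq 1) by lra. apply Rsqr_le_abs_0. unfold Rsqr. nra. }
          assert (Hq2 : q^2 <= V * t^2). { rewrite <- (pow2_abs q). pose proof (Rabs_pos q). nra. }
          assert (Hc1 : Rabs c <= 1) by lra. apply Rabs_le_between in Hc1.
          assert (Hcc : -(V * t^2/2) <= c * (1 - c) <= V * t^2 / 2) by (split; nra).
          assert (Hz2 : 0 <= 2 - z - z' <= (1 + INR s) * t^2).
          (* Here the lower bound 2 pi/L on the frequency enters: the distances of z and z' from 1
             are of order L^-2 and hence of order t^2. *)
          { split; [lra|]. assert (/ L^2 <= t^2).
            { assert (1 / L <= t). { eapply Rle_trans; [|exact Ht]. unfold Rdiv. apply Rmult_le_compat_r; [left; apply Rinv_0_lt_compat; lra|]. pose proof PI2_1. lra. }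
              replace (/ L^2) with ((1/L)^2) by (field; lra). apply pow_incr. split; auto. apply Rlt_le, Rdiv_lt_0_compat; lra. }
            assert (1 - z = / L^2) by (unfold z, radius; ring). nra. }
          assert (Hr2 : 0 <= r^2 <= 1) by nra. pose proof (pow2_ge_0 q).
          assert (0 <= r^2 * (2 - z - z') <= (1 + INR s) * t^2) by (split; nra).
          replace (2 * c - r^2 * (z + z')) with (2 * (c * (1 - c)) - 2 * q^2 + r^2 * (2 - z - z')) by (rewrite Hrs; ring).
          apply Rabs_le; split; lra. }
        eapply Rle_trans; [exact Hmain|]. apply (Rmult_le_reg_r w); auto. unfold Rdiv. rewrite (Rmult_assoc (B * t^2)), Rinv_l, Rmult_1_r by lra.
        apply Rle_trans with ((3 * V + 1 + INR s) * t^2 * 4).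
        * apply Rmult_le_compat_l; [apply Rmult_le_pos; lra|auto].
        * unfold B. assert (0 <= 8 * (1 + K * PI) * t^2) by (apply Rmult_le_pos; lra). lra.
      + apply Rnot_le_lt in Ht1. assert (1 < t^2) by nra.
        apply Rle_trans with (4 * r).
        { apply Rabs_le_between in Hc. assert (0 <= r^2 <= r) by (split; nra). assert (0 <= r^2 * (z + z') <= 2 * r) by (split; nra). apply Rabs_le; lra. }
        pose proof (rho_decay2 phi D1 D2 K Hphi t) as Hrd. fold r in Hrd.
        apply Rle_trans with (4 * ((1 + K * PI) * / (1 + t^2))); [lra|].
        apply (Rmult_le_reg_r w); auto. unfold Rdiv. rewrite (Rmult_assoc (B * t^2)), Rinv_l, Rmult_1_r by lra.
        replace (4 * ((1 + K * PI) * / (1 + t ^ 2)) * w) with (4 * (1 + K * PI) * (1 + t^2)) by (unfold w; field; lra).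
        unfold B. assert (0 <= 4 * (3 * V + 1 + INR s) * t^2) by (apply Rmult_le_pos; lra). nra. }
  apply Rle_trans with (INR s * / L^2 * (B * t^2 / w) / (k^2 * t^4 / w)).
  - unfold Rdiv at 1 4. apply Rmult_le_compat_r; [left; now apply Rinv_0_lt_compat|exact Hdiff].
  - right. field. repeat split; lra.
Qed.

Lemma inv_L_lim : is_lim_seq (fun N => / Ls N) 0.
Proof. replace (Finite 0) with (Rbar_inv p_infty) by reflexivity. apply is_lim_seq_inv; [exact HLs|discriminate]. Qed.

Lemma radius_lim : is_lim_seq (fun N => radius (Ls N)) 1.
Proof.
  replace 1 with (1 - 0 * 0) by ring. unfold radius.
  apply is_lim_seq_ext with (fun N => 1 - / Ls N * / Ls N).
  - intros N. pose proof (HLs2 N). field. lra.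
  - apply is_lim_seq_minus'; [apply is_lim_seq_const|]. apply is_lim_seq_mult'; apply inv_L_lim.
Qed.

Lemma radius_pow_lim s : is_lim_seq (fun N => radius (Ls N) ^ s) 1.
Proof.
  induction s; [apply is_lim_seq_const|]. replace 1 with (1 * 1) by ring. simpl. apply is_lim_seq_mult'; [apply radius_lim|exact IHs].
Qed.

Lemma radius_pow_scaled s : is_lim_seq (fun N => Ls N ^ 2 * (1 - radius (Ls N) ^ s)) (INR s).
Proof.
  induction s.
  - apply is_lim_seq_ext with (fun _ => 0); [intros; simpl; ring|apply is_lim_seq_const].
  - rewrite S_INR, Rplus_comm. apply is_lim_seq_ext with (fun N => 1 + radius (Ls N) * (Ls N ^ 2 * (1 - radius (Ls N) ^ s))).
    + intros N. pose proof (HLs2 N).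
      assert (Hx : Ls N ^ 2 * (1 - radius (Ls N)) = 1) by (unfold radius; field; lra).
      rewrite <- Hx at 1. simpl. ring.
    + apply is_lim_seq_plus'; [apply is_lim_seq_const|]. rewrite <- (Rmult_1_l (INR s)). apply is_lim_seq_mult'; [apply radius_lim|exact IHs].
Qed.

(** L^2 V t^2/2 for the frequency t = 2 pi/L. *)
Let q := 2 * PI ^ 2 * V.

Lemma freq_lim i : is_lim_seq (fun N => freq (Ls N) i) 0.
Proof.
  replace 0 with (2 * PI * INR i * 0) by ring.
  apply is_lim_seq_ext with (fun N => 2 * PI * INR i * / Ls N).
  - intros N. pose proof (HLs2 N). unfold freq. field. lra.
  - apply (is_lim_seq_mult' (fun _ => _)); [apply is_lim_seq_const|apply inv_L_lim].
Qed.

Lemma one_minus_chi_c_scaled i : is_lim_seq (fun N => Ls N ^ 2 * (1 - chi_c phi (freq (Ls N) i))) (q * INR i ^ 2).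
Proof.
  set (tau := (2 * PI * INR i)^2).
  assert (Htau : forall N, Ls N ^ 2 * freq (Ls N) i ^ 2 = tau). { intros N. pose proof (HLs2 N). unfold freq, tau. field. lra. }
  apply (is_lim_seq_le_le (fun N => V * tau / 2 - fourth_moment phi / 24 * tau * (freq (Ls N) i * freq (Ls N) i)) _ (fun _ => V * tau / 2)).
  - intros N. pose proof (chi_c_lower phi D1 D2 K Hphi (freq (Ls N) i)) as H1. pose proof (chi_c_upper phi D1 D2 K Hphi (freq (Ls N) i)) as H2.
    fold V in H1, H2. rewrite <- (Htau N). set (t := freq (Ls N) i) in *. pose proof (HLs2 N). assert (0 < Ls N ^ 2) by nra. split.
    + replace (V * (Ls N ^ 2 * t ^ 2) / 2 - fourth_moment phi / 24 * (Ls N ^ 2 * t ^ 2) * (t * t)) with (Ls N ^ 2 * (V * t^2/2 - fourth_moment phi * t^4/24)) by field.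
      apply Rmult_le_compat_l; lra.
    + replace (V * (Ls N ^ 2 * t ^ 2) / 2) with (Ls N ^ 2 * (V * t^2/2)) by field. apply Rmult_le_compat_l; lra.
  - replace (Finite (q * INR i ^ 2)) with (Finite (V * tau / 2 - fourth_moment phi / 24 * tau * (0 * 0))) by (f_equal; unfold q, tau; field).
    apply is_lim_seq_minus'; [apply is_lim_seq_const|]. apply (is_lim_seq_mult' (fun _ => _)); [apply is_lim_seq_const|]. apply is_lim_seq_mult'; apply freq_lim.
  - replace (q * INR i ^ 2) with (V * tau / 2) by (unfold q, tau; field). apply is_lim_seq_const.
Qed.

Lemma chi_s_scaled i : is_lim_seq (fun N => Ls N ^ 2 * chi_s phi (freq (Ls N) i)) 0.
Proof.
  set (tau := (2 * PI * INR i)^2).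
  assert (Htau : forall N, Ls N ^ 2 * freq (Ls N) i ^ 2 = tau). { intros N. pose proof (HLs2 N). unfold freq, tau. field. lra. }
  apply is_lim_seq_abs_0.
  apply (is_lim_seq_le_le (fun _ => 0) _ (fun N => (V + fourth_moment phi) * tau * freq (Ls N) i)).
  - intros N. split; [apply Rabs_pos|]. pose proof (chi_s_le3 phi D1 D2 K Hphi (freq (Ls N) i)) as H. fold V in H.
    rewrite <- (Htau N). pose proof (HLs2 N). pose proof (freq_coef_pos (Ls N) ltac:(lra)). pose proof (pos_INR i).
    assert (Ht : 0 <= freq (Ls N) i) by (unfold freq; nra). rewrite (Rabs_pos_eq (freq _ _)) in H by auto. set (t := freq (Ls N) i) in *.
    rewrite Rabs_mult, (Rabs_pos_eq (Ls N ^ 2)) by nra.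
    replace ((V + fourth_moment phi) * (Ls N ^ 2 * t ^ 2) * t) with (Ls N ^ 2 * ((V + fourth_moment phi) * t^3)) by ring.
    apply Rmult_le_compat_l; [nra|auto].
  - apply is_lim_seq_const.
  - replace (Finite 0) with (Finite ((V + fourth_moment phi) * tau * 0)) by (f_equal; ring).
    apply (is_lim_seq_mult' (fun _ => _)); [apply is_lim_seq_const|apply freq_lim].
Qed.

(** |1 - chi z|^2 is the sum of the squares of 1 - z Re chi and z Im chi. After scaling by L^2 the
    first has a limit, while the second vanishes since Im chi is of third order. *)
Lemma log_den_scaled s i : is_lim_seq (fun N => Ls N ^ 4 * log_den (chi_c phi (freq (Ls N) i)) (rho phi (freq (Ls N) i)) (radius (Ls N) ^ s))
   ((INR s + q * INR i ^ 2) ^ 2).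
Proof.
  replace ((INR s + q * INR i ^ 2) ^ 2) with ((INR s + q * INR i ^ 2 * 1) * (INR s + q * INR i ^ 2 * 1) + (0 * 1) * (0 * 1)) by ring.
  apply is_lim_seq_ext with (fun N =>
    (Ls N ^ 2 * (1 - radius (Ls N) ^ s) + Ls N ^ 2 * (1 - chi_c phi (freq (Ls N) i)) * radius (Ls N) ^ s) *
    (Ls N ^ 2 * (1 - radius (Ls N) ^ s) + Ls N ^ 2 * (1 - chi_c phi (freq (Ls N) i)) * radius (Ls N) ^ s) +
    (Ls N ^ 2 * chi_s phi (freq (Ls N) i) * radius (Ls N) ^ s) * (Ls N ^ 2 * chi_s phi (freq (Ls N) i) * radius (Ls N) ^ s)).
  - intros N. unfold log_den. rewrite rho_sq. ring.
  - pose proof (radius_pow_scaled s). pose proof (radius_pow_lim s). pose proof (one_minus_chi_c_scaled i). pose proof (chi_s_scaled i).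
    apply is_lim_seq_plus'; apply is_lim_seq_mult'; try apply is_lim_seq_plus'; auto; apply is_lim_seq_mult'; auto.
Qed.

Lemma is_lim_seq_ln (u : nat -> R) (l : R) : 0 < l -> is_lim_seq u l -> is_lim_seq (fun n => ln (u n)) (ln l).
Proof.
  intros Hl Hu. apply (is_lim_seq_continuous ln); auto. apply derivable_continuous_pt. eexists. now apply derivable_pt_lim_ln.
Qed.

Lemma log_den_lim s i : (1 <= s)%nat -> (1 <= i)%nat ->
  is_lim_seq (fun N => - (1/2) * ln (log_den (chi_c phi (freq (Ls N) i)) (rho phi (freq (Ls N) i)) (radius (Ls N) ^ s))
     - - (1/2) * ln (log_den (chi_c phi (freq (Ls N) i)) (rho phi (freq (Ls N) i)) (radius (Ls N))))
   (- ln ((INR s + q * INR i ^ 2) / (1 + q * INR i ^ 2))).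
Proof.
  intros Hs Hi. assert (HV : 0 < V) by (eapply second_moment_pos; eauto).
  pose proof PI_RGT_0. assert (Hq : 0 < q) by (unfold q; assert (0 < PI^2) by nra; nra).
  assert (Hi0 : 0 < INR i) by (apply lt_0_INR; lia). assert (Hi2 : 0 < INR i ^ 2) by nra. assert (Hs0 : 1 <= INR s) by (apply (le_INR 1); auto).
  assert (Hqi : 0 < q * INR i ^ 2) by nra.
  assert (Hpos : forall N z, 0 <= z <= 1 -> 0 < log_den (chi_c phi (freq (Ls N) i)) (rho phi (freq (Ls N) i)) z).
  { intros N z Hz. pose proof (HLs2 N). assert (Ht : 0 < freq (Ls N) i) by (unfold freq; apply Rmult_lt_0_compat; auto; apply freq_coef_pos; lra).
    destruct (rho_gap phi D1 D2 K Hphi) as [k [Hk Hg]]. specialize (Hg _ Ht). set (t := freq (Ls N) i) in *.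
    assert (0 < t^2/(1+t^2)). { apply Rdiv_lt_0_compat; nra. }
    eapply Rlt_le_trans; [|apply log_den_lower; auto].
    - apply pow_lt. nra.
    - split; [apply rho_nonneg|eapply rho_le_1; eauto].
    - apply chi_c_abs_le. }
  assert (Hlim : forall s, (1 <= s)%nat -> is_lim_seq (fun N => ln (Ls N ^ 4 * log_den (chi_c phi (freq (Ls N) i)) (rho phi (freq (Ls N) i)) (radius (Ls N) ^ s))) (ln ((INR s + q * INR i ^ 2) ^ 2))).
  { intros s' Hs'. apply is_lim_seq_ln; [|apply log_den_scaled]. apply pow_lt. pose proof (pos_INR s'). lra. }
  pose proof (Hlim s Hs) as L1. pose proof (Hlim 1%nat (le_n _)) as L2.
  replace (- ln ((INR s + q * INR i ^ 2) / (1 + q * INR i ^ 2))) with (- (1/2) * ln ((INR s + q * INR i ^ 2) ^ 2) - - (1/2) * ln ((INR 1 + q * INR i ^ 2) ^ 2)).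
  2:{ rewrite ln_div by lra. rewrite !ln_pow by (simpl; lra). simpl INR. field. }
  eapply is_lim_seq_ext; [|apply is_lim_seq_minus'; apply (is_lim_seq_mult' (fun _ => - (1/2))); [apply is_lim_seq_const|exact L1|apply is_lim_seq_const|exact L2]].
  intros N. pose proof (HLs2 N) as HL2. pose proof (radius_bounds (Ls N) HL2). cbv beta. rewrite pow_1.
  assert (0 < Ls N ^ 4) by (apply pow_lt; lra).
  assert (E : forall z, 0 <= z <= 1 -> ln (Ls N ^ 4 * log_den (chi_c phi (freq (Ls N) i)) (rho phi (freq (Ls N) i)) z) =
     ln (Ls N ^ 4) + ln (log_den (chi_c phi (freq (Ls N) i)) (rho phi (freq (Ls N) i)) z)) by (intros z Hz; apply ln_mult; auto).
  rewrite !E; [ring|lra|].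
  split; [apply pow_le; lra|]. rewrite <- (pow1 s). apply pow_incr; lra.
Qed.

(** The zero frequency contributes L^2 (1 - r^s), which tends to s. The remaining frequencies pass
    to the limit by [tannery]; L^2 t_i^2 = (2 pi i)^2 does not depend on L, which makes the majorant
    of [log_den_ratio] uniform. *)
Lemma laplace_limit s : (1 <= s)%nat -> exists l : R,
  is_lim_seq (psum (fun i => ln ((INR s + q * INR (S i) ^ 2) / (1 + q * INR (S i) ^ 2)))) l /\
  is_lim_seq (fun N => G phi theta (Ls N) (radius (Ls N) ^ s) - G phi theta (Ls N) (radius (Ls N))) (- theta * (ln (INR s) + 2 * l)).
Proof.
  intros Hs. destruct (log_den_ratio s Hs) as [C [HC Hrat]]. pose proof PI_RGT_0 as Hpi. pose proof PI2_1 as Hpi2.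
  set (gi := fun L z i => - (1/2) * ln (log_den (chi_c phi (freq L (S i))) (rho phi (freq L (S i))) z)).
  set (f := fun N i => gi (Ls N) (radius (Ls N) ^ s) i - gi (Ls N) (radius (Ls N)) i).
  set (F := fun N => ((G phi theta (Ls N) (radius (Ls N) ^ s) / theta + ln (1 - radius (Ls N) ^ s)) / 2) - ((G phi theta (Ls N) (radius (Ls N)) / theta + ln (1 - radius (Ls N))) / 2)).
  assert (Hz : forall N, 0 <= radius (Ls N) ^ s < 1).
  { intros N. pose proof (radius_bounds _ (HLs2 N)) as Hr. split; [apply pow_le; lra|]. destruct s as [|s']; [lia|]. simpl.
    assert (radius (Ls N) ^ s' <= 1). { rewrite <- (pow1 s'). apply pow_incr; lra. } nra. }
  destruct (tannery f (fun i => - ln ((INR s + q * INR (S i) ^ 2) / (1 + q * INR (S i) ^ 2))) F 1 C Rlt_0_1) as [l [Hl HF]].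
  - intros N i. unfold f, gi. pose proof (HLs2 N) as HL.
    assert (Hf : 2 * PI / Ls N <= freq (Ls N) (S i)).
    { unfold freq. pose proof (freq_coef_pos (Ls N) ltac:(lra)). assert (1 <= INR (S i)) by (apply (le_INR 1); lia). nra. }
    pose proof (Hrat (Ls N) _ HL Hf) as H.
    replace (Ls N ^ 2 * freq (Ls N) (S i) ^ 2) with ((2 * PI)^2 * (INR i + 1)^2) in H by (unfold freq; rewrite (S_INR i); field; lra).
    rewrite <- Rmult_minus_distr_l, Rabs_mult, Rabs_Ropp, (Rabs_pos_eq (1/2)) by lra.
    pose proof (pos_INR i). assert (1 <= (INR i + 1)^2) by nra.
    apply Rle_trans with (C / ((2 * PI) ^ 2 * (INR i + 1) ^ 2)); [pose proof (Rabs_pos (ln (log_den (chi_c phi (freq (Ls N) (S i))) (rho phi (freq (Ls N) (S i))) (radius (Ls N) ^ s)) -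
       ln (log_den (chi_c phi (freq (Ls N) (S i))) (rho phi (freq (Ls N) (S i))) (radius (Ls N))))); lra|].
    assert (Hp16 : 16 <= (2 * PI) ^ 2) by nra. set (y := (INR i + 1)^2) in *.
    unfold Rdiv. apply Rmult_le_compat_l; [lra|]. apply Rinv_le_contravar; nra.
  - intros i. apply log_den_lim; auto. lia.
  - intros N. apply is_lim_seq_ext with (fun I => psum (gi (Ls N) (radius (Ls N) ^ s)) I - psum (gi (Ls N) (radius (Ls N))) I).
    + intros I. unfold f. now rewrite psum_minus.
    + pose proof (HLs2 N). pose proof (radius_bounds _ (HLs2 N)). apply is_lim_seq_minus'; apply (G_log_lim phi D1 D2 K Hphi theta Htheta); auto; lra.
  - exists (- l). split.
    + apply is_lim_seq_ext with (fun n => - psum (fun i => - ln ((INR s + q * INR (S i) ^ 2) / (1 + q * INR (S i) ^ 2))) n).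
      * intros n. rewrite (psum_ext _ (fun i => (-1) * ln ((INR s + q * INR (S i) ^ 2) / (1 + q * INR (S i) ^ 2)))) by (intros; ring). rewrite psum_scal. ring.
      * apply (is_lim_seq_opp _ l). exact Hl.
    + apply is_lim_seq_ext with (fun N => theta * (2 * F N - ln (Ls N ^ 2 * (1 - radius (Ls N) ^ s)))).
      * intros N. pose proof (HLs2 N). pose proof (radius_bounds _ (HLs2 N)). pose proof (Hz N). unfold F.
        rewrite ln_mult by nra. replace (ln (1 - radius (Ls N))) with (- ln (Ls N ^ 2)).
        -- field. lra.
        -- unfold radius. replace (1 - (1 - / Ls N ^ 2)) with (/ Ls N ^ 2) by ring. symmetry. apply ln_Rinv. nra.
      * replace (- theta * (ln (INR s) + 2 * - l)) with (theta * (2 * l - ln (INR s))) by ring.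
        apply (is_lim_seq_mult' (fun _ => theta)); [apply is_lim_seq_const|]. apply is_lim_seq_minus'.
        -- apply (is_lim_seq_mult' (fun _ => 2)); [apply is_lim_seq_const|exact HF].
        -- apply is_lim_seq_ln; [apply lt_0_INR; lia|apply radius_pow_scaled].
Qed.
End Laplace.

(** * The product formula for sinh and the limiting transform *)

Lemma exp_mono x y : x <= y -> exp x <= exp y.
Proof. intros [H|H]; [left; now apply exp_increasing|subst; lra]. Qed.

Lemma is_derive_cosh_aff a b x : is_derive (fun x => cosh (a + b * x)) x (b * sinh (a + b * x)).
Proof. unfold cosh, sinh. auto_derive; auto. field. Qed.

Lemma sinh_pos x : 0 < x -> 0 < sinh x.
Proof. intros Hx. unfold sinh. pose proof (exp_increasing (-x) x ltac:(lra)). lra. Qed.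

Lemma sin_half_period m : sin (2 * PI * INR m * (1/2)) = 0.
Proof. apply sin_eq_0_1. exists (Z.of_nat m). rewrite <- INR_IZR_INZ. field. Qed.

Lemma cosh_fourier_coef c m : 0 < c ->
  is_RInt (fun x => cosh (c * (1/2 - Rabs x)) * cos (2 * PI * INR m * x)) (-(1/2)) (1/2)
   (2 * c * sinh (c/2) / (c ^ 2 + (2 * PI * INR m) ^ 2)).
Proof.
  intros Hc. pose proof (sin_half_period m) as Hs. set (w := 2 * PI * INR m) in *.
  assert (Hd : 0 < c^2 + w^2) by (pose proof (pow2_ge_0 w); nra).
  replace (2 * c * sinh (c/2) / (c ^ 2 + w ^ 2)) with (plus (c * sinh (c/2) / (c^2+w^2)) (c * sinh (c/2) / (c^2 + w^2))) by (unfold plus; simpl; field; simpl in *; lra).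
  assert (Hsinh0 : sinh 0 = 0) by apply sinh_0.
  apply (is_RInt_Chasles (V:=R_NormedModule)) with 0.
  - apply (is_RInt_ext (fun x => cosh (c/2 + c * x) * cos (w * x))).
    + rewrite Rmin_left, Rmax_right by lra. intros x Hx. rewrite Rabs_left by lra. f_equal. f_equal. field.
    + set (F := fun x => (c * (sinh (c/2 + c * x) * cos (w * x)) + w * (cosh (c/2 + c * x) * sin (w * x))) / (c^2+w^2)).
      replace (c * sinh (c/2) / (c^2 + w^2)) with (minus (F 0) (F (-(1/2)))).
      * apply (is_RInt_derive (V:=R_CompleteNormedModule) F).
        -- intros x _. unfold F, sinh, cosh. auto_derive; [auto|]. field. simpl in *; lra.
        -- intros x _. apply (ex_derive_continuous (V:=R_NormedModule)). unfold cosh. auto_derive; auto.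
      * unfold F, minus, plus, opp; simpl. replace (c/2 + c * -(1/2)) with 0 by field. rewrite Hsinh0, !Rmult_0_r, sin_0, cos_0, Rplus_0_r.
        replace (w * -(1/2)) with (-(w * (1/2))) by ring. rewrite sin_neg, Hs. field. simpl in *; lra.
  - apply (is_RInt_ext (fun x => cosh (c/2 + (-c) * x) * cos (w * x))).
    + rewrite Rmin_left, Rmax_right by lra. intros x Hx. rewrite Rabs_pos_eq by lra. f_equal. f_equal. field.
    + set (F := fun x => (- c * (sinh (c/2 + (-c) * x) * cos (w * x)) + w * (cosh (c/2 + (-c) * x) * sin (w * x))) / (c^2+w^2)).
      replace (c * sinh (c/2) / (c^2 + w^2)) with (minus (F (1/2)) (F 0)).
      * apply (is_RInt_derive (V:=R_CompleteNormedModule) F).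
        -- intros x _. unfold F, sinh, cosh. auto_derive; [auto|]. field. simpl in *; lra.
        -- intros x _. apply (ex_derive_continuous (V:=R_NormedModule)). unfold cosh. auto_derive; auto.
      * unfold F, minus, plus, opp; simpl. replace (c/2 + -c * (1/2)) with 0 by field. rewrite Hsinh0, !Rmult_0_r, sin_0, cos_0, Rplus_0_r, Hs.
        field. simpl in *; lra.
Qed.

(* The Fourier series of cosh(c(1/2 - |x|)) on one period, evaluated at x = 0. *)
Lemma coth_partial_fractions b : 0 < b ->
  is_lim_seq (psum (fun i => 2 * b / (b ^ 2 + PI ^ 2 * (INR i + 1) ^ 2))) (cosh b / sinh b - / b).
Proof.
  intros Hb. pose proof PI_RGT_0 as Hpi. set (c := 2 * b). assert (Hc : 0 < c) by (unfold c; lra).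
  set (p := fun x => cosh (c * (1/2 - Rabs x))).
  set (A := fun m => 2 * c * sinh (c/2) / (c ^ 2 + (2 * PI * INR m) ^ 2)).
  pose proof (sinh_pos (c/2) ltac:(lra)) as Hsh.
  set (Kl := c * exp (c/2)). assert (HKl : 0 <= Kl) by (unfold Kl; pose proof (exp_pos (c/2)); nra).
  assert (HL : forall x, Rabs x <= 1/2 -> Rabs (p x - p 0) <= Kl * Rabs x).
  { intros x Hx. unfold p. rewrite Rabs_R0. set (y := Rabs x) in *. assert (0 <= y) by apply Rabs_pos.
    pose proof (is_derive_bounded (fun u => cosh (c/2 + (-c) * u)) (fun u => -c * sinh (c/2 + (-c) * u)) 0 y Kl) as H1.
    rewrite Rminus_0_r, (Rabs_pos_eq y) in H1 by auto.
    replace (c * (1/2 - y)) with (c/2 + - c * y) by field. replace (c * (1/2 - 0)) with (c/2 + - c * 0) by field. apply H1.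
    - intros; apply is_derive_cosh_aff.
    - rewrite Rmin_left, Rmax_right by lra. intros u Hu. rewrite Rabs_mult, Rabs_Ropp, (Rabs_pos_eq c) by lra. unfold Kl.
      apply Rmult_le_compat_l; [lra|]. assert (Hv : 0 <= c/2 + - c * u <= c/2) by nra. set (v := c/2 + -c * u) in *.
      unfold sinh. pose proof (exp_pos (-v)). assert (exp (-v) <= exp v) by (apply exp_mono; lra). assert (exp v <= exp (c/2)) by (apply exp_mono; lra).
      rewrite Rabs_pos_eq; lra. }
  assert (Hlim : is_lim_seq (fun M => A 0%nat + 2 * psum (fun i => A (S i)) M) (p 0)).
  { apply (abel_poisson A (p 0) Kl Kl (2 * c * sinh (c/2) / c^2) (2 * PI / c)); auto.
    - apply Rdiv_lt_0_compat; lra.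
    - intros q eta M Hq Heta. apply (poisson_approx p); auto.
      + intros x. unfold p. apply (continuous_comp (fun x => c * (1/2 - Rabs x)) cosh).
        * apply continuous_mult_R; [apply continuous_const|]. apply (continuous_minus (V:=R_NormedModule)); [apply continuous_const|].
          apply continuous_Rabs.
        * apply (ex_derive_continuous (V:=R_NormedModule)). unfold cosh. auto_derive; auto.
      + intros x Hx. eapply Rle_trans; [apply HL; auto|]. pose proof (Rabs_pos x). nra.
      + intros m. apply cosh_fourier_coef, Hc.
    - intros i. unfold A. pose proof (pow2_ge_0 (INR i + 1)) as Hy. rewrite (S_INR i). rewrite Rpow_mult_distr.
      assert (0 <= (2 * PI)^2 * (INR i + 1)^2) by (apply Rmult_le_pos; [apply pow2_ge_0|auto]).
      assert (0 < c^2) by nra. rewrite Rabs_pos_eq.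
      + right. unfold Rdiv. replace ((2 * PI * / c)^2) with ((2 * PI)^2 * / c^2) by (field; lra). field. repeat split; lra.
      + apply Rmult_le_pos; [nra|]. left; apply Rinv_0_lt_compat; lra. }
  assert (E : p 0 = cosh b) by (unfold p, c; rewrite Rabs_R0; f_equal; field).
  rewrite E in Hlim.
  assert (Ecb : c / 2 = b) by (unfold c; field). rewrite Ecb in Hsh.
  replace (cosh b / sinh b - / b) with ((cosh b - A 0%nat) / sinh b).
  2:{ unfold A. rewrite Ecb. unfold c. simpl INR. field. repeat split; lra. }
  apply is_lim_seq_ext with (fun M => ((A 0%nat + 2 * psum (fun i => A (S i)) M) - A 0%nat) * / sinh b).
  - intros M. rewrite (psum_ext (fun i => A (S i)) (fun i => (sinh b / 2) * (2 * b / (b ^ 2 + PI ^ 2 * (INR i + 1) ^ 2)))).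
    + rewrite (psum_scal (fun i => 2 * b / (b ^ 2 + PI ^ 2 * (INR i + 1) ^ 2)) (sinh b / 2)). set (P := psum _ _). field. lra.
    + intros i _. unfold A. rewrite Ecb, (S_INR i). unfold c. field. pose proof (pow2_ge_0 (PI * (INR i + 1))). split; nra.
  - apply (is_lim_seq_mult' _ (fun _ => / sinh b)); [|apply is_lim_seq_const]. apply is_lim_seq_minus'; [exact Hlim|apply is_lim_seq_const].
Qed.

(** Euler's product as a quotient at two points. The derivative in b of [F M] is the tail of the
    partial fractions of coth b - 1/b, small uniformly on [b1, b2], so the mean value inequality
    gives the limit. *)
Lemma sinh_product_log b1 b2 : 0 < b1 <= b2 ->
  is_lim_seq (psum (fun i => ln ((b2 ^ 2 + PI ^ 2 * (INR i + 1) ^ 2) / (b1 ^ 2 + PI ^ 2 * (INR i + 1) ^ 2))))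
    ((ln (sinh b2) - ln b2) - (ln (sinh b1) - ln b1)).
Proof.
  intros Hb. pose proof PI_RGT_0 as Hpi. pose proof PI2_1.
  set (F := fun M b => ln (sinh b) - ln b - psum (fun i => ln (b ^ 2 + PI ^ 2 * (INR i + 1) ^ 2)) M).
  assert (Hpos : forall b i, 0 < b -> 0 < b ^ 2 + PI ^ 2 * (INR i + 1) ^ 2).
  { intros b i Hb0. pose proof (pow2_ge_0 (PI * (INR i + 1))). nra. }
  set (tl := fun M => 2 * b2 * ((PI/2 - atan (1 * INR M)) / 1)).
  assert (HF : forall M, Rabs (F M b2 - F M b1) <= tl M * Rabs (b2 - b1)).
  { intros M. apply (is_derive_bounded (F M) (fun b => (cosh b / sinh b - / b) - psum (fun i => 2 * b / (b ^ 2 + PI ^ 2 * (INR i + 1) ^ 2)) M)).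
    - rewrite Rmin_left, Rmax_right by lra. intros b Hbb. unfold F.
      apply (is_derive_minus (V:=R_NormedModule) (fun b => ln (sinh b) - ln b)).
      + pose proof (sinh_pos b ltac:(lra)) as Hs. unfold sinh in Hs. unfold cosh, sinh. auto_derive; [split; [lra|split; [lra|auto]]|]. field. split; lra.
      + induction M; [apply (is_derive_const (V:=R_NormedModule) 0)|].
        apply (is_derive_ext (fun b => psum (fun i => ln (b ^ 2 + PI ^ 2 * (INR i + 1) ^ 2)) M + ln (b ^ 2 + PI ^ 2 * (INR M + 1) ^ 2))); [reflexivity|].
        rewrite psum_S. apply (is_derive_plus (V:=R_NormedModule)); [exact IHM|].
        pose proof (Hpos b M ltac:(lra)) as Hp. auto_derive; [simpl in *; lra|]. simpl. field. simpl in *; lra.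
    - rewrite Rmin_left, Rmax_right by lra. intros b Hbb. unfold tl.
      apply (tail_bound_lim _ 1 (2 * b2) M _ Rlt_0_1 (coth_partial_fractions b ltac:(lra))).
      intros i. pose proof (Hpos b i ltac:(lra)). rewrite Rabs_pos_eq.
      + unfold Rdiv. apply Rmult_le_compat; [lra|left; now apply Rinv_0_lt_compat|lra|]. pose proof (pos_INR i). assert (1 <= (INR i + 1)^2) by nra. assert (4 <= PI^2) by nra.
        apply Rinv_le_contravar; nra.
      + apply Rmult_le_pos; [lra|left; now apply Rinv_0_lt_compat]. }
  apply is_lim_seq_ext with (fun M => ((ln (sinh b2) - ln b2) - (ln (sinh b1) - ln b1)) - (F M b2 - F M b1)).
  - intros M. unfold F. rewrite (psum_ext (fun i => ln (_ / _)) (fun i => ln (b2 ^ 2 + PI ^ 2 * (INR i + 1) ^ 2) - ln (b1 ^ 2 + PI ^ 2 * (INR i + 1) ^ 2))).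
    + rewrite psum_minus. ring.
    + intros i _. apply ln_div; apply Hpos; lra.
  - replace (Finite ((ln (sinh b2) - ln b2) - (ln (sinh b1) - ln b1))) with (Finite (((ln (sinh b2) - ln b2) - (ln (sinh b1) - ln b1)) - 0)) by (f_equal; ring).
    apply is_lim_seq_minus'; [apply is_lim_seq_const|]. apply is_lim_seq_Reals. intros eps Heps.
    destruct (atan_tail_small 1 (2 * b2 * (b2 - b1)) (eps/2) Rlt_0_1 ltac:(lra) ltac:(nra)) as [M0 HM0]. exists M0. intros M HM. specialize (HM0 M HM).
    unfold Rdist. rewrite Rminus_0_r. eapply Rle_lt_trans; [apply HF|]. rewrite Rabs_pos_eq by lra. unfold tl. lra.
Qed.

(** The coefficient of x^n in (1 - x)^(-2 theta); the sign cancels that of the generalized binomial,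
    so that it is positive. *)
Definition binom_coef (theta : R) (n : nat) : R := (-1) ^ n * gbinom (- (2 * theta)) n.

Lemma binom_coef_0 theta : binom_coef theta 0 = 1.
Proof. unfold binom_coef, gbinom. simpl. field. Qed.

Lemma binom_coef_S theta n : INR (S n) * binom_coef theta (S n) = (2 * theta + INR n) * binom_coef theta n.
Proof.
  unfold binom_coef, gbinom. cbn [fallfact pow]. rewrite fact_simpl, mult_INR. field. split; [apply INR_fact_neq_0|apply not_0_INR; lia].
Qed.

Lemma binom_coef_pos theta n : 0 < theta -> 0 < binom_coef theta n.
Proof.
  intros Ht. induction n; [rewrite binom_coef_0; lra|]. pose proof (binom_coef_S theta n) as H. pose proof (lt_0_INR (S n) ltac:(lia)).
  pose proof (pos_INR n). assert (0 < (2 * theta + INR n) * binom_coef theta n) by (apply Rmult_lt_0_compat; lra). nra.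
Qed.

(** (1 - x)^(-2 theta) is the exponential of the series with coefficients 2 theta/j, so [exp_series]
    applies once its recursively defined coefficients are recognised. *)
Lemma binom_series theta x : 0 < theta -> 0 <= x < 1 ->
  is_series (fun n => binom_coef theta n * x ^ n) (exp (- (2 * theta) * ln (1 - x))).
Proof.
  intros Ht Hx. set (g := fun j : nat => match j with O => 0 | S _ => 2 * theta / INR j end).
  assert (Hg : forall j, 0 <= g j <= 2 * theta).
  { intros [|j]; [simpl; lra|]. change (g (S j)) with (2 * theta / INR (S j)). assert (1 <= INR (S j)) by (apply (le_INR 1); lia).
    split; [apply Rlt_le, Rdiv_lt_0_compat; lra|]. apply (Rmult_le_reg_r (INR (S j))); [lra|]. unfold Rdiv. rewrite Rmult_assoc, Rinv_l by lra. nra. }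
  assert (Hr : forall z, Rabs z < 1 -> Rbar_lt (Rabs z) (CV_radius g)).
  { apply radius_ge_1. intros r Hr. exists (2 * theta). intros n. destruct (Hg n). rewrite Rabs_pos_eq by (apply Rmult_le_pos; auto; apply pow_le; lra).
    assert (r ^ n <= 1). { rewrite <- (pow1 n). apply pow_incr; lra. } pose proof (pow_le r n ltac:(lra)). nra. }
  assert (Hx1 : Rabs x < 1) by (rewrite Rabs_pos_eq; lra).
  assert (HP : PSeries g x = - (2 * theta) * ln (1 - x)).
  { apply is_pseries_unique, is_pseries_R, is_series_psum, is_lim_seq_incr_1.
    apply is_lim_seq_ext with (fun M => 2 * theta * psum (fun j => x ^ S j / INR (S j)) M).
    { intros M. rewrite psum_S_l. simpl (g 0%nat). rewrite Rmult_0_l, Rplus_0_l, <- psum_scal. apply psum_ext. intros j _.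
      change (g (S j)) with (2 * theta / INR (S j)). unfold Rdiv; ring. }
    replace (- (2 * theta) * ln (1 - x)) with (2 * theta * (- ln (1 - x))) by ring.
    apply (is_lim_seq_mult' (fun _ => 2 * theta)); [apply is_lim_seq_const|].
    apply is_lim_seq_ext with (fun M => (psum (fun j => x ^ S j / INR (S j)) M - - ln (1 - x)) + - ln (1 - x)); [intros; ring|].
    replace (Finite (- ln (1 - x))) with (Finite (0 + - ln (1 - x))) by (f_equal; ring). apply is_lim_seq_plus'; [|apply is_lim_seq_const].
    apply is_lim_seq_abs_0. apply (is_lim_seq_le_le (fun _ => 0) _ (fun M => 2 * x ^ S M / (1 - x) ^ 2)); auto using is_lim_seq_const.
    - intros n. split; [apply Rabs_pos|]. pose proof (log_series_partial 0 x n Hx) as H. rewrite cos_0 in H.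
      replace (- (1 / 2) * ln (log_den 1 1 x)) with (- ln (1 - x)) in H.
      + rewrite (psum_ext (fun j => x ^ S j / INR (S j)) (fun j => cos (INR (S j) * 0) * x ^ S j / INR (S j))); [exact H|].
        intros. rewrite Rmult_0_r, cos_0. unfold Rdiv; ring.
      + replace (log_den 1 1 x) with ((1 - x) * (1 - x)) by (unfold log_den; ring). rewrite ln_mult by lra. field.
    - replace (Finite 0) with (Rbar_mult (2 * / (1-x)^2) 0) by (simpl; f_equal; ring).
      apply is_lim_seq_ext with (fun M => (2 * / (1-x)^2) * x ^ (S M)).
      + intros; field. lra.
      + apply is_lim_seq_scal_l. apply -> (is_lim_seq_incr_1 (fun n => x ^ n)). apply is_lim_seq_geom. exact Hx1. }
  assert (HE : forall n, exp_coef g n = binom_coef theta n).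
  { assert (Hrec : forall n, INR (S n) * exp_coef g (S n) = (2 * theta + INR n) * exp_coef g n).
    { intros n. rewrite exp_coef_S.
      (* j g_j is the constant 2 theta, so the recursion only involves partial sums; subtracting
         consecutive instances leaves a two-term recurrence. *)
      assert (Hs : forall m, psum (fun j => INR (S j) * g (S j) * exp_coef g (m - j)) (S m) = 2 * theta * psum (exp_coef g) (S m)).
      { intros m. assert (Hrev : forall (f : nat -> R) k, psum (fun j => f (k - j)%nat) (S k) = psum f (S k)).
        { intros f k. induction k; [reflexivity|]. rewrite psum_S_l, Nat.sub_0_r. rewrite (psum_S f (S k)), <- IHk, Rplus_comm. f_equal. }
        rewrite <- (Hrev (exp_coef g) m), <- psum_scal. apply psum_ext. intros j _. change (g (S j)) with (2 * theta / INR (S j)).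
        field. apply not_0_INR; lia. }
      rewrite Hs, psum_S, Rmult_plus_distr_l. destruct n as [|n].
      - simpl. ring.
      - rewrite <- Hs, <- exp_coef_S. ring. }
    induction n; [rewrite binom_coef_0; reflexivity|]. apply (Rmult_eq_reg_l (INR (S n))); [|apply not_0_INR; lia].
    rewrite Hrec, binom_coef_S, IHn. reflexivity. }
  rewrite <- HP, <- (exp_series g (fun j => proj1 (Hg j)) Hr eq_refl x Hx1).
  apply is_series_ext with (fun n => exp_coef g n * x ^ n); [intros; now rewrite HE|].
  apply is_pseries_R, PSeries_correct, CV_radius_inside, exp_radius; auto. intros; apply Hg.
Qed.

(* The limiting Laplace transform psi(s) = (sinh(b sqrt s) / sinh b)^(-2 theta), where b = 1/(sqrt 2 sigma),
   expands by the binomial series into exponentials of sqrt s. *)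
Definition psi (theta b s : R) : R := exp (- (2 * theta) * (ln (sinh (b * sqrt s)) - ln (sinh b))).
Definition rate (theta b : R) (n : nat) : R := 2 * b * (theta + INR n).
Definition weight (theta b : R) (n : nat) : R := exp (2 * theta * ln (2 * sinh b)) * binom_coef theta n.

Lemma psi_series theta b s : 0 < theta -> 0 < b -> 0 < s ->
  is_series (fun n => weight theta b n * exp (- rate theta b n * sqrt s)) (psi theta b s).
Proof.
  intros Ht Hb Hs. pose proof (sqrt_lt_R0 s Hs) as Hq. set (v := b * sqrt s). assert (Hv : 0 < v) by (unfold v; nra).
  set (x := exp (- (2 * v))). assert (Hx : 0 <= x < 1). { split; [left; apply exp_pos|]. unfold x. rewrite <- exp_0. apply exp_increasing. lra. }
  pose proof (binom_series theta x Ht Hx) as HB.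
  pose proof (sinh_pos b Hb) as Hsb. pose proof (sinh_pos v Hv) as Hsv.
  assert (Esv : sinh v = exp v * (1 - x) * / 2).
  { unfold sinh, x. replace (exp v * (1 - exp (- (2 * v)))) with (exp v - exp v * exp (- (2 * v))) by ring. rewrite <- exp_plus.
    replace (v + - (2 * v)) with (- v) by ring. field. }
  assert (E : psi theta b s = exp (2 * theta * ln (2 * sinh b)) * exp (- (2 * theta) * v) * exp (- (2 * theta) * ln (1 - x))).
  { unfold psi. fold v. rewrite <- !exp_plus. f_equal. rewrite Esv. pose proof (exp_pos v).
    assert (0 < exp v * (1 - x)) by (apply Rmult_lt_0_compat; lra).
    rewrite (ln_mult (exp v * (1 - x)) (/2)), (ln_mult (exp v)), ln_exp, ln_Rinv, (ln_mult 2) by lra. ring. }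
  rewrite E. apply is_series_ext with (fun n => exp (2 * theta * ln (2 * sinh b)) * exp (- (2 * theta) * v) * (binom_coef theta n * x ^ n)).
  - intros n. unfold weight, rate. eqR.
    replace (x ^ n) with (exp (- (2 * INR n) * v)).
    + replace (- (2 * b * (theta + INR n)) * sqrt s) with (- (2 * theta) * v + - (2 * INR n) * v) by (unfold v; ring).
      rewrite exp_plus. ring.
    + unfold x. induction n; [simpl; rewrite <- exp_0; f_equal; ring|]. rewrite S_INR. simpl (_ ^ S n). rewrite <- IHn, <- exp_plus. f_equal. ring.
  - apply (is_series_scal (V:=R_NormedModule)). exact HB.
Qed.

Lemma rate_pos theta b n : 0 < theta -> 0 < b -> 0 < rate theta b n.
Proof. intros. unfold rate. pose proof (pos_INR n). nra. Qed.

Lemma weight_pos theta b n : 0 < theta -> 0 < weight theta b n.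
Proof. intros. unfold weight. apply Rmult_lt_0_compat; [apply exp_pos|now apply binom_coef_pos]. Qed.

Section Limit.
Variables (phi D1 D2 : R -> R) (K : R).
Hypothesis Hphi : smooth_density phi D1 D2 K.
Variable theta : R.
Hypothesis Htheta : 0 < theta.
Variable Ls : nat -> R.
Hypothesis HLs2 : forall N, 2 <= Ls N.
Hypothesis HLs : is_lim_seq Ls p_infty.

Definition inv_sqrt2_sigma (phi : R -> R) := / sqrt (2 * second_moment phi).

Lemma exp_G_limit s : (1 <= s)%nat ->
  is_lim_seq (fun N => exp (G phi theta (Ls N) (radius (Ls N) ^ s) - G phi theta (Ls N) (radius (Ls N)))) (psi theta (inv_sqrt2_sigma phi) (INR s)).
Proof.
  intros Hs. destruct (laplace_limit phi D1 D2 K Hphi theta Htheta Ls HLs2 HLs s Hs) as [l [Hl HG]].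
  set (V := second_moment phi) in *. assert (HV : 0 < V) by (eapply second_moment_pos; eauto).
  set (b := inv_sqrt2_sigma phi). assert (Hs2 : 0 < sqrt (2 * V)) by (apply sqrt_lt_R0; lra).
  assert (Hb : 0 < b) by (now apply Rinv_0_lt_compat).
  assert (Hb2 : b^2 = / (2 * V)). { unfold b, inv_sqrt2_sigma. fold V. rewrite pow_inv, pow2_sqrt by lra. reflexivity. }
  assert (Hs1 : 1 <= INR s) by (apply (le_INR 1); auto).
  assert (Hqs : 1 <= sqrt (INR s)). { rewrite <- sqrt_1. now apply sqrt_le_1_alt. }
  pose proof (sinh_product_log b (b * sqrt (INR s)) ltac:(split; nra)) as HP.
  assert (El : l = (ln (sinh (b * sqrt (INR s))) - ln (b * sqrt (INR s))) - (ln (sinh b) - ln b)).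
  { apply is_lim_seq_unique in HP.
    rewrite (Lim_seq_ext _ (psum (fun i => ln ((INR s + 2 * PI ^ 2 * V * INR (S i) ^ 2) / (1 + 2 * PI ^ 2 * V * INR (S i) ^ 2))))) in HP.
    - apply is_lim_seq_unique in Hl. rewrite HP in Hl. injection Hl; auto.
    (* Since b^2 = 1/(2V), dividing numerator and denominator by 2V turns them into those of the
       sinh product at b sqrt(s) and b. *)
    - intros n. apply psum_ext. intros i _. f_equal. rewrite (S_INR i), Rpow_mult_distr, pow2_sqrt, Hb2 by lra.
      assert (Hd : 0 < 1 + 2 * PI ^ 2 * V * (INR i + 1) ^ 2).
      { assert (0 <= 2 * V * (PI * (INR i + 1))^2) by (apply Rmult_le_pos; [lra|apply pow2_ge_0]). nra. }
      replace (/ (2 * V) * INR s + PI ^ 2 * (INR i + 1) ^ 2) with ((INR s + 2 * PI ^ 2 * V * (INR i + 1) ^ 2) * / (2 * V)) by (field; lra).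
      replace (/ (2 * V) + PI ^ 2 * (INR i + 1) ^ 2) with ((1 + 2 * PI ^ 2 * V * (INR i + 1) ^ 2) * / (2 * V)) by (field; lra).
      field. split; lra. }
  unfold psi. fold b. replace (- (2 * theta) * (ln (sinh (b * sqrt (INR s))) - ln (sinh b))) with (- theta * (ln (INR s) + 2 * l)).
  - apply (is_lim_seq_continuous exp); [|exact HG]. apply derivable_continuous_pt, derivable_pt_exp.
  - rewrite El, (ln_mult b) by lra. replace (ln (INR s)) with (2 * ln (sqrt (INR s))); [ring|].
    rewrite <- (sqrt_sqrt (INR s)) at 2 by lra. rewrite ln_mult by lra. ring.
Qed.
End Limit.

(** * Estimates for the renewal equation *)

Lemma psum_rev (f : nat -> R) k : psum (fun j => f (k - j)%nat) (S k) = psum f (S k).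
Proof.
  induction k; [reflexivity|]. rewrite psum_S_l, Nat.sub_0_r. rewrite (psum_S f (S k)), <- IHk, Rplus_comm. f_equal.
Qed.

Lemma psum_inv_sqrt n : psum (fun j => / sqrt (INR (S j))) n <= 2 * sqrt (INR n).
Proof.
  induction n; [simpl; rewrite sqrt_0; lra|]. rewrite psum_S. eapply Rle_trans; [apply Rplus_le_compat_r, IHn|].
  assert (H1 : 0 < INR (S n)) by (apply lt_0_INR; lia). pose proof (sqrt_lt_R0 _ H1) as Hs. pose proof (pos_INR n).
  pose proof (sqrt_pos (INR n)). pose proof (sqrt_sqrt (INR n) ltac:(lra)) as E1. pose proof (sqrt_sqrt (INR (S n)) ltac:(lra)) as E2.
  rewrite (S_INR n) in E2 at 3. set (a := sqrt (INR n)) in *. set (c := sqrt (INR (S n))) in *.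
  apply (Rmult_le_reg_r c); auto. rewrite Rmult_plus_distr_r, Rinv_l by lra. nra.
Qed.

(* The scaled renewal equation n p_n = sum_j w_j p_(n-1-j), with w_j standing for the kernel at lag j+1. *)
Record renewal (L C : R) (w p : nat -> R) : Prop := {
  rn_pos : forall n, 0 <= p n;
  rn_mass : forall n, psum p n <= 1;
  rn_rec : forall n, INR (S n) * p (S n) = psum (fun j => w j * p (n - j)%nat) (S n);
  rn_w : forall j, 0 <= w j <= C * (1 + L / sqrt (INR (S j)));
  rn_step : forall j m, (1 <= m)%nat -> (2 * m <= S j)%nat ->
    Rabs (w (S j) - w j) <= C * (L / (INR m * sqrt (INR m)) + / L ^ 2 * (1 + L / sqrt (INR m))) }.

(** For indices up to T L^2 the constant part of the kernel bound is absorbed by L/sqrt(j). *)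
Lemma renewal_w_local L C w p T C1 j : renewal L C w p -> 2 <= L -> 0 < C -> 0 < T -> C * (1 + sqrt T) <= C1 -> INR (S j) <= T * L ^ 2 ->
  w j <= C1 * L * / sqrt (INR (S j)).
Proof.
  intros Hr HL HC HT HC1 Hj. eapply Rle_trans; [apply (rn_w _ _ _ _ Hr)|].
  assert (H0 : 0 < INR (S j)) by (apply lt_0_INR; lia). pose proof (sqrt_lt_R0 _ H0) as Hs.
  assert (Hb : sqrt (INR (S j)) <= sqrt T * L).
  { rewrite <- (sqrt_pow2 L) by lra. rewrite <- sqrt_mult by nra. apply sqrt_le_1_alt. exact Hj. }
  apply (Rmult_le_reg_r (sqrt (INR (S j)))); auto. rewrite (Rmult_assoc (C1 * L)), Rinv_l by lra.
  replace (C * (1 + L / sqrt (INR (S j))) * sqrt (INR (S j))) with (C * (sqrt (INR (S j)) + L)) by (field; lra).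
  pose proof (sqrt_pos T). apply Rle_trans with (C * (1 + sqrt T) * L); [|nra]. rewrite Rmult_assoc. apply Rmult_le_compat_l; [lra|]. lra.
Qed.

Lemma renewal_w_sum L C w p T C1 J : renewal L C w p -> 2 <= L -> 0 < C -> 0 < T -> C * (1 + sqrt T) <= C1 -> INR J <= T * L ^ 2 ->
  psum w J <= 2 * C1 * L * sqrt (INR J).
Proof.
  intros Hr HL HC HT HC1 HJ.
  assert (0 < C1). { pose proof (sqrt_pos T). nra. }
  apply Rle_trans with (psum (fun j => C1 * L * / sqrt (INR (S j))) J).
  - apply psum_le. intros j Hj. apply (renewal_w_local L C w p T); auto. apply Rle_trans with (INR J); auto. apply le_INR; lia.
  - rewrite psum_scal. pose proof (psum_inv_sqrt J). assert (0 < C1 * L) by nra.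
    replace (2 * C1 * L * sqrt (INR J)) with (C1 * L * (2 * sqrt (INR J))) by ring. apply Rmult_le_compat_l; lra.
Qed.

(* Bootstrap: lags up to J ~ (n/L)^2 feed on the inductive bound, longer lags only on the total mass. *)
Lemma renewal_apriori C T : 0 < C -> 0 < T -> exists Q, 0 < Q /\ forall L w p, 2 <= L -> renewal L C w p ->
  forall n, (1 <= n)%nat -> INR n <= T * L ^ 2 -> INR n ^ 2 * p n <= Q * L ^ 2.
Proof.
  (* The summand 1 + T ensures T <= C1^2, which below keeps the short lags within n/2. *)
  intros HC HT. set (C1 := C * (1 + sqrt T) + 1 + T). pose proof (sqrt_pos T) as HsT.
  assert (HC1 : 1 + T <= C1) by (unfold C1; nra). assert (HC1' : C * (1 + sqrt T) <= C1) by (unfold C1; lra).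
  (* Long lags have w <= 16 C1^2 L^2/n; with total mass 1 they use exactly half of Q L^2/n. *)
  set (Q := 32 * C1^2). exists Q. split; [unfold Q; nra|].
  intros L w p HL Hr n. induction n as [n IH] using lt_wf_ind. intros Hn HnT.
  assert (Hn0 : 1 <= INR n) by (apply (le_INR 1); auto).
  (* Then the kernel mass 2 C1 L sqrt(J) of the short lags is at most n/8. The inductive bound at
     indices above n/2 costs a factor 4, so this part too uses at most half of Q L^2/n. *)
  set (x := (INR n / (16 * C1 * L))^2).
  assert (HxL : 0 < 16 * C1 * L) by nra.
  assert (Hx0 : 0 < INR n / (16 * C1 * L)) by (apply Rdiv_lt_0_compat; lra).
  assert (Hsx : sqrt x = INR n / (16 * C1 * L)) by (apply sqrt_pow2; lra).
  assert (Hx : 0 < x) by (unfold x; nra).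
  destruct (nfloor_ex x ltac:(lra)) as [J [HJ1 HJ2]].
  assert (HJn : 2 * INR J <= INR n).
  { apply Rle_trans with (2 * x); [lra|]. unfold x. replace (2 * (INR n / (16 * C1 * L)) ^ 2) with (INR n * (INR n / (128 * C1^2 * L^2))) by (field; lra).
    rewrite <- (Rmult_1_r (INR n)) at 3. apply Rmult_le_compat_l; [lra|].
    assert (0 < L^2) by nra. assert (T <= C1^2) by nra.
    apply (Rmult_le_reg_r (128 * C1^2 * L^2)); [nra|]. unfold Rdiv. rewrite Rmult_assoc, Rinv_l by nra. nra. }
  assert (HJn' : (2 * J <= n)%nat). { apply INR_le. rewrite mult_INR. simpl (INR 2). lra. }
  destruct n as [|n]; [lia|]. pose proof (rn_rec _ _ _ _ Hr n) as Hrec.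
  assert (HJle : (J <= S n)%nat) by lia.
  replace (S n) with (J + (S n - J))%nat in Hrec at 3 by lia. rewrite psum_add in Hrec.
  set (N := INR (S n)) in *.
  assert (Hfirst : psum (fun j => w j * p (n - j)%nat) J <= Q * L^2 / (2 * N)).
  { apply Rle_trans with (psum (fun j => (4 * Q * L^2 / N^2) * w j) J).
    - apply psum_le. intros j Hj. rewrite Rmult_comm. apply Rmult_le_compat_r; [apply (rn_w _ _ _ _ Hr)|].
      assert (Hm : (1 <= n - j)%nat) by lia.
      assert (HmT : INR (n - j) <= T * L^2) by (eapply Rle_trans; [|exact HnT]; apply le_INR; lia).
      pose proof (IH (n - j)%nat ltac:(lia) Hm HmT) as Hi.
      assert (HN2 : N / 2 <= INR (n - j)).
      { assert (INR (S n) <= INR (2 * (n - j))). { apply le_INR. lia. } rewrite mult_INR in H. simpl (INR 2) in H. fold N in H. lra. }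
      pose proof (rn_pos _ _ _ _ Hr (n - j)%nat). apply (Rmult_le_reg_r (N^2)); [nra|].
      unfold Rdiv. rewrite (Rmult_assoc (4 * Q * L^2)), Rinv_l by nra.
      assert (N^2 <= 4 * INR (n - j)^2) by nra. nra.
    - rewrite psum_scal. pose proof (renewal_w_sum L C w p T C1 J Hr HL HC HT HC1' ltac:(lra)) as Hw.
      assert (Hsq : sqrt (INR J) <= N / (16 * C1 * L)) by (rewrite <- Hsx; apply sqrt_le_1_alt; lra).
      assert (HQ : 0 < 4 * Q * L^2 / N^2). { apply Rdiv_lt_0_compat; [|nra]. assert (0 < Q) by (unfold Q; nra). nra. }
      apply Rle_trans with (4 * Q * L^2 / N^2 * (2 * C1 * L * (N / (16 * C1 * L)))).
      + apply Rmult_le_compat_l; [lra|]. eapply Rle_trans; [exact Hw|]. apply Rmult_le_compat_l; [nra|exact Hsq].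
      + right. field. repeat split; lra. }
  assert (Hsecond : psum (fun i => w (J + i)%nat * p (n - (J + i))%nat) (S n - J) <= Q * L^2 / (2 * N)).
  { assert (Hb : forall i, (i < S n - J)%nat -> w (J + i)%nat <= 16 * C1^2 * L^2 / N).
    { intros i Hi. eapply Rle_trans; [apply (renewal_w_local L C w p T C1); auto; eapply Rle_trans; [|exact HnT]; apply le_INR; lia|].
      assert (Hsq : N / (16 * C1 * L) <= sqrt (INR (S (J + i)))).
      { rewrite <- Hsx. apply sqrt_le_1_alt. rewrite S_INR, plus_INR. pose proof (pos_INR i). lra. }
      replace (16 * C1^2 * L^2 / N) with (C1 * L * / (N / (16 * C1 * L))) by (field; repeat split; lra).
      apply Rmult_le_compat_l; [nra|]. apply Rinv_le_contravar; auto. }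
    apply Rle_trans with (psum (fun i => 16 * C1^2 * L^2 / N * p (n - (J + i))%nat) (S n - J)).
    - apply psum_le. intros i Hi. apply Rmult_le_compat_r; [apply (rn_pos _ _ _ _ Hr)|apply Hb; auto].
    - rewrite psum_scal. replace (Q * L^2 / (2 * N)) with (16 * C1^2 * L^2 / N * 1) by (unfold Q; field; lra).
      apply Rmult_le_compat_l; [apply Rlt_le, Rdiv_lt_0_compat; nra|].
      apply Rle_trans with (psum (fun j => p (n - j)%nat) (S n)).
      + replace (S n) with (J + (S n - J))%nat at 2 by lia. rewrite psum_add.
        assert (0 <= psum (fun j => p (n - j)%nat) J) by (apply psum_nonneg; intros; apply (rn_pos _ _ _ _ Hr)). lra.
      + rewrite psum_rev. apply (rn_mass _ _ _ _ Hr). }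
  assert (Hfin : N * p (S n) <= Q * L^2 / N).
  { rewrite Hrec. replace (Q * L^2 / N) with (Q * L^2 / (2 * N) + Q * L^2 / (2 * N)) by (field; lra). lra. }
  replace (N^2 * p (S n)) with (N * (N * p (S n))) by ring. replace (Q * L^2) with (N * (Q * L^2 / N)) by (field; lra).
  apply Rmult_le_compat_l; lra.
Qed.

(** Long lags are indexed by the position k, short ones by the lag. Replacing (n, J) by (n + i, J +
    i) therefore keeps the range of k and the values p_k, and only shifts the kernel. *)
Lemma renewal_conv L C w p n J : renewal L C w p -> (1 <= n)%nat -> (J <= n)%nat ->
  INR n * p n = psum (fun k => w (n - 1 - k)%nat * p k) (n - J) + psum (fun j => w j * p (n - 1 - j)%nat) J.
Proof.
  intros Hr Hn HJ. destruct n as [|n]; [lia|]. rewrite (rn_rec _ _ _ _ Hr n). replace (S n - 1)%nat with n by lia.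
  replace (S n) with (J + (S n - J))%nat at 1 by lia. rewrite psum_add, Rplus_comm. f_equal.
  destruct (S n - J)%nat as [|k] eqn:E; [reflexivity|].
  rewrite <- (psum_rev (fun i => w (n - i)%nat * p i) k). apply psum_ext. intros i Hi.
  f_equal; f_equal; lia.
Qed.

Lemma renewal_steps L C w p j m i : renewal L C w p -> (1 <= m)%nat -> (2 * m <= S j)%nat ->
  Rabs (w (j + i)%nat - w j) <= INR i * (C * (L / (INR m * sqrt (INR m)) + / L ^ 2 * (1 + L / sqrt (INR m)))).
Proof.
  intros Hr Hm Hj. induction i.
  - rewrite Nat.add_0_r, Rminus_diag, Rabs_R0. simpl. lra.
  - rewrite S_INR, Nat.add_succ_r. pose proof (rn_step _ _ _ _ Hr (j + i) m Hm ltac:(lia)) as Hs.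
    replace (w (S (j + i)) - w j) with ((w (S (j+i)) - w (j + i)%nat) + (w (j + i)%nat - w j)) by ring.
    eapply Rle_trans; [apply Rabs_triang|]. lra.
Qed.

(** n p_n and (n + i) p_(n+i) are compared through [renewal_conv]. Over long lags the kernel is
    smooth and moves by at most i D/L^2 against mass 1; short lags carry little kernel mass and are
    estimated separately by the a priori bound. Division by n >= delta L^2 concludes. *)
Lemma renewal_equicont C T delta eps : 0 < C -> 0 < T -> 0 < delta -> 0 < eps ->
  exists kappa L0, 0 < kappa /\ forall L w p, L0 <= L -> 2 <= L -> renewal L C w p ->
  forall n i, delta * L ^ 2 <= INR n -> INR (n + i) <= T * L ^ 2 -> INR i <= kappa * L ^ 2 ->
   L ^ 2 * Rabs (p n - p (n + i)%nat) <= eps.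
Proof.
  intros HC HT Hdel Heps.
  destruct (renewal_apriori C T HC HT) as [Q [HQ Hap]].
  set (C1 := C * (1 + sqrt T)). pose proof (sqrt_pos T) as HsT. assert (HC1 : 0 < C1) by (unfold C1; nra).
  set (A := 16 * Q * C1 / delta^3). assert (Hd3 : 0 < delta^3) by (apply pow_lt; auto). assert (Hd2 : 0 < delta^2) by nra.
  assert (HA : 0 < A) by (apply Rdiv_lt_0_compat; nra).
  (* Lags below about 2 eta L^2 count as short. The first entry keeps them within n/2; the second
     makes their share A sqrt(3 eta) at most eps/3. *)
  set (eta := Rmin (delta / 4) ((eps / (3 * A))^2 / 3)).
  assert (Heta : 0 < eta). { apply Rmin_pos; [lra|]. assert (0 < eps / (3 * A)) by (apply Rdiv_lt_0_compat; lra). nra. }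
  assert (Heta1 : eta <= delta / 4) by apply Rmin_l.
  assert (HAeta : A * sqrt (3 * eta) <= eps / 3).
  { assert (0 < eps / (3 * A)) by (apply Rdiv_lt_0_compat; lra).
    assert (sqrt (3 * eta) <= eps / (3 * A)). { rewrite <- (sqrt_pow2 (eps / (3 * A))) by lra. apply sqrt_le_1_alt. pose proof (Rmin_r (delta / 4) ((eps / (3 * A))^2 / 3)) as H0. fold eta in H0. lra. }
    apply Rle_trans with (A * (eps / (3 * A))); [apply Rmult_le_compat_l; lra|]. right; field; lra. }
  set (D := C * (8 / (eta * sqrt eta) + (1 + 2 / sqrt eta))).
  assert (Hse : 0 < sqrt eta) by (apply sqrt_lt_R0; auto).
  assert (HD : 0 < D). { assert (0 < 8 / (eta * sqrt eta)) by (apply Rdiv_lt_0_compat; nra). assert (0 < 2 / sqrt eta) by (apply Rdiv_lt_0_compat; lra). unfold D. apply Rmult_lt_0_compat; lra. }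
  (* kappa D is the cost of shifting the kernel and kappa Q/delta^2 that of the term i p_(n+i);
     kappa <= eta keeps J + i below 3 eta L^2. *)
  set (kappa := Rmin eta (Rmin (eps * delta / (3 * D)) (eps * delta^3 / (3 * Q)))).
  assert (Hkap : 0 < kappa). { apply Rmin_pos; [exact Heta|]. apply Rmin_pos; (apply Rdiv_lt_0_compat; [apply Rmult_lt_0_compat; lra|lra]). }
  assert (Hk1 : kappa <= eta) by apply Rmin_l.
  assert (Hk2 : kappa <= eps * delta / (3 * D)) by (eapply Rle_trans; [apply Rmin_r|apply Rmin_l]).
  assert (Hk3 : kappa <= eps * delta^3 / (3 * Q)) by (eapply Rle_trans; [apply Rmin_r|apply Rmin_r]).
  exists kappa, (2 / eta + 1). split; auto.
  intros L w p HL0 HL Hr n i Hn Hn' Hi.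
  assert (HetaL : 2 <= eta * L^2).
  { assert (2 / eta <= L) by lra. assert (2 <= eta * L). { apply (Rmult_le_compat_l eta) in H; [|lra]. replace (eta * (2 / eta)) with 2 in H by (field; lra). lra. } nra. }
  assert (HL2 : 0 < L^2) by nra.
  destruct (nfloor_ex (2 * eta * L^2) ltac:(nra)) as [J [HJ1 HJ2]].
  assert (HJeta : eta * L^2 <= INR J) by lra.
  assert (HJn : 2 * INR J <= INR n). { assert (2 * (2 * eta * L^2) <= delta * L^2) by nra. lra. }
  assert (HJn' : (2 * J <= n)%nat). { apply INR_le. rewrite mult_INR. simpl (INR 2). lra. }
  (* All long lags exceed 2m, as [rn_step] requires, and m is still of order eta L^2. *)
  set (m := (J / 2)%nat).
  assert (Hm : (2 * m <= J < 2 * m + 2)%nat). { unfold m. pose proof (Nat.div_mod_eq J 2). pose proof (Nat.mod_upper_bound J 2). lia. }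
  assert (Hm4 : eta * L^2 / 4 <= INR m).
  { destruct Hm as [_ Hm]. apply lt_INR in Hm. rewrite plus_INR, mult_INR in Hm. simpl (INR 2) in Hm.
    assert (INR J <= 2 * INR m + 1). { assert (J <= 2 * m + 1)%nat by (unfold m; pose proof (Nat.div_mod_eq J 2); pose proof (Nat.mod_upper_bound J 2); lia). apply le_INR in H. rewrite plus_INR, mult_INR in H. simpl in H. simpl. lra. }
    lra. }
  assert (HJ0 : (1 <= J)%nat). { destruct J; [simpl in HJeta; lra|lia]. }
  assert (Hm1 : (1 <= m)%nat). { destruct m; [simpl in Hm4; lra|lia]. }
  assert (Hn1 : (1 <= n)%nat) by lia.
  assert (Hnpos : 0 < INR n) by (apply lt_0_INR; lia).
  assert (Hsm : sqrt eta * L / 2 <= sqrt (INR m)).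
  { replace (sqrt eta * L / 2) with (sqrt (eta * L^2 / 4)).
    - apply sqrt_le_1_alt; auto.
    - replace (eta * L^2 / 4) with (eta * (L/2)^2) by field. rewrite sqrt_mult, sqrt_pow2 by nra. field. }
  assert (Hsm0 : 0 < sqrt eta * L / 2) by nra.
  assert (Hstep : C * (L / (INR m * sqrt (INR m)) + / L ^ 2 * (1 + L / sqrt (INR m))) <= D / L^2).
  { replace (D / L^2) with (C * (8 / (eta * sqrt eta) * / L^2 + / L^2 * (1 + 2 / sqrt eta))) by (unfold D; field; repeat split; lra).
    apply Rmult_le_compat_l; [lra|]. apply Rplus_le_compat.
    - apply Rle_trans with (L / ((eta * L^2 / 4) * (sqrt eta * L / 2))).
      + unfold Rdiv at 1 2. apply Rmult_le_compat_l; [lra|]. apply Rinv_le_contravar; [apply Rmult_lt_0_compat; nra|].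
        apply Rmult_le_compat; nra.
      + right. field. repeat split; lra.
    - apply Rmult_le_compat_l; [left; now apply Rinv_0_lt_compat|]. apply Rplus_le_compat_l.
      apply Rle_trans with (L / (sqrt eta * L / 2)); [unfold Rdiv at 1 2; apply Rmult_le_compat_l; [lra|apply Rinv_le_contravar; auto]|].
      right. field. lra. }
  assert (HiL : 0 <= INR i) by apply pos_INR.
  pose proof (renewal_conv L C w p n J Hr Hn1 ltac:(lia)) as E1.
  pose proof (renewal_conv L C w p (n + i) (J + i) Hr ltac:(lia) ltac:(lia)) as E2.
  replace (n + i - (J + i))%nat with (n - J)%nat in E2 by lia.
  assert (HT2 : forall k, (n <= 2 * k)%nat -> (1 <= k)%nat -> (k <= n + i)%nat -> p k <= 4 * Q / (delta^2 * L^2)).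
  { intros k Hk2' Hk1' Hk. assert (Hk0 : INR k <= T * L^2) by (eapply Rle_trans; [|exact Hn']; apply le_INR; auto).
    pose proof (Hap L w p HL Hr k Hk1' Hk0) as Hb. pose proof (rn_pos _ _ _ _ Hr k).
    assert (INR n <= 2 * INR k). { apply le_INR in Hk2'. rewrite mult_INR in Hk2'. simpl (INR 2) in Hk2'. lra. }
    assert (delta * L^2 / 2 <= INR k) by lra.
    assert (Hd4 : (delta * L^2/2)^2 <= INR k ^ 2) by (apply pow_incr; split; [nra|auto]).
    apply (Rmult_le_reg_r (delta^2 * L^2)); [nra|]. unfold Rdiv. rewrite (Rmult_assoc (4 * Q)), Rinv_l by nra.
    assert ((delta * L^2/2)^2 * p k <= Q * L^2) by nra.
    replace ((delta * L^2/2)^2 * p k) with (p k * (delta^2 * L^2) * L^2 / 4) in H2 by field.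
    apply (Rmult_le_reg_r (L^2)); auto. lra. }
  (* Used for (n, J) and for (n + i, J + i): all positions involved are at least n/2, where the a
     priori bound makes p of order L^-2. *)
  assert (Hpart : forall n0 J0, (n0 <= n + i)%nat -> (1 <= n0)%nat -> (J0 <= J + i)%nat -> (J0 <= n0)%nat -> (n <= 2 * (n0 - J0))%nat ->
     0 <= psum (fun j => w j * p (n0 - 1 - j)%nat) J0 <= 4 * Q / (delta^2 * L^2) * (2 * C1 * L * (sqrt (3 * eta) * L))).
  { intros n0 J0 H1 H2 H3 H4 H5. split.
    - apply psum_nonneg. intros; apply Rmult_le_pos; [apply (rn_w _ _ _ _ Hr)|apply (rn_pos _ _ _ _ Hr)].
    - apply Rle_trans with (psum (fun j => 4 * Q / (delta^2 * L^2) * w j) J0).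
      + apply psum_le. intros j Hj. rewrite Rmult_comm. apply Rmult_le_compat_r; [apply (rn_w _ _ _ _ Hr)|]. apply HT2; lia.
      + rewrite psum_scal. apply Rmult_le_compat_l; [apply Rlt_le, Rdiv_lt_0_compat; nra|].
        assert (HJ0' : INR J0 <= 3 * eta * L^2). { apply le_INR in H3. rewrite plus_INR in H3. assert (kappa * L^2 <= eta * L^2) by nra. lra. }
        eapply Rle_trans; [apply (renewal_w_sum L C w p T C1 J0); auto; [unfold C1; lra|]|].
        * apply Rle_trans with (INR (n + i)); [apply le_INR; lia|auto].
        * apply Rmult_le_compat_l; [nra|]. replace (sqrt (3 * eta) * L) with (sqrt (3 * eta * L^2)).
          -- apply sqrt_le_1_alt; auto.
          -- rewrite sqrt_mult, sqrt_pow2 by nra. reflexivity. }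
  pose proof (Hpart n J ltac:(lia) ltac:(lia) ltac:(lia) ltac:(lia) ltac:(lia)) as P1.
  pose proof (Hpart (n + i)%nat (J + i)%nat ltac:(lia) ltac:(lia) ltac:(lia) ltac:(lia) ltac:(lia)) as P2.
  assert (Hdiff : Rabs (psum (fun k => w (n - 1 - k)%nat * p k) (n - J) - psum (fun k => w (n + i - 1 - k)%nat * p k) (n - J)) <= INR i * (D / L^2)).
  { rewrite <- psum_minus. apply Rle_trans with (psum (fun k => INR i * (D / L^2) * p k) (n - J)).
    - apply psum_abs_le. intros k Hk. rewrite <- Rmult_minus_distr_r, Rabs_mult, (Rabs_pos_eq (p k)) by apply (rn_pos _ _ _ _ Hr).
      apply Rmult_le_compat_r; [apply (rn_pos _ _ _ _ Hr)|].
      pose proof (renewal_steps L C w p (n - 1 - k) m i Hr Hm1 ltac:(lia)) as Hst. rewrite Rabs_minus_sym.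
      replace (n + i - 1 - k)%nat with (n - 1 - k + i)%nat by lia. eapply Rle_trans; [exact Hst|]. apply Rmult_le_compat_l; auto.
    - rewrite psum_scal. rewrite <- (Rmult_1_r (INR i * (D / L^2))) at 2. apply Rmult_le_compat_l; [|apply (rn_mass _ _ _ _ Hr)].
      apply Rmult_le_pos; auto. apply Rlt_le, Rdiv_lt_0_compat; lra. }
  assert (HiD : INR i * (D / L^2) <= kappa * D).
  { apply Rle_trans with (kappa * L^2 * (D / L^2)); [apply Rmult_le_compat_r; [apply Rlt_le, Rdiv_lt_0_compat; lra|auto]|]. right; field; lra. }
  assert (HBn : Rabs (INR n * p n - INR (n + i) * p (n + i)%nat) <= kappa * D + 4 * Q / (delta^2 * L^2) * (2 * C1 * L * (sqrt (3 * eta) * L))).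
  { rewrite E1, E2. apply Rabs_le_between in Hdiff. apply Rabs_le. lra. }
  replace (4 * Q / (delta^2 * L^2) * (2 * C1 * L * (sqrt (3 * eta) * L))) with (8 * Q * C1 / delta^2 * sqrt (3 * eta)) in HBn by (field; repeat split; lra).
  assert (Hpn' : INR i * p (n + i)%nat <= kappa * Q / delta^2).
  { assert (Hni : INR n <= INR (n + i)) by (apply le_INR; lia).
    pose proof (Hap L w p HL Hr (n + i)%nat ltac:(lia) Hn') as Hb. pose proof (rn_pos _ _ _ _ Hr (n + i)%nat).
    assert (Hd4 : (delta * L^2)^2 <= INR (n + i) ^ 2) by (apply pow_incr; split; [nra|lra]).
    assert (p (n + i)%nat <= Q / (delta^2 * L^2)).
    { apply (Rmult_le_reg_r (delta^2 * L^2)); [nra|]. unfold Rdiv. rewrite (Rmult_assoc Q), Rinv_l by nra.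
      assert ((delta * L^2)^2 * p (n+i)%nat <= Q * L^2) by nra.
      replace ((delta * L^2)^2 * p (n + i)%nat) with (p (n + i)%nat * (delta^2 * L^2) * L^2) in H0 by ring. apply (Rmult_le_reg_r (L^2)); auto. lra. }
    apply Rle_trans with (kappa * L^2 * (Q / (delta^2 * L^2))); [apply Rmult_le_compat; auto|]. right; field. split; lra. }
  assert (Hmain : INR n * Rabs (p n - p (n + i)%nat) <= kappa * D + 8 * Q * C1 / delta^2 * sqrt (3 * eta) + kappa * Q / delta^2).
  { rewrite <- (Rabs_pos_eq (INR n)) by lra. rewrite <- Rabs_mult.
    replace (INR n * (p n - p (n + i)%nat)) with ((INR n * p n - INR (n + i) * p (n + i)%nat) + INR i * p (n + i)%nat) by (rewrite plus_INR; ring).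
    eapply Rle_trans; [apply Rabs_triang|]. rewrite (Rabs_pos_eq (INR i * _)) by (apply Rmult_le_pos; auto; apply (rn_pos _ _ _ _ Hr)). lra. }
  pose proof (Rabs_pos (p n - p (n + i)%nat)) as Hpp.
  apply (Rmult_le_reg_l delta); auto.
  apply Rle_trans with (INR n * Rabs (p n - p (n + i)%nat)); [rewrite <- Rmult_assoc; apply Rmult_le_compat_r; auto|].
  eapply Rle_trans; [exact Hmain|].
  assert (T1 : kappa * D <= eps * delta / 3).
  { apply Rle_trans with (eps * delta / (3 * D) * D); [apply Rmult_le_compat_r; lra|]. right; field; lra. }
  assert (T2 : 8 * Q * C1 / delta^2 * sqrt (3 * eta) <= eps * delta / 3).
  { replace (8 * Q * C1 / delta^2 * sqrt (3 * eta)) with (delta / 2 * (A * sqrt (3 * eta))) by (unfold A; field; lra). nra. }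
  assert (T3 : kappa * Q / delta^2 <= eps * delta / 3).
  { apply Rle_trans with (eps * delta^3 / (3 * Q) * Q / delta^2).
    - unfold Rdiv at 1 2. apply Rmult_le_compat_r; [left; now apply Rinv_0_lt_compat|]. apply Rmult_le_compat_r; lra.
    - right; field; lra. }
  lra.
Qed.

(** * Bernstein approximation *)

(* E F(S_d) for S_d a sum of d Bernoulli(y) variables; F i = f (i/d) gives the Bernstein polynomial of f. *)
Fixpoint bern (d : nat) (F : nat -> R) (y : R) : R :=
  match d with
  | O => F 0%nat
  | S d' => (1 - y) * bern d' F y + y * bern d' (fun i => F (S i)) y
  end.

Lemma bern_lin d F1 F2 a b y : bern d (fun i => a * F1 i + b * F2 i) y = a * bern d F1 y + b * bern d F2 y.
Proof. revert F1 F2. induction d; intros; simpl; [ring|]. rewrite (IHd F1 F2), (IHd (fun i => F1 (S i)) (fun i => F2 (S i))). ring. Qed.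

Lemma bern_le d F1 F2 y : 0 <= y <= 1 -> (forall i, F1 i <= F2 i) -> bern d F1 y <= bern d F2 y.
Proof.
  intros Hy. revert F1 F2. induction d; intros F1 F2 H; simpl; [auto|].
  pose proof (IHd F1 F2 H). pose proof (IHd (fun i => F1 (S i)) (fun i => F2 (S i)) (fun i => H (S i))). nra.
Qed.

Lemma bern_const d c y : bern d (fun _ => c) y = c.
Proof. induction d; simpl; auto. rewrite IHd. ring. Qed.

Lemma bern_ext d F1 F2 y : (forall i, F1 i = F2 i) -> bern d F1 y = bern d F2 y.
Proof. revert F1 F2. induction d; intros F1 F2 H; simpl; auto. rewrite (IHd F1 F2), (IHd (fun i => F1 (S i)) (fun i => F2 (S i))); auto. Qed.

(** For a = - d y this is the variance of a binomial variable; the shift is left free for the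
    induction. *)
Lemma bern_sq d a y : bern d (fun i => (INR i + a) ^ 2) y = INR d * y * (1 - y) + (INR d * y + a) ^ 2.
Proof.
  revert a. induction d; intros a; [simpl; ring|]. cbn [bern]. rewrite IHd.
  rewrite (bern_ext d (fun i => (INR (S i) + a) ^ 2) (fun i => (INR i + (1 + a)) ^ 2)) by (intros; rewrite S_INR; ring).
  rewrite IHd, S_INR. ring.
Qed.

Lemma bern_cont d F x : continuous (bern d F) x.
Proof.
  revert F. induction d; intros F; [apply (continuous_const (F 0%nat))|]. cbn [bern].
  apply continuous_plus_R; apply continuous_mult_R; auto using continuous_id.
  apply (continuous_minus (V:=R_NormedModule)); [apply continuous_const|apply continuous_id].
Qed.

(** Chebyshev's argument in the form |s| <= eta + s^2/eta, which reduces the average error to the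
    variance y (1 - y)/d. *)
Lemma bernstein_error (f : R -> R) K d eta y : (1 <= d)%nat -> 0 < eta -> 0 <= K -> 0 <= y <= 1 ->
  (forall u v, Rabs (f u - f v) <= K * Rabs (u - v)) ->
  Rabs (f y - bern d (fun i => f (INR i / INR d)) y) <= K * (eta + / (INR d * eta)).
Proof.
  intros Hd He HK Hy Hf. assert (Hd0 : 0 < INR d) by (apply lt_0_INR; lia).
  set (g := fun i => K * (eta + (INR i + - (INR d * y)) ^ 2 / (INR d ^ 2 * eta))).
  assert (Hb : forall i, Rabs (f y - f (INR i / INR d)) <= g i).
  { intros i. eapply Rle_trans; [apply Hf|]. unfold g. apply Rmult_le_compat_l; auto.
    replace ((INR i + - (INR d * y)) ^ 2 / (INR d ^ 2 * eta)) with ((y - INR i / INR d)^2 / eta) by (field; lra).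
    rewrite <- pow2_abs. set (a := Rabs (y - INR i / INR d)). assert (0 <= a) by apply Rabs_pos.
    apply (Rmult_le_reg_r eta); auto. rewrite Rmult_plus_distr_r. unfold Rdiv. rewrite Rmult_assoc, Rinv_l by lra. nra. }
  assert (Hg : bern d g y <= K * (eta + / (INR d * eta))).
  { rewrite (bern_ext d g (fun i => (K * eta) * 1 + (K / (INR d ^ 2 * eta)) * (INR i + - (INR d * y))^2)) by (intros; unfold g, Rdiv; ring).
    rewrite (bern_lin d (fun _ => 1)), bern_const, bern_sq.
    replace (INR d * y + - (INR d * y)) with 0 by ring.
    replace (K * eta * 1 + K / (INR d ^ 2 * eta) * (INR d * y * (1 - y) + 0 ^ 2)) with (K * (eta + / (INR d * eta) * (y * (1 - y)))) by (field; lra).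
    apply Rmult_le_compat_l; auto. apply Rplus_le_compat_l. assert (0 < / (INR d * eta)) by (apply Rinv_0_lt_compat; nra). nra. }
  assert (E : f y = bern d (fun _ => f y) y) by (now rewrite bern_const).
  apply Rabs_le. split.
  - assert (bern d (fun i => 1 * f (INR i / INR d) + (-1) * f y) y <= bern d g y).
    { apply bern_le; auto. intros i. pose proof (Hb i) as H. apply Rabs_le_between in H. lra. }
    rewrite (bern_lin d (fun i => f (INR i / INR d)) (fun _ => f y)), bern_const in H. lra.
  - assert (bern d (fun i => 1 * f y + (-1) * f (INR i / INR d)) y <= bern d g y).
    { apply bern_le; auto. intros i. pose proof (Hb i) as H. apply Rabs_le_between in H. lra. }
    rewrite (bern_lin d (fun _ => f y) (fun i => f (INR i / INR d))), bern_const in H. lra.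
Qed.

(** * From moments to uniform convergence over Lipschitz functions *)

Section UniformMoments.
Variable D : nat -> (R -> R) -> R.
Hypothesis D_lin : forall N f g a b, (forall x, continuous f x) -> (forall x, continuous g x) ->
  D N (fun y => a * f y + b * g y) = a * D N f + b * D N g.
Hypothesis D_bound : forall N f B, (forall x, continuous f x) -> (forall y, 0 <= y <= 1 -> Rabs (f y) <= B) -> Rabs (D N f) <= 2 * B.
Hypothesis D_mom : forall i, is_lim_seq (fun N => D N (fun y => y ^ i)) 0.

Lemma D_ext N f g : (forall y, f y = g y) -> D N f = D N g.
Proof. intros H. f_equal. apply FunctionalExtensionality.functional_extensionality, H. Qed.

Lemma monom_cont i j x : continuous (fun y => y ^ i * (1 - y) ^ j) x.
Proof. apply (ex_derive_continuous (V:=R_NormedModule)). auto_derive; auto. Qed.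

Lemma D_monom i j : is_lim_seq (fun N => D N (fun y => y ^ i * (1 - y) ^ j)) 0.
Proof.
  revert i. induction j; intros i.
  - apply is_lim_seq_ext with (2 := D_mom i). intros N. apply D_ext. intros; simpl; ring.
  - apply is_lim_seq_ext with (fun N => 1 * D N (fun y => y ^ i * (1 - y) ^ j) + (-1) * D N (fun y => y ^ S i * (1 - y) ^ j)).
    + intros N. rewrite <- D_lin by apply monom_cont. apply D_ext. intros; simpl; ring.
    + replace (Finite 0) with (Finite (1 * 0 + (-1) * 0)) by (f_equal; ring).
      apply is_lim_seq_plus'; apply (is_lim_seq_mult' (fun _ => _)); auto using is_lim_seq_const.
Qed.

(** The prefactor y^i (1 - y)^j is carried along so that the two branches of [bern] have the same
    form as the statement. Only finitely many monomials occur for given [d], whence one threshold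
    for all bounded [F]. *)
Lemma D_bern d : forall i j eps, 0 < eps -> exists N0 : nat, forall N, (N0 <= N)%nat -> forall F, (forall k, Rabs (F k) <= 1) ->
  Rabs (D N (fun y => y ^ i * (1 - y) ^ j * bern d F y)) <= eps.
Proof.
  induction d; intros i j eps Heps.
  - pose proof (D_monom i j) as H. apply is_lim_seq_Reals in H. destruct (H eps Heps) as [N0 HN0].
    exists N0. intros N HN F HF. specialize (HN0 N HN). unfold Rdist in HN0. rewrite Rminus_0_r in HN0. simpl bern.
    rewrite (D_ext N _ (fun y => F 0%nat * (y ^ i * (1 - y) ^ j) + 0 * (y ^ i * (1 - y) ^ j))) by (intros; ring).
    rewrite D_lin by apply monom_cont. rewrite Rmult_0_l, Rplus_0_r, Rabs_mult. pose proof (HF 0%nat).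
    pose proof (Rabs_pos (F 0%nat)). pose proof (Rabs_pos (D N (fun y => y ^ i * (1 - y) ^ j))). nra.
  - destruct (IHd i (S j) (eps/2) ltac:(lra)) as [N1 HN1]. destruct (IHd (S i) j (eps/2) ltac:(lra)) as [N2 HN2].
    exists (N1 + N2)%nat. intros N HN F HF.
    specialize (HN1 N ltac:(lia) F HF). specialize (HN2 N ltac:(lia) (fun i => F (S i)) (fun k => HF (S k))).
    rewrite (D_ext N _ (fun y => 1 * (y ^ i * (1 - y) ^ S j * bern d F y) + 1 * (y ^ S i * (1 - y) ^ j * bern d (fun i => F (S i)) y))) by (intros; simpl; ring).
    rewrite D_lin.
    + eapply Rle_trans; [apply Rabs_triang|]. rewrite !Rmult_1_l. lra.
    + intros x. apply continuous_mult_R; [apply monom_cont|apply bern_cont].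
    + intros x. apply continuous_mult_R; [apply monom_cont|apply bern_cont].
Qed.

(** The threshold depends on [f] only through [K]; this permits tents whose centre moves with N. A
    degree [d] is fixed by [bernstein_error], and then [D_bern] treats all approximating polynomials
    at once. *)
Lemma D_lipschitz K eps : 0 <= K -> 0 < eps -> exists N0 : nat, forall N, (N0 <= N)%nat ->
  forall f, (forall y, Rabs (f y) <= 1) -> (forall u v, Rabs (f u - f v) <= K * Rabs (u - v)) -> Rabs (D N f) <= eps.
Proof.
  intros HK Heps. set (eta := eps / (8 * (K + 1))). assert (Heta : 0 < eta) by (apply Rdiv_lt_0_compat; lra).
  destruct (INR_unbounded (/ eta ^ 2)) as [d0 Hd0]. set (d := S d0).
  assert (Hd : / eta^2 <= INR d) by (unfold d; rewrite S_INR; lra).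
  assert (Hd1 : 0 < INR d) by (apply lt_0_INR; lia). assert (He2 : 0 < eta^2) by nra.
  assert (Hde : / (INR d * eta) <= eta).
  { apply (Rmult_le_reg_r (INR d * eta)); [nra|]. rewrite Rinv_l by nra.
    apply (Rmult_le_compat_r (eta^2)) in Hd; [|lra]. rewrite Rinv_l in Hd; lra. }
  destruct (D_bern d 0 0 (eps/2) ltac:(lra)) as [N0 HN0]. exists N0. intros N HN f Hf1 HfK.
  set (F := fun i => f (INR i / INR d)).
  specialize (HN0 N HN F ltac:(intros; apply Hf1)).
  assert (Hfc : forall x, continuous f x).
  { intros x. apply continuity_pt_filterlim. intros e He. exists (e / (K + 1)).
    split; [apply Rdiv_lt_0_compat; lra|]. intros z [_ Hz]. simpl in *. unfold Rdist in *.
    eapply Rle_lt_trans; [apply HfK|].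
    apply Rle_lt_trans with (K * (e / (K+1))); [apply Rmult_le_compat_l; lra|].
    apply (Rmult_lt_reg_r (K + 1)); [lra|]. replace (K * (e / (K + 1)) * (K + 1)) with (K * e) by (field; lra). nra. }
  rewrite (D_ext N f (fun y => 1 * (1 * f y + (-1) * bern d F y) + 1 * (y ^ 0 * (1 - y) ^ 0 * bern d F y))) by (intros; simpl; ring).
  assert (Hc1 : forall x, continuous (fun y => 1 * f y + (-1) * bern d F y) x).
  { intros x. apply continuous_plus_R; apply continuous_mult_R; auto using bern_cont; apply continuous_const. }
  rewrite D_lin; auto.
  2:{ intros x. apply continuous_mult_R; [apply monom_cont|apply bern_cont]. }
  eapply Rle_trans; [apply Rabs_triang|]. rewrite !Rmult_1_l.
  assert (Rabs (D N (fun y => 1 * f y + -1 * bern d F y)) <= 2 * (K * (eta + eta))).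
  { apply D_bound; auto. intros y Hy. replace (1 * f y + -1 * bern d F y) with (f y - bern d F y) by ring.
    eapply Rle_trans; [apply (bernstein_error f K d eta y); auto; unfold d; lia|]. apply Rmult_le_compat_l; lra. }
  assert (2 * (K * (eta + eta)) <= eps / 2).
  { unfold eta. replace (2 * (K * (eps / (8 * (K + 1)) + eps / (8 * (K + 1))))) with (eps / 2 * (K / (K+1))) by (field; lra).
    assert (K / (K + 1) <= 1). { apply (Rmult_le_reg_r (K+1)); [lra|]. unfold Rdiv. rewrite Rmult_assoc, Rinv_l; lra. } nra. }
  lra.
Qed.
End UniformMoments.

(** * Gaussian integral *)

Definition gauss_int (x : R) : R := RInt.RInt (fun t => exp (- t ^ 2)) 0 x.

Lemma gauss_cont t : continuous (fun t => exp (- t ^ 2)) t.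
Proof. apply (ex_derive_continuous (V:=R_NormedModule)). auto_derive; auto. Qed.

Lemma gauss_int_correct x : is_RInt (fun t => exp (- t ^ 2)) 0 x (gauss_int x).
Proof. apply (RInt_correct (V:=R_CompleteNormedModule)), (ex_RInt_continuous (V:=R_CompleteNormedModule)). intros; apply gauss_cont. Qed.

Lemma is_derive_gauss_int x : is_derive gauss_int x (exp (- x ^ 2)).
Proof.
  apply (is_derive_RInt (V:=R_NormedModule) (fun t => exp (- t ^ 2)) gauss_int 0 x).
  - exists (mkposreal 1 Rlt_0_1). intros y _. apply gauss_int_correct.
  - apply gauss_cont.
Qed.

Lemma gauss_int_0 : gauss_int 0 = 0.
Proof. unfold gauss_int. apply (RInt_point (V:=R_CompleteNormedModule)). Qed.

Lemma gauss_int_odd x : gauss_int (- x) = - gauss_int x.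
Proof.
  pose proof (gauss_int_correct x) as H.
  assert (H2 : is_RInt (fun y => - exp (- y ^ 2)) 0 (- x) (gauss_int x)).
  { apply is_RInt_ext with (fun y => opp (exp (- (- y) ^ 2))).
    - intros t _. unfold opp; simpl. eqR. f_equal. f_equal. ring.
    - apply (is_RInt_comp_opp (V:=R_NormedModule) (fun t => exp (- t ^ 2))). rewrite Ropp_0, Ropp_involutive. exact H. }
  apply (is_RInt_opp (V:=R_NormedModule)) in H2. unfold gauss_int at 1. apply is_RInt_unique.
  apply is_RInt_ext with (2 := H2). intros t _. unfold opp; simpl. eqR. ring.
Qed.

(** The classical companion of the Gaussian integral: the square of [gauss_int] plus the integral of
    [gauss_aux x] over [0, 1] has derivative zero in x. At 0 it is atan 1, and at infinity the
    companion vanishes. *)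
Definition gauss_aux (x t : R) := exp (- x ^ 2 * (1 + t ^ 2)) / (1 + t ^ 2).

Lemma gauss_aux_derive x t : is_derive (fun x => gauss_aux x t) x (- 2 * x * exp (- x ^ 2 * (1 + t ^ 2))).
Proof. unfold gauss_aux. pose proof (pow2_ge_0 t). auto_derive; [simpl in *; lra|]. simpl. field. simpl in *; lra. Qed.

Lemma gauss_aux_cont x t : continuous (gauss_aux x) t.
Proof. apply (ex_derive_continuous (V:=R_NormedModule)). unfold gauss_aux. pose proof (pow2_ge_0 t). auto_derive. simpl in *; lra. Qed.

Lemma gauss_param_derive x : is_derive (fun x => RInt.RInt (gauss_aux x) 0 1) x (- 2 * exp (- x ^ 2) * gauss_int x).
Proof.
  replace (- 2 * exp (- x ^ 2) * gauss_int x) with (RInt.RInt (fun t => Derive (fun u => gauss_aux u t) x) 0 1).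
  - apply (is_derive_RInt_param gauss_aux 0 1 x).
    + exists (mkposreal 1 Rlt_0_1). intros y _ t _. eexists; apply gauss_aux_derive.
    + intros t _. apply continuity_2d_pt_ext with (fun u v => - 2 * u * exp (- (u * u) * (1 + v * v))).
      * intros u v. symmetry. apply is_derive_unique. replace (- (u * u) * (1 + v * v)) with (- u ^ 2 * (1 + v ^ 2)) by ring. apply gauss_aux_derive.
      * apply continuity_2d_pt_mult.
        -- apply continuity_2d_pt_mult; [apply continuity_2d_pt_const|apply continuity_2d_pt_id1].
        -- apply (continuity_1d_2d_pt_comp exp (fun u v => - (u * u) * (1 + v * v))); [apply derivable_continuous_pt, derivable_pt_exp|].
           apply continuity_2d_pt_mult.
           ++ apply continuity_2d_pt_opp, continuity_2d_pt_mult; apply continuity_2d_pt_id1.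
           ++ apply continuity_2d_pt_plus; [apply continuity_2d_pt_const|]. apply continuity_2d_pt_mult; apply continuity_2d_pt_id2.
    + exists (mkposreal 1 Rlt_0_1). intros y _. apply (ex_RInt_continuous (V:=R_CompleteNormedModule)). intros; apply gauss_aux_cont.
  - pose proof (is_RInt_comp_lin (V:=R_NormedModule) (fun t => exp (- t ^ 2)) x 0 0 1 (gauss_int x)) as H.
    rewrite Rmult_0_r, Rmult_1_r, !Rplus_0_r in H. specialize (H (gauss_int_correct x)).
    apply is_RInt_unique. apply (is_RInt_scalR _ _ _ (- 2 * exp (- x^2))) in H. apply is_RInt_ext with (2 := H).
    intros t _. assert (E : Derive (fun u => gauss_aux u t) x = - 2 * x * exp (- x ^ 2 * (1 + t ^ 2))) by apply is_derive_unique, gauss_aux_derive.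
    etransitivity; [|symmetry; exact E]. unfold scal; simpl. unfold mult; simpl. eqR.
    rewrite Rplus_0_r. replace (- (x * (x * 1)) * (1 + t * (t * 1))) with (- (x * (x * 1)) + - ((x * t) * ((x * t) * 1))) by ring. rewrite exp_plus. ring.
Qed.

Lemma gauss_int_sq x : gauss_int x ^ 2 + RInt.RInt (gauss_aux x) 0 1 = PI / 4.
Proof.
  set (f := fun x => gauss_int x ^ 2 + RInt.RInt (gauss_aux x) 0 1).
  assert (Hd : forall y, is_derive f y 0).
  { intros y. replace 0 with (INR 2 * exp (- y ^ 2) * gauss_int y ^ 1 + (- 2 * exp (- y ^ 2) * gauss_int y)) by (simpl; ring).
    apply (is_derive_plus (V:=R_NormedModule)).
    - apply (is_derive_pow gauss_int 2 y (exp (- y ^ 2))), is_derive_gauss_int.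
    - apply gauss_param_derive. }
  assert (E : f x = f 0).
  { pose proof (is_derive_bounded f (fun _ => 0) 0 x 0 (fun y _ => Hd y)) as Hb. specialize (Hb ltac:(intros; cbv beta; rewrite Rabs_R0; lra)).
    rewrite Rmult_0_l in Hb. pose proof (Rabs_pos (f x - f 0)). apply Rminus_diag_uniq. destruct (Req_dec (f x - f 0) 0); auto.
    pose proof (Rabs_pos_lt _ H0). lra. }
  fold (f x). rewrite E. unfold f. rewrite gauss_int_0.
  assert (HI : is_RInt (gauss_aux 0) 0 1 (atan 1 - atan 0)).
  { apply is_RInt_ext with (fun t => / (1 + t ^ 2)).
    - intros t _. unfold gauss_aux. eqR. replace (- 0 ^ 2 * (1 + t ^ 2)) with 0 by ring. rewrite exp_0. unfold Rdiv. ring.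
    - apply (is_RInt_derive (V:=R_CompleteNormedModule) atan).
      + intros y _. apply is_derive_Reals, derivable_pt_lim_atan.
      + intros y _. apply (ex_derive_continuous (V := R_NormedModule)). auto_derive. nra. }
  rewrite (is_RInt_unique _ _ _ _ HI), atan_0, atan_1. ring.
Qed.

Lemma gauss_int_pos x : 0 <= x -> 0 <= gauss_int x.
Proof.
  intros Hx. apply RInt_ge_0; auto.
  - eexists; apply gauss_int_correct.
  - intros; left; apply exp_pos.
Qed.

Lemma gauss_int_lim : is_lim gauss_int p_infty (sqrt PI / 2).
Proof.
  pose proof PI_RGT_0 as Hpi.
  assert (Hk : sqrt PI / 2 = sqrt (PI / 4)).
  { rewrite sqrt_div by lra. f_equal. replace 4 with (2^2) by ring. symmetry. apply sqrt_pow2. lra. }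
  rewrite Hk.
  assert (Hb : forall x, 0 <= x -> gauss_int x = sqrt (PI/4 - RInt.RInt (gauss_aux x) 0 1)).
  { intros x Hx. rewrite <- (gauss_int_sq x). replace (gauss_int x ^ 2 + RInt.RInt (gauss_aux x) 0 1 - RInt.RInt (gauss_aux x) 0 1) with (gauss_int x ^ 2) by ring.
    symmetry. apply sqrt_pow2. now apply gauss_int_pos. }
  apply is_lim_ext_loc with (fun x => sqrt (PI/4 - RInt.RInt (gauss_aux x) 0 1)).
  { exists 0. intros x Hx. symmetry. apply Hb. lra. }
  assert (Hr : is_lim (fun x => RInt.RInt (gauss_aux x) 0 1) p_infty 0).
  { apply (is_lim_le_le_loc (fun _ => 0) (fun x => exp (- x))).
    - exists 1. intros x Hx.
      assert (Hex : ex_RInt (gauss_aux x) 0 1) by (apply (ex_RInt_continuous (V:=R_CompleteNormedModule)); intros; apply gauss_aux_cont).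
      split.
      + apply RInt_ge_0; [lra|exact Hex|]. intros t _. unfold gauss_aux. pose proof (pow2_ge_0 t). apply Rmult_le_pos; [left; apply exp_pos|left; apply Rinv_0_lt_compat; lra].
      + apply (is_RInt_le (gauss_aux x) (fun _ => exp (- x)) 0 1); [lra|apply (RInt_correct (V:=R_CompleteNormedModule)), Hex| |].
        * pose proof (is_RInt_constR (exp (- x)) 0 1) as Hc. replace ((1 - 0) * exp (- x)) with (exp (- x)) in Hc by ring. exact Hc.
        * intros t _. unfold gauss_aux. pose proof (pow2_ge_0 t). apply Rle_trans with (exp (- x ^ 2 * (1 + t ^ 2)) * 1).
          -- apply Rmult_le_compat_l; [left; apply exp_pos|]. rewrite <- Rinv_1. apply Rinv_le_contravar; lra.
          -- rewrite Rmult_1_r. apply exp_mono. assert (0 <= x^2 * t^2) by (apply Rmult_le_pos; [nra|auto]). nra.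
    - apply is_lim_const.
    - apply (is_lim_comp exp (fun x => - x) p_infty 0 m_infty); [apply is_lim_exp_m| |].
      + apply (is_lim_opp (fun x => x) p_infty p_infty). apply is_lim_id.
      + exists 0. intros y Hy. discriminate. }
  apply (is_lim_comp_continuous (fun x => PI / 4 - RInt.RInt (gauss_aux x) 0 1) sqrt).
  - pose proof (is_lim_minus' (fun _ => PI/4) _ p_infty (PI/4) 0 (is_lim_const _ _) Hr) as Hm. rewrite Rminus_0_r in Hm. exact Hm.
  - apply continuity_pt_filterlim, continuity_pt_sqrt. lra.
Qed.

(** * Limit density *)

(* Inverse Laplace transform of s |-> exp(-c sqrt s), then the same density in the variable v = exp(-x). *)
Definition hit (c x : R) : R := c / (2 * sqrt PI) / (x * sqrt x) * exp (- c ^ 2 / (4 * x)).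

Definition kern (c v : R) : R :=
  if Rlt_dec 0 v then if Rlt_dec v 1 then hit c (- ln v) else 0 else 0.

(** A primitive of hit(c, x) exp(- q^2 x), found by completing the square in two ways: c^2/(4x) +
    q^2 x equals (c/(2 sqrt x) - q sqrt x)^2 + c q and also (c/(2 sqrt x) + q sqrt x)^2 - c q. It
    gives the Laplace transform of [hit] by evaluation at the ends. *)
Definition hit_prim (c q x : R) : R :=
  ((sqrt PI / 2 - gauss_int (c / (2 * sqrt x) - q * sqrt x)) * exp (- (c * q)) +
   (sqrt PI / 2 - gauss_int (c / (2 * sqrt x) + q * sqrt x)) * exp (c * q)) / sqrt PI.

Lemma sqrt_PI_pos : 0 < sqrt PI.
Proof. apply sqrt_lt_R0, PI_RGT_0. Qed.

Lemma hit_pos c x : 0 < c -> 0 < x -> 0 < hit c x.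
Proof.
  intros Hc Hx. pose proof sqrt_PI_pos. pose proof (sqrt_lt_R0 x Hx). unfold hit.
  apply Rmult_lt_0_compat; [|apply exp_pos]. apply Rdiv_lt_0_compat; [apply Rdiv_lt_0_compat; lra|nra].
Qed.

Lemma is_derive_hit_prim c q x : 0 < x -> is_derive (hit_prim c q) x (hit c x * exp (- q ^ 2 * x)).
Proof.
  intros Hx. pose proof sqrt_PI_pos as Hp. pose proof (sqrt_lt_R0 x Hx) as Hs. pose proof (sqrt_sqrt x ltac:(lra)) as Hss.
  assert (Hz : forall e, is_derive (fun x => c / (2 * sqrt x) + e * sqrt x) x (- c / (4 * (x * sqrt x)) + e / (2 * sqrt x))).
  { intros e. auto_derive; [repeat split; auto; lra|]. set (w := sqrt x) in *. rewrite <- Hss. field. lra. }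
  assert (Hg : forall e, is_derive (fun x => gauss_int (c / (2 * sqrt x) + e * sqrt x)) x
     ((- c / (4 * (x * sqrt x)) + e / (2 * sqrt x)) * exp (- (c / (2 * sqrt x) + e * sqrt x) ^ 2))).
  { intros e. apply (is_derive_comp gauss_int (fun x => c / (2 * sqrt x) + e * sqrt x)); [apply is_derive_gauss_int|apply Hz]. }
  assert (He : forall e, exp (- (c / (2 * sqrt x) + e * sqrt x) ^ 2) = exp (- c ^ 2 / (4 * x)) * exp (- e ^ 2 * x) * exp (- (c * e))).
  { intros e. rewrite <- !exp_plus. f_equal. set (w := sqrt x) in *. rewrite <- Hss. field. lra. }
  set (z := fun e x => c / (2 * sqrt x) + e * sqrt x) in *.
  apply is_derive_ext with (fun x => / sqrt PI * (exp (- (c * q)) * (sqrt PI / 2 - gauss_int (z (- q) x)) + exp (c * q) * (sqrt PI / 2 - gauss_int (z q x)))).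
  { intros t. unfold hit_prim, z. eqR. replace (c / (2 * sqrt t) + - q * sqrt t) with (c / (2 * sqrt t) - q * sqrt t) by ring. field. lra. }
  evar_last.
  - apply is_derive_scal. apply (is_derive_plus (V:=R_NormedModule)).
    + apply is_derive_scal. apply (is_derive_minus (V:=R_NormedModule) (fun _ => sqrt PI / 2)); [apply (is_derive_const (V:=R_NormedModule))|apply Hg].
    + apply is_derive_scal. apply (is_derive_minus (V:=R_NormedModule) (fun _ => sqrt PI / 2)); [apply (is_derive_const (V:=R_NormedModule))|apply Hg].
  - rewrite !He. unfold minus, plus, opp, zero; simpl. unfold hit.
    replace (- (q * (q * 1)) * x) with (- q ^ 2 * x) by ring. replace (- (- q * (- q * 1)) * x) with (- q ^ 2 * x) by ring.
    replace (exp (- (c * - q))) with (exp (c * q)) by (f_equal; ring).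
    assert (E1 : exp (c * q) * exp (- (c * q)) = 1) by (rewrite <- exp_plus, Rplus_opp_r; apply exp_0).
    set (A := exp (c * q)) in *. set (B := exp (- (c * q))) in *. replace (- (c * (c * 1)) / (4 * x)) with (- c ^ 2 / (4 * x)) by (unfold Rdiv; ring).
    set (X := exp (- c ^ 2 / (4 * x))). set (Y := exp (- q ^ 2 * x)).
    (* Both summands carry the same Gaussian factor, so that the terms in q/(2 sqrt x) cancel and
       those in c/(4 x sqrt x) add up. *)
    transitivity (/ sqrt PI * (A * B) * (X * Y) * (c / (2 * (x * sqrt x)))); [field; repeat split; lra|].
    rewrite E1. field. repeat split; lra.
Qed.

Lemma gauss_int_comp_lim (u : nat -> R) : is_lim_seq u p_infty -> is_lim_seq (fun n => gauss_int (u n)) (sqrt PI / 2).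
Proof.
  intros Hu. apply (is_lim_comp_seq gauss_int u p_infty (sqrt PI / 2)); auto.
  - apply gauss_int_lim.
  - exists 0%nat. intros n _. discriminate.
Qed.

Lemma is_lim_seq_lin_infty (u : nat -> R) a b : 0 < a -> (forall n, a * INR n - b <= u n) -> is_lim_seq u p_infty.
Proof.
  intros Ha Hu. apply (is_lim_seq_le_p_loc (fun n => a * INR n - b)); [exists 0%nat; intros; apply Hu|].
  apply is_lim_seq_spec. intros M. destruct (INR_unbounded ((M + b) / a)) as [N HN]. exists N. intros n Hn. apply le_INR in Hn.
  assert ((M + b) / a < INR n) by lra. apply (Rmult_lt_compat_l a) in H; auto. replace (a * ((M + b) / a)) with (M + b) in H by (field; lra). lra.
Qed.

Lemma hit_prim_zero c q : 0 < c -> 0 < q -> is_lim_seq (fun n => hit_prim c q ((/ INR (S n)) ^ 2)) 0.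
Proof.
  intros Hc Hq. pose proof sqrt_PI_pos as Hp.
  assert (Hn : forall n, 1 <= INR (S n)) by (intros; apply (le_INR 1); lia).
  assert (Hin : forall n, 0 < / INR (S n) <= 1).
  { intros n. pose proof (Hn n). split; [apply Rinv_0_lt_compat; lra|]. rewrite <- Rinv_1. apply Rinv_le_contravar; lra. }
  assert (Hl : forall e, Rabs e <= q -> is_lim_seq (fun n => gauss_int (c / (2 * / INR (S n)) + e * / INR (S n))) (sqrt PI / 2)).
  { intros e He. apply gauss_int_comp_lim. apply is_lim_seq_lin_infty with (c/2) q; [lra|]. intros n. pose proof (Hin n). pose proof (Hn n).
    replace (c / (2 * / INR (S n))) with (c / 2 * INR (S n)) by (field; lra). apply Rabs_le_between in He.
    pose proof (S_INR n) as ES. rewrite ES at 1. assert (- q <= e * / INR (S n)) by nra. lra. }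
  apply is_lim_seq_ext with (fun n => ((sqrt PI / 2 - gauss_int (c / (2 * / INR (S n)) + (- q) * / INR (S n))) * exp (- (c * q)) +
     (sqrt PI / 2 - gauss_int (c / (2 * / INR (S n)) + q * / INR (S n))) * exp (c * q)) * / sqrt PI).
  { intros n. unfold hit_prim. pose proof (Hin n). rewrite sqrt_pow2 by lra. unfold Rdiv at 5. f_equal. f_equal. f_equal. f_equal. f_equal. ring. }
  replace (Finite 0) with (Finite (((sqrt PI / 2 - sqrt PI / 2) * exp (- (c * q)) + (sqrt PI / 2 - sqrt PI / 2) * exp (c * q)) * / sqrt PI)) by (f_equal; ring).
  apply (is_lim_seq_mult' _ (fun _ => / sqrt PI)); [|apply is_lim_seq_const].
  apply is_lim_seq_plus'; (apply (is_lim_seq_mult' _ (fun _ => _)); [|apply is_lim_seq_const]); apply is_lim_seq_minus'; try apply is_lim_seq_const; apply Hl.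
  - rewrite Rabs_Ropp, Rabs_pos_eq; lra.
  - rewrite Rabs_pos_eq; lra.
Qed.

Lemma hit_prim_infty c q : 0 < c -> 0 < q -> is_lim_seq (fun n => hit_prim c q (INR (S n) ^ 2)) (exp (- (c * q))).
Proof.
  intros Hc Hq. pose proof sqrt_PI_pos as Hp.
  assert (Hn : forall n, 1 <= INR (S n)) by (intros; apply (le_INR 1); lia).
  assert (H1 : is_lim_seq (fun n => gauss_int (q * INR (S n) - c / (2 * INR (S n)))) (sqrt PI / 2)).
  { apply gauss_int_comp_lim. apply is_lim_seq_lin_infty with q (c/2); [lra|]. intros n. pose proof (Hn n).
    assert (c / (2 * INR (S n)) <= c / 2). { unfold Rdiv. apply Rmult_le_compat_l; [lra|]. apply Rinv_le_contravar; lra. }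
    pose proof (S_INR n) as ES. rewrite ES at 1. nra. }
  assert (H2 : is_lim_seq (fun n => gauss_int (c / (2 * INR (S n)) + q * INR (S n))) (sqrt PI / 2)).
  { apply gauss_int_comp_lim. apply is_lim_seq_lin_infty with q 0; [lra|]. intros n. pose proof (Hn n).
    assert (0 < c / (2 * INR (S n))) by (apply Rdiv_lt_0_compat; lra).
    pose proof (S_INR n) as ES. rewrite ES at 2. nra. }
  apply is_lim_seq_ext with (fun n => ((sqrt PI / 2 + gauss_int (q * INR (S n) - c / (2 * INR (S n)))) * exp (- (c * q)) +
     (sqrt PI / 2 - gauss_int (c / (2 * INR (S n)) + q * INR (S n))) * exp (c * q)) * / sqrt PI).
  { intros n. unfold hit_prim. pose proof (Hn n). rewrite sqrt_pow2 by lra.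
    replace (c / (2 * INR (S n)) - q * INR (S n)) with (- (q * INR (S n) - c / (2 * INR (S n)))) by ring. rewrite gauss_int_odd.
    generalize (gauss_int (q * INR (S n) - c / (2 * INR (S n)))) (gauss_int (c / (2 * INR (S n)) + q * INR (S n))). intros; unfold Rdiv; ring. }
  replace (Finite (exp (- (c * q)))) with (Finite (((sqrt PI / 2 + sqrt PI / 2) * exp (- (c * q)) + (sqrt PI / 2 - sqrt PI / 2) * exp (c * q)) * / sqrt PI)) by (f_equal; field; lra).
  apply (is_lim_seq_mult' _ (fun _ => / sqrt PI)); [|apply is_lim_seq_const].
  apply is_lim_seq_plus'; (apply (is_lim_seq_mult' _ (fun _ => _)); [|apply is_lim_seq_const]).
  - apply is_lim_seq_plus'; [apply is_lim_seq_const|exact H1].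
  - apply is_lim_seq_minus'; [apply is_lim_seq_const|exact H2].
Qed.

Lemma kern_in c v : 0 < v < 1 -> kern c v = hit c (- ln v).
Proof. intros Hv. unfold kern. destruct (Rlt_dec 0 v); [|lra]. destruct (Rlt_dec v 1); [auto|lra]. Qed.

Lemma neg_ln_pos v : 0 < v < 1 -> 0 < - ln v.
Proof. intros Hv. pose proof (ln_increasing v 1 ltac:(lra) ltac:(lra)) as H. rewrite ln_1 in H. lra. Qed.

Lemma kern_nonneg c v : 0 < c -> 0 <= kern c v.
Proof.
  intros Hc. unfold kern. destruct (Rlt_dec 0 v); [|lra]. destruct (Rlt_dec v 1); [|lra].
  left. apply hit_pos; auto. now apply neg_ln_pos.
Qed.

Lemma exp_neg_le_inv_sq u : 0 < u -> exp (- u) <= 4 / u ^ 2.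
Proof.
  intros Hu. rewrite exp_Ropp. replace (4 / u^2) with (/ (u/2)^2) by (field; lra). apply Rinv_le_contravar; [nra|].
  replace (exp u) with (exp (u/2) * exp (u/2)) by (rewrite <- exp_plus; f_equal; field).
  pose proof (exp_ineq1_le (u/2)). nra.
Qed.

Lemma hit_le_sqrt c x : 0 < c -> 0 < x -> hit c x <= 32 / (c ^ 3 * sqrt PI) * sqrt x.
Proof.
  intros Hc Hx. pose proof sqrt_PI_pos as Hp. pose proof (sqrt_lt_R0 x Hx) as Hs. pose proof (sqrt_sqrt x ltac:(lra)) as Hss.
  assert (Hu : 0 < c^2 / (4 * x)) by (apply Rdiv_lt_0_compat; nra).
  pose proof (exp_neg_le_inv_sq _ Hu) as H. unfold hit. replace (- c^2 / (4 * x)) with (- (c^2 / (4 * x))) by (field; lra).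
  apply Rle_trans with (c / (2 * sqrt PI) / (x * sqrt x) * (4 / (c^2 / (4 * x))^2)).
  - apply Rmult_le_compat_l; [|exact H]. apply Rlt_le. apply Rdiv_lt_0_compat; [apply Rdiv_lt_0_compat; lra|nra].
  - right. set (w := sqrt x) in *. rewrite <- Hss. field. repeat split; lra.
Qed.

Lemma hit_le_inv c x : 0 < c -> 1 <= x -> hit c x <= c / (2 * sqrt PI) / x.
Proof.
  intros Hc Hx. pose proof sqrt_PI_pos as Hp. assert (Hs : 1 <= sqrt x) by (rewrite <- sqrt_1; now apply sqrt_le_1_alt).
  unfold hit. assert (Ha : 0 < c / (2 * sqrt PI)) by (apply Rdiv_lt_0_compat; lra).
  assert (He : exp (- c ^ 2 / (4 * x)) <= 1).
  { rewrite <- exp_0. apply exp_mono. assert (0 < c^2 / (4 * x)) by (apply Rdiv_lt_0_compat; nra). unfold Rdiv in *. lra. }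
  apply Rle_trans with (c / (2 * sqrt PI) / (x * sqrt x) * 1).
  - apply Rmult_le_compat_l; [|exact He]. apply Rlt_le, Rdiv_lt_0_compat; nra.
  - rewrite Rmult_1_r. unfold Rdiv at 1 3. apply Rmult_le_compat_l; [lra|]. apply Rinv_le_contravar; nra.
Qed.

Lemma neg_ln_le v : 1/2 <= v < 1 -> - ln v <= 2 * (1 - v).
Proof.
  intros Hv. rewrite <- ln_Rinv by lra. eapply Rle_trans; [apply ln_le_sub, Rinv_0_lt_compat; lra|].
  apply (Rmult_le_reg_r v); [lra|]. rewrite Rmult_minus_distr_r, Rinv_l by lra. nra.
Qed.

(** Only the ends need care: v near 0 means large x, where [hit] is of order 1/x, and v near 1 means
    small x, where the exponential leaves at most a multiple of sqrt x. *)
Lemma kern_cont c v : 0 < c -> continuous (kern c) v.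
Proof.
  intros Hc. pose proof sqrt_PI_pos as Hp. apply continuity_pt_filterlim.
  assert (Hsmall : forall v0, kern c v0 = 0 -> (forall eps, 0 < eps -> exists d, 0 < d /\ forall u, Rabs (u - v0) < d -> kern c u < eps) -> continuity_pt (kern c) v0).
  { intros v0 H0 H eps Heps. destruct (H eps Heps) as [d [Hd Hu]]. exists d. split; auto. intros u [_ Hud]. simpl in *. unfold Rdist in *.
    rewrite H0, Rminus_0_r, Rabs_pos_eq by now apply kern_nonneg. auto. }
  assert (Hout : forall u, u <= 0 \/ 1 <= u -> kern c u = 0).
  { intros u Hu. unfold kern. destruct (Rlt_dec 0 u); auto. destruct (Rlt_dec u 1); auto. lra. }
  destruct (Rlt_le_dec v 0) as [H1|H1]; [|destruct (Rle_lt_dec v 0) as [H2|H2]; [|destruct (Rlt_le_dec v 1) as [H3|H3]; [|destruct (Rle_lt_dec v 1) as [H4|H4]]]].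
  - apply Hsmall; [apply Hout; lra|]. intros eps He. exists (- v). split; [lra|]. intros u Hu. apply Rabs_def2 in Hu. rewrite Hout; lra.
  - replace v with 0 in * by lra. apply Hsmall; [apply Hout; lra|]. intros eps He.
    set (a := c / (2 * sqrt PI)). assert (Ha : 0 < a) by (apply Rdiv_lt_0_compat; lra).
    exists (exp (- (1 + a / eps))). split; [apply exp_pos|]. intros u Hu. rewrite Rminus_0_r in Hu. apply Rabs_def2 in Hu.
    destruct (Rle_lt_dec u 0) as [Hu0|Hu0]; [rewrite Hout; lra|].
    assert (0 < a / eps) by (apply Rdiv_lt_0_compat; lra).
    assert (Hu1 : u < 1). { pose proof (exp_increasing (- (1 + a / eps)) 0 ltac:(lra)) as Hei. rewrite exp_0 in Hei. lra. }
    assert (Hx : 1 + a / eps < - ln u).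
    { destruct Hu as [Hu _]. apply ln_increasing in Hu; auto. rewrite ln_exp in Hu. lra. }
    rewrite kern_in by lra. eapply Rle_lt_trans; [apply hit_le_inv; lra|]. fold a.
    apply (Rmult_lt_reg_r (- ln u)); [lra|]. unfold Rdiv. rewrite Rmult_assoc, Rinv_l, Rmult_1_r by lra.
    apply (Rmult_lt_reg_r (/ eps)); [now apply Rinv_0_lt_compat|]. replace (eps * - ln u * / eps) with (- ln u) by (field; lra). unfold Rdiv in *; lra.
  - apply continuity_pt_filterlim. apply (continuous_ext_loc _ (fun u => hit c (- ln u))).
    + exists (mkposreal (Rmin v (1 - v)) ltac:(apply Rmin_pos; lra)). intros u Hu.
      change (Rabs (u - v) < Rmin v (1 - v)) in Hu. pose proof (Rmin_l v (1 - v)). pose proof (Rmin_r v (1 - v)). apply Rabs_def2 in Hu. symmetry. apply kern_in. lra.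
    + pose proof (neg_ln_pos v ltac:(lra)) as Hx. pose proof (sqrt_lt_R0 _ Hx). apply (ex_derive_continuous (V:=R_NormedModule)). unfold hit.
      auto_derive. repeat split; auto; try lra. apply Rgt_not_eq. nra.
  - replace v with 1 in * by lra. apply Hsmall; [apply Hout; lra|]. intros eps He.
    set (a := 32 / (c ^ 3 * sqrt PI)). assert (Hc3 : 0 < c^3) by (apply pow_lt; auto). assert (Ha : 0 < a) by (apply Rdiv_lt_0_compat; nra).
    assert (Hea : 0 < eps / a) by (apply Rdiv_lt_0_compat; lra).
    exists (Rmin (1/2) ((eps / a)^2 / 2)). split; [apply Rmin_pos; nra|]. intros u Hu.
    pose proof (Rmin_l (1/2) ((eps / a)^2 / 2)). pose proof (Rmin_r (1/2) ((eps / a)^2 / 2)). apply Rabs_def2 in Hu.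
    destruct (Rlt_le_dec u 1) as [Hu1|Hu1]; [|rewrite Hout; lra].
    pose proof (neg_ln_pos u ltac:(lra)) as Hx. pose proof (neg_ln_le u ltac:(lra)) as Hx2.
    rewrite kern_in by lra. eapply Rle_lt_trans; [apply hit_le_sqrt; auto|]. fold a.
    assert (Hsq : sqrt (- ln u) < eps / a). { rewrite <- (sqrt_pow2 (eps / a)) by lra. apply sqrt_lt_1_alt. lra. }
    apply (Rmult_lt_compat_l a) in Hsq; auto. replace (a * (eps / a)) with eps in Hsq by (field; lra). exact Hsq.
  - apply Hsmall; [apply Hout; lra|]. intros eps He. exists (v - 1). split; [lra|]. intros u Hu. apply Rabs_def2 in Hu. rewrite Hout; lra.
Qed.

Lemma pow_exp_ln v i : 0 < v -> v ^ i = exp (INR i * ln v).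
Proof. intros Hv. rewrite <- Rpower_pow by auto. reflexivity. Qed.

Lemma kern_moment_local c i v0 v1 : 0 < c -> 0 < v0 -> v0 <= v1 -> v1 < 1 ->
  is_RInt (fun v => v ^ i * kern c v) v0 v1 (hit_prim c (sqrt (INR i + 1)) (- ln v0) - hit_prim c (sqrt (INR i + 1)) (- ln v1)).
Proof.
  intros Hc H0 H01 H1. set (q := sqrt (INR i + 1)). pose proof (pos_INR i).
  assert (Hq : q ^ 2 = INR i + 1) by (unfold q; rewrite pow2_sqrt; lra).
  replace (hit_prim c q (- ln v0) - hit_prim c q (- ln v1)) with (minus ((fun v => - hit_prim c q (- ln v)) v1) ((fun v => - hit_prim c q (- ln v)) v0)) by (unfold minus, plus, opp; simpl; ring).
  apply (is_RInt_derive (V:=R_CompleteNormedModule) (fun v => - hit_prim c q (- ln v))).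
  - rewrite Rmin_left, Rmax_right by lra. intros v Hv. pose proof (neg_ln_pos v ltac:(lra)) as Hx.
    evar_last.
    + apply (is_derive_opp (V:=R_NormedModule)). apply (is_derive_comp (hit_prim c q) (fun v => - ln v) v (hit c (- ln v) * exp (- q ^ 2 * - ln v)) (- / v)); [now apply is_derive_hit_prim|].
      auto_derive; [lra|]. field. lra.
    + rewrite kern_in by lra. unfold opp, scal; simpl. unfold mult; simpl. replace (- (q * (q * 1)) * - ln v) with (q ^ 2 * ln v) by ring. rewrite Hq, Rmult_plus_distr_r, Rmult_1_l, exp_plus, exp_ln by lra.
      rewrite pow_exp_ln by lra. field. lra.
  - intros v _. apply continuous_mult_R; [|now apply kern_cont]. apply (ex_derive_continuous (V:=R_NormedModule)). auto_derive; auto.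
Qed.

(** [kern] contains no Jacobian 1/v, so the substitution v = exp(-x) leaves a factor exp(-x): the
    i-th moment is the Laplace transform at i + 1. The missing factor is precisely the tilt by
    r^n. *)
Lemma kern_moment c i : 0 < c -> RInt.RInt (fun v => v ^ i * kern c v) 0 1 = exp (- c * sqrt (INR i + 1)).
Proof.
  intros Hc. set (g := fun v => v ^ i * kern c v). set (q := sqrt (INR i + 1)). pose proof (pos_INR i).
  assert (Hq : 0 < q) by (apply sqrt_lt_R0; lra).
  assert (Hg : forall v, continuous g v).
  { intros v. apply continuous_mult_R; [|now apply kern_cont]. apply (ex_derive_continuous (V:=R_NormedModule)). auto_derive; auto. }
  assert (Hex : forall a b, ex_RInt g a b) by (intros; apply (ex_RInt_continuous (V:=R_CompleteNormedModule)); auto).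
  set (v0 := fun n => exp (- INR (S n) ^ 2)). set (v1 := fun n => exp (- (/ INR (S n)) ^ 2)).
  assert (Hn : forall n, 1 <= INR (S n)) by (intros; apply (le_INR 1); lia).
  assert (Hin : forall n, 0 < / INR (S n) <= 1).
  { intros n. pose proof (Hn n). split; [apply Rinv_0_lt_compat; lra|]. rewrite <- Rinv_1. apply Rinv_le_contravar; lra. }
  assert (E : forall n, RInt.RInt g (v0 n) (v1 n) = hit_prim c q (INR (S n) ^ 2) - hit_prim c q ((/ INR (S n)) ^ 2)).
  { intros n. pose proof (Hn n). pose proof (Hin n).
    assert (Hm : is_RInt g (v0 n) (v1 n) (hit_prim c q (- ln (v0 n)) - hit_prim c q (- ln (v1 n)))).
    { apply kern_moment_local; auto; [apply exp_pos| |].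
      - apply exp_mono. nra.
      - unfold v1. rewrite <- exp_0. apply exp_increasing. nra. }
    unfold v0, v1 in *. rewrite !ln_exp, !Ropp_involutive in Hm. apply is_RInt_unique, Hm. }
  assert (L1 : is_lim_seq (fun n => RInt.RInt g (v0 n) (v1 n)) (exp (- (c * q)))).
  { replace (exp (- (c * q))) with (exp (- (c * q)) - 0) by ring.
    apply is_lim_seq_ext with (fun n => hit_prim c q (INR (S n) ^ 2) - hit_prim c q ((/ INR (S n)) ^ 2)); [intros; symmetry; apply E|].
    apply is_lim_seq_minus'; [now apply hit_prim_infty|now apply hit_prim_zero]. }
  assert (Hi : is_lim_seq (fun n => / INR (S n)) 0).
  { apply -> (is_lim_seq_incr_1 (fun n => / INR n)). replace (Finite 0) with (Rbar_inv p_infty) by reflexivity. apply is_lim_seq_inv; [apply is_lim_seq_INR|discriminate]. }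
  assert (Lv1 : is_lim_seq v1 1).
  { replace (Finite 1) with (Finite (exp (- (0 * 0)))) by (f_equal; rewrite Rmult_0_l, Ropp_0; apply exp_0).
    apply (is_lim_seq_continuous exp); [apply derivable_continuous_pt, derivable_pt_exp|]. apply -> (is_lim_seq_opp (fun n => (/ INR (S n)) ^ 2) (Finite (0 * 0))).
    apply is_lim_seq_ext with (fun n => / INR (S n) * / INR (S n)); [intros; simpl; ring|]. apply is_lim_seq_mult'; auto. }
  assert (Lv0 : is_lim_seq v0 0).
  { apply (is_lim_seq_le_le (fun _ => 0) _ (fun n => / INR (S n))); auto using is_lim_seq_const. intros n. pose proof (Hn n). split; [left; apply exp_pos|].
    unfold v0. rewrite exp_Ropp. apply Rinv_le_contravar; [lra|]. pose proof (exp_ineq1_le (INR (S n) ^ 2)). nra. }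
  set (P := fun x => RInt.RInt g 0 x).
  assert (HP : forall x, continuity_pt P x).
  { intros x. apply continuity_pt_filterlim. apply (ex_derive_continuous (V:=R_NormedModule)). exists (g x).
    apply (is_derive_RInt (V:=R_NormedModule) g P 0 x); auto. exists (mkposreal 1 Rlt_0_1). intros y _. apply (RInt_correct (V:=R_CompleteNormedModule)), Hex. }
  assert (L2 : is_lim_seq (fun n => RInt.RInt g (v0 n) (v1 n)) (P 1 - P 0)).
  { apply is_lim_seq_ext with (fun n => P (v1 n) - P (v0 n)).
    - intros n. unfold P. rewrite <- (RInt_Chasles (V:=R_CompleteNormedModule) g 0 (v0 n) (v1 n)) by apply Hex. unfold plus; simpl. ring.
    - apply is_lim_seq_minus'; apply is_lim_seq_continuous; auto. }
  apply is_lim_seq_unique in L1. apply is_lim_seq_unique in L2. rewrite L1 in L2. injection L2. intros E2.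
  unfold P in E2. rewrite (RInt_point (V:=R_CompleteNormedModule) 0 g) in E2. unfold zero in E2; simpl in E2. fold g. fold q.
  replace (- c * q) with (- (c * q)) by ring. symmetry. etransitivity; [exact E2|apply Rminus_0_r].
Qed.

(** From (c - 4 X1)^2 >= 0 the Gaussian is at most exp(4 X1 - 2c), and one exp(-c) pays for the
    polynomial. The other is the factor against which the weights are summable. *)
Lemma cubic_gauss_le c x X1 : 0 < c -> 0 < x <= X1 -> (c + c ^ 3) * exp (- c ^ 2 / (4 * x)) <= 7 * exp (4 * X1) * exp (- c).
Proof.
  intros Hc Hx.
  assert (H1 : exp (- c ^ 2 / (4 * x)) <= exp (4 * X1 - 2 * c)).
  { apply exp_mono. assert (c^2 / (4 * X1) <= c^2 / (4 * x)) by (unfold Rdiv; apply Rmult_le_compat_l; [nra|apply Rinv_le_contravar; lra]).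
    assert (2 * c - 4 * X1 <= c^2 / (4 * X1)).
    { apply (Rmult_le_reg_r (4 * X1)); [lra|]. unfold Rdiv. rewrite Rmult_assoc, Rinv_l by lra. pose proof (pow2_ge_0 (c - 4 * X1)). nra. }
    unfold Rdiv in *. lra. }
  assert (H2 : c + c^3 <= 7 * exp c).
  { pose proof (exp_ineq1_le c).
    assert (Hd : c^3 <= 6 * exp c).
    { pose proof (is_derive_nonneg_le (fun y => exp y - y^3/6) (fun y => exp y - y^2/2) 0 c ltac:(lra)) as Hm.
      assert (H4 : forall y, 0 <= y -> 0 <= exp y - y^2/2).
      { intros y Hy. pose proof (is_derive_nonneg_le (fun y => exp y - y^2/2) (fun y => exp y - y) 0 y Hy) as Hm2. cbv beta in Hm2. rewrite exp_0 in Hm2.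
        enough (1 - 0^2/2 <= exp y - y^2/2) by lra. apply Hm2; intros z Hz; [auto_derive; auto; field|pose proof (exp_ineq1_le z); lra]. }
      cbv beta in Hm. rewrite exp_0 in Hm. enough (1 - 0^3/6 <= exp c - c^3/6) by lra.
      apply Hm; intros z Hz; [auto_derive; auto; field|apply H4; lra]. }
    lra. }
  apply Rle_trans with (7 * exp c * exp (4 * X1 - 2 * c)).
  - apply Rmult_le_compat; auto; [|left; apply exp_pos]. assert (0 < c^3) by (apply pow_lt; auto). lra.
  - right. rewrite !Rmult_assoc. f_equal. rewrite <- !exp_plus. f_equal. ring.
Qed.

(** One constant for all c, up to exp(-c), so that bounds and Lipschitz estimates survive summation
    over the rates. *)
Lemma hit_regular X0 X1 : 0 < X0 <= X1 -> exists C, 0 < C /\ forall c, 0 < c ->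
  (forall x, X0 <= x <= X1 -> hit c x <= C * exp (- c)) /\
  (forall x y, X0 <= x <= X1 -> X0 <= y <= X1 -> Rabs (hit c x - hit c y) <= C * exp (- c) * Rabs (x - y)).
Proof.
  intros HX. pose proof sqrt_PI_pos as Hp. assert (Hs0 : 0 < sqrt X0) by (apply sqrt_lt_R0; lra).
  set (B := 7 * exp (4 * X1)). assert (HB : 0 < B) by (unfold B; pose proof (exp_pos (4 * X1)); lra).
  set (k := / (2 * sqrt PI)). assert (Hk : 0 < k) by (apply Rinv_0_lt_compat; lra).
  set (m1 := / (X0 * sqrt X0)). set (m2 := / (X0^2 * sqrt X0)). set (m3 := / (X0^3 * sqrt X0)).
  assert (Hm1 : 0 < m1) by (apply Rinv_0_lt_compat; nra). assert (H2p : 0 < X0^2) by nra. assert (H3p : 0 < X0^3) by (apply pow_lt; lra).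
  assert (Hm2 : 0 < m2) by (apply Rinv_0_lt_compat; nra). assert (Hm3 : 0 < m3) by (apply Rinv_0_lt_compat; nra).
  exists (k * (m1 + 2 * m2 + m3) * B). split; [apply Rmult_lt_0_compat; [apply Rmult_lt_0_compat|]; lra|].
  intros c Hc.
  assert (Hsx : forall x, X0 <= x -> sqrt X0 <= sqrt x) by (intros; apply sqrt_le_1_alt; auto).
  assert (Hc3 : 0 < c^3) by (apply pow_lt; auto).
  split.
  - intros x Hx. pose proof (cubic_gauss_le c x X1 Hc ltac:(lra)) as HG. fold B in HG. pose proof (Hsx x ltac:(lra)).
    set (e := exp (- c ^ 2 / (4 * x))) in *. assert (He : 0 < e) by apply exp_pos. pose proof (exp_pos (- c)).
    assert (Hi : / (x * sqrt x) <= m1) by (apply Rinv_le_contravar; [nra|apply Rmult_le_compat; lra]).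
    assert (Hi0 : 0 < / (x * sqrt x)) by (apply Rinv_0_lt_compat; nra).
    unfold hit. fold e. replace (c / (2 * sqrt PI) / (x * sqrt x) * e) with (k * / (x * sqrt x) * (c * e)) by (unfold k; field; repeat split; nra).
    apply Rle_trans with (k * m1 * (B * exp (- c))).
    + apply Rmult_le_compat; [nra|nra|apply Rmult_le_compat_l; lra|]. eapply Rle_trans; [|exact HG]. apply Rmult_le_compat_r; lra.
    + replace (k * (m1 + 2 * m2 + m3) * B * exp (- c)) with (k * (m1 + 2 * m2 + m3) * (B * exp (-c))) by ring.
      apply Rmult_le_compat_r; [nra|]. apply Rmult_le_compat_l; lra.
  - assert (Hd : forall z, X0 <= z <= X1 -> is_derive (hit c) z (k * c * exp (- c ^ 2 / (4 * z)) * (- (3/2) * / (z^2 * sqrt z) + c^2 / 4 * / (z^3 * sqrt z)))).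
    { intros z Hz. pose proof (Hsx z ltac:(lra)). assert (Hsz : 0 < sqrt z) by lra. pose proof (sqrt_sqrt z ltac:(lra)) as Hss. unfold hit.
      auto_derive; [repeat split; auto; try lra; apply Rgt_not_eq; nra|].
      replace (- c ^ 2 * / (4 * z)) with (- c ^ 2 / (4 * z)) by reflexivity. replace (- (c * (c * 1)) * / (4 * z)) with (- c ^ 2 / (4 * z)) by (unfold Rdiv; ring).
      set (e := exp _). unfold k. set (w := sqrt z) in *. rewrite <- Hss. field. repeat split; lra. }
    intros x y Hx Hy. rewrite Rabs_minus_sym, (Rabs_minus_sym x). apply (is_derive_bounded (hit c) (fun z => k * c * exp (- c ^ 2 / (4 * z)) * (- (3/2) * / (z^2 * sqrt z) + c^2 / 4 * / (z^3 * sqrt z)))).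
    + intros z Hz. apply Hd. revert Hz. unfold Rmin, Rmax. destruct (Rle_dec x y); lra.
    + intros z Hz. assert (Hz' : X0 <= z <= X1) by (revert Hz; unfold Rmin, Rmax; destruct (Rle_dec x y); lra).
      pose proof (cubic_gauss_le c z X1 Hc ltac:(lra)) as HG. fold B in HG. pose proof (Hsx z ltac:(lra)).
      set (e := exp (- c ^ 2 / (4 * z))) in *. assert (He : 0 < e) by apply exp_pos. pose proof (exp_pos (- c)).
      assert (Hz2 : X0^2 <= z^2) by (apply pow_incr; lra). assert (Hz3 : X0^3 <= z^3) by (apply pow_incr; lra).
      assert (Hi2 : / (z^2 * sqrt z) <= m2) by (apply Rinv_le_contravar; [nra|apply Rmult_le_compat; lra]).
      assert (Hi3 : / (z^3 * sqrt z) <= m3) by (apply Rinv_le_contravar; [nra|apply Rmult_le_compat; lra]).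
      assert (Hj2 : 0 < / (z^2 * sqrt z)) by (apply Rinv_0_lt_compat; nra). assert (Hj3 : 0 < / (z^3 * sqrt z)) by (apply Rinv_0_lt_compat; nra).
      set (i2 := / (z^2 * sqrt z)) in *. set (i3 := / (z^3 * sqrt z)) in *.
      apply Rle_trans with (k * (2 * m2 + m3) * ((c + c^3) * e)).
      * rewrite Rabs_mult, (Rabs_pos_eq (k * c * e)) by (apply Rmult_le_pos; [nra|lra]).
        assert (Hab : Rabs (- (3/2) * i2 + c^2/4 * i3) <= (2 * m2 + m3) * (1 + c^2)) by (apply Rabs_le; split; nra).
        replace (k * (2 * m2 + m3) * ((c + c ^ 3) * e)) with (k * c * e * ((2 * m2 + m3) * (1 + c^2))) by ring.
        apply Rmult_le_compat_l; [apply Rmult_le_pos; [nra|lra]|exact Hab].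
      * replace (k * (m1 + 2 * m2 + m3) * B * exp (- c)) with (k * (m1 + 2 * m2 + m3) * (B * exp (-c))) by ring.
        apply Rmult_le_compat; [nra|apply Rmult_le_pos; nra|apply Rmult_le_compat_l; lra|exact HG].
Qed.

Lemma kern_regular v0 v1 : 0 < v0 -> v0 <= v1 -> v1 < 1 -> exists C, 0 < C /\ forall c, 0 < c ->
  (forall v, v0 <= v <= v1 -> kern c v <= C * exp (- c)) /\
  (forall u v, v0 <= u <= v1 -> v0 <= v <= v1 -> Rabs (kern c u - kern c v) <= C * exp (- c) * Rabs (u - v)).
Proof.
  intros H0 H01 H1.
  assert (Hm : forall v, v0 <= v <= v1 -> - ln v1 <= - ln v <= - ln v0).
  { intros v Hv. pose proof (ln_le v v1 ltac:(lra) ltac:(lra)). pose proof (ln_le v0 v ltac:(lra) ltac:(lra)). lra. }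
  pose proof (neg_ln_pos v1 ltac:(lra)) as Hp. pose proof (Hm v0 ltac:(lra)).
  destruct (hit_regular (- ln v1) (- ln v0) ltac:(lra)) as [C [HC Hr]].
  exists (C + C / v0). assert (HCv : 0 < C / v0) by (apply Rdiv_lt_0_compat; lra). split; [lra|]. intros c Hc. destruct (Hr c Hc) as [R1 R2].
  pose proof (exp_pos (- c)). split.
  - intros v Hv. rewrite kern_in by lra. eapply Rle_trans; [apply R1, Hm, Hv|]. apply Rmult_le_compat_r; lra.
  - intros u v Hu Hv. rewrite !kern_in by lra. eapply Rle_trans; [apply R2; apply Hm; auto|].
    replace (- ln u - - ln v) with (- (ln u - ln v)) by ring. rewrite Rabs_Ropp.
    pose proof (ln_ratio_bound u v v0 H0 ltac:(lra) ltac:(lra)) as Hl. pose proof (Rabs_pos (u - v)).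
    apply Rle_trans with (C * exp (- c) * (Rabs (u - v) / v0)); [apply Rmult_le_compat_l; [nra|exact Hl]|].
    replace (C * exp (- c) * (Rabs (u - v) / v0)) with (C / v0 * (exp (- c) * Rabs (u - v))) by (field; lra).
    rewrite (Rmult_assoc (C + C / v0)). apply Rmult_le_compat_r; [nra|lra].
Qed.

Lemma cont_bounded_01 (g : R -> R) : (forall x, continuous g x) -> exists B, forall y, 0 <= y <= 1 -> Rabs (g y) <= B.
Proof.
  intros Hg. destruct (continuity_ab_maj (fun y => Rabs (g y)) 0 1 ltac:(lra)) as [M [HM _]].
  - intros c _. apply continuity_pt_filterlim. apply (continuous_comp g Rabs); auto. apply continuous_Rabs.
  - exists (Rabs (g M)). exact HM.
Qed.

(** * The limit law and its density *)

Section LimitFunctional.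
Variables (theta b : R).
Hypothesis Htheta : 0 < theta.
Hypothesis Hb : 0 < b.

Let A := weight theta b.
Let c := rate theta b.

Let HA n : 0 < A n.
Proof. now apply weight_pos. Qed.
Let Hc n : 0 < c n.
Proof. now apply rate_pos. Qed.

(** The value psi(1) = 1, that is, total mass one; it is the summable majorant behind the series in
    n of this section. *)
Lemma weight_series : is_series (fun n => A n * exp (- c n)) 1.
Proof.
  pose proof (psi_series theta b 1 Htheta Hb Rlt_0_1) as H.
  assert (E : psi theta b 1 = 1). { unfold psi. rewrite sqrt_1, Rmult_1_r, Rminus_diag, Rmult_0_r. apply exp_0. }
  rewrite E in H. apply is_series_ext with (2 := H). intros n. rewrite sqrt_1, Rmult_1_r. reflexivity.
Qed.

Definition kern_int (g : R -> R) (n : nat) : R := RInt.RInt (fun v => g v * kern (c n) v) 0 1.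

Definition limit_functional (g : R -> R) : R := Series (fun n => A n * kern_int g n).

Lemma kern_int_correct g n : (forall x, continuous g x) -> is_RInt (fun v => g v * kern (c n) v) 0 1 (kern_int g n).
Proof.
  intros Hg. apply (RInt_correct (V:=R_CompleteNormedModule)), (ex_RInt_continuous (V:=R_CompleteNormedModule)).
  intros x _. apply continuous_mult_R; auto. apply kern_cont, Hc.
Qed.

Lemma kern_int_bound g B n : (forall x, continuous g x) -> (forall y, 0 <= y <= 1 -> Rabs (g y) <= B) -> Rabs (kern_int g n) <= B * exp (- c n).
Proof.
  intros Hg HB.
  assert (Hm : is_RInt (fun v => B * kern (c n) v) 0 1 (B * exp (- c n))).
  { apply is_RInt_scalR. pose proof (kern_moment (c n) 0 (Hc n)) as Hk. rewrite Rplus_0_l, sqrt_1, Rmult_1_r in Hk. rewrite <- Hk.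
    apply is_RInt_ext with (fun v => v ^ 0 * kern (c n) v); [intros; eqR; simpl; ring|].
    apply (RInt_correct (V:=R_CompleteNormedModule)), (ex_RInt_continuous (V:=R_CompleteNormedModule)).
    intros x _. apply continuous_mult_R; [apply (continuous_const 1)|apply kern_cont, Hc]. }
  apply (norm_RInt_le (V:=R_NormedModule) (fun v => g v * kern (c n) v) (fun v => B * kern (c n) v) 0 1); auto; [lra| |now apply kern_int_correct].
  intros y Hy. change (Rabs (g y * kern (c n) y) <= B * kern (c n) y). pose proof (kern_nonneg (c n) y (Hc n)).
  rewrite Rabs_mult, (Rabs_pos_eq (kern _ _)) by auto. apply Rmult_le_compat_r; auto.
Qed.

Lemma limit_functional_ex g B : (forall x, continuous g x) -> (forall y, 0 <= y <= 1 -> Rabs (g y) <= B) ->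
  ex_series (fun n => A n * kern_int g n) /\ Rabs (limit_functional g) <= B.
Proof.
  intros Hg HB.
  assert (Ht : forall n, Rabs (A n * kern_int g n) <= B * (A n * exp (- c n))).
  { intros n. rewrite Rabs_mult, Rabs_pos_eq by (left; apply HA). pose proof (kern_int_bound g B n Hg HB). pose proof (HA n). nra. }
  assert (Hs : is_series (fun n => B * (A n * exp (- c n))) (B * 1)) by (apply (is_series_scal (V:=R_NormedModule) B _ 1), weight_series).
  assert (Hex : ex_series (fun n => Rabs (A n * kern_int g n))).
  { apply (ex_series_le (V:=R_CompleteNormedModule) _ (fun n => B * (A n * exp (- c n)))); [|eexists; exact Hs].
    intros n. change (Rabs (Rabs (A n * kern_int g n)) <= B * (A n * exp (- c n))). rewrite Rabs_Rabsolu. apply Ht. }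
  split; [now apply ex_series_Rabs|].
  eapply Rle_trans; [apply Series_Rabs, Hex|]. replace B with (B * 1) by ring. rewrite <- (is_series_unique _ _ Hs).
  apply Series_le; [|eexists; exact Hs]. intros n. split; [apply Rabs_pos|apply Ht].
Qed.

Lemma limit_functional_lin f g x y : (forall z, continuous f z) -> (forall z, continuous g z) ->
  limit_functional (fun v => x * f v + y * g v) = x * limit_functional f + y * limit_functional g.
Proof.
  intros Hf Hg. destruct (cont_bounded_01 f Hf) as [B1 HB1]. destruct (cont_bounded_01 g Hg) as [B2 HB2].
  destruct (limit_functional_ex f B1 Hf HB1) as [E1 _]. destruct (limit_functional_ex g B2 Hg HB2) as [E2 _].
  unfold limit_functional. rewrite <- !Series_scal_l, <- Series_plus.
  - apply Series_ext. intros n.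
    replace (kern_int (fun v => x * f v + y * g v) n) with (x * kern_int f n + y * kern_int g n); [ring|].
    symmetry. apply is_RInt_unique. apply is_RInt_ext with (fun v => x * (f v * kern (c n) v) + y * (g v * kern (c n) v)); [intros; eqR; ring|].
    apply is_RInt_plusR; apply is_RInt_scalR; now apply kern_int_correct.
  - now apply (ex_series_scal (V:=R_NormedModule) x).
  - now apply (ex_series_scal (V:=R_NormedModule) y).
Qed.

Lemma limit_functional_pow i : limit_functional (fun v => v ^ i) = psi theta b (INR (S i)).
Proof.
  apply is_series_unique. pose proof (psi_series theta b (INR (S i)) Htheta Hb ltac:(apply lt_0_INR; lia)) as H.
  apply is_series_ext with (2 := H). intros n. fold (A n) (c n). unfold kern_int. rewrite (kern_moment (c n) i (Hc n)), <- S_INR. reflexivity.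
Qed.

Definition limit_density (x : R) : R := Series (fun n => A n * hit (c n) x).

(** Bounds and Lipschitz estimates come from [hit_regular] summed by [weight_series]. The lower
    bound is what later permits a relative error. *)
Lemma limit_density_regular X0 X1 : 0 < X0 <= X1 -> exists C, 0 < C /\
  (forall x, X0 <= x <= X1 -> is_series (fun n => A n * hit (c n) x) (limit_density x) /\ limit_density x <= C) /\
  (forall x y, X0 <= x <= X1 -> X0 <= y <= X1 -> Rabs (limit_density x - limit_density y) <= C * Rabs (x - y)) /\
  (exists m, 0 < m /\ forall x, X0 <= x <= X1 -> m <= limit_density x).
Proof.
  intros HX. destruct (hit_regular X0 X1 HX) as [C [HC Hr]]. exists C. split; auto.
  assert (Hs : is_series (fun n => C * (A n * exp (- c n))) (C * 1)) by (apply (is_series_scal (V:=R_NormedModule) C _ 1), weight_series).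
  assert (Ht : forall x n, X0 <= x <= X1 -> 0 <= A n * hit (c n) x <= C * (A n * exp (- c n))).
  { intros x n Hx. pose proof (HA n). pose proof (hit_pos (c n) x (Hc n) ltac:(lra)). destruct (Hr (c n) (Hc n)) as [R1 _]. specialize (R1 x Hx). split; nra. }
  assert (Hex : forall x, X0 <= x <= X1 -> ex_series (fun n => A n * hit (c n) x)).
  { intros x Hx. apply (ex_series_le (V:=R_CompleteNormedModule) _ (fun n => C * (A n * exp (- c n)))); [|eexists; exact Hs].
    intros n. change (Rabs (A n * hit (c n) x) <= C * (A n * exp (- c n))). rewrite Rabs_pos_eq; apply Ht, Hx. }
  assert (Hle : forall x, X0 <= x <= X1 -> limit_density x <= C).
  { intros x Hx. replace C with (C * 1) by ring. rewrite <- (is_series_unique _ _ Hs). apply Series_le; [|eexists; exact Hs]. intros n. apply Ht, Hx. }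
  split; [intros x Hx; split; [apply Series_correct, Hex, Hx|apply Hle, Hx]|]. split.
  - intros x y Hx Hy. unfold limit_density. rewrite <- Series_minus by auto.
    assert (Hs2 : is_series (fun n => Rabs (x - y) * (C * (A n * exp (- c n)))) (Rabs (x - y) * (C * 1))) by (apply (is_series_scal (V:=R_NormedModule) (Rabs (x - y)) _ (C * 1)), Hs).
    assert (Ht2 : forall n, Rabs (A n * hit (c n) x - A n * hit (c n) y) <= Rabs (x - y) * (C * (A n * exp (- c n)))).
    { intros n. rewrite <- Rmult_minus_distr_l, Rabs_mult, (Rabs_pos_eq (A n)) by (left; apply HA). destruct (Hr (c n) (Hc n)) as [_ R2]. specialize (R2 x y Hx Hy).
      pose proof (HA n). nra. }
    assert (Hex2 : ex_series (fun n => Rabs (A n * hit (c n) x - A n * hit (c n) y))).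
    { apply (ex_series_le (V:=R_CompleteNormedModule) _ (fun n => Rabs (x - y) * (C * (A n * exp (- c n))))); [|eexists; exact Hs2].
      intros n. change (Rabs (Rabs (A n * hit (c n) x - A n * hit (c n) y)) <= Rabs (x - y) * (C * (A n * exp (- c n)))). rewrite Rabs_Rabsolu. apply Ht2. }
    eapply Rle_trans; [apply Series_Rabs, Hex2|]. replace (C * Rabs (x - y)) with (Rabs (x - y) * (C * 1)) by ring. rewrite <- (is_series_unique _ _ Hs2).
    apply Series_le; [|eexists; exact Hs2]. intros n. split; [apply Rabs_pos|apply Ht2].
  - pose proof sqrt_PI_pos as Hp. assert (Hs1 : 0 < sqrt X1) by (apply sqrt_lt_R0; lra).
    (* All terms being positive, the first one suffices; its power of x is smallest at [X1] and its
       exponential at [X0]. *)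
    exists (A 0%nat * (c 0%nat / (2 * sqrt PI) / (X1 * sqrt X1) * exp (- c 0%nat ^ 2 / (4 * X0)))). split.
    + apply Rmult_lt_0_compat; [apply HA|]. apply Rmult_lt_0_compat; [|apply exp_pos]. apply Rdiv_lt_0_compat; [apply Rdiv_lt_0_compat; [apply Hc|lra]|nra].
    + intros x Hx. apply Rle_trans with (A 0%nat * hit (c 0%nat) x).
      * apply Rmult_le_compat_l; [left; apply HA|]. unfold hit. pose proof (Hc 0%nat). assert (0 < sqrt x) by (apply sqrt_lt_R0; lra). assert (sqrt x <= sqrt X1) by (apply sqrt_le_1_alt; lra).
        apply Rmult_le_compat; [apply Rlt_le; apply Rdiv_lt_0_compat; [apply Rdiv_lt_0_compat; lra|nra]|left; apply exp_pos| |].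
        -- unfold Rdiv at 1 3. apply Rmult_le_compat_l; [apply Rlt_le, Rdiv_lt_0_compat; lra|]. apply Rinv_le_contravar; [nra|apply Rmult_le_compat; lra].
        -- apply exp_mono. assert (0 < c 0%nat ^ 2) by nra. unfold Rdiv. assert (/ (4 * x) <= / (4 * X0)) by (apply Rinv_le_contravar; lra). nra.
      * pose proof (psum_le_series (fun n => A n * hit (c n) x) (limit_density x) 1) as H. simpl psum in H. rewrite Rplus_0_l in H. apply H; [intros; apply Ht; auto|apply Series_correct, Hex, Hx].
Qed.
End LimitFunctional.

(** * Local limit theorem *)

Lemma one_minus_ge_exp x : 0 <= x <= 1/2 -> exp (- (2 * x)) <= 1 - x.
Proof.
  intros Hx. rewrite exp_Ropp. pose proof (exp_ineq1_le (2 * x)). rewrite <- (Rinv_inv (1 - x)). apply Rinv_le_contravar; [apply Rinv_0_lt_compat; lra|].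
  apply Rle_trans with (1 + 2 * x); auto. apply (Rmult_le_reg_r (1 - x)); [lra|]. rewrite Rinv_l by lra. nra.
Qed.

Lemma radius_pow_bounds L k : 2 <= L -> exp (- (2 * (INR k / L ^ 2))) <= radius L ^ k <= exp (- (INR k / L ^ 2)).
Proof.
  intros HL. pose proof (radius_bounds L HL) as Hr. assert (HL2 : 4 <= L^2) by nra.
  set (x := / L^2). assert (Hx : 0 < x <= 1/4). { split; [apply Rinv_0_lt_compat; lra|]. replace (1/4) with (/4) by field. apply Rinv_le_contravar; lra. }
  assert (Er : radius L = 1 - x) by reflexivity.
  assert (Hpw : forall y, exp (y) ^ k = exp (INR k * y)).
  { intros y. rewrite pow_exp_ln by apply exp_pos. rewrite ln_exp. reflexivity. }
  split.
  - replace (- (2 * (INR k / L^2))) with (INR k * (- (2 * x))) by (unfold x; field; lra). rewrite <- Hpw. apply pow_incr. split; [left; apply exp_pos|]. rewrite Er. apply one_minus_ge_exp. lra.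
  - replace (- (INR k / L^2)) with (INR k * (- x)) by (unfold x; field; lra). rewrite <- Hpw. apply pow_incr. split; [lra|]. rewrite Er. pose proof (exp_ineq1_le (- x)). lra.
Qed.

Definition tent (y0 k y : R) : R := Rmax 0 (1 - Rabs (y - y0) / k).

Lemma tent_bounds y0 k y : 0 < k -> 0 <= tent y0 k y <= 1.
Proof.
  intros Hk. unfold tent. split; [apply Rmax_l|]. apply Rmax_lub; [lra|].
  assert (0 <= Rabs (y - y0) / k) by (apply Rmult_le_pos; [apply Rabs_pos|left; now apply Rinv_0_lt_compat]). lra.
Qed.

Lemma tent_support y0 k y : 0 < k -> k < Rabs (y - y0) -> tent y0 k y = 0.
Proof.
  intros Hk Hy. unfold tent. apply Rmax_left. assert (1 <= Rabs (y - y0) / k); [|lra].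
  apply (Rmult_le_reg_r k); auto. unfold Rdiv. rewrite Rmult_assoc, Rinv_l; lra.
Qed.

Lemma tent_lip y0 k u v : 0 < k -> Rabs (tent y0 k u - tent y0 k v) <= / k * Rabs (u - v).
Proof.
  intros Hk. assert (Hm : forall x y, Rabs (Rmax 0 x - Rmax 0 y) <= Rabs (x - y)).
  { intros x y. unfold Rmax. destruct (Rle_dec 0 x), (Rle_dec 0 y); unfold Rabs; repeat destruct (Rcase_abs _); lra. }
  unfold tent. eapply Rle_trans; [apply Hm|].
  replace (1 - Rabs (u - y0) / k - (1 - Rabs (v - y0) / k)) with (/ k * (Rabs (v - y0) - Rabs (u - y0))) by (field; lra).
  assert (0 < / k) by (now apply Rinv_0_lt_compat). rewrite Rabs_mult, (Rabs_pos_eq (/ k)) by lra. apply Rmult_le_compat_l; [lra|].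
  eapply Rle_trans; [apply Rabs_triang_inv2|]. replace (v - y0 - (u - y0)) with (- (u - v)) by ring. rewrite Rabs_Ropp. lra.
Qed.

Lemma tent_cont y0 k x : 0 < k -> continuous (tent y0 k) x.
Proof.
  intros Hk. apply continuity_pt_filterlim. intros e He. exists (e * k). split; [nra|]. intros z [_ Hz]. simpl in *. unfold Rdist in *.
  eapply Rle_lt_trans; [now apply tent_lip|]. apply (Rmult_lt_reg_l k); auto. rewrite <- Rmult_assoc, Rinv_r, Rmult_1_l by lra. lra.
Qed.

(** The nodes r^k are those at which the tilted distribution evaluates test functions. No cell is
    longer than 1 - r, and the cells add up to 1 - r^M. *)
Lemma riemann_geometric (f : R -> R) Kf r M : 0 < r < 1 -> 0 <= Kf -> (forall x, continuous f x) -> (forall u v, Rabs (f u - f v) <= Kf * Rabs (u - v)) ->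
  Rabs (psum (fun k => f (r ^ k) * (r ^ k - r ^ S k)) M - RInt.RInt f (r ^ M) 1) <= Kf * (1 - r) * (1 - r ^ M).
Proof.
  intros Hr HK Hc HL.
  assert (Hex : forall a b, ex_RInt f a b) by (intros; apply (ex_RInt_continuous (V:=R_CompleteNormedModule)); auto).
  induction M.
  - simpl. rewrite (RInt_point (V:=R_CompleteNormedModule)). unfold zero; simpl. rewrite !Rminus_diag, Rabs_R0. lra.
  - rewrite psum_S. assert (EC : RInt.RInt f (r ^ S M) 1 = RInt.RInt f (r ^ S M) (r ^ M) + RInt.RInt f (r ^ M) 1) by (symmetry; apply (RInt_Chasles (V:=R_CompleteNormedModule)); apply Hex).
    rewrite EC.
    set (v := r ^ M) in *. assert (Hv : 0 < v <= 1). { unfold v. split; [apply pow_lt; lra|]. rewrite <- (pow1 M). apply pow_incr; lra. }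
    replace (r ^ S M) with (r * v) by reflexivity. set (w := r * v). assert (Hw : w <= v) by (unfold w; nra).
    assert (Hone : Rabs (f v * (v - w) - RInt.RInt f w v) <= Kf * (1 - r) * (v - w)).
    { assert (Hi : is_RInt (fun t => f v + (-1) * f t) w v (f v * (v - w) - RInt.RInt f w v)).
      { replace (f v * (v - w) - RInt.RInt f w v) with ((v - w) * f v + (-1) * RInt.RInt f w v) by ring.
        apply is_RInt_plusR; [apply is_RInt_constR|]. apply is_RInt_scalR, (RInt_correct (V:=R_CompleteNormedModule)), Hex. }
      replace (Kf * (1 - r) * (v - w)) with ((v - w) * (Kf * (1 - r))) by ring.
      apply (norm_RInt_le (V:=R_NormedModule) (fun t => f v + (-1) * f t) (fun _ => Kf * (1 - r)) w v); auto; [|apply is_RInt_constR].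
      intros t Ht. change (Rabs (f v + -1 * f t) <= Kf * (1 - r)). replace (f v + -1 * f t) with (f v - f t) by ring.
      eapply Rle_trans; [apply HL|]. apply Rmult_le_compat_l; auto. rewrite Rabs_pos_eq by lra. unfold w in Ht. nra. }
    apply Rabs_le_between in Hone. apply Rabs_le_between in IHM. apply Rabs_le.
    lra.
Qed.

Section LocalLimit.
Variables (phi D1 D2 : R -> R) (K : R).
Hypothesis Hphi : smooth_density phi D1 D2 K.
Variable theta : R.
Hypothesis Htheta : 0 < theta.

Definition tilted (L : R) (k : nat) : R := H phi theta L k * radius L ^ k / exp (G phi theta L (radius L)).

(** Tilting multiplies the kernel at lag j by r^j. The kernel step splits into the step of W,
    bounded by [W_step], and a damping term (1 - r) W, which accounts for the summand in L^-2 of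
    [rn_step]. *)
Lemma tilted_renewal : exists C, 0 < C /\ forall L, 2 <= L -> renewal L C (fun j => W phi theta L (S j) * radius L ^ S j) (tilted L).
Proof.
  destruct (W_bound phi D1 D2 K Hphi theta Htheta) as [C1 [HC1 HW]]. destruct (W_step phi D1 D2 K Hphi theta Htheta) as [C2 [HC2 HS]].
  exists (C1 + C2). split; [lra|]. intros L HL. assert (HL0 : 0 < L) by lra. pose proof (radius_bounds L HL) as Hr. set (r := radius L) in *.
  assert (Hp : forall n, 0 < r ^ n <= 1). { intros n. split; [apply pow_lt; lra|]. rewrite <- (pow1 n). apply pow_incr; lra. }
  assert (HW0 : forall j, 0 <= W phi theta L (S j)) by (intros; eapply W_nonneg; eauto).
  assert (Hsq : forall m, (1 <= m)%nat -> 0 < sqrt (INR m)) by (intros; apply sqrt_lt_R0, lt_0_INR; lia).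
  pose proof (exp_pos (G phi theta L r)) as HZ. unfold tilted. fold r. set (Z := exp (G phi theta L r)) in *.
  split.
  - intros n. apply Rmult_le_pos; [|left; now apply Rinv_0_lt_compat]. apply Rmult_le_pos; [eapply H_nonneg; eauto|left; apply Hp].
  - intros n. rewrite (psum_ext _ (fun k => / Z * (H phi theta L k * r ^ k))) by (intros; unfold Rdiv; ring). rewrite psum_scal.
    pose proof (psum_le_series (fun k => H phi theta L k * r ^ k) Z n) as Hs. apply (Rmult_le_reg_l Z); auto. rewrite <- Rmult_assoc, Rinv_r by lra.
    rewrite Rmult_1_l, Rmult_1_r. apply Hs.
    + intros i. apply Rmult_le_pos; [eapply H_nonneg; eauto|left; apply Hp].
    + eapply H_gen; eauto. lra.
  - intros n. unfold Rdiv. replace (INR (S n) * (H phi theta L (S n) * r ^ S n * / Z)) with (INR (S n) * H phi theta L (S n) * (r ^ S n * / Z)) by ring.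
    rewrite (H_rec phi D1 D2 K Hphi theta Htheta L HL0), Rmult_comm, <- psum_scal. apply psum_ext. intros j Hj.
    replace (r ^ S n) with (r ^ S j * r ^ (n - j)) by (rewrite <- pow_add; f_equal; lia). ring.
  - intros j. pose proof (HW0 j). pose proof (Hp (S j)). pose proof (HW L (S j) HL0 ltac:(lia)).
    assert (0 < L / sqrt (INR (S j))) by (apply Rdiv_lt_0_compat; [lra|apply Hsq; lia]). set (y := L / sqrt (INR (S j))) in *.
    split; [nra|]. apply Rle_trans with (W phi theta L (S j)); [nra|]. nra.
  - intros j m Hm Hj. pose proof (HS L (S j) m HL0 Hm Hj) as Hst. pose proof (Hp (S j)). pose proof (Hp (S (S j))).
    pose proof (HW L (S j) HL0 ltac:(lia)) as Hw. pose proof (HW0 j).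
    assert (Hm0 : 0 < INR m) by (apply lt_0_INR; lia). pose proof (Hsq m Hm) as Hsm.
    assert (Hy : L / sqrt (INR (S j)) <= L / sqrt (INR m)).
    { unfold Rdiv. apply Rmult_le_compat_l; [lra|]. apply Rinv_le_contravar; auto. apply sqrt_le_1_alt, le_INR. lia. }
    assert (0 < L / sqrt (INR m)) by (apply Rdiv_lt_0_compat; lra).
    assert (0 < L / sqrt (INR (S j))) by (apply Rdiv_lt_0_compat; [lra|apply Hsq; lia]).
    assert (HL2 : 0 < / L^2) by (apply Rinv_0_lt_compat; nra).
    assert (HB : 0 <= L / (INR m * sqrt (INR m))) by (apply Rlt_le, Rdiv_lt_0_compat; nra).
    replace (W phi theta L (S (S j)) * r ^ S (S j) - W phi theta L (S j) * r ^ S j) with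
      (r ^ S (S j) * (W phi theta L (S (S j)) - W phi theta L (S j)) - / L^2 * (r ^ S j * W phi theta L (S j))).
    2:{ replace (/ L^2) with (1 - r) by (unfold r, radius; ring). simpl. ring. }
    unfold Rminus at 1. eapply Rle_trans; [apply Rabs_triang|]. rewrite Rabs_Ropp, !Rabs_mult, (Rabs_pos_eq (r ^ S (S j))), (Rabs_pos_eq (/ L^2)), (Rabs_pos_eq (r ^ S j)), (Rabs_pos_eq (W phi theta L (S j))) by lra.
    rewrite Rmult_plus_distr_l. apply Rplus_le_compat.
    + apply Rle_trans with (1 * (C2 * L / (INR m * sqrt (INR m)))); [apply Rmult_le_compat; auto; [lra|apply Rabs_pos|lra]|].
      replace (1 * (C2 * L / (INR m * sqrt (INR m)))) with (C2 * (L / (INR m * sqrt (INR m)))) by (field; split; lra). apply Rmult_le_compat_r; lra.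
    + replace ((C1 + C2) * (/ L ^ 2 * (1 + L / sqrt (INR m)))) with (/ L^2 * ((C1 + C2) * (1 + L / sqrt (INR m)))) by ring. apply Rmult_le_compat_l; [lra|].
      apply Rle_trans with (W phi theta L (S j)); [nra|]. eapply Rle_trans; [exact Hw|]. apply Rmult_le_compat; lra.
Qed.

Variable Ls : nat -> R.
Hypothesis HLs2 : forall N, 2 <= Ls N.
Hypothesis HLs : is_lim_seq Ls p_infty.

Let b := inv_sqrt2_sigma phi.

Lemma inv_sqrt2_sigma_pos : 0 < b.
Proof. apply Rinv_0_lt_compat, sqrt_lt_R0. pose proof (second_moment_pos phi D1 D2 K Hphi). lra. Qed.

Let Hb : 0 < b := inv_sqrt2_sigma_pos.

Definition tilted_functional (N : nat) (g : R -> R) : R := Series (fun k => tilted (Ls N) k * g (radius (Ls N) ^ k)).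

Lemma tilted_nonneg N k : 0 <= tilted (Ls N) k.
Proof. destruct tilted_renewal as [C [_ HR]]. apply (rn_pos _ _ _ _ (HR _ (HLs2 N))). Qed.

(** The tilt already contains one factor r^k, so the i-th moment of r^k is a value of the generating
    function at r^(i+1). *)
Lemma tilted_pow_series N i : is_series (fun k => tilted (Ls N) k * (radius (Ls N) ^ k) ^ i)
  (exp (G phi theta (Ls N) (radius (Ls N) ^ S i) - G phi theta (Ls N) (radius (Ls N)))).
Proof.
  pose proof (HLs2 N) as HL. pose proof (radius_bounds _ HL) as Hr. set (L := Ls N) in *. set (r := radius L) in *.
  assert (Hr1 : 0 <= r ^ S i < 1).
  { split; [apply pow_le; lra|]. simpl. assert (r ^ i <= 1). { rewrite <- (pow1 i). apply pow_incr; lra. } nra. }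
  pose proof (H_gen phi D1 D2 K Hphi theta Htheta L ltac:(lra) (r ^ S i) Hr1) as Hs.
  replace (exp (G phi theta L (r ^ S i) - G phi theta L r)) with (/ exp (G phi theta L r) * exp (G phi theta L (r ^ S i))).
  - apply is_series_ext with (fun k => / exp (G phi theta L r) * (H phi theta L k * (r ^ S i) ^ k)).
    + intros k. unfold tilted. fold r. rewrite <- !pow_mult. replace (S i * k)%nat with (k + k * i)%nat by lia. rewrite pow_add. unfold Rdiv. eqR. ring.
    + apply (is_series_scal (V:=R_NormedModule)). exact Hs.
  - unfold Rminus. rewrite exp_plus, exp_Ropp. ring.
Qed.

Lemma radius_pow_01 N k : 0 <= radius (Ls N) ^ k <= 1.
Proof. pose proof (radius_bounds _ (HLs2 N)). split; [apply pow_le; lra|]. rewrite <- (pow1 k). apply pow_incr; lra. Qed.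

Lemma tilted_functional_ex N g B : (forall y, 0 <= y <= 1 -> Rabs (g y) <= B) ->
  ex_series (fun k => tilted (Ls N) k * g (radius (Ls N) ^ k)) /\ Rabs (tilted_functional N g) <= B.
Proof.
  intros HB. pose proof (tilted_pow_series N 0) as H1. rewrite pow_1, Rminus_diag, exp_0 in H1.
  assert (Hs : is_series (fun k => B * (tilted (Ls N) k * (radius (Ls N) ^ k) ^ 0)) (B * 1)) by (apply (is_series_scal (V:=R_NormedModule) B _ 1), H1).
  assert (Ht : forall k, Rabs (tilted (Ls N) k * g (radius (Ls N) ^ k)) <= B * (tilted (Ls N) k * (radius (Ls N) ^ k) ^ 0)).
  { intros k. rewrite Rabs_mult, Rabs_pos_eq by apply tilted_nonneg. simpl. pose proof (HB _ (radius_pow_01 N k)). pose proof (tilted_nonneg N k). nra. }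
  assert (Hex : ex_series (fun k => Rabs (tilted (Ls N) k * g (radius (Ls N) ^ k)))).
  { apply (ex_series_le (V:=R_CompleteNormedModule) _ (fun k => B * (tilted (Ls N) k * (radius (Ls N) ^ k) ^ 0))); [|eexists; exact Hs].
    intros k. change (Rabs (Rabs (tilted (Ls N) k * g (radius (Ls N) ^ k))) <= B * (tilted (Ls N) k * (radius (Ls N) ^ k) ^ 0)). rewrite Rabs_Rabsolu. apply Ht. }
  split; [now apply ex_series_Rabs|]. eapply Rle_trans; [apply Series_Rabs, Hex|]. replace B with (B * 1) by ring. rewrite <- (is_series_unique _ _ Hs).
  apply Series_le; [|eexists; exact Hs]. intros k. split; [apply Rabs_pos|apply Ht].
Qed.

(** [D_lipschitz] for the difference of the two functionals. Each of them is bounded by the supremum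
    of the test function, which explains the factor 2 there, and their moments agree in the limit by
    [exp_G_limit]. *)
Lemma functional_convergence Kf eps : 0 <= Kf -> 0 < eps -> exists N0 : nat, forall N, (N0 <= N)%nat ->
  forall f, (forall y, Rabs (f y) <= 1) -> (forall u v, Rabs (f u - f v) <= Kf * Rabs (u - v)) ->
  Rabs (tilted_functional N f - limit_functional theta b f) <= eps.
Proof.
  apply (D_lipschitz (fun N f => tilted_functional N f - limit_functional theta b f)).
  - intros N f g x y Hf Hg. rewrite (limit_functional_lin theta b Htheta Hb f g x y Hf Hg).
    destruct (cont_bounded_01 f Hf) as [B1 HB1]. destruct (cont_bounded_01 g Hg) as [B2 HB2].
    destruct (tilted_functional_ex N f B1 HB1) as [E1 _]. destruct (tilted_functional_ex N g B2 HB2) as [E2 _].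
    replace (tilted_functional N (fun y0 => x * f y0 + y * g y0)) with (x * tilted_functional N f + y * tilted_functional N g); [ring|].
    unfold tilted_functional. rewrite <- !Series_scal_l, <- Series_plus.
    + apply Series_ext. intros k. ring.
    + now apply (ex_series_scal (V:=R_NormedModule) x).
    + now apply (ex_series_scal (V:=R_NormedModule) y).
  - intros N f B Hf HB. destruct (tilted_functional_ex N f B HB) as [_ E1]. destruct (limit_functional_ex theta b Htheta Hb f B Hf HB) as [_ E2].
    apply Rabs_le_between in E1. apply Rabs_le_between in E2. apply Rabs_le. lra.
  - intros i. replace (Finite 0) with (Finite (psi theta b (INR (S i)) - psi theta b (INR (S i)))) by (f_equal; ring).
    apply is_lim_seq_ext with (fun N => exp (G phi theta (Ls N) (radius (Ls N) ^ S i) - G phi theta (Ls N) (radius (Ls N))) - psi theta b (INR (S i))).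
    + intros N. rewrite (limit_functional_pow theta b Htheta Hb i). f_equal. symmetry. apply is_series_unique, tilted_pow_series.
    + apply is_lim_seq_minus'; [|apply is_lim_seq_const]. apply (exp_G_limit phi D1 D2 K Hphi theta Htheta Ls HLs2 HLs). lia.
Qed.

(** On the support of the tent each [kern] varies by at most C exp(-c) k, and the weights sum
    exp(-c) to 1. The error is proportional to the mass of the tent, so it stays small after
    division by it. *)
Lemma limit_functional_tent v0 v1 : 0 < v0 -> v0 <= v1 -> v1 < 1 -> exists C, 0 < C /\ forall y0 k, 0 < k -> v0 <= y0 - k -> y0 + k <= v1 ->
  Rabs (limit_functional theta b (tent y0 k) - limit_density theta b (- ln y0) * RInt.RInt (tent y0 k) 0 1) <= C * k * RInt.RInt (tent y0 k) 0 1.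
Proof.
  intros H0 H01 H1. destruct (kern_regular v0 v1 H0 H01 H1) as [C [HC Hr]]. exists C. split; auto. intros y0 k Hk Hlo Hhi.
  set (f := tent y0 k). set (S := RInt.RInt f 0 1). assert (Hf : forall x, continuous f x) by (intros; now apply tent_cont).
  assert (HS : is_RInt f 0 1 S) by (apply (RInt_correct (V:=R_CompleteNormedModule)), (ex_RInt_continuous (V:=R_CompleteNormedModule)); auto).
  assert (Hfb : forall y, 0 <= f y <= 1) by (intros; now apply tent_bounds).
  assert (HS0 : 0 <= S) by (apply RInt_ge_0; [lra|eexists; exact HS|intros; apply Hfb]).
  destruct (limit_functional_ex theta b Htheta Hb f 1 Hf) as [E1 _].
  { intros y _. rewrite Rabs_pos_eq; apply Hfb. }
  set (A := weight theta b). set (c := rate theta b).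
  assert (HA : forall n, 0 < A n) by (intros; now apply weight_pos). assert (Hc : forall n, 0 < c n) by (intros; now apply rate_pos).
  assert (Hy0 : 0 < y0 < 1) by lra.
  assert (HW1 : is_series (fun n => C * k * S * (A n * exp (- c n))) (C * k * S * 1)) by (apply (is_series_scal (V:=R_NormedModule) (C * k * S) _ 1), (weight_series theta b Htheta Hb)).
  assert (E2 : ex_series (fun n => A n * hit (c n) (- ln y0))).
  { pose proof (neg_ln_pos y0 Hy0) as Hl. destruct (limit_density_regular theta b Htheta Hb (- ln y0) (- ln y0) ltac:(lra)) as [C' [_ [Hd _]]].
    destruct (Hd (- ln y0) ltac:(lra)) as [Hs _]. eexists; exact Hs. }
  unfold limit_functional, limit_density. fold A c. rewrite Rmult_comm, <- Series_scal_l, <- Series_minus; auto.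
  2:{ now apply (ex_series_scal (V:=R_NormedModule) S). }
  assert (Ht : forall n, Rabs (A n * kern_int theta b f n - S * (A n * hit (c n) (- ln y0))) <= C * k * S * (A n * exp (- c n))).
  { intros n. destruct (Hr (c n) (Hc n)) as [_ R2].
    replace (A n * kern_int theta b f n - S * (A n * hit (c n) (- ln y0))) with (A n * (kern_int theta b f n + (- kern (c n) y0) * S)) by (rewrite kern_in by lra; ring).
    rewrite Rabs_mult, (Rabs_pos_eq (A n)) by (left; apply HA).
    replace (C * k * S * (A n * exp (- c n))) with (A n * (C * exp (- c n) * k * S)) by ring. apply Rmult_le_compat_l; [left; apply HA|].
    apply (norm_RInt_le (V:=R_NormedModule) (fun v => f v * kern (c n) v + (- kern (c n) y0) * f v) (fun v => C * exp (- c n) * k * f v) 0 1); [lra| | |].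
    - intros v Hv. change (Rabs (f v * kern (c n) v + (- kern (c n) y0) * f v) <= C * exp (- c n) * k * f v).
      replace (f v * kern (c n) v + - kern (c n) y0 * f v) with ((kern (c n) v - kern (c n) y0) * f v) by ring.
      pose proof (Hfb v). rewrite Rabs_mult, (Rabs_pos_eq (f v)) by lra.
      destruct (Rle_lt_dec (Rabs (v - y0)) k) as [Hin|Hout].
      + apply Rmult_le_compat_r; [lra|]. pose proof (Rabs_le_between (v - y0) k) as [Hbt _]. specialize (Hbt Hin).
        eapply Rle_trans; [apply R2; lra|]. apply Rmult_le_compat_l; auto. pose proof (exp_pos (- c n)). nra.
      + unfold f. rewrite (tent_support y0 k v Hk Hout), !Rmult_0_r. lra.
    - apply is_RInt_plusR; [apply (kern_int_correct theta b Htheta Hb f n Hf)|apply is_RInt_scalR, HS].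
    - apply is_RInt_scalR, HS. }
  assert (Hex : ex_series (fun n => Rabs (A n * kern_int theta b f n - S * (A n * hit (c n) (- ln y0))))).
  { apply (ex_series_le (V:=R_CompleteNormedModule) _ (fun n => C * k * S * (A n * exp (- c n)))); [|eexists; exact HW1].
    intros n. change (Rabs (Rabs (A n * kern_int theta b f n - S * (A n * hit (c n) (- ln y0)))) <= C * k * S * (A n * exp (- c n))). rewrite Rabs_Rabsolu. apply Ht. }
  eapply Rle_trans; [apply Series_Rabs, Hex|]. replace (C * k * S) with (C * k * S * 1) by ring. rewrite <- (is_series_unique _ _ HW1).
  apply Series_le; [|eexists; exact HW1]. intros n. split; [apply Rabs_pos|apply Ht].
Qed.
End LocalLimit.

Lemma tent_mass_lower y0 k : 0 < k -> 0 <= y0 - k -> y0 + k <= 1 -> k / 4 <= RInt.RInt (tent y0 k) 0 1.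
Proof.
  intros Hk H0 H1.
  assert (Hex : forall a b, ex_RInt (tent y0 k) a b) by (intros; apply (ex_RInt_continuous (V:=R_CompleteNormedModule)); intros; now apply tent_cont).
  assert (Hp : forall a b, a <= b -> 0 <= RInt.RInt (tent y0 k) a b) by (intros; apply RInt_ge_0; auto; intros; apply tent_bounds; auto).
  rewrite <- (RInt_Chasles (V:=R_CompleteNormedModule) (tent y0 k) 0 y0 1) by apply Hex.
  rewrite <- (RInt_Chasles (V:=R_CompleteNormedModule) (tent y0 k) y0 (y0 + k/2) 1) by apply Hex.
  change (k / 4 <= RInt.RInt (tent y0 k) 0 y0 + (RInt.RInt (tent y0 k) y0 (y0 + k/2) + RInt.RInt (tent y0 k) (y0 + k/2) 1)).
  pose proof (Hp 0 y0 ltac:(lra)). pose proof (Hp (y0 + k/2) 1 ltac:(lra)).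
  assert (k/4 <= RInt.RInt (tent y0 k) y0 (y0 + k/2)); [|lra].
  apply (is_RInt_le (fun _ => 1/2) (tent y0 k) y0 (y0 + k/2)); [lra| |apply (RInt_correct (V:=R_CompleteNormedModule)), Hex|].
  - replace (k/4) with ((y0 + k/2 - y0) * (1/2)) by field. apply is_RInt_constR.
  - intros x Hx. unfold tent. eapply Rle_trans; [|apply Rmax_r]. rewrite Rabs_pos_eq by lra.
    assert ((x - y0) / k <= 1/2); [|lra]. apply (Rmult_le_reg_r k); auto. unfold Rdiv. rewrite Rmult_assoc, Rinv_l; lra.
Qed.

Lemma window_bounds L k v0 v1 : 2 <= L -> 0 < v0 -> v1 < 1 -> v0 <= radius L ^ k <= v1 ->
  - ln v1 / 2 * L ^ 2 <= INR k /\ INR k <= - ln v0 * L ^ 2.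
Proof.
  intros HL H0 H1 Hk. pose proof (radius_pow_bounds L k HL) as Hb. assert (HL2 : 0 < L^2) by nra.
  assert (Hv1 : 0 < v1) by lra. set (x := INR k / L^2) in *. assert (Ek : INR k = x * L^2) by (unfold x; field; lra).
  rewrite Ek. split; apply Rmult_le_compat_r; try lra.
  - assert (exp (- (2 * x)) <= v1) by lra. apply ln_le in H; [|apply exp_pos]. rewrite ln_exp in H. lra.
  - assert (v0 <= exp (- x)) by lra. apply ln_le in H; auto. rewrite ln_exp in H. lra.
Qed.

(** The relative drop 1 - r^i is at most k/v0 <= 1/2, and 1 - x >= exp(-2x) in that range;
    logarithms turn this into a bound on i. *)
Lemma window_gap L n i k v0 : 2 <= L -> 0 < v0 -> 0 < k -> 2 * k <= v0 -> v0 <= radius L ^ n ->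
  radius L ^ n - radius L ^ (n + i) <= k -> INR i <= 2 * k / v0 * L ^ 2.
Proof.
  intros HL H0 Hk Hkv Hn Hd. pose proof (radius_pow_bounds L i HL) as [_ Hb]. assert (HL2 : 0 < L^2) by nra.
  rewrite pow_add in Hd. set (y := radius L ^ n) in *. set (z := radius L ^ i) in *.
  assert (Hkv0 : k / v0 <= 1/2). { apply (Rmult_le_reg_r v0); auto. unfold Rdiv. rewrite Rmult_assoc, Rinv_l; lra. }
  assert (Hkv1 : 0 < k / v0) by (apply Rdiv_lt_0_compat; auto).
  assert (Hz : 1 - k / v0 <= z).
  { destruct (Rle_lt_dec 1 z) as [|Hz1]; [lra|]. assert (v0 * (1 - z) <= k) by nra.
    apply (Rmult_le_reg_l v0); auto. rewrite Rmult_minus_distr_l. replace (v0 * (k / v0)) with k by (field; lra). lra. }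
  pose proof (one_minus_ge_exp (k / v0) ltac:(lra)) as He.
  assert (exp (- (2 * (k / v0))) <= exp (- (INR i / L^2))) by lra.
  apply ln_le in H; [|apply exp_pos]. rewrite !ln_exp in H.
  replace (INR i) with (INR i / L^2 * L^2) by (field; lra). apply Rmult_le_compat_r; [lra|]. unfold Rdiv in *. lra.
Qed.

Section LocalLimit2.
Variables (phi D1 D2 : R -> R) (K : R).
Hypothesis Hphi : smooth_density phi D1 D2 K.
Variable theta : R.
Hypothesis Htheta : 0 < theta.
Variable Ls : nat -> R.
Hypothesis HLs2 : forall N, 2 <= Ls N.
Hypothesis HLs : is_lim_seq Ls p_infty.

Let b := inv_sqrt2_sigma phi.

(** On a narrow tent around r^n the ratios [u k] nearly equal [u n], so the tilted functional of the
    tent is nearly [u n] times a Riemann sum of it. By weak convergence it is also nearly the limit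
    density times the integral of the tent, and dividing by that integral compares the two. *)
Lemma local_limit delta T eps : 0 < delta -> delta <= T -> 0 < eps -> exists N0 : nat, forall N n, (N0 <= N)%nat ->
  delta * Ls N ^ 2 <= INR n -> INR n <= T * Ls N ^ 2 ->
  Rabs (Ls N ^ 2 * Defs.H phi theta (Ls N) n / exp (G phi theta (Ls N) (radius (Ls N))) - limit_density theta b (- ln (radius (Ls N) ^ n))) <= eps.
Proof.
  intros Hdel HdT Heps.
  pose proof (inv_sqrt2_sigma_pos phi D1 D2 K Hphi) as Hb. fold b in Hb.
  (* r^n lies between exp(-2n/L^2) and exp(-n/L^2), hence in [vlo, vhi]; [v0] and [v1] leave room
     for the width of the tent. *)
  set (vlo := exp (- (2 * T))). set (vhi := exp (- delta)).
  assert (Hvlo : 0 < vlo) by apply exp_pos.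
  assert (Hvhi : vhi < 1). { unfold vhi. rewrite <- exp_0. apply exp_increasing. lra. }
  assert (Hlh : vlo <= vhi) by (apply exp_mono; lra).
  set (v0 := vlo / 2). set (v1 := (1 + vhi) / 2).
  assert (Hv0 : 0 < v0) by (unfold v0; lra). assert (Hv1 : v1 < 1) by (unfold v1; lra). assert (Hv01 : v0 <= v1) by (unfold v0, v1; lra).
  set (d' := - ln v1 / 2). set (T' := - ln v0).
  assert (Hd' : 0 < d') by (pose proof (neg_ln_pos v1 ltac:(unfold v1 in *; lra)); unfold d'; lra).
  assert (HT' : 0 < T') by (apply neg_ln_pos; lra).
  destruct (tilted_renewal phi D1 D2 K Hphi theta Htheta) as [C [HC Hren]].
  destruct (renewal_apriori C T' HC HT') as [Q [HQ Hap]].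
  set (U := Q / d'^2). assert (HU : 0 < U) by (apply Rdiv_lt_0_compat; nra).
  destruct (limit_functional_tent phi D1 D2 K Hphi theta Htheta v0 v1 Hv0 Hv01 Hv1) as [C2 [HC2 Htent]]. fold b in Htent.
  set (eps1 := eps * v0 / 8). assert (Heps1 : 0 < eps1) by (unfold eps1; nra).
  destruct (renewal_equicont C T' d' eps1 HC HT' Hd' Heps1) as [kap1 [L0 [Hkap1 Heq]]].
  (* In turn: the tent stays inside [v0, v1]; its indices differ from n by at most kap1 L^2; the
     factor 1/r^k varies little on it; and so does the limit density. *)
  set (kap := Rmin (Rmin (vlo / 4) ((1 - vhi) / 2)) (Rmin (kap1 * v0 / 2) (Rmin (eps * v0^2 / (8 * U)) (eps / (4 * C2))))).
  assert (Hv02 : 0 < v0^2) by nra.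
  assert (Hk : 0 < kap).
  { unfold kap. apply Rmin_pos; [apply Rmin_pos; lra|]. apply Rmin_pos; [nra|]. apply Rmin_pos; apply Rdiv_lt_0_compat; nra. }
  assert (Hk1 : kap <= vlo / 4) by (unfold kap; eapply Rle_trans; [apply Rmin_l|apply Rmin_l]).
  assert (Hk2 : kap <= (1 - vhi) / 2) by (unfold kap; eapply Rle_trans; [apply Rmin_l|apply Rmin_r]).
  assert (Hk3 : kap <= kap1 * v0 / 2) by (unfold kap; eapply Rle_trans; [apply Rmin_r|apply Rmin_l]).
  assert (Hk4 : kap <= eps * v0^2 / (8 * U)) by (unfold kap; eapply Rle_trans; [apply Rmin_r|]; eapply Rle_trans; [apply Rmin_r|apply Rmin_l]).
  assert (Hk5 : kap <= eps / (4 * C2)) by (unfold kap; eapply Rle_trans; [apply Rmin_r|]; eapply Rle_trans; [apply Rmin_r|apply Rmin_r]).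
  assert (HC2k : C2 * kap <= eps / 4). { apply (Rmult_le_compat_l C2) in Hk5; [|lra]. replace (C2 * (eps / (4 * C2))) with (eps / 4) in Hk5 by (field; lra). exact Hk5. }
  (* Variation of [u] over the tent: the first term comes from p, the second from 1/r^k. *)
  set (omega := eps1 / v0 + U * kap / v0^2).
  assert (Hom : 0 < omega <= eps / 4).
  { assert (0 < eps1 / v0) by (apply Rdiv_lt_0_compat; lra). assert (0 < U * kap / v0^2) by (apply Rdiv_lt_0_compat; nra).
    assert (eps1 / v0 = eps / 8) by (unfold eps1; field; lra).
    assert (U * kap / v0^2 <= eps / 8). { replace (eps / 8) with (U * (eps * v0^2 / (8 * U)) / v0^2) by (field; split; lra). unfold Rdiv at 1 2. apply Rmult_le_compat_r; [left; now apply Rinv_0_lt_compat|]. apply Rmult_le_compat_l; lra. }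
    unfold omega. lra. }
  (* The tent has mass at least kap/4, and the errors not proportional to that mass add up to at
     most 2 (U/v0 + omega + 1) tau, which is then at most eps/2 times the mass. *)
  set (tau := eps * kap / (16 * (U / v0 + omega + 1))).
  assert (HUv : 0 < U / v0) by (apply Rdiv_lt_0_compat; lra).
  assert (Htau : 0 < tau) by (unfold tau; apply Rdiv_lt_0_compat; nra).
  destruct (functional_convergence phi D1 D2 K Hphi theta Htheta Ls HLs2 HLs (/ kap) tau) as [N1 HN1]; [left; now apply Rinv_0_lt_compat|auto|]. fold b in HN1.
  (* L >= 1/(kap tau) bounds the mesh error L^-2/kap of the Riemann sum by tau. *)
  pose proof HLs as HLs'. apply is_lim_seq_spec in HLs'. destruct (HLs' (Rmax L0 (/ (kap * tau)))) as [N2 HN2].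
  exists (N1 + N2)%nat. intros N n HN Hn1 Hn2.
  specialize (HN1 N ltac:(lia)). specialize (HN2 N ltac:(lia)).
  pose proof (HLs2 N) as HL. set (L := Ls N) in *. pose proof (Rmax_l L0 (/ (kap * tau))). pose proof (Rmax_r L0 (/ (kap * tau))).
  assert (HL0 : L0 <= L) by lra. assert (HLk : / (kap * tau) <= L) by lra.
  assert (HL2 : 0 < L^2) by nra. pose proof (radius_bounds L HL) as Hr. pose proof (radius_pow_bounds L n HL) as Hrn.
  set (r := radius L) in *. set (y0 := r ^ n) in *.
  assert (Hy0 : vlo <= y0 <= vhi).
  { assert (delta <= INR n / L^2) by (apply (Rmult_le_reg_r (L^2)); auto; unfold Rdiv; rewrite Rmult_assoc, Rinv_l; lra).
    assert (INR n / L^2 <= T) by (apply (Rmult_le_reg_r (L^2)); auto; unfold Rdiv; rewrite Rmult_assoc, Rinv_l; lra).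
    split; [eapply Rle_trans; [|apply Hrn]|eapply Rle_trans; [apply Hrn|]]; apply exp_mono; lra. }
  assert (Hy0' : v0 <= y0 <= v1) by (unfold v0, v1; lra).
  specialize (Hren L HL). set (p := tilted phi theta L) in *.
  set (f := tent y0 kap).
  assert (Hfb : forall y, 0 <= f y <= 1) by (intros; now apply tent_bounds).
  assert (Hfl : forall u v, Rabs (f u - f v) <= / kap * Rabs (u - v)) by (intros; now apply tent_lip).
  assert (Hrp : forall k, 0 < r ^ k) by (intros; apply pow_lt; lra).
  assert (HD : Rabs (tilted_functional phi theta Ls N f - limit_functional theta b f) <= tau).
  { apply HN1; auto. intros y. rewrite Rabs_pos_eq; apply Hfb. }
  set (S := RInt.RInt f 0 1).
  assert (HS : kap / 4 <= S) by (apply tent_mass_lower; auto; unfold v0 in *; lra).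
  pose proof (Htent y0 kap Hk ltac:(unfold v0; lra) ltac:(unfold v1; lra)) as Hlim. fold f S in Hlim.
  set (a := limit_density theta b (- ln y0)) in *.
  set (u := fun k => L^2 * p k / r ^ k).
  assert (Hu : L^2 * Defs.H phi theta L n / exp (G phi theta L r) = u n).
  { unfold u, p, tilted. fold r. pose proof (Hrp n). pose proof (exp_pos (G phi theta L r)). field. split; lra. }
  rewrite Hu.
  assert (Hwin : forall k, v0 <= r ^ k <= v1 -> L^2 * p k <= U).
  { intros k Hkw. destruct (window_bounds L k v0 v1 HL Hv0 Hv1 Hkw) as [W1 W2]. fold d' T' in W1, W2.
    assert (Hk0 : (1 <= k)%nat). { destruct k; [|lia]. simpl in W1. nra. }
    pose proof (Hap L _ p HL Hren k Hk0 W2) as Hb2. pose proof (rn_pos _ _ _ _ Hren k).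
    assert ((d' * L^2)^2 <= INR k ^ 2) by (apply pow_incr; split; [nra|lra]).
    unfold U. apply (Rmult_le_reg_r (d'^2)); [nra|]. unfold Rdiv. rewrite (Rmult_assoc Q), Rinv_l by nra.
    assert ((d' * L^2)^2 * p k <= Q * L^2) by nra. apply (Rmult_le_reg_r (L^2)); auto. replace (L ^ 2 * p k * d' ^ 2 * L ^ 2) with ((d' * L^2)^2 * p k) by ring. lra. }
  assert (Hequi : forall k, v0 <= r ^ k <= v1 -> Rabs (r ^ k - y0) <= kap -> Rabs (L^2 * p k - L^2 * p n) <= eps1).
  { intros k Hkw Hkd. apply Rabs_le_between in Hkd.
    destruct (window_bounds L k v0 v1 HL Hv0 Hv1 Hkw) as [W1 W2]. destruct (window_bounds L n v0 v1 HL Hv0 Hv1 Hy0') as [W3 W4]. fold d' T' in W1, W2, W3, W4.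
    assert (Hgap : 2 * kap / v0 * L^2 <= kap1 * L^2).
    { apply Rmult_le_compat_r; [lra|]. apply (Rmult_le_reg_r v0); auto. unfold Rdiv. rewrite Rmult_assoc, Rinv_l; lra. }
    rewrite <- Rmult_minus_distr_l, Rabs_mult, (Rabs_pos_eq (L^2)) by lra.
    destruct (Nat.le_ge_cases n k) as [Hnk|Hnk].
    - pose proof (Heq L _ p HL0 HL Hren n (k - n)%nat) as He. pose proof (window_gap L n (k - n) kap v0 HL Hv0 Hk) as Hg.
      replace (n + (k - n))%nat with k in He, Hg by lia. fold r in Hg. fold y0 in Hg. rewrite Rabs_minus_sym.
      apply He; auto. eapply Rle_trans; [|exact Hgap]. apply Hg; [unfold v0; lra|lra|lra].
    - pose proof (Heq L _ p HL0 HL Hren k (n - k)%nat) as He. pose proof (window_gap L k (n - k) kap v0 HL Hv0 Hk) as Hg.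
      replace (k + (n - k))%nat with n in He, Hg by lia. fold r in Hg. fold y0 in Hg.
      apply He; auto. eapply Rle_trans; [|exact Hgap]. apply Hg; [unfold v0; lra|lra|lra]. }
  assert (Hun : 0 <= u n <= U / v0).
  { pose proof (rn_pos _ _ _ _ Hren n). pose proof (Hwin n Hy0'). unfold u. fold y0. split; [apply Rmult_le_pos; [nra|left; apply Rinv_0_lt_compat; lra]|].
    unfold Rdiv. apply Rmult_le_compat; [nra|left; apply Rinv_0_lt_compat; lra|lra|]. apply Rinv_le_contravar; lra. }
  assert (Huk : forall k, v0 <= r ^ k <= v1 -> Rabs (r ^ k - y0) <= kap -> Rabs (u k - u n) <= omega).
  { intros k Hkw Hkd. pose proof (Hequi k Hkw Hkd) as He. pose proof (Hwin n Hy0') as Hpn. pose proof (rn_pos _ _ _ _ Hren n).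
    unfold u. fold y0. replace (L ^ 2 * p k / r ^ k - L ^ 2 * p n / y0) with ((L^2 * p k - L^2 * p n) * / r ^ k + L^2 * p n * ((y0 - r ^ k) * (/ r ^ k * / y0))) by (field; split; lra).
    assert (Hik : 0 < / r ^ k <= / v0) by (split; [apply Rinv_0_lt_compat; lra|apply Rinv_le_contravar; lra]).
    assert (Hiy : 0 < / y0 <= / v0) by (split; [apply Rinv_0_lt_compat; lra|apply Rinv_le_contravar; lra]).
    eapply Rle_trans; [apply Rabs_triang|]. unfold omega. apply Rplus_le_compat.
    - rewrite Rabs_mult, (Rabs_pos_eq (/ r ^ k)) by lra. apply Rmult_le_compat; try lra. apply Rabs_pos.
    - rewrite !Rabs_mult, (Rabs_pos_eq (L^2)), (Rabs_pos_eq (p n)), (Rabs_pos_eq (/ r ^ k)), (Rabs_pos_eq (/ y0)), Rabs_minus_sym by lra.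
      replace (U * kap / v0^2) with (U * (kap * (/ v0 * / v0))) by (field; lra).
      apply Rmult_le_compat; [nra|apply Rmult_le_pos; [apply Rabs_pos|nra]|lra|]. apply Rmult_le_compat; [apply Rabs_pos|nra|lra|]. apply Rmult_le_compat; lra. }
  set (X := psum (fun k => p k * f (r ^ k))). set (Y := psum (fun k => f (r ^ k) * (r ^ k - r ^ Datatypes.S k))).
  assert (HXlim : is_lim_seq X (tilted_functional phi theta Ls N f)).
  { apply is_series_psum. apply Series_correct. apply (tilted_functional_ex phi D1 D2 K Hphi theta Htheta Ls HLs2 N f 1). intros y _. rewrite Rabs_pos_eq; apply Hfb. }
  assert (HXY : forall M, Rabs (X M - u n * Y M) <= omega * Y M).
  { intros M. unfold X, Y. rewrite <- !psum_scal, <- psum_minus. apply psum_abs_le. intros k _.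
    assert (HD' : r ^ k - r ^ Datatypes.S k = r ^ k / L^2). { simpl. replace (r ^ k - r * r ^ k) with (r ^ k * (1 - r)) by ring. unfold r at 2, radius. field. lra. }
    rewrite HD'. pose proof (Hrp k). pose proof (Hfb (r ^ k)).
    assert (0 < r ^ k / L^2) by (apply Rdiv_lt_0_compat; lra).
    replace (p k * f (r ^ k) - u n * (f (r ^ k) * (r ^ k / L ^ 2))) with ((u k - u n) * (f (r ^ k) * (r ^ k / L^2))) by (unfold u; pose proof (Hrp n); field; repeat split; lra).
    assert (0 <= f (r ^ k) * (r ^ k / L^2)) by (apply Rmult_le_pos; lra).
    rewrite Rabs_mult, (Rabs_pos_eq (f (r ^ k) * _)) by auto.
    destruct (Rle_lt_dec (Rabs (r ^ k - y0)) kap) as [Hin|Hout].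
    - apply Rmult_le_compat_r; auto. apply Huk; auto. apply Rabs_le_between in Hin. unfold v0, v1. lra.
    - unfold f. rewrite (tent_support y0 kap _ Hk Hout), !Rmult_0_l, !Rmult_0_r. lra. }
  assert (Hpowlim : is_lim_seq (fun M => r ^ M) 0) by (apply is_lim_seq_geom; rewrite Rabs_pos_eq; lra).
  apply is_lim_seq_Reals in HXlim. apply is_lim_seq_Reals in Hpowlim.
  destruct (HXlim tau Htau) as [M1 HM1]. destruct (Hpowlim tau Htau) as [M2 HM2].
  set (M := (M1 + M2)%nat). specialize (HM1 M ltac:(unfold M; lia)). specialize (HM2 M ltac:(unfold M; lia)). unfold Rdist in HM1, HM2.
  rewrite Rminus_0_r, Rabs_pos_eq in HM2 by (left; apply Hrp). specialize (HXY M).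
  assert (Hfc : forall x, continuous f x) by (intros; now apply tent_cont).
  assert (HYS : Rabs (Y M - S) <= 2 * tau).
  { pose proof (riemann_geometric f (/ kap) r M ltac:(lra) ltac:(left; now apply Rinv_0_lt_compat) Hfc Hfl) as HR.
    fold (Y M) in HR.
    assert (Hex : forall a b, ex_RInt f a b) by (intros; apply (ex_RInt_continuous (V:=R_CompleteNormedModule)); auto).
    assert (ES : S = RInt.RInt f 0 (r ^ M) + RInt.RInt f (r ^ M) 1) by (symmetry; apply (RInt_Chasles (V:=R_CompleteNormedModule)); apply Hex).
    pose proof (Hrp M) as HrM.
    assert (Hsm : 0 <= RInt.RInt f 0 (r ^ M) <= r ^ M).
    { split; [apply RInt_ge_0; [lra|apply Hex|intros; apply Hfb]|].
      pose proof (is_RInt_constR 1 0 (r ^ M)) as Hcst. replace ((r ^ M - 0) * 1) with (r ^ M) in Hcst by ring.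
      apply (is_RInt_le f (fun _ => 1) 0 (r ^ M) _ _ ltac:(lra) (RInt_correct (V:=R_CompleteNormedModule) _ _ _ (Hex _ _)) Hcst). intros; apply Hfb. }
    assert (HrM1 : r ^ M <= 1). { rewrite <- (pow1 M). apply pow_incr; lra. }
    assert (Hik : 0 < / kap) by (now apply Rinv_0_lt_compat).
    assert (Hkt : / kap * (1 - r) <= tau).
    { replace (1 - r) with (/ L^2) by (unfold r, radius; ring). apply (Rmult_le_reg_r (kap * L^2)); [nra|].
      replace (/ kap * / L ^ 2 * (kap * L ^ 2)) with 1 by (field; split; lra).
      assert (1 <= kap * tau * L). { apply (Rmult_le_compat_l (kap * tau)) in HLk; [|nra]. rewrite Rinv_r in HLk; nra. } nra. }
    assert (0 <= / kap * (1 - r)) by nra. assert (/ kap * (1 - r) * (1 - r ^ M) <= tau) by nra.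
    apply Rabs_le_between in HR. apply Rabs_le. lra. }
  apply Rabs_le_between in HYS. apply Rabs_le_between in HXY. apply Rabs_def2 in HM1. apply Rabs_le_between in HD. apply Rabs_le_between in Hlim.
  set (Lam := tilted_functional phi theta Ls N f) in *. set (Lam' := limit_functional theta b f) in *.
  assert (HY : omega * Y M <= omega * S + omega * (2 * tau)). { rewrite <- Rmult_plus_distr_l. apply Rmult_le_compat_l; lra. }
  assert (Hmain : Rabs ((u n - a) * S) <= (omega + C2 * kap) * S + (2 * (U / v0) + 2 * omega + 2) * tau).
  { replace ((u n - a) * S) with (u n * (S - Y M) - (X M - u n * Y M) + (X M - Lam) + (Lam - Lam') + (Lam' - a * S)) by ring.
    assert (Hus : - (U / v0 * (2 * tau)) <= u n * (S - Y M) <= U / v0 * (2 * tau)) by (split; nra).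
    apply Rabs_le. lra. }
  assert (HS0 : 0 < S) by lra.
  assert (Hte : (2 * (U / v0) + 2 * omega + 2) * tau <= eps / 2 * S).
  { apply Rle_trans with (eps / 2 * (kap / 4)); [|apply Rmult_le_compat_l; lra]. right.
    replace (2 * (U / v0) + 2 * omega + 2) with (2 * (U / v0 + omega + 1)) by ring. unfold tau.
    assert (HG : 0 < U / v0 + omega + 1) by lra. revert HG. clear. generalize (U / v0 + omega + 1). intros g Hg0. field. lra. }
  rewrite Rabs_mult, (Rabs_pos_eq S) in Hmain by lra. apply (Rmult_le_reg_r S); auto.
  eapply Rle_trans; [exact Hmain|]. assert ((omega + C2 * kap) * S <= eps / 2 * S) by (apply Rmult_le_compat_r; lra). lra.
Qed.
End LocalLimit2.

(** * Deduction of the theorem *)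

Lemma schwartz_smooth_density phi : Schwartz phi -> (forall x, 0 <= phi x) -> is_improper_integral phi 1 ->
  is_improper_integral (fun x => x * phi x) 0 -> exists D1 D2 K, smooth_density phi D1 D2 K.
Proof.
  intros [D [HD0 [HD HB]]] Hpos Hm1 Hm0.
  destruct (HB 0%nat 0%nat) as [C00 H00]. destruct (HB 0%nat 2%nat) as [C02 H02]. destruct (HB 0%nat 4%nat) as [C04 H04]. destruct (HB 0%nat 6%nat) as [C06 H06].
  destruct (HB 1%nat 0%nat) as [C10 H10]. destruct (HB 1%nat 2%nat) as [C12 H12]. destruct (HB 2%nat 0%nat) as [C20 H20]. destruct (HB 2%nat 2%nat) as [C22 H22].
  set (K := Rmax (C00 + 3 * C02 + 3 * C04 + C06) (Rmax (C10 + C12) (C20 + C22))).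
  exists (D 1%nat), (D 2%nat), K.
  assert (Hk : forall k C0 C2, (forall x, Rabs (x ^ 0 * D k x) <= C0) -> (forall x, Rabs (x ^ 2 * D k x) <= C2) -> forall x, Rabs (D k x) * (1 + x^2) <= C0 + C2).
  { intros k C0 C2 E0 E2 x. specialize (E0 x). specialize (E2 x). rewrite Rabs_mult in E0, E2. rewrite (Rabs_pos_eq (x^0)) in E0 by (simpl; lra). rewrite (Rabs_pos_eq (x^2)) in E2 by nra. simpl in *. lra. }
  split; auto.
  - intros x. apply is_derive_Reals. pose proof (HD 0%nat x) as H. intros e He. destruct (H e He) as [d Hd]. exists d. intros h. rewrite <- !HD0. apply Hd.
  - intros x. apply is_derive_Reals, HD.
  - intros x. apply (ex_derive_continuous (V:=R_NormedModule)). exists (D 3%nat x). apply is_derive_Reals, HD.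
  - intros x. eapply Rle_trans; [|apply Rmax_l]. specialize (H00 x). specialize (H02 x). specialize (H04 x). specialize (H06 x).
    rewrite HD0, Rabs_mult, (Rabs_pos_eq (phi x)) in H00, H02, H04, H06 by apply Hpos.
    rewrite Rabs_pos_eq in H00 by (simpl; lra). rewrite Rabs_pos_eq in H02 by nra.
    rewrite Rabs_pos_eq in H04 by (replace (x^4) with ((x^2)^2) by ring; apply pow2_ge_0).
    rewrite Rabs_pos_eq in H06 by (replace (x^6) with ((x^3)^2) by ring; apply pow2_ge_0).
    replace (phi x * (1 + x^2)^3) with (x ^ 0 * phi x + 3 * (x^2 * phi x) + 3 * (x^4 * phi x) + x^6 * phi x) by ring. lra.
  - intros x. eapply Rle_trans; [|apply Rmax_r]. eapply Rle_trans; [|apply Rmax_l]. now apply (Hk 1%nat).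
  - intros x. eapply Rle_trans; [|apply Rmax_r]. eapply Rle_trans; [|apply Rmax_r]. now apply (Hk 2%nat).
Qed.

(** - ln r exceeds L^-2 only by a term of order L^-4, so the argument of the limit density may be
    compared with n/L^2. *)
Lemma neg_ln_radius_bounds L n : 2 <= L -> INR n / L ^ 2 <= - ln (radius L ^ n) <= INR n / L ^ 2 * (1 + 2 / L ^ 2).
Proof.
  intros HL. pose proof (radius_bounds L HL) as Hr. assert (HL2 : 4 <= L^2) by nra. pose proof (pos_INR n).
  rewrite ln_pow by lra. replace (- (INR n * ln (radius L))) with (INR n * - ln (radius L)) by ring.
  set (x := / L^2). assert (Hx : 0 < x <= 1/4). { split; [apply Rinv_0_lt_compat; lra|]. replace (1/4) with (/4) by field. apply Rinv_le_contravar; lra. }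
  assert (Er : radius L = 1 - x) by reflexivity. rewrite Er.
  assert (H1 : x <= - ln (1 - x)) by (pose proof (ln_le_sub (1 - x) ltac:(lra)); lra).
  assert (H2 : - ln (1 - x) <= x * (1 + 2 * x)).
  { rewrite <- ln_Rinv by lra. eapply Rle_trans; [apply ln_le_sub, Rinv_0_lt_compat; lra|].
    apply (Rmult_le_reg_r (1 - x)); [lra|]. rewrite Rmult_minus_distr_r, Rinv_l by lra. nra. }
  unfold Rdiv. fold x. split; [apply Rmult_le_compat_l; auto|]. rewrite Rmult_assoc. apply Rmult_le_compat_l; auto.
Qed.

(** With b^2 = 1/(2 sigma^2) and rates 2b(theta + n), the exponents c_n^2/(4x) at x = alpha^2 t are
    those of the theorem. The factor (2 sinh b)^(2 theta) equals exp(2b theta)(1 - exp(-2b))^(2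
    theta), the numerator of C_0. *)
Lemma density_series theta sigma alpha t : 0 < theta -> 0 < sigma -> 0 < alpha -> 0 < t <= 1 ->
  exp (sqrt 2 / sigma * theta) * Rpower (1 - exp (- (sqrt 2 / sigma))) (2 * theta) / (sqrt (2 * PI) * alpha * sigma) *
  Rpower t (- (3 / 2)) *
  ser (fun n => (-1) ^ n * gbinom (- (2 * theta)) n * (theta + INR n) * exp (- (theta + INR n) ^ 2 / (2 * alpha ^ 2 * sigma ^ 2 * t)))
  = alpha ^ 2 * limit_density theta (/ sqrt (2 * sigma ^ 2)) (alpha ^ 2 * t).
Proof.
  intros Hth Hs Ha Ht. pose proof sqrt_PI_pos as Hp. assert (Hs2 : 0 < sqrt 2) by (apply sqrt_lt_R0; lra). pose proof (sqrt_sqrt 2 ltac:(lra)) as Hss2.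
  assert (Hst : 0 < sqrt t) by (apply sqrt_lt_R0; lra). pose proof (sqrt_sqrt t ltac:(lra)) as Hsst.
  set (b := / sqrt (2 * sigma^2)).
  assert (Eb : b = / (sqrt 2 * sigma)). { unfold b. rewrite sqrt_mult, sqrt_pow2 by nra. reflexivity. }
  assert (Hb : 0 < b) by (rewrite Eb; apply Rinv_0_lt_compat; nra).
  assert (E2b : sqrt 2 / sigma = 2 * b). { rewrite Eb. rewrite <- Hss2 at 2. field. split; lra. }
  rewrite E2b.
  assert (He1 : exp (- (2 * b)) < 1) by (rewrite <- exp_0; apply exp_increasing; lra).
  set (w0 := exp (2 * theta * ln (2 * sinh b))).
  assert (Ew : exp (2 * b * theta) * Rpower (1 - exp (- (2 * b))) (2 * theta) = w0).
  { unfold Rpower, w0. rewrite <- exp_plus. f_equal. replace (2 * sinh b) with (exp b * (1 - exp (- (2 * b)))).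
    - rewrite ln_mult, ln_exp by (try apply exp_pos; lra). ring.
    - unfold sinh. rewrite Rmult_minus_distr_l, <- exp_plus. replace (b + - (2 * b)) with (- b) by ring. field. }
  assert (Hw0 : 0 < w0) by apply exp_pos.
  assert (Ex : sqrt (alpha^2 * t) = alpha * sqrt t) by (rewrite sqrt_mult, sqrt_pow2 by nra; reflexivity).
  assert (Hx : 0 < alpha^2 * t) by (apply Rmult_lt_0_compat; nra).
  (* The factor common to all terms of the limit density at alpha^2 t. *)
  set (kap := w0 * b / sqrt PI / (alpha^2 * t * (alpha * sqrt t))).
  assert (Hd3 : 0 < alpha^2 * t * (alpha * sqrt t)) by (apply Rmult_lt_0_compat; nra).
  assert (Hkap : 0 < kap). { unfold kap. apply Rdiv_lt_0_compat; auto. apply Rdiv_lt_0_compat; nra. }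
  destruct (limit_density_regular theta b Hth Hb (alpha^2 * t) (alpha^2 * t) ltac:(lra)) as [C [_ [Hreg _]]].
  destruct (Hreg (alpha^2 * t) ltac:(lra)) as [Hser _]. set (a := limit_density theta b (alpha^2 * t)) in *.
  assert (Es : ser (fun n => (-1) ^ n * gbinom (- (2 * theta)) n * (theta + INR n) * exp (- (theta + INR n) ^ 2 / (2 * alpha ^ 2 * sigma ^ 2 * t))) = / kap * a).
  { apply ser_eq. apply is_series_ext with (fun n => / kap * (weight theta b n * hit (rate theta b n) (alpha^2 * t))).
    - intros n. unfold weight, hit, rate, binom_coef. fold w0. rewrite Ex.
      replace (- (2 * b * (theta + INR n)) ^ 2 / (4 * (alpha ^ 2 * t))) with (- (theta + INR n) ^ 2 / (2 * alpha ^ 2 * sigma ^ 2 * t)).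
      + set (e := exp _). set (g := gbinom _ _). set (s := (-1) ^ n). unfold kap. eqR. field. repeat split; lra.
      + rewrite Eb. replace ((2 * / (sqrt 2 * sigma) * (theta + INR n)) ^ 2) with (4 * (theta + INR n)^2 / (sqrt 2 * sqrt 2) / sigma^2) by (field; split; lra).
        rewrite Hss2. field. repeat split; lra.
    - apply (is_series_scal (V:=R_NormedModule)). exact Hser. }
  rewrite Es, Ew.
  assert (Er : Rpower t (- (3/2)) = / (t * sqrt t)).
  { rewrite Rpower_Ropp. f_equal. replace (3/2) with (1 + /2) by field. rewrite Rpower_plus, Rpower_1, Rpower_sqrt by lra. reflexivity. }
  rewrite Er, sqrt_mult by (pose proof PI_RGT_0; lra). unfold kap. rewrite Eb.
  replace (w0 / (sqrt 2 * sqrt PI * alpha * sigma) * / (t * sqrt t) * (/ (w0 * / (sqrt 2 * sigma) / sqrt PI / (alpha ^ 2 * t * (alpha * sqrt t))) * a))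
    with (alpha^2 * a) by (field; repeat split; lra). reflexivity.
Qed.

Theorem mainTheorem20
  (theta : R) (phi : R -> R) (rho : nat -> R) (alpha : R)
  (Htheta : 0 < theta)
  (Hschw : Schwartz phi)
  (Hnonneg : forall x, 0 <= phi x)
  (Hdens : is_improper_integral phi 1)
  (Hmean : is_improper_integral (fun x => x * phi x) 0)
  (Hrho_pos : forall N : nat, 0 < rho N)
  (Halpha : 0 < alpha)
  (Hrho : Un_cv (fun N => rho N / sqrt (INR N)) alpha) :
  let sigma := sqrt (ImpInt (fun x => x ^ 2 * phi x)) in
  let L := fun N : nat => INR N / rho N in
  let C0 := exp (sqrt 2 / sigma * theta)
            * Rpower (1 - exp (- (sqrt 2 / sigma))) (2 * theta)
            / (sqrt (2 * PI) * alpha * sigma) in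
  let RHS := fun N j : nat =>
    C0 * exp (G phi theta (L N) (1 - / (L N) ^ 2)) / INR N
    * Rpower (1 - INR j / INR N) (- (3 / 2))
    * ser (fun n => (-1) ^ n * gbinom (- (2 * theta)) n * (theta + INR n)
                    * exp (- (theta + INR n) ^ 2
                           / (2 * alpha ^ 2 * sigma ^ 2 * (1 - INR j / INR N)))) in
  forall eps, 0 < eps ->
  forall delta, 0 < delta ->
  exists N0 : nat, forall N j : nat, (N0 <= N)%nat ->
    INR j <= (1 - eps) * INR N ->
    Rabs (H phi theta (L N) (N - j) - RHS N j) <= delta * Rabs (RHS N j).
Proof.
  intros sigma L C0 RHS eps Heps delta Hdelta.
  destruct (schwartz_smooth_density phi Hschw Hnonneg Hdens Hmean) as [D1 [D2 [K Hphi]]].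
  pose proof (second_moment_pos phi D1 D2 K Hphi) as HV. set (V := second_moment phi) in *.
  assert (Esig : sigma = sqrt V) by reflexivity.
  assert (Hsig : 0 < sigma) by (rewrite Esig; now apply sqrt_lt_R0).
  assert (Esig2 : sigma^2 = V) by (rewrite Esig; apply pow2_sqrt; lra).
  set (b := inv_sqrt2_sigma phi). pose proof (inv_sqrt2_sigma_pos phi D1 D2 K Hphi) as Hb. fold b in Hb.
  assert (Eb : / sqrt (2 * sigma^2) = b) by (rewrite Esig2; reflexivity).
  (* The cap at 1 keeps [X0] below [X1] whatever [eps] is. *)
  set (eps' := Rmin eps 1). assert (Heps' : 0 < eps' <= 1) by (unfold eps'; split; [apply Rmin_pos; lra|apply Rmin_r]).
  assert (Heps'' : eps' <= eps) by apply Rmin_l.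
  assert (Ha2 : 0 < alpha^2) by nra.
  (* n/L^2 is t times q = N/L^2, which will lie between 3/4 and 5/4 of alpha^2, and - ln r^n exceeds
     it by at most 3 alpha^2/4; the interval has room for both and for the limit alpha^2 t. *)
  set (X0 := eps' * alpha^2 / 2). set (X1 := 3 * alpha^2).
  assert (HX : 0 < X0 <= X1) by (unfold X0, X1; nra).
  destruct (limit_density_regular theta b Htheta Hb X0 X1 HX) as [C [HC [Hub [Hlip [m [Hm Hlow]]]]]].
  assert (Hrl : is_lim_seq (fun N => rho N / sqrt (INR N)) alpha) by (apply is_lim_seq_Reals; exact Hrho).
  assert (Hqlim : is_lim_seq (fun N => (rho N / sqrt (INR N)) * (rho N / sqrt (INR N))) (alpha * alpha)) by (apply is_lim_seq_mult'; auto).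
  assert (Hqe : forall N, (1 <= N)%nat -> (rho N / sqrt (INR N)) * (rho N / sqrt (INR N)) = INR N / L N ^ 2).
  { intros N HN. assert (HN0 : 0 < INR N) by (apply lt_0_INR; lia). pose proof (sqrt_lt_R0 _ HN0). pose proof (sqrt_sqrt (INR N) ltac:(lra)) as Hss. pose proof (Hrho_pos N).
    unfold L. set (w := sqrt (INR N)) in *. rewrite <- Hss. field. split; lra. }
  assert (HLinf : is_lim_seq L p_infty).
  { apply is_lim_seq_spec. intros M. apply is_lim_seq_Reals in Hqlim. destruct (Hqlim (alpha * alpha) ltac:(nra)) as [N1 HN1].
    destruct (INR_unbounded (2 * alpha^2 * M^2)) as [N2 HN2]. exists (N1 + N2 + 1)%nat. intros N HN.
    specialize (HN1 N ltac:(lia)). unfold Rdist in HN1. rewrite Hqe in HN1 by lia. apply Rabs_def2 in HN1.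
    assert (HN0 : 0 < INR N) by (apply lt_0_INR; lia). assert (HLp : 0 < L N) by (unfold L; apply Rdiv_lt_0_compat; auto).
    assert (HNN : INR N2 <= INR N) by (apply le_INR; lia). assert (HL2 : 0 < L N ^ 2) by nra.
    assert (Hlt : INR N < 2 * alpha^2 * L N ^ 2).
    { destruct HN1 as [HN1 _]. apply (Rmult_lt_compat_r (L N ^ 2)) in HN1; auto. 
      assert (INR N / L N ^ 2 < 2 * alpha^2) by nra. apply (Rmult_lt_compat_r (L N ^ 2)) in H; auto. unfold Rdiv in H. rewrite Rmult_assoc, Rinv_l in H by lra. lra. }
    destruct (Rle_lt_dec M 0) as [HM|HM]; [lra|]. apply Rnot_le_lt. intros Hle. assert (L N ^ 2 <= M^2) by (apply pow_incr; lra). nra. }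
  pose proof HLinf as HLinf'. apply is_lim_seq_spec in HLinf'. destruct (HLinf' 2) as [N1 HN1].
  (* L >= 2 holds only eventually, whereas [local_limit] asks for it at every index; hence the shift
     by [N1]. *)
  set (Ls := fun N => L (N + N1)%nat).
  assert (HLs2 : forall N, 2 <= Ls N) by (intros N; left; apply HN1; lia).
  assert (HLs : is_lim_seq Ls p_infty) by (apply -> (is_lim_seq_incr_n L N1); exact HLinf).
  (* Of the admissible error delta alpha^2 m, the local limit theorem uses a sixth; [eta] (distance
     of q from alpha^2) and a large L (distance of - ln r^n from n/L^2) use a quarter each. *)
  set (e1 := delta * m / 12). assert (He1 : 0 < e1) by (unfold e1; nra).
  destruct (local_limit phi D1 D2 K Hphi theta Htheta Ls HLs2 HLs X0 X1 e1 ltac:(lra) ltac:(lra) He1) as [N2 HN2]. fold b in HN2.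
  set (eta := Rmin (alpha^2 / 4) (delta * (alpha^2 * m) / (4 * (2 * alpha^2 * C + C)))).
  assert (HCC : 0 < 2 * alpha^2 * C + C) by nra.
  assert (Ham : 0 < alpha^2 * m) by nra.
  assert (Heta : 0 < eta). { unfold eta. apply Rmin_pos; [lra|]. apply Rdiv_lt_0_compat; nra. }
  assert (Heta1 : eta <= alpha^2 / 4) by apply Rmin_l.
  assert (Heta2 : (2 * alpha^2 * C + C) * eta <= delta * (alpha^2 * m) / 4).
  { assert (eta <= delta * (alpha^2 * m) / (4 * (2 * alpha^2 * C + C))) by apply Rmin_r.
    apply (Rmult_le_compat_l (2 * alpha^2 * C + C)) in H; [|lra]. eapply Rle_trans; [exact H|]. right. field. lra. }
  apply is_lim_seq_Reals in Hqlim. destruct (Hqlim eta Heta) as [N3 HN3].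
  (* The value at which the contribution 6 alpha^4 C/L^2 of the drift becomes a quarter of the
     admissible error, as soon as L^2 >= B. *)
  set (B := 24 * alpha^2 * C / (delta * m)). assert (HB : 0 < B) by (apply Rdiv_lt_0_compat; nra).
  destruct (HLinf' (1 + B)) as [N4 HN4].
  exists (N1 + N2 + N3 + N4 + 1)%nat. intros N j HN Hj.
  assert (HN0 : 0 < INR N) by (apply lt_0_INR; lia).
  specialize (HN3 N ltac:(lia)). unfold Rdist in HN3. rewrite Hqe in HN3 by lia. specialize (HN4 N ltac:(lia)).
  set (LN := L N) in *. assert (HLN2 : 2 <= LN) by (left; apply HN1; lia).
  set (q := INR N / LN ^ 2) in *. replace (alpha * alpha) with (alpha^2) in HN3 by ring. apply Rabs_def2 in HN3.
  assert (HL4 : 4 <= LN^2) by nra.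
  set (t := 1 - INR j / INR N).
  assert (Hjn : INR j / INR N <= 1 - eps). { apply (Rmult_le_reg_r (INR N)); auto. unfold Rdiv. rewrite Rmult_assoc, Rinv_l; lra. }
  assert (Hj0 : 0 <= INR j / INR N) by (apply Rmult_le_pos; [apply pos_INR|left; now apply Rinv_0_lt_compat]).
  assert (Ht : eps' <= t <= 1) by (unfold t; lra).
  assert (HjN : (j <= N)%nat). { apply INR_le. apply (Rmult_le_compat_r (INR N)) in Hjn; [|lra]. unfold Rdiv in Hjn. rewrite Rmult_assoc, Rinv_l in Hjn by lra. nra. }
  set (n := (N - j)%nat). assert (En : INR n = t * INR N). { unfold n, t. rewrite minus_INR by auto. field. lra. }
  assert (Enq : INR n / LN^2 = t * q) by (rewrite En; unfold q; field; lra).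
  assert (Hq : 3/4 * alpha^2 < q < 5/4 * alpha^2) by lra.
  assert (Htq : eps' * (3/4 * alpha^2) <= t * q <= 5/4 * alpha^2) by (split; nra).
  assert (Hea : 0 < eps' * alpha^2) by (apply Rmult_lt_0_compat; lra).
  assert (HnX : X0 * LN^2 <= INR n <= X1 * LN^2).
  { replace (INR n) with (INR n / LN^2 * LN^2) by (field; lra). rewrite Enq. split; apply Rmult_le_compat_r; unfold X0, X1; lra. }
  assert (ELs : Ls (N - N1)%nat = LN). { unfold Ls, LN. f_equal. lia. }
  pose proof (HN2 (N - N1)%nat n ltac:(lia)) as Hloc. rewrite ELs in Hloc. specialize (Hloc (proj1 HnX) (proj2 HnX)).
  set (x := - ln (radius LN ^ n)) in *. pose proof (neg_ln_radius_bounds LN n HLN2) as Hxb. fold x in Hxb. rewrite Enq in Hxb.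
  assert (HiL : 0 < / LN^2 <= /4) by (split; [apply Rinv_0_lt_compat; lra|apply Rinv_le_contravar; lra]).
  assert (Hxd : 0 <= x - t * q <= 3 * alpha^2 / LN^2).
  { unfold Rdiv in *. split; [lra|]. assert (t * q * (2 * / LN^2) <= 5/4 * alpha^2 * (2 * / LN^2)) by (apply Rmult_le_compat_r; lra). nra. }
  assert (HxX : X0 <= x <= X1).
  { assert (3 * alpha^2 / LN^2 <= 3 * alpha^2 / 4) by (unfold Rdiv; apply Rmult_le_compat_l; lra). unfold X0, X1. lra. }
  assert (HaX : X0 <= alpha^2 * t <= X1) by (unfold X0, X1; split; nra).
  set (ax := limit_density theta b x) in *. set (a := limit_density theta b (alpha^2 * t)).
  assert (Hax : Rabs (ax - a) <= C * (eta + 3 * alpha^2 / LN^2)).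
  { eapply Rle_trans; [apply Hlip; auto|]. apply Rmult_le_compat_l; [lra|].
    assert (- eta <= t * (q - alpha^2) <= eta) by (split; nra). apply Rabs_le; lra. }
  assert (HLC : 2 * alpha^2 * (C * (3 * alpha^2 / LN^2)) <= delta * (alpha^2 * m) / 4).
  { assert (HBL : B <= LN^2) by nra.
    replace (2 * alpha^2 * (C * (3 * alpha^2 / LN^2))) with (6 * alpha^2 * alpha^2 * C * / LN^2) by (field; lra).
    apply Rle_trans with (6 * alpha^2 * alpha^2 * C * / B).
    - apply Rmult_le_compat_l; [apply Rlt_le; repeat apply Rmult_lt_0_compat; lra|]. apply Rinv_le_contravar; lra.
    - right. unfold B. field. repeat split; lra. }
  destruct (Hub (alpha^2 * t) HaX) as [_ HaC]. fold a in HaC. pose proof (Hlow (alpha^2 * t) HaX) as Ham'. fold a in Ham'.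
  change (1 - / LN^2) with (radius LN) in *.
  pose proof (exp_pos (G phi theta LN (radius LN))) as HZ.
  assert (ER : RHS N j = exp (G phi theta LN (radius LN)) / INR N * (alpha^2 * a)).
  { unfold RHS. fold LN t. change (1 - / LN^2) with (radius LN). pose proof (density_series theta sigma alpha t Htheta Hsig Halpha ltac:(lra)) as HDs.
    rewrite Eb in HDs. fold a in HDs. rewrite <- HDs. unfold C0. field. repeat split; try lra. apply Rgt_not_eq, sqrt_lt_R0. pose proof PI_RGT_0; lra. }
  set (Z := exp (G phi theta LN (radius LN))) in *.
  set (u := LN ^ 2 * Defs.H phi theta LN n / Z) in *.
  assert (EH : Defs.H phi theta LN n = Z / INR N * (u * q)) by (unfold u, q; field; repeat split; lra).
  assert (HZN : 0 < Z / INR N) by (apply Rdiv_lt_0_compat; auto).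
  rewrite ER, EH, <- Rmult_minus_distr_l, !Rabs_mult, (Rabs_pos_eq (Z / INR N)), (Rabs_pos_eq (alpha^2)), (Rabs_pos_eq a) by lra.
  replace (delta * (Z / INR N * (alpha ^ 2 * a))) with (Z / INR N * (delta * (alpha^2 * a))) by ring.
  apply Rmult_le_compat_l; [lra|].
  assert (Hfin : Rabs (u * q - alpha^2 * a) <= delta * (alpha^2 * m)).
  { replace (u * q - alpha^2 * a) with ((u - ax) * q + (ax - a) * q + (q - alpha^2) * a) by ring.
    eapply Rle_trans; [apply Rabs_triang|]. eapply Rle_trans; [apply Rplus_le_compat_r, Rabs_triang|].
    rewrite !Rabs_mult, (Rabs_pos_eq q), (Rabs_pos_eq a) by lra.
    assert (T1 : Rabs (u - ax) * q <= e1 * (2 * alpha^2)) by (apply Rmult_le_compat; [apply Rabs_pos|lra|auto|lra]).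
    assert (T2 : Rabs (ax - a) * q <= C * (eta + 3 * alpha^2 / LN^2) * (2 * alpha^2)) by (apply Rmult_le_compat; [apply Rabs_pos|lra|auto|lra]).
    assert (T3 : Rabs (q - alpha^2) * a <= eta * C) by (apply Rmult_le_compat; [apply Rabs_pos|lra|apply Rabs_le; lra|auto]).
    assert (E1 : e1 * (2 * alpha^2) = delta * (alpha^2 * m) / 6) by (unfold e1; field).
    assert (0 < delta * (alpha^2 * m)) by (apply Rmult_lt_0_compat; lra). lra. }
  eapply Rle_trans; [exact Hfin|]. apply Rmult_le_compat_l; [lra|]. apply Rmult_le_compat_l; lra.
Qed.
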